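(* Let $K_\bullet$ be a simplicial manifold which satisfies the Kan condition and which is $m$-truncated for some $m\in\mathbb{N}$. Let $F_{K_\bullet}$ be the presheaf on the category $\mathsf{SSM}$ of surjective submersions between supermanifolds given by $F_{K_\bullet}(M\to N)=\mathrm{Hom}((M\to N)_\bullet,K_\bullet)$. Then for every $n\in\mathbb{N}$ the $n$-jet of $F_{K_\bullet}$ is representable; that is, the presheaf on the category $\mathsf{SM}$ of supermanifolds $$N\longmapsto F_{K_\bullet}\bigl(\mathbb{R}^{0|n}\times N\to N\bigr)$$ (where $\mathbb{R}^{0|n}\times N\to N$ is the canonical projection) is isomorphic to $\mathrm{Hom}_{\mathsf{SM}}(-,X)$ for some supermanifold $X$.
   Context: $\mathsf{SM}$ is the category of smooth (finite-dimensional) supermanifolds. $\mathsf{SSM}$ is the category whose objects are surjective submersions $M\to N$ between supermanifolds and whose morphisms are commutative squares. A presheaf on a category $\mathsf{C}$ is a functor $\mathsf{C}^{op}\to\mathsf{Set}$; it is representable if it is isomorphic to $\mathrm{Hom}_{\mathsf C}(-,X)$ for some object $X$. For a surjective submersion $M\to N$, $(M\to N)_\bullet$ denotes the simplicial supermanifold which is the nerve of the groupoid $M\times_N M\rightrightarrows M$; its $p$-simplices are the $(p+1)$-fold fibre product $M\times_N\cdots\times_N M$. $\mathrm{Hom}((M\to N)_\bullet,K_\bullet)$ is the set of morphisms of simplicial supermanifolds; it is contravariantly functorial in $(M\to N)\in\mathsf{SSM}$. $n$-jet: for a presheaf $F$ on $\mathsf{SSM}$, restrict $F$ to the full subcategory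 $\mathsf{SSM}_n$ of objects of the form $\mathbb{R}^{0|n}\times N\to N$ (canonical projection, $N$ any supermanifold). This restriction is equivalently the presheaf $N\mapsto F(\mathbb{R}^{0|n}\times N\to N)$ on $\mathsf{SM}$ equipped with a right action of the monoid presheaf $T\mapsto \mathrm{Hom}(\mathbb{R}^{0|n}\times T,\mathbb{R}^{0|n})$; this presheaf with action is the $n$-jet of $F$. Representability of the $n$-jet means representability as a presheaf on $\mathsf{SM}$. Kan condition and truncation: let $\Delta$ be the category of finite (nonempty) ordered sets, $[p]$ the ordered set $0<1<\dots<p$ and also the simplicial set it represents. For $p\ge 1$ and $0\le k\le p$ let the horn $[p,k]\subset[p]$ be the simplicial subset with $$[p,k]_q=\{f\in\mathrm{Hom}_\Delta([q],[p]) : \{0,\dots,k-1,k+1,\dots,p\}\not\subset \mathrm{Im}(f)\}.$$ For a simplicial manifold $K_\bullet$ (a functor from $\Delta^{op}$ to smooth manifolds) put $K_{p,k}=\mathrm{Hom}([p,k],K_\bullet)$, the space of horns in $K_\bullet$, i.e. the limit (of presheaves on $\mathsf{SM}$) of the diagram of the $K_q$'s indexed by the simplices of $[p,k]$. The inclusion $[p,k]\to[p]$ induces a map $K_p\to K_{p,k}$. $K_\bullet$ is Kan (satisfies the Kan condition) if for all $p\ge1$, $0\le k\le p$, the map $K_p\to K_{p,k}$ is a surjective submersion (the fact that $K_{p,k}$ is a manifold is guaranteed recursively in $p$ by the condition for smaller $p$). A Kan simplicial manifold $K_\bullet$ is $m$-truncated if $K_p\to K_{p,k}$ is a bijection (hence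 a diffeomorphism) for all $p\ge m$ (with $p\geq 1$) and all $0\le k\le p$. *)

(* Defs.v *)
From HB Require Import structures.
From mathcomp Require Import all_boot all_order all_algebra.
From mathcomp Require Import all_classical all_reals all_analysis.

Set Implicit Arguments.
Unset Strict Implicit.
Unset Printing Implicit Defensive.

Import Order.TTheory GRing.Theory Num.Theory numFieldNormedType.Exports.
Local Open Scope classical_set_scope.
Local Open Scope ring_scope.

(* A supercommutative superalgebra over R.  The Z/2-grading is carried by the
   parity automorphism: x has degree i when parity x = (-1)^i x.  The algebra may
   be zero, as sections over the empty set are; algType excludes this. *)
Record superAlgebra (R : realType) := SuperAlgebra {
  sa_car : lmodType R;
  sa_one : sa_car;
  sa_mul : sa_car -> sa_car -> sa_car;
  sa_mulA : associative sa_mul;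
  sa_mul1l : left_id sa_one sa_mul;
  sa_mul1r : right_id sa_one sa_mul;
  sa_mulDl : left_distributive sa_mul +%R;
  sa_mulDr : right_distributive sa_mul +%R;
  sa_scaleAl : forall (a : R) x y, a *: sa_mul x y = sa_mul (a *: x) y;
  sa_scaleAr : forall (a : R) x y, a *: sa_mul x y = sa_mul x (a *: y);
  sa_parity : sa_car -> sa_car;
  sa_parity_linear : linear sa_parity;
  sa_parity1 : sa_parity sa_one = sa_one;
  sa_parityM : {morph sa_parity : x y / sa_mul x y};
  sa_parityK : involutive sa_parity;
  sa_comm : forall (i j : bool) x y,
    sa_parity x = (-1) ^+ i *: x -> sa_parity y = (-1) ^+ j *: y ->
    sa_mul x y = (-1) ^+ (i && j) *: sa_mul y x
}.

Definition sa_sort (R : realType) (A : superAlgebra R) : Type := sa_car A.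
Coercion sa_sort : superAlgebra >-> Sortclass.

HB.instance Definition _ (R : realType) (A : superAlgebra R) :=
  GRing.Lmodule.copy (sa_sort A) (sa_car A).
HB.instance Definition _ (R : realType) (A : superAlgebra R) :=
  GRing.Zmodule_isPzRing.Build (sa_sort A)
    (@sa_mulA R A) (@sa_mul1l R A) (@sa_mul1r R A) (@sa_mulDl R A) (@sa_mulDr R A).

Definition parity (R : realType) (A : superAlgebra R) (x : A) : A := sa_parity x.

Definition odd_elt (R : realType) (A : superAlgebra R) (x : A) : Prop :=
  parity x = - x.

Definition invertible (R : realType) (A : superAlgebra R) (x : A) : Prop :=
  exists y : A, x * y = 1 /\ y * x = 1.

Definition superalg_morphism (R : realType) (A B : superAlgebra R)
    (f : A -> B) : Prop :=
  [/\ linear f, monoid_morphism f & {morph f : x / parity x}].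

Section SuperAlgebraTheory.
Context {R : realType}.
Implicit Type A : superAlgebra R.

Lemma scaleAl A (a : R) (x y : A) : a *: (x * y) = (a *: x) * y.
Proof. exact: sa_scaleAl. Qed.
Lemma scaleAr A (a : R) (x y : A) : a *: (x * y) = x * (a *: y).
Proof. exact: sa_scaleAr. Qed.
Lemma parityD A (x y : A) : parity (x + y) = parity x + parity y.
Proof. by have := @sa_parity_linear _ A 1 x y; rewrite !scale1r. Qed.
Lemma parity0 A : parity (0 : A) = 0.
Proof. by apply: (addrI (parity (0 : A))); rewrite -parityD !addr0. Qed.
Lemma parityZ A (a : R) (x : A) : parity (a *: x) = a *: parity x.
Proof.
by have := @sa_parity_linear _ A a x 0; rewrite addr0 [sa_parity 0]parity0 addr0.
Qed.
Lemma parityN A (x : A) : parity (- x) = - parity x.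
Proof. by rewrite -scaleN1r parityZ scaleN1r. Qed.
Lemma parityM A (x y : A) : parity (x * y) = parity x * parity y.
Proof. exact: sa_parityM. Qed.
Lemma parity1 A : parity (1 : A) = 1.
Proof. exact: sa_parity1. Qed.
Lemma parityK A : involutive (@parity R A).
Proof. exact: sa_parityK. Qed.
Lemma supercomm A (i j : bool) (x y : A) :
  parity x = (-1) ^+ i *: x -> parity y = (-1) ^+ j *: y ->
  x * y = (-1) ^+ (i && j) *: (y * x).
Proof. exact: sa_comm. Qed.

End SuperAlgebraTheory.

Section AdjoinOdd.
Context {R : realType} (A : superAlgebra R).
Local Notation B := (A * A)%type.

(* A[theta] for an odd variable theta; (x, y) stands for x + y theta. *)
Definition aodd_mul (u v : B) : B :=
  (u.1 * v.1, u.1 * v.2 + u.2 * parity v.1).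
Definition aodd_parity (u : B) : B := (parity u.1, - parity u.2).

Lemma aodd_mulA : associative aodd_mul.
Proof.
move=> [a b] [c d] [e f]; rewrite /aodd_mul /=; congr pair; first exact: mulrA.
by rewrite parityM !mulrDr !mulrDl !mulrA addrA.
Qed.
Lemma aodd_mul1l : left_id ((1, 0) : B) aodd_mul.
Proof. by move=> [a b]; rewrite /aodd_mul /= !mul1r mul0r addr0. Qed.
Lemma aodd_mul1r : right_id ((1, 0) : B) aodd_mul.
Proof. by move=> [a b]; rewrite /aodd_mul /= parity1 !mulr1 mulr0 add0r. Qed.
Lemma aodd_mulDl : left_distributive aodd_mul +%R.
Proof.
move=> [a b] [c d] [e f]; rewrite /aodd_mul /=; congr pair => /=.
  by rewrite mulrDl.
by rewrite !mulrDl addrACA.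
Qed.
Lemma aodd_mulDr : right_distributive aodd_mul +%R.
Proof.
move=> [a b] [c d] [e f]; rewrite /aodd_mul /=; congr pair => /=.
  by rewrite mulrDr.
by rewrite parityD !mulrDr addrACA.
Qed.
Lemma aodd_scaleAl (a : R) (u v : B) :
  a *: aodd_mul u v = aodd_mul (a *: u) v.
Proof.
case: u v => [u u'] [v v']; congr pair => /=; first exact: scaleAl.
by rewrite scalerDr !scaleAl.
Qed.
Lemma aodd_scaleAr (a : R) (u v : B) :
  a *: aodd_mul u v = aodd_mul u (a *: v).
Proof.
case: u v => [u u'] [v v']; congr pair => /=; first exact: scaleAr.
by rewrite scalerDr parityZ !scaleAr.
Qed.
Lemma aodd_parity_linear : linear aodd_parity.
Proof.
move=> a [u u'] [v v']; congr pair; rewrite /= parityD parityZ //.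
by rewrite opprD scalerN.
Qed.
Lemma aodd_parity1 : aodd_parity (1, 0) = (1, 0).
Proof. by congr pair; rewrite /= ?parity1 // parity0 oppr0. Qed.
Lemma aodd_parityM : {morph aodd_parity : u v / aodd_mul u v}.
Proof.
move=> [u u'] [v v']; congr pair; rewrite /= ?parityM //.
by rewrite parityD !parityM opprD mulrN mulNr parityK.
Qed.
Lemma aodd_parityK : involutive aodd_parity.
Proof. by move=> [u v]; rewrite /aodd_parity /= parityN opprK !parityK. Qed.
Lemma aodd_comm (i j : bool) (x y : B) :
  aodd_parity x = (-1) ^+ i *: x -> aodd_parity y = (-1) ^+ j *: y ->
  aodd_mul x y = (-1) ^+ (i && j) *: aodd_mul y x.
Proof.
have aux (k : bool) (a : A) :
    - parity a = (-1) ^+ k *: a -> parity a = (-1) ^+ (~~ k) *: a.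
  move=> h; rewrite -[LHS]opprK h -scaleN1r scalerA; congr (_ *: _).
  by case: k {h}; rewrite /= ?expr0 ?expr1 ?mulN1r ?mulr1 ?opprK.
case: x y => [x x'] [y y'] [hx /aux hx'] [hy /aux hy'].
congr pair => /=; first exact: supercomm.
rewrite scalerDr hx hy -!scaleAr (supercomm hx hy') (supercomm hx' hy).
rewrite !scalerA addrC; case: i {hx hx'}; case: j {hy hy'};
  by rewrite /= ?expr0 ?expr1 ?mulrNN ?mulN1r ?mul1r ?mulr1 ?opprK.
Qed.

Definition adjoin_odd : superAlgebra R :=
  @SuperAlgebra R (A * A)%type (1, 0) aodd_mul
    aodd_mulA aodd_mul1l aodd_mul1r aodd_mulDl aodd_mulDr
    aodd_scaleAl aodd_scaleAr aodd_parity aodd_parity_linear aodd_parity1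
    aodd_parityM aodd_parityK aodd_comm.

End AdjoinOdd.

Section Smooth.
Context {R : realType} {p : nat}.
Local Notation E := 'rV[R]_p.

Fixpoint Ck (k : nat) (U : set E) (f : E -> R) : Prop :=
  (forall x, U x -> {for x, continuous f}) /\
  if k is k'.+1 then forall i : 'I_p,
    (forall x, U x -> derivable f x (delta_mx 0 i)) /\
    Ck k' U (fun x => 'D_(delta_mx 0 i) f x)
  else True.

Definition smooth_on (U : set E) (f : E -> R) : Prop := forall k, Ck k U f.

Lemma CkS k U f : Ck k.+1 U f -> Ck k U f.
Proof.
elim: k f => [|k IH] f; first by case=> h _; split.
move=> [h1 h2]; split => // i; have [hd hk] := h2 i; split => //.
exact: IH.
Qed.

Lemma Ck_sub k (U V : set E) f : V `<=` U -> Ck k U f -> Ck k V f.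
Proof.
move=> VU; elim: k f => [|k IH] f [h1 h2]; split => //; try by move=> x /VU /h1.
move=> i; have [hd hk] := h2 i; split; last exact: IH.
by move=> x /VU /hd.
Qed.

Lemma Ck_bigcup k (I : Type) (F : I -> set E) f :
  (forall i, Ck k (F i) f) -> Ck k (\bigcup_i F i) f.
Proof.
elim: k f => [|k IH] f h; split => //.
- by move=> x [i _ Fx]; apply: (h i).1.
- by move=> x [i _ Fx]; apply: (h i).1.
- move=> j; split; first by move=> x [i _ Fx]; exact: ((h i).2 j).1.
  by apply: IH => i; exact: ((h i).2 j).2.
Qed.

Lemma Ck_eq k (U : set E) f g : open U -> {in U, f =1 g} -> Ck k U f -> Ck k U g.
Proof.
move=> oU; elim: k f g => [|k IH] f g fg [h1 h2].
all: have fgx x : U x -> \forall y \near x, f y = g y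
  by move=> Ux; apply: filterS (open_nbhs_nbhs (conj oU Ux)) => y Uy;
     apply: fg; rewrite inE.
all: have cg x : U x -> {for x, continuous g}
  by move=> Ux; have fx := fgx x Ux; rewrite /prop_for /continuous_at;
     rewrite -(nbhs_singleton fx); apply: cvg_trans (h1 x Ux);
     exact: (@near_eq_cvg _ _ (nbhs x) _ f g fx).
all: split => //.
move=> i; have [hd hk] := h2 i; split.
  by move=> x Ux; apply: near_eq_derivable (hd x Ux); exact: fgx.
apply: IH hk => x; rewrite inE => Ux; apply: near_eq_derive; exact: fgx.
Qed.

Lemma Ck_cst k U (a : R) : Ck k U (cst a).
Proof.
elim: k a => [|k IH] a; split => //; try by move=> x _; exact: cst_continuous.
move=> i; split; first by move=> x _; exact: derivable_cst.
suff -> : (fun x : E => 'D_(delta_mx 0 i) (cst a) x) = cst 0 by exact: IH.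
by apply/funext => x; rewrite derive_cst.
Qed.

Lemma CkD k U f g : open U -> Ck k U f -> Ck k U g -> Ck k U (f \+ g).
Proof.
move=> oU; elim: k f g => [|k IH] f g [f1 f2] [g1 g2]; split => //.
- by move=> x Ux; apply: continuousD; [exact: f1|exact: g1].
- by move=> x Ux; apply: continuousD; [exact: f1|exact: g1].
move=> i; have [fd fk] := f2 i; have [gd gk] := g2 i; split.
  by move=> x Ux; apply: derivableD; [exact: fd|exact: gd].
apply: Ck_eq (IH _ _ fk gk) => // x; rewrite inE => Ux.
by rewrite [RHS]deriveD //; [exact: fd|exact: gd].
Qed.

Lemma CkM k U f g : open U -> Ck k U f -> Ck k U g -> Ck k U (f \* g).
Proof.
move=> oU; elim: k f g => [|k IH] f g Hf Hg.
  by split => // x Ux; apply: continuousM; [exact: Hf.1|exact: Hg.1].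
have [f1 f2] := Hf; have [g1 g2] := Hg; split.
  by move=> x Ux; apply: continuousM; [exact: f1|exact: g1].
move=> i; have [fd fk] := f2 i; have [gd gk] := g2 i; split.
  by move=> x Ux; apply: derivableM; [exact: fd|exact: gd].
apply: Ck_eq (CkD oU (IH _ _ (CkS Hf) gk) (IH _ _ (CkS Hg) fk)) => //.
move=> x; rewrite inE => Ux.
by rewrite [RHS]deriveM //; [exact: fd|exact: gd].
Qed.

End Smooth.

(* Sections over U of the sheaf of smooth functions on R^p, a function on U being
   represented by its extension by 0.  Only open sets U matter: interior U = U. *)
Section SmoothSections.
Context {R : realType} {p : nat} (U : set 'rV[R]_p).
Local Notation E := 'rV[R]_p.

Definition smooth_section (f : E -> R) : Prop :=
  smooth_on (interior U) f /\ forall x, ~ U x -> f x = 0.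

Definition smooth_section_pred : {pred E -> R} :=
  fun f => `[< smooth_section f >].

Lemma smooth_section_submod : submod_closed smooth_section_pred.
Proof.
split.
  by apply/asboolP; split=> // k; exact: Ck_cst.
move=> a f g /asboolP [fs f0] /asboolP [gs g0]; apply/asboolP; split.
  move=> k; apply: CkD (gs k); first exact: open_interior.
  by apply: CkM (fs k); [exact: open_interior|exact: (@Ck_cst _ _ k _ a)].
by move=> x Ux; change (a * f x + g x = 0); rewrite f0 // g0 // mulr0 addr0.
Qed.

HB.instance Definition _ := GRing.isSubmodClosed.Build R (E -> R)
  smooth_section_pred smooth_section_submod.

Record smoothSection := SmoothSection {
  smooth_val :> E -> R;
  smooth_valP : smooth_val \in smooth_section_pred }.

HB.instance Definition _ := [isSub for smooth_val].
HB.instance Definition _ := [Choice of smoothSection by <:].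
HB.instance Definition _ := [SubChoice_isSubLmodule of smoothSection by <:].

Lemma smooth_ext (f g : smoothSection) : f =1 g -> f = g.
Proof. by move=> fg; apply: val_inj; apply/funext. Qed.

Lemma smooth0 (f : smoothSection) x : ~ U x -> f x = 0.
Proof. by have /asboolP [_] := smooth_valP f; apply. Qed.

Lemma smooth_in (f : smoothSection) : smooth_on (interior U) f.
Proof. by have /asboolP [] := smooth_valP f. Qed.

End SmoothSections.

Section SmoothAlgebra.
Context {R : realType} {p : nat}.
Local Notation E := 'rV[R]_p.

Lemma smooth_patch (U V : set E) (f : E -> R) :
  smooth_on U f -> interior V `<=` U -> smooth_section V (f \_ V).
Proof.
move=> fs VU; split; last by move=> x Vx; rewrite patchN // notin_setE.
move=> k; apply: Ck_eq (Ck_sub VU (fs k)); first exact: open_interior.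
by move=> x; rewrite inE => /interior_subset Vx; rewrite patchT // inE.
Qed.

Lemma smooth_one_subproof (U : set E) : ((cst 1 : E -> R) \_ U) \in smooth_section_pred U.
Proof. by apply/asboolP; apply: (@smooth_patch setT) => // k; exact: Ck_cst. Qed.
Definition smooth_one (U : set E) : smoothSection U :=
  SmoothSection (smooth_one_subproof U).

Lemma smooth_mul_subproof (U : set E) (f g : smoothSection U) :
  (f \* g : E -> R) \in smooth_section_pred U.
Proof.
apply/asboolP; split; last by move=> x Ux /=; rewrite smooth0 // mul0r.
by move=> k; apply: CkM; [exact: open_interior|exact: smooth_in|exact: smooth_in].
Qed.
Definition smooth_mul (U : set E) (f g : smoothSection U) : smoothSection U :=
  SmoothSection (smooth_mul_subproof f g).

Lemma smooth_res_subproof (U V : set E) (VU : V `<=` U) (f : smoothSection U) :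
  ((f : E -> R) \_ V) \in smooth_section_pred V.
Proof.
by apply/asboolP; apply: smooth_patch (@smooth_in _ _ _ f) _; exact: interiorS.
Qed.
Definition smooth_res (U V : set E) (VU : V `<=` U) (f : smoothSection U) :
  smoothSection V := SmoothSection (smooth_res_subproof VU f).

Section Laws.
Variable U : set E.
Lemma smooth_mulC : commutative (@smooth_mul U).
Proof. by move=> f g; apply: smooth_ext => x /=; rewrite mulrC. Qed.
Lemma smooth_mulA : associative (@smooth_mul U).
Proof. by move=> f g h; apply: smooth_ext => x /=; rewrite mulrA. Qed.
Lemma smooth_mul1l : left_id (smooth_one U) (@smooth_mul U).
Proof.
move=> f; apply: smooth_ext => x /=; rewrite /patch.
by case: ifPn => [_|]; rewrite ?mul1r // notin_setE => Ux; rewrite smooth0 ?mul0r.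
Qed.
Lemma smooth_mul1r : right_id (smooth_one U) (@smooth_mul U).
Proof. by move=> f; rewrite smooth_mulC smooth_mul1l. Qed.
Lemma smooth_mulDl : left_distributive (@smooth_mul U) +%R.
Proof. by move=> f g h; apply: smooth_ext => x; exact: mulrDl. Qed.
Lemma smooth_mulDr : right_distributive (@smooth_mul U) +%R.
Proof. by move=> f g h; apply: smooth_ext => x; exact: mulrDr. Qed.
Lemma smooth_scaleAl (a : R) (f g : smoothSection U) :
  a *: smooth_mul f g = smooth_mul (a *: f) g.
Proof. by apply: smooth_ext => x; exact: mulrA. Qed.
Lemma smooth_scaleAr (a : R) (f g : smoothSection U) :
  a *: smooth_mul f g = smooth_mul f (a *: g).
Proof. by apply: smooth_ext => x; exact: mulrCA. Qed.
Lemma smooth_id_linear : linear (id : smoothSection U -> smoothSection U).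
Proof. by []. Qed.
Lemma smooth_super_comm (i j : bool) (f g : smoothSection U) :
  f = (-1) ^+ i *: f -> g = (-1) ^+ j *: g ->
  smooth_mul f g = (-1) ^+ (i && j) *: smooth_mul g f.
Proof.
case: i => /=; last by rewrite !expr0 !scale1r smooth_mulC.
case: j => /=; last by rewrite !expr0 !scale1r smooth_mulC.
rewrite !expr1 !scaleN1r => hf _.
have -> : f = 0.
  apply: smooth_ext => x; apply/eqP; have /(congr1 (fun h : smoothSection U => h x)) := hf.
  change (f x = - f x -> f x == 0); move/eqP; rewrite -subr_eq0 opprK -mulr2n.
  by rewrite mulrn_eq0.
rewrite (smooth_mulC g); apply: smooth_ext => x /=.
by change (0 * g x = - (0 * g x)); rewrite mul0r oppr0.
Qed.

Definition smooth_algebra : superAlgebra R :=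
  @SuperAlgebra R (smoothSection U) (smooth_one U) (@smooth_mul U)
    smooth_mulA smooth_mul1l smooth_mul1r smooth_mulDl smooth_mulDr
    smooth_scaleAl smooth_scaleAr id smooth_id_linear (erefl _)
    (fun _ _ => erefl _) (fun _ => erefl _) smooth_super_comm.
End Laws.

Lemma smooth_res_alg (U V : set E) (VU : V `<=` U) :
  @superalg_morphism R (smooth_algebra U) (smooth_algebra V) (smooth_res VU).
Proof.
split=> [a f g| |f //].
  apply: smooth_ext => x; rewrite /smooth_res /=.
  change ((a *: (f : smoothSection U) + (g : smoothSection U) : E -> R) \_ V x =
     a * ((f : smoothSection U) : E -> R) \_ V x + ((g : smoothSection U) : E -> R) \_ V x).
  by rewrite /patch; case: ifP => // _; rewrite mulr0 addr0.
split.
  apply: smooth_ext => x /=; rewrite /patch; case: ifPn => //.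
  by rewrite inE => /VU Ux; rewrite (mem_set Ux).
move=> f g; apply: smooth_ext => x /=; rewrite /patch; case: ifP => //.
by rewrite mulr0.
Qed.

Lemma smooth_res_id (U : set E) (UU : U `<=` U) f : smooth_res UU f = f.
Proof.
apply: smooth_ext => x /=; rewrite /patch; case: ifPn => //.
by rewrite notin_setE => Ux; rewrite smooth0.
Qed.

Lemma smooth_res_comp (U V W : set E) (VU : V `<=` U) (WV : W `<=` V)
    (WU : W `<=` U) f : smooth_res WV (smooth_res VU f) = smooth_res WU f.
Proof.
apply: smooth_ext => x /=; rewrite /patch; case: ifPn => //.
by rewrite inE => /WV Vx; rewrite mem_set.
Qed.

Lemma smooth_glue (I : Type) (F : I -> set E) (oF : forall i, open (F i))
    (s : forall i, smoothSection (F i)) :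
  (forall i j, smooth_res (@subIsetl _ (F i) (F j)) (s i) =
               smooth_res (@subIsetr _ (F i) (F j)) (s j)) ->
  exists! t : smoothSection (\bigcup_i F i),
    forall i, smooth_res (bigcup_sup Logic.I) t = s i.
Proof.
move=> agree.
have ag i j x : F i x -> F j x -> s i x = s j x.
  move=> Fi Fj; have /(congr1 (fun h : smoothSection (F i `&` F j) => h x)) := agree i j.
  by rewrite /= !patchT // inE.
pose f x : R := if pselect (exists i, F i x) is left h then s (projT1 (cid h)) x else 0.
have fE i x : F i x -> f x = s i x.
  move=> Fx; rewrite /f; case: pselect => [h|[]]; last by exists i.
  by apply: ag => //; exact: projT2 (cid h).
have fP : f \in smooth_section_pred (\bigcup_i F i).
  apply/asboolP; split.
    move=> k; apply: Ck_sub (@interior_subset _ _) _; apply: Ck_bigcup => i.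
    apply: (@Ck_eq _ _ _ _ (s i)) => //; first by move=> x; rewrite inE => /fE.
    by apply: Ck_sub (@smooth_in _ _ _ (s i) k); have := oF i; rewrite openE.
  move=> x nx; rewrite /f; case: pselect => // -[i Fx]; case: nx; by exists i.
exists (SmoothSection fP); split.
  move=> i; apply: smooth_ext => x /=; rewrite /patch; case: ifPn.
    by rewrite inE => /fE.
  by rewrite notin_setE => nx; rewrite smooth0.
move=> t ht; apply: smooth_ext => x /=.
have [[i _ Fx]|nx] := pselect ((\bigcup_i F i) x); last first.
  rewrite [RHS]smooth0 // /f; case: pselect => // -[i Fx]; case: nx; by exists i.
rewrite (fE i) // -(ht i) /= patchT // inE //.
Qed.

End SmoothAlgebra.

(* Topological spaces with a sheaf of supercommutative superalgebras.  Sections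
   over sets that are not open are never used. *)
Record superspace (R : realType) := Superspace {
  space :> topologicalType;
  sec : set space -> superAlgebra R;
  res : forall U V : set space, V `<=` U -> sec U -> sec V;
  res_alg : forall (U V : set space) (VU : V `<=` U),
    superalg_morphism (res VU);
  res_id : forall (U : set space) (UU : U `<=` U) s, res UU s = s;
  res_comp : forall (U V W : set space) (VU : V `<=` U) (WV : W `<=` V)
    (WU : W `<=` U) s, res WV (res VU s) = res WU s;
  sec_glue : forall (I : Type) (F : I -> set space) (oF : forall i, open (F i))
    (s : forall i, sec (F i)),
    (forall i j, res (@subIsetl _ (F i) (F j)) (s i) =
                 res (@subIsetr _ (F i) (F j)) (s j)) ->
    exists! t : sec (\bigcup_i F i), forall i, res (bigcup_sup Logic.I) t = s i
}.
Arguments sec {R} M U : rename.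
Arguments res {R M U V} VU s : rename.

Section Superspaces.
Context {R : realType}.
Implicit Types M N P T : superspace R.

(* The germ of s at x is invertible. *)
Definition invertible_at M (x : M) (U : set M) (s : sec M U) : Prop :=
  exists (W : set M) (WU : W `<=` U), [/\ open W, W x & invertible (res WU s)].

(* a is the value s(x), i.e. the number a with s - a in the maximal ideal of the
   stalk at x. *)
Definition value_at M (x : M) (U : set M) (s : sec M U) (a : R) : Prop :=
  ~ invertible_at x (s - a *: (1 : sec M U)).

Record smor M N := Smor {
  smor_fun :> M -> N;
  smor_cont : forall V : set N, open V -> open (smor_fun @^-1` V);
  pull : forall V : set N, open V -> sec N V -> sec M (smor_fun @^-1` V);
  pull_alg : forall (V : set N) (oV : open V), superalg_morphism (pull oV);
  pull_res : forall (U V : set N) (oU : open U) (oV : open V) (VU : V `<=` U) s,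
    pull oV (res VU s) = res (preimage_subset VU) (pull oU s);
  pull_local : forall (V : set N) (oV : open V) (x : M) (s : sec N V),
    V (smor_fun x) -> invertible_at x (pull oV s) ->
    invertible_at (smor_fun x) s
}.

Lemma smor_ext M N (f g : smor M N) (e : smor_fun f = smor_fun g) :
  (forall V (oV : open V) s,
    eq_rect (smor_fun f) (fun h => sec M (h @^-1` V)) (pull f oV s) _ e =
    pull g oV s) -> f = g.
Proof.
case: f g e => [f fc fp fa fr fl] [g gc gp ga gr gl] /= e; subst g => /= h.
have e : fp = gp.
  by do 3 apply/functional_extensionality_dep => ?; exact: h.
subst gp; rewrite (Prop_irrelevance gc fc) (Prop_irrelevance ga fa).
by rewrite (Prop_irrelevance gr fr) (Prop_irrelevance gl fl).
Qed.

Lemma smor_eq_pull M N (f g : smor M N) (E : f = g) (e : smor_fun f = smor_fun g)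
    V (oV : open V) s :
  eq_rect (smor_fun f) (fun h => sec M (h @^-1` V)) (pull f oV s) _ e =
  pull g oV s.
Proof. by subst g; rewrite (Prop_irrelevance e erefl). Qed.

Lemma smor_id_local M (V : set M) (x : M) (s : sec M V) :
  V x -> invertible_at x s -> invertible_at x s.
Proof. by []. Qed.

Lemma superalg_morphism_id (A : superAlgebra R) : superalg_morphism (@id A).
Proof. by []. Qed.

Lemma superalg_morphism_comp (A B C : superAlgebra R) (f : A -> B) (g : B -> C) :
  superalg_morphism f -> superalg_morphism g -> superalg_morphism (g \o f).
Proof.
move=> [fl [f1 fM] fp] [gl [g1 gM] gp]; split.
- by move=> a x y; rewrite /= fl gl.
- by split => [|x y]; rewrite /= ?f1 // fM gM.
- by move=> x; rewrite /= fp gp.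
Qed.

Lemma smor_id_res M (U V : set M) (oU : open U) (oV : open V) (VU : V `<=` U)
    (s : sec M U) : res VU s = res (@preimage_subset _ _ (@id M) _ _ VU) s.
Proof. by congr res; exact: Prop_irrelevance. Qed.

Definition sid M : smor M M :=
  @Smor M M id (fun _ oV => oV) (fun _ _ s => s)
    (fun V _ => superalg_morphism_id (sec M V)) (@smor_id_res M)
    (fun V _ x s => @smor_id_local M V x s).

Section Comp.
Variables (M N P : superspace R) (g : smor N P) (f : smor M N).
Let pullgf (V : set P) (oV : open V) (s : sec P V) : sec M ((g \o f) @^-1` V) :=
  pull f (smor_cont g oV) (pull g oV s).

Lemma scomp_res (U V : set P) (oU : open U) (oV : open V) (VU : V `<=` U) s :
  pullgf oV (res VU s) = res (preimage_subset VU) (pullgf oU s).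
Proof.
rewrite /pullgf (pull_res g oU oV) (pull_res f (smor_cont g oU) (smor_cont g oV)).
by congr res; exact: Prop_irrelevance.
Qed.

Lemma scomp_local (V : set P) (oV : open V) (x : M) (s : sec P V) :
  V ((g \o f) x) -> invertible_at x (pullgf oV s) -> invertible_at ((g \o f) x) s.
Proof.
by move=> Vx h; apply: (pull_local (oV := oV)) => //; exact: pull_local h.
Qed.

Definition scomp : smor M P :=
  @Smor M P (g \o f) (fun V oV => smor_cont f (smor_cont g oV)) pullgf
    (fun V oV => superalg_morphism_comp (pull_alg g oV)
                   (pull_alg f (smor_cont g oV)))
    scomp_res scomp_local.
End Comp.

Lemma scomp1 M N (f : smor M N) : scomp (sid N) f = f.
Proof.
by apply: (@smor_ext _ _ (scomp (sid N) f) f erefl) => V oV s /=;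
  congr pull; exact: Prop_irrelevance.
Qed.
Lemma scomp1r M N (f : smor M N) : scomp f (sid M) = f.
Proof. exact: (@smor_ext _ _ (scomp f (sid M)) f erefl). Qed.
Lemma scompA M N P T (h : smor P T) (g : smor N P) (f : smor M N) :
  scomp h (scomp g f) = scomp (scomp h g) f.
Proof.
exact: (@smor_ext _ _ (scomp h (scomp g f)) (scomp (scomp h g) f) erefl).
Qed.

Definition open_immersion M N (f : smor M N) : Prop :=
  [/\ injective f, forall U : set M, open U -> open (f @` U) &
      forall (V : set N) (oV : open V), V `<=` range f -> bijective (pull f oV)].

(* A tangent vector at x, as a point derivation of the stalk at x.  No sign is
   needed in the Leibniz rule, as odd sections take the value 0. *)
Definition tangent M (x : M) (D : forall U : set M, sec M U -> R) : Prop :=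
  forall U : set M, open U -> U x ->
  [/\ forall (a : R) (s t : sec M U), D U (a *: s + t) = a * D U s + D U t,
      forall (V : set M) (VU : V `<=` U) (s : sec M U),
        open V -> V x -> D V (res VU s) = D U s &
      forall (s t : sec M U) (a b : R), value_at x s a -> value_at x t b ->
        D U (s * t) = a * D U t + D U s * b].

Definition surjective_submersion M N (f : smor M N) : Prop :=
  (forall y : N, exists x : M, f x = y) /\
  forall (x : M) (w : forall V : set N, sec N V -> R), tangent (f x) w ->
    exists v : forall U : set M, sec M U -> R, tangent x v /\
      forall (V : set N) (oV : open V) (s : sec N V), V (f x) ->
        v (f @^-1` V) (pull f oV s) = w V s.

End Superspaces.

Section AlgLemmas.
Context {R : realType} {A B : superAlgebra R} {f : A -> B}.
Hypothesis fm : superalg_morphism f.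
Lemma sam_linear : linear f. Proof. by case: fm. Qed.
Lemma samM x y : f (x * y) = f x * f y. Proof. by case: fm => _ []. Qed.
Lemma sam1 : f 1 = 1. Proof. by case: fm => _ []. Qed.
Lemma samP x : f (parity x) = parity (f x). Proof. by case: fm => _ _ h; exact: h. Qed.
Lemma samD x y : f (x + y) = f x + f y.
Proof. by have := sam_linear 1 x y; rewrite !scale1r. Qed.
Lemma sam0 : f 0 = 0.
Proof. by apply: (addrI (f 0)); rewrite -samD !addr0. Qed.
Lemma samZ a x : f (a *: x) = a *: f x.
Proof. by have := sam_linear a x 0; rewrite !addr0 sam0 addr0. Qed.
Lemma samN x : f (- x) = - f x.
Proof. by rewrite -scaleN1r samZ scaleN1r. Qed.
End AlgLemmas.

Section OddSuperspace.
Context {R : realType}.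

Lemma aoddM (A : superAlgebra R) (u v : adjoin_odd A) :
  u * v = (u.1 * v.1, u.1 * v.2 + u.2 * parity v.1) :> adjoin_odd A.
Proof. by []. Qed.

Lemma aodd_invertible (A : superAlgebra R) (u : adjoin_odd A) :
  invertible u <-> invertible (u.1 : A).
Proof.
case: u => x y; split.
  by move=> [[z w] [[h _] [h' _]]]; exists z.
move=> [z [xz zx]].
exists ((z, - (z * y * parity z)) : adjoin_odd A); rewrite !aoddM /=; split.
  by congr pair; rewrite // mulrN !mulrA xz mul1r addNr.
congr pair; rewrite // mulNr -(mulrA (z * y)) -parityM zx parity1 mulr1.
by rewrite addrN.
Qed.

Section AdjoinMap.
Variables (A B : superAlgebra R) (f : A -> B) (fm : superalg_morphism f).
Definition aodd_map (u : adjoin_odd A) : adjoin_odd B := (f u.1, f u.2).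
Lemma aodd_map_alg : superalg_morphism aodd_map.
Proof.
split.
- by move=> a u v; congr pair; exact: (sam_linear fm).
- split; first by congr pair; [exact: (sam1 fm)|exact: (sam0 fm)].
  move=> u v; congr pair; first exact: (samM fm).
  by rewrite /= (samD fm) !(samM fm) (samP fm).
- move=> u; congr pair; first exact: (samP fm).
  by change (f (- parity u.2) = - parity (f u.2)); rewrite (samN fm) (samP fm).
Qed.
Lemma aodd_map_bij : bijective f -> bijective aodd_map.
Proof.
move=> [g gK fK]; exists (fun u => (g u.1, g u.2)) => -[x y];
  by rewrite /aodd_map /= ?gK ?fK.
Qed.
Lemma aodd_incl_alg : superalg_morphism (fun x : A => ((x, 0) : adjoin_odd A)).
Proof.
split.
- by move=> a x y; congr pair; rewrite /= scaler0 addr0.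
- split=> // x y; rewrite aoddM /=; congr pair.
  by rewrite mulr0 mul0r addr0.
- move=> x; congr pair; change ((0 : A) = - parity (0 : A)).
  by rewrite parity0 oppr0.
Qed.
End AdjoinMap.

Section OddSpace.
Variable M : superspace R.
Let osec (U : set M) := adjoin_odd (sec M U).
Let ores (U V : set M) (VU : V `<=` U) : osec U -> osec V := aodd_map (res VU).

Lemma odd_res_id (U : set M) (UU : U `<=` U) s : ores UU s = s.
Proof. by case: s => x y; congr pair; exact: res_id. Qed.
Lemma odd_res_comp (U V W : set M) (VU : V `<=` U) (WV : W `<=` V)
  (WU : W `<=` U) s : ores WV (ores VU s) = ores WU s.
Proof. by congr pair; exact: res_comp. Qed.
Lemma odd_glue (I : Type) (F : I -> set M) (oF : forall i, open (F i))
    (s : forall i, osec (F i)) :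
    (forall i j, ores (@subIsetl _ (F i) (F j)) (s i) =
                 ores (@subIsetr _ (F i) (F j)) (s j)) ->
    exists! t : osec (\bigcup_i F i), forall i, ores (bigcup_sup Logic.I) t = s i.
Proof.
move=> h.
have [i j|t1 [t1P t1u]] := @sec_glue _ M I F oF (fun i => (s i).1).
  by have [] := h i j.
have [i j|t2 [t2P t2u]] := @sec_glue _ M I F oF (fun i => (s i).2).
  by have [] := h i j.
exists (t1, t2); split.
  by move=> i; rewrite /ores /aodd_map /= t1P t2P; case: (s i).
move=> [u1 u2] hu; congr pair.
  by apply: t1u => i; have [] := (hu i, f_equal fst (hu i)).
by apply: t2u => i; have [] := (hu i, f_equal snd (hu i)).
Qed.

(* The product of M with R^{0|1}: same space, with structure sheaf O_M[theta]. *)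
Definition odd_superspace : superspace R :=
  @Superspace R M osec ores (fun U V VU => aodd_map_alg (@res_alg _ M U V VU))
    odd_res_id odd_res_comp odd_glue.

Lemma odd_invertible_at (x : M) (U : set M) (s : sec odd_superspace U) :
  @invertible_at R odd_superspace x U s <-> @invertible_at R M x U s.1.
Proof.
split=> -[W [WU [oW Wx h]]]; exists W, WU; split=> //.
  exact: (aodd_invertible _).1 h.
exact: (aodd_invertible (ores WU s)).2 h.
Qed.

Lemma odd_proj_res (U V : set M) (oU : open U) (oV : open V) (VU : V `<=` U)
    (s : sec M U) :
  ((res VU s, 0) : sec odd_superspace V) =
  @res R odd_superspace _ _ (@preimage_subset _ _ (@id M) _ _ VU) (s, 0).
Proof.
congr pair; last by rewrite (sam0 (res_alg _)).
by congr res; exact: Prop_irrelevance.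
Qed.

Definition odd_proj : smor odd_superspace M :=
  @Smor R odd_superspace M id (fun _ oV => oV)
    (fun V _ s => ((s, 0) : sec odd_superspace V))
    (fun V _ => aodd_incl_alg (sec M V)) odd_proj_res
    (fun V _ x s Vx h => (odd_invertible_at x (s, 0)).1 h).

Lemma odd_proj_submersion : surjective_submersion odd_proj.
Proof.
split; first by move=> y; exists y.
move=> x w wt; exists (fun U (s : sec odd_superspace U) => w U s.1); split=> //.
move=> U oU Ux; have [wl wr wm] := wt U oU Ux; split.
- by move=> a s t; exact: wl.
- by move=> V VU s oV Vx; exact: wr.
- move=> s t a b sa tb; apply: wm.
    move=> h; apply: sa; apply/odd_invertible_at; exact: h.
  by move=> h; apply: tb; apply/odd_invertible_at; exact: h.
Qed.
End OddSpace.

Section OddMap.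
Variables (M N : superspace R) (f : smor M N).
Let opull (V : set N) (oV : open V) :
  sec (odd_superspace N) V -> sec (odd_superspace M) (f @^-1` V) :=
  aodd_map (pull f oV).
Lemma odd_map_res (U V : set N) (oU : open U) (oV : open V) (VU : V `<=` U)
    (s : sec (odd_superspace N) U) :
  opull oV (@res R (odd_superspace N) _ _ VU s) =
  @res R (odd_superspace M) _ _ (@preimage_subset _ _ f _ _ VU) (opull oU s).
Proof. by congr pair; exact: pull_res. Qed.
Lemma odd_map_local (V : set N) (oV : open V) (x : M)
    (s : sec (odd_superspace N) V) : V (f x) ->
  @invertible_at R (odd_superspace M) x _ (opull oV s) ->
  @invertible_at R (odd_superspace N) (f x) _ s.
Proof.
by move=> Vx /odd_invertible_at h; apply/odd_invertible_at; exact: pull_local h.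
Qed.
Definition odd_map : smor (odd_superspace M) (odd_superspace N) :=
  @Smor R (odd_superspace M) (odd_superspace N) f (@smor_cont _ _ _ f) opull
    (fun V oV => aodd_map_alg (pull_alg f oV)) odd_map_res odd_map_local.
Lemma odd_map_immersion : open_immersion f -> open_immersion odd_map.
Proof.
move=> [fi fo fb]; split=> // V oV Vf; apply: aodd_map_bij; exact: fb.
Qed.
Lemma odd_map_proj : scomp (odd_proj N) odd_map = scomp f (odd_proj M).
Proof.
apply: (@smor_ext _ _ _ (scomp (odd_proj N) odd_map)
  (scomp f (odd_proj M)) erefl) => V oV s /=.
by congr pair; exact: (sam0 (pull_alg f oV)).
Qed.
End OddMap.

Lemma odd_map_id (M : superspace R) : odd_map (sid M) = sid (odd_superspace M).
Proof.
by apply: (@smor_ext _ _ _ (odd_map (sid M)) (sid (odd_superspace M)) erefl)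
  => V oV [s t].
Qed.
Lemma odd_map_comp (M N P : superspace R) (g : smor N P) (f : smor M N) :
  odd_map (scomp g f) = scomp (odd_map g) (odd_map f).
Proof.
by apply: (@smor_ext _ _ _ (odd_map (scomp g f)) (scomp (odd_map g) (odd_map f))
  erefl) => V oV [s t].
Qed.
End OddSuperspace.

(* R^{p|q}: the space R^p with structure sheaf C^oo[theta_1, ..., theta_q]. *)
Definition Rsuper (R : realType) (p q : nat) : superspace R :=
  iter q (@odd_superspace R)
    (@Superspace R 'rV[R]_p (@smooth_algebra R p) (@smooth_res R p)
      (@smooth_res_alg R p) (@smooth_res_id R p) (@smooth_res_comp R p)
      (@smooth_glue R p)).

Definition locally_iso (R : realType) (M N : superspace R) : Prop :=
  forall x : M, exists (A : superspace R) (f : smor A M) (g : smor A N),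
    [/\ open_immersion f, open_immersion g & range f x].

Definition is_supermanifold (R : realType) (p q : nat) (M : superspace R) : Prop :=
  [/\ hausdorff_space M, @second_countable M & locally_iso M (Rsuper R p q)].

Lemma odd_is_supermanifold (R : realType) p q (M : superspace R) :
  is_supermanifold p q M -> is_supermanifold p q.+1 (odd_superspace M).
Proof.
move=> [h2 sc li]; split=> // x; have [A [f [g [fi gi fx]]]] := li x.
exists (odd_superspace A), (odd_map f), (odd_map g).
by split=> //; exact: odd_map_immersion.
Qed.

Record sm (R : realType) := SM {
  sm_space :> superspace R;
  smP : exists p q, is_supermanifold p q sm_space
}.

(* Ordinary manifolds are the supermanifolds of odd dimension 0. *)
Definition is_manifold (R : realType) (M : sm R) : Prop :=
  exists p, is_supermanifold p 0 M.

Record category := Category {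
  ob :> Type;
  hom : ob -> ob -> Type;
  idm : forall X, hom X X;
  cmp : forall X Y Z, hom Y Z -> hom X Y -> hom X Z;
  cmp1l : forall X Y (f : hom X Y), cmp (idm Y) f = f;
  cmp1r : forall X Y (f : hom X Y), cmp f (idm X) = f;
  cmpA : forall X Y Z T (h : hom Z T) (g : hom Y Z) (f : hom X Y),
    cmp h (cmp g f) = cmp (cmp h g) f
}.

Record presheaf (C : category) := Presheaf {
  psh :> C -> Type;
  act : forall X Y : C, hom X Y -> psh Y -> psh X;
  act1 : forall (X : C) (s : psh X), act (idm X) s = s;
  actM : forall (X Y Z : C) (g : hom Y Z) (f : hom X Y) (s : psh Z),
    act (cmp g f) s = act f (act g s)
}.

Definition representable (C : category) (F : presheaf C) : Prop :=
  exists (X : C) (phi : forall N : C, F N -> hom N X),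
    (forall N, bijective (phi N)) /\
    forall (N N' : C) (b : hom N' N) (s : F N),
      phi N' (act b s) = cmp (phi N s) b.

Definition SM_cat (R : realType) : category :=
  @Category (sm R) (fun M N => smor M N) (fun M => sid M)
    (fun M N P => @scomp R M N P) (fun M N => @scomp1 R M N)
    (fun M N => @scomp1r R M N) (fun M N P T => @scompA R M N P T).

(* Morphisms [q] -> [p] of the simplex category, [p] being 'I_p.+1. *)
Record delta (q p : nat) := Delta {
  delta_fun :> 'I_q.+1 -> 'I_p.+1;
  delta_mono : forall i j : 'I_q.+1, (i <= j)%N -> (delta_fun i <= delta_fun j)%N
}.

Definition delta_id (p : nat) : delta p p := @Delta p p id (fun _ _ h => h).
Definition delta_comp (r q p : nat) (f : delta q p) (g : delta r q) : delta r p :=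
  @Delta r p (f \o g) (fun i j h => delta_mono f (delta_mono g h)).

Section Simplicial.
Context {R : realType}.

Record simplicial := Simplicial {
  sx :> nat -> sm R;
  sop : forall q p : nat, delta q p -> smor (sx p) (sx q);
  sop_id : forall p, sop (delta_id p) = sid (sx p);
  sop_comp : forall (r q p : nat) (f : delta q p) (g : delta r q),
    sop (delta_comp f g) = scomp (sop g) (sop f)
}.

Record simplicial_map (Z K : simplicial) := SimplicialMap {
  smap :> forall p : nat, smor (Z p) (K p);
  smap_nat : forall (q p : nat) (f : delta q p),
    scomp (sop K f) (smap p) = scomp (smap q) (sop Z f)
}.

Lemma smap_ext (Z K : simplicial) (u v : simplicial_map Z K) :
  (forall p, u p = v p) -> u = v.
Proof.
case: u v => [u un] [v vn] /= h.
have e : u = v by apply/functional_extensionality_dep.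
by subst v; rewrite (Prop_irrelevance un vn).
Qed.

(* The q-simplices of the horn [p, k]. *)
Definition in_horn (p : nat) (k : 'I_p.+1) (q : nat) (f : delta q p) : Prop :=
  ~ (forall i : 'I_p.+1, i != k -> exists j, f j = i).

(* T-points of K_{p,k}: compatible families of maps T -> K_q indexed by the
   simplices of the horn. *)
Record horn (K : simplicial) (p : nat) (k : 'I_p.+1) (T : sm R) := Horn {
  horn_face : forall (q : nat) (f : delta q p), in_horn k f -> smor T (K q);
  horn_nat : forall (r q : nat) (g : delta r q) (f : delta q p)
    (hf : in_horn k f) (hfg : in_horn k (delta_comp f g)),
    horn_face hfg = scomp (sop K g) (horn_face hf)
}.

(* (H, u) represents the presheaf of horns, u being the universal horn. *)
Definition is_horn_space (K : simplicial) (p : nat) (k : 'I_p.+1) (H : sm R)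
    (u : horn K k H) : Prop :=
  forall (T : sm R) (x : horn K k T), exists! g : smor T H,
    forall (q : nat) (f : delta q p) (hf : in_horn k f),
      horn_face x hf = scomp (horn_face u hf) g.

(* P holds for K_{p,k} and the map K_p -> K_{p,k}. *)
Definition horn_map_satisfies (K : simplicial) (p : nat) (k : 'I_p.+1)
    (P : forall H : sm R, smor (K p) H -> Prop) : Prop :=
  exists (H : sm R) (u : horn K k H) (r : smor (K p) H),
    [/\ is_manifold H, is_horn_space u,
        forall (q : nat) (f : delta q p) (hf : in_horn k f),
          scomp (horn_face u hf) r = sop K f
      & P H r].

Arguments horn_map_satisfies K {p} k P.

Definition kan (K : simplicial) : Prop :=
  forall (p : nat) (k : 'I_p.+1), (0 < p)%N ->
    horn_map_satisfies K k (fun H r => surjective_submersion r).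

Definition truncated (m : nat) (K : simplicial) : Prop :=
  forall (p : nat) (k : 'I_p.+1), (0 < p)%N -> (m <= p)%N ->
    horn_map_satisfies K k (fun H r => bijective r).

End Simplicial.
Arguments simplicial : clear implicits.

Section Nerve.
Context {R : realType}.

Definition equalized (M N : sm R) (pi : smor M N) (p : nat) (T : sm R)
    (g : 'I_p.+1 -> smor T M) : Prop :=
  forall i j, scomp pi (g i) = scomp pi (g j).

(* The (p+1)-fold fibre product of M over N. *)
Record fibre_power (M N : sm R) (pi : smor M N) (p : nat) := FibrePower {
  fp_ob : sm R;
  fp_pr : 'I_p.+1 -> smor fp_ob M;
  fp_eq : equalized pi fp_pr;
  fp_lift : forall (T : sm R) (g : 'I_p.+1 -> smor T M), equalized pi g ->
    smor T fp_ob;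
  fp_liftK : forall (T : sm R) (g : 'I_p.+1 -> smor T M) (h : equalized pi g) i,
    scomp (fp_pr i) (fp_lift h) = g i;
  fp_uniq : forall (T : sm R) (u v : smor T fp_ob),
    (forall i, scomp (fp_pr i) u = scomp (fp_pr i) v) -> u = v
}.

(* Surjective submersions M -> N.  They carry a choice of the fibre products
   M x_N ... x_N M; these always exist, and are unique up to unique isomorphism,
   so that the choices do not change SSM up to equivalence. *)
Record ssm := SSM {
  ss_src : sm R;
  ss_tgt : sm R;
  ss_map : smor ss_src ss_tgt;
  ss_subm : surjective_submersion ss_map;
  ss_fib : forall p : nat, fibre_power ss_map p
}.

Record square (s t : ssm) := Square {
  sq_src : smor (ss_src s) (ss_src t);
  sq_tgt : smor (ss_tgt s) (ss_tgt t);
  sq_comm : scomp (ss_map t) sq_src = scomp sq_tgt (ss_map s)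
}.

Lemma square_ext (s t : ssm) (a b : square s t) :
  sq_src a = sq_src b -> sq_tgt a = sq_tgt b -> a = b.
Proof.
case: a b => [a a' ac] [b b' bc] /= ? ?; subst b b'.
by rewrite (Prop_irrelevance ac bc).
Qed.

Definition square_id (s : ssm) : square s s :=
  @Square s s (sid _) (sid _) (etrans (scomp1r _) (esym (scomp1 _))).

Lemma square_comp_subproof (s t u : ssm) (b : square t u) (a : square s t) :
  scomp (ss_map u) (scomp (sq_src b) (sq_src a)) =
  scomp (scomp (sq_tgt b) (sq_tgt a)) (ss_map s).
Proof. by rewrite scompA sq_comm -scompA sq_comm scompA. Qed.
Definition square_comp (s t u : ssm) (b : square t u) (a : square s t) :
  square s u := Square (square_comp_subproof b a).

Lemma square_comp1l (s t : ssm) (a : square s t) : square_comp (square_id t) a = a.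
Proof. by apply: square_ext; exact: scomp1. Qed.
Lemma square_comp1r (s t : ssm) (a : square s t) : square_comp a (square_id s) = a.
Proof. by apply: square_ext; exact: scomp1r. Qed.
Lemma square_compA (s t u v : ssm) (c : square u v) (b : square t u)
    (a : square s t) :
  square_comp c (square_comp b a) = square_comp (square_comp c b) a.
Proof. by apply: square_ext; exact: scompA. Qed.

Definition SSM_cat : category :=
  Category square_comp1l square_comp1r square_compA.

Lemma equalized_sub (M N : sm R) (pi : smor M N) (p q : nat) (T : sm R)
    (g : 'I_p.+1 -> smor T M) (f : 'I_q.+1 -> 'I_p.+1) :
  equalized pi g -> equalized pi (g \o f).
Proof. by move=> h i j; exact: h. Qed.

(* The simplicial supermanifold (M -> N)_., the nerve of M x_N M => M. *)
Section NerveObject.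
Variable s : ssm.
Local Notation F p := (ss_fib s p).

Definition nerve_op (q p : nat) (f : delta q p) : smor (fp_ob (F p)) (fp_ob (F q)) :=
  fp_lift (F q) (equalized_sub f (@fp_eq _ _ _ _ (F p))).

Lemma nerve_opE q p (f : delta q p) i :
  scomp (fp_pr (F q) i) (nerve_op f) = fp_pr (F p) (f i).
Proof. exact: fp_liftK. Qed.

Lemma nerve_op_id p : nerve_op (delta_id p) = sid (fp_ob (F p)).
Proof. by apply: fp_uniq => i; rewrite nerve_opE scomp1r. Qed.
Lemma nerve_op_comp r q p (f : delta q p) (g : delta r q) :
  nerve_op (delta_comp f g) = scomp (nerve_op g) (nerve_op f).
Proof. by apply: fp_uniq => i; rewrite scompA !nerve_opE. Qed.

Definition nerve : simplicial R := Simplicial nerve_op_id nerve_op_comp.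
End NerveObject.

Section NerveMap.
Variables (s t : ssm) (a : square s t).

Lemma nerve_map_equalized p :
  equalized (ss_map t) (fun i => scomp (sq_src a) (fp_pr (ss_fib s p) i)).
Proof.
by move=> i j; rewrite !scompA sq_comm -!scompA (@fp_eq _ _ _ _ (ss_fib s p) i j).
Qed.
Definition nerve_map_at p : smor (nerve s p) (nerve t p) :=
  fp_lift (ss_fib t p) (@nerve_map_equalized p).
Lemma nerve_map_atE p i :
  scomp (fp_pr (ss_fib t p) i) (nerve_map_at p) =
  scomp (sq_src a) (fp_pr (ss_fib s p) i).
Proof. exact: fp_liftK. Qed.
Lemma nerve_map_nat q p (f : delta q p) :
  scomp (sop (nerve t) f) (nerve_map_at p) = scomp (nerve_map_at q) (sop (nerve s) f).
Proof.
apply: fp_uniq => i; rewrite !scompA nerve_opE !nerve_map_atE -scompA.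
by rewrite nerve_opE.
Qed.
Definition nerve_map : simplicial_map (nerve s) (nerve t) :=
  SimplicialMap nerve_map_nat.
End NerveMap.

Section HomPresheaf.
Variable K : simplicial R.

Lemma nerve_act_nat (s t : ssm) (a : square s t)
    (u : simplicial_map (nerve t) K) q p (f : delta q p) :
  scomp (sop K f) (scomp (u p) (nerve_map a p)) =
  scomp (scomp (u q) (nerve_map a q)) (sop (nerve s) f).
Proof. by rewrite scompA smap_nat -!scompA smap_nat. Qed.
Definition nerve_act (s t : ssm) (a : square s t)
    (u : simplicial_map (nerve t) K) : simplicial_map (nerve s) K :=
  SimplicialMap (nerve_act_nat a u).

Lemma nerve_act1 s (u : simplicial_map (nerve s) K) :
  nerve_act (square_id s) u = u.
Proof.
apply: smap_ext => p /=; rewrite -[RHS]scomp1r; congr scomp.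
by apply: fp_uniq => i; rewrite nerve_map_atE scomp1 scomp1r.
Qed.
Lemma nerve_actM s t r (b : square t r) (a : square s t)
    (u : simplicial_map (nerve r) K) :
  nerve_act (square_comp b a) u = nerve_act a (nerve_act b u).
Proof.
apply: smap_ext => p /=; rewrite -scompA; congr scomp.
apply: fp_uniq => i; rewrite scompA !nerve_map_atE -scompA nerve_map_atE.
by rewrite scompA.
Qed.

(* (M -> N) |-> Hom((M -> N)_., K_.) *)
Definition F_presheaf : presheaf SSM_cat :=
  @Presheaf SSM_cat (fun s => simplicial_map (nerve s) K) nerve_act
    nerve_act1 nerve_actM.
End HomPresheaf.

End Nerve.
Arguments ssm : clear implicits.
Arguments SSM_cat : clear implicits.

(* Products with R^{0|n}, and their fibre powers over the other factor. *)
Section OddCoordinates.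
Context {R : realType}.

Definition gpull (M N : superspace R) (h : smor M N) (s : sec N setT) :
  sec M setT := pull h openT s.

Lemma gpull_comp (M N P : superspace R) (g : smor N P) (f : smor M N) s :
  gpull (scomp g f) s = gpull f (gpull g s).
Proof. by rewrite /gpull /=; congr pull; exact: Prop_irrelevance. Qed.

Section OddLift.
Variables (T N : superspace R) (f : smor T N) (t : sec T setT).
Hypothesis todd : odd_elt t.
Let tV (V : set T) : sec T V := res (@subsetT _ V) t.

Let tV_odd V : parity (tV V) = - tV V.
Proof. by rewrite -(samP (res_alg _)) todd (samN (res_alg _)). Qed.

Let twice (A : superAlgebra R) (c : A) : c + c = (1 + 1) *: c.
Proof. by rewrite scalerDl scale1r. Qed.
Let two0 : (1 + 1 : R) != 0.
Proof. by rewrite -[_ + _]/(2%:R) pnatr_eq0. Qed.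

Lemma odd_commute (A : superAlgebra R) (u c : A) :
  parity u = - u -> u * c = parity c * u.
Proof.
have [h hE] : exists h : R, h * (1 + 1) = 1 by exists (1 + 1)^-1; rewrite mulVf.
move=> uo; pose c0 := h *: (c + parity c); pose c1 := h *: (c - parity c).
have pc0 : parity c0 = c0 by rewrite parityZ parityD parityK addrC.
have pc1 : parity c1 = - c1.
  by rewrite parityZ parityD parityN parityK -scalerN opprB addrC.
have cE : c = c0 + c1.
  by rewrite -scalerDr addrACA subrr addr0 twice [RHS]scalerA hE scale1r.
have h0 : u * c0 = c0 * u.
  have := @supercomm _ A true false u c0; rewrite !expr0 !scale1r; apply=> //.
  by rewrite expr1 scaleN1r.
have h1 : u * c1 = - (c1 * u).
  have := @supercomm _ A true true u c1; rewrite !expr1 !scaleN1r; apply=> //.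
by rewrite {1 2}cE mulrDr h0 h1 parityD pc0 pc1 mulrDl mulNr.
Qed.

Lemma odd_square0 (A : superAlgebra R) (u : A) : parity u = - u -> u * u = 0.
Proof.
move=> uo; have := odd_commute u uo; rewrite uo mulNr => h.
have : (1 + 1) *: (u * u) = 0 by rewrite -twice {2}h subrr.
by move/(congr1 (fun z => (1 + 1)^-1 *: z)); rewrite [LHS]scalerA mulVf // scale1r scaler0.
Qed.

Lemma odd_sandwich (A : superAlgebra R) (u c : A) :
  parity u = - u -> u * c * u = 0.
Proof.
by move=> uo; rewrite (odd_commute c uo) -mulrA (odd_square0 uo) mulr0.
Qed.

Lemma invertible_odd (A : superAlgebra R) (a b u : A) :
  parity u = - u -> invertible (a + b * u) -> invertible a.
Proof.
move=> uo [v [h1 h2]]; exists (v + v * (b * u) * v).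
have z : (b * u) * v * (b * u) = 0.
  have -> : (b * u) * v * (b * u) = b * (u * (v * b) * u) by rewrite !mulrA.
  by rewrite odd_sandwich ?mulr0.
set n := b * u in h1 h2 z *.
have e1 : a * v = 1 - n * v by rewrite -h1 mulrDl addrK.
have e2 : v * a = 1 - v * n by rewrite -h2 mulrDr addrK.
split.
  have -> : a * (v + v * n * v) = a * v + a * v * n * v.
    by rewrite mulrDr !mulrA.
  by rewrite e1 !mulrBl z mul0r !mul1r subr0 subrK.
have -> : (v + v * n * v) * a = v * a + v * n * (v * a).
  by rewrite mulrDl -!mulrA.
rewrite e2 mulrBr mulr1; have -> : v * n * (v * n) = v * (n * v * n).
  by rewrite !mulrA.
by rewrite z mulr0 subr0 subrK.
Qed.

Let lpull (V : set N) (oV : open V) (s : sec (odd_superspace N) V) :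
  sec T (f @^-1` V) := pull f oV s.1 + pull f oV s.2 * tV (f @^-1` V).

Lemma odd_lift_alg V (oV : open V) : superalg_morphism (@lpull V oV).
Proof.
have fm := pull_alg f oV; have to := tV_odd (f @^-1` V); rewrite /lpull; split.
- move=> a [x x'] [y y'].
  change (pull f oV (a *: x + y) + pull f oV (a *: x' + y') * tV (f @^-1` V) =
   a *: (pull f oV x + pull f oV x' * tV (f @^-1` V)) +
   (pull f oV y + pull f oV y' * tV (f @^-1` V))).
  by rewrite !(sam_linear fm) scalerDr mulrDl scaleAl addrACA.
- split.
    change (pull f oV 1 + pull f oV 0 * tV (f @^-1` V) = 1).
    by rewrite (sam1 fm) (sam0 fm) mul0r addr0.
  move=> [x x'] [y y'].
  change (pull f oV (x * y) + pull f oV (x * y' + x' * parity y) * tV (f @^-1` V) =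
   (pull f oV x + pull f oV x' * tV (f @^-1` V)) *
   (pull f oV y + pull f oV y' * tV (f @^-1` V))).
  rewrite (samD fm) !(samM fm) (samP fm).
  set u := tV _ in to *.
  set X := pull f oV x; set X' := pull f oV x'; set Y := pull f oV y.
  set Y' := pull f oV y'.
  have k0 : X' * u * (Y' * u) = 0.
    have -> : X' * u * (Y' * u) = X' * (u * Y' * u) by rewrite !mulrA.
    by rewrite odd_sandwich // mulr0.
  have k1 : X' * u * Y = X' * parity Y * u by rewrite -!mulrA (odd_commute Y to).
  by rewrite [RHS]mulrDl !mulrDr k0 k1 addr0 [in LHS]mulrDl mulrA addrA.
- move=> [x x'].
  change (pull f oV (parity x) + pull f oV (- parity x') * tV (f @^-1` V) =
   parity (pull f oV x + pull f oV x' * tV (f @^-1` V))).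
  by rewrite parityD parityM to (samN fm) !(samP fm) mulNr mulrN.
Qed.

Lemma odd_lift_res (U V : set N) (oU : open U) (oV : open V) (VU : V `<=` U)
    (s : sec (odd_superspace N) U) :
  lpull oV (@res R (odd_superspace N) _ _ VU s) =
  res (@preimage_subset _ _ f _ _ VU) (lpull oU s).
Proof.
rewrite /lpull (samD (res_alg _)) (samM (res_alg _)) -!(pull_res f oU oV).
congr (_ + _ * _); rewrite /tV (@res_comp _ _ _ _ _ _ _ (@subsetT _ _)) //.
Qed.

Lemma odd_lift_local (V : set N) (oV : open V) (x : T)
    (s : sec (odd_superspace N) V) : V (f x) ->
  invertible_at x (lpull oV s) -> @invertible_at R (odd_superspace N) (f x) _ s.
Proof.
move=> Vx [W [WU [oW Wx h]]]; apply/odd_invertible_at.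
apply: (pull_local (oV := oV)) => //; exists W, WU; split=> //.
move: h; rewrite /lpull (samD (res_alg _)) (samM (res_alg _)).
apply: invertible_odd; rewrite -(samP (res_alg _)) tV_odd.
by rewrite (samN (res_alg _)).
Qed.

Definition odd_lift : smor T (odd_superspace N) :=
  @Smor R T (odd_superspace N) f (@smor_cont _ _ _ f) lpull odd_lift_alg
    odd_lift_res odd_lift_local.

Lemma odd_lift_proj : scomp (odd_proj N) odd_lift = f.
Proof.
apply: (@smor_ext _ _ _ (scomp (odd_proj N) odd_lift) f erefl) => V oV s /=.
change (pull f oV s + pull f oV 0 * tV (f @^-1` V) = pull f oV s).
by rewrite (sam0 (pull_alg f oV)) mul0r addr0.
Qed.

Lemma gpull_odd_lift (x y : sec N setT) :
  @gpull T (odd_superspace N) odd_lift (x, y) = gpull f x + gpull f y * t.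
Proof.
change (gpull f x + gpull f y * tV setT = gpull f x + gpull f y * t).
by rewrite /tV res_id.
Qed.
End OddLift.

Definition odd_theta (N : superspace R) : sec (odd_superspace N) setT := (0, 1).
Definition odd_incl (N : superspace R) (s : sec N setT) :
  sec (odd_superspace N) setT := (s, 0).

Lemma odd_lift_uniq (T N : superspace R) (h h' : smor T (odd_superspace N)) :
  scomp (odd_proj N) h = scomp (odd_proj N) h' ->
  gpull h (odd_theta N) = gpull h' (odd_theta N) -> h = h'.
Proof.
case: h h' => [f fc fp fa fr fl] [g gc gp ga gr gl] E Eth.
have e : f = g := f_equal (@smor_fun _ _ _) E.
subst g; apply: (@smor_ext _ _ _ (Smor fc fa fr fl) (Smor gc ga gr gl) erefl).
move=> V oV [x y] /=.
have E0 z : fp V oV (z, 0) = gp V oV (z, 0).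
  exact: (smor_eq_pull E erefl oV z).
have Et : fp V oV (0, 1) = gp V oV (0, 1).
  have hV : (0, 1) = @res R (odd_superspace N) _ _ (@subsetT _ V) (odd_theta N).
    by rewrite /= /aodd_map /= (sam0 (res_alg _)) (sam1 (res_alg _)).
  rewrite hV (fr _ _ openT oV) (gr _ _ openT oV); congr res; exact: Eth.
pose a : sec (odd_superspace N) V := (x, 0).
pose b : sec (odd_superspace N) V := (y, 0).
pose th : sec (odd_superspace N) V := (0, 1).
have -> : (x, y) = a + b * th.
  change ((x, y) = (x + y * 0, 0 + (y * 1 + 0 * parity 0)) :> sec N V * sec N V).
  by rewrite mulr0 mulr1 mul0r !addr0 add0r.
by rewrite (samD (fa V oV)) (samM (fa V oV)) (samD (ga V oV)) (samM (ga V oV)) /a /b /th !E0 Et.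
Qed.

Definition odd_coordinates (I : Type) (N P : superspace R) (pi : smor P N)
    (th : I -> sec P setT) : Prop :=
  (forall i, odd_elt (th i)) /\
  forall (T : superspace R) (f : smor T N) (t : I -> sec T setT),
    (forall i, odd_elt (t i)) ->
    exists! h : smor T P, scomp pi h = f /\ forall i, gpull h (th i) = t i.

Lemma odd_coordinates0 (N : superspace R) (th : 'I_0 -> sec N setT) :
  odd_coordinates (sid N) th.
Proof.
split; first by case.
move=> T f t _; exists f; split; first by split; [exact: scomp1|case].
by move=> h [<- _]; rewrite scomp1.
Qed.

Lemma odd_coordinatesS n (N P : superspace R) (pi : smor P N)
    (th : 'I_n -> sec P setT) : odd_coordinates pi th ->
  odd_coordinates (scomp pi (odd_proj P))
    (fun i : 'I_n.+1 => if unlift ord0 i is Some j then odd_incl (th j)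
                        else odd_theta P).
Proof.
move=> [tho univ]; split.
  move=> i; case: unliftP => [j _|_]; rewrite /odd_elt.
    change ((parity (th j), - parity 0) = (- th j, - 0) :> sec (odd_superspace P) setT).
    by rewrite tho parity0.
  change ((parity 0, - parity 1) = (- 0, - 1) :> sec (odd_superspace P) setT).
  by rewrite parity0 parity1 oppr0.
move=> T f t to.
have [h0 [[h0f h0t] h0u]] := univ T f (fun j => t (lift ord0 j)) (fun j => to _).
exists (odd_lift h0 (to ord0)); split.
  split; first by rewrite -scompA odd_lift_proj.
  move=> i; case: unliftP => [j ->|->].
    rewrite gpull_odd_lift h0t /gpull (sam0 (pull_alg h0 _)).
    by rewrite mul0r addr0.
  rewrite gpull_odd_lift /gpull (sam0 (pull_alg h0 _)) (sam1 (pull_alg h0 _)).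
  by rewrite mul1r add0r.
move=> h' [h'f h't].
have e : h0 = scomp (odd_proj P) h'.
  apply: h0u; split; first by rewrite scompA.
  by move=> j; have := h't (lift ord0 j); rewrite liftK.
apply: odd_lift_uniq; first by rewrite odd_lift_proj.
have := h't ord0; rewrite unlift_none => ->.
rewrite gpull_odd_lift /gpull (sam0 (pull_alg h0 _)) (sam1 (pull_alg h0 _)).
by rewrite mul1r add0r.
Qed.

Definition odd_sm (N : sm R) : sm R :=
  @SM R (odd_superspace N)
    (let: ex_intro p (ex_intro q h) := smP N in
     ex_intro _ p (ex_intro _ q.+1 (odd_is_supermanifold h))).

(* R^{0|n} x N, with structure sheaf O_N[theta_1, ..., theta_n], and its canonical
   projection; the maps T -> R^{0|n} x N are given by a map T -> N and n odd
   functions on T (odd_product_coordinates). *)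
Definition odd_product (n : nat) (N : sm R) : sm R := iter n odd_sm N.

Fixpoint odd_product_proj (n : nat) (N : sm R) : smor (odd_product n N) N :=
  if n is n'.+1 then scomp (odd_product_proj n' N) (odd_proj (odd_product n' N))
  else sid N.

Fixpoint odd_product_map (n : nat) (N N' : sm R) (b : smor N N') :
    smor (odd_product n N) (odd_product n N') :=
  if n is n'.+1 then odd_map (odd_product_map n' b) else b.

Fixpoint odd_product_theta (n : nat) (N : sm R) :
    'I_n -> sec (odd_product n N) setT :=
  if n is n'.+1 then fun i => if unlift ord0 i is Some j
    then odd_incl (@odd_product_theta n' N j) else odd_theta (odd_product n' N)
  else fun i => 0.

Lemma odd_product_coordinates n N :
  odd_coordinates (odd_product_proj n N) (@odd_product_theta n N).
Proof.
elim: n => [|n IH]; first exact: odd_coordinates0.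
exact: (odd_coordinatesS IH).
Qed.

Lemma submersion_id (M : superspace R) : surjective_submersion (sid M).
Proof.
by split=> [y|x w wt]; [exists y|exists w].
Qed.

Lemma submersion_comp (M N P : superspace R) (g : smor N P) (f : smor M N) :
  surjective_submersion g -> surjective_submersion f ->
  surjective_submersion (scomp g f).
Proof.
move=> [gs gt] [fs ft]; split.
  by move=> z; have [y <-] := gs z; have [x <-] := fs y; exists x.
move=> x w wt; have [v [vt vw]] := gt (f x) w wt.
have [u [ut uv]] := ft x v vt; exists u; split=> // V oV s Vx.
change (u (f @^-1` (g @^-1` V)) (pull f (smor_cont g oV) (pull g oV s)) = w V s).
by rewrite uv // vw.
Qed.

Lemma odd_product_submersion n N : surjective_submersion (odd_product_proj n N).
Proof.
elim: n => [|n IH]; first exact: submersion_id.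
by apply: submersion_comp IH _; exact: odd_proj_submersion.
Qed.

Lemma odd_product_map_proj n (N N' : sm R) (b : smor N N') :
  scomp (odd_product_proj n N') (odd_product_map n b) =
  scomp b (odd_product_proj n N).
Proof.
elim: n => [|n IH] /=; first by rewrite scomp1 scomp1r.
by rewrite -scompA odd_map_proj scompA IH scompA.
Qed.

Lemma odd_product_map_id n (N : sm R) : odd_product_map n (sid N) = sid _.
Proof. by elim: n => //= n ->; rewrite odd_map_id. Qed.

Lemma odd_product_map_comp n (N N' N'' : sm R) (c : smor N' N'') (b : smor N N') :
  odd_product_map n (scomp c b) = scomp (odd_product_map n c) (odd_product_map n b).
Proof. by elim: n => //= n ->; rewrite odd_map_comp. Qed.

Section OddFibrePower.
Variables (n : nat) (N : sm R) (p : nat).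
Local Notation P := (odd_product (p.+1 * n) N).
Local Notation piP := (odd_product_proj (p.+1 * n) N).
Local Notation M := (odd_product n N).
Local Notation piM := (odd_product_proj n N).

Definition odd_fp_theta (i : 'I_p.+1) (j : 'I_n) : sec P setT :=
  @odd_product_theta (p.+1 * n) N (mxvec_index i j).

Lemma odd_fp_theta_odd i j : odd_elt (odd_fp_theta i j).
Proof. exact: (odd_product_coordinates _ _).1. Qed.

Lemma gpull_odd (A B : superspace R) (h : smor A B) (s : sec B setT) :
  odd_elt s -> odd_elt (gpull h s).
Proof.
move=> so; rewrite /odd_elt /gpull.
have := samP (pull_alg h openT) s; rewrite so (samN (pull_alg h openT)) => e.
exact: esym e.
Qed.

Lemma odd_fp_univ (T : superspace R) (f : smor T N)
    (t : 'I_p.+1 -> 'I_n -> sec T setT) : (forall i j, odd_elt (t i j)) ->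
  exists h : smor T P, scomp piP h = f /\
    forall i j, gpull h (odd_fp_theta i j) = t i j.
Proof.
move=> to; have [g gK Kg] := curry_mxvec_bij p.+1 n.
have [h [[hf ht] _]] := (odd_product_coordinates (p.+1 * n) N).2 T f
  (fun k => t (g k).1 (g k).2) (fun k => to _ _).
exists h; split=> // i j; rewrite /odd_fp_theta ht.
have -> : g (mxvec_index i j) = (i, j) by exact: (gK (i, j)).
by [].
Qed.

Lemma odd_fp_uniq (T : superspace R) (h h' : smor T P) :
  scomp piP h = scomp piP h' ->
  (forall i j, gpull h (odd_fp_theta i j) = gpull h' (odd_fp_theta i j)) -> h = h'.
Proof.
move=> e et; have [tho univ] := odd_product_coordinates (p.+1 * n) N.
have [k [_ ku]] := univ T (scomp piP h) (fun k => gpull h (odd_product_theta N k))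
  (fun k => gpull_odd h (tho k)).
rewrite -(ku h) // -(ku h') //; split=> // k'.
by case/mxvec_indexP: k' => i j; rewrite -et.
Qed.

Definition odd_fp_pr (i : 'I_p.+1) : smor P M :=
  projT1 (cid ((odd_product_coordinates n N).2 P piP (odd_fp_theta i)
    (odd_fp_theta_odd i))).

Lemma odd_fp_prP i : scomp piM (odd_fp_pr i) = piP /\
  forall j, gpull (odd_fp_pr i) (odd_product_theta N j) = odd_fp_theta i j.
Proof. by rewrite /odd_fp_pr; case: cid => h [/= hP _]. Qed.

Lemma odd_fp_eq : equalized piM odd_fp_pr.
Proof. by move=> i j; rewrite !(odd_fp_prP _).1. Qed.

Section Lift.
Variables (T : sm R) (g : 'I_p.+1 -> smor T M) (gE : equalized piM g).
Definition odd_fp_lift : smor T P :=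
  projT1 (cid (odd_fp_univ (scomp piM (g ord0))
    (fun i j => gpull_odd (g i) ((odd_product_coordinates n N).1 j)))).
Lemma odd_fp_liftK i : scomp (odd_fp_pr i) odd_fp_lift = g i.
Proof.
rewrite /odd_fp_lift; case: cid => h [/= hf ht].
have [tho univ] := odd_product_coordinates n N.
have [k [_ ku]] := univ T (scomp piM (g i)) (fun j => gpull (g i) (odd_product_theta N j))
  (fun j => gpull_odd (g i) (tho j)).
transitivity k; last by apply: ku.
symmetry; apply: ku; split.
  by rewrite scompA (odd_fp_prP i).1 hf; exact: gE.
by move=> j; rewrite -ht -(odd_fp_prP i).2 gpull_comp.
Qed.
End Lift.

Lemma odd_fp_pr_uniq (T : sm R) (u v : smor T P) :
  (forall i, scomp (odd_fp_pr i) u = scomp (odd_fp_pr i) v) -> u = v.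
Proof.
move=> e; apply: odd_fp_uniq.
  by rewrite -(odd_fp_prP ord0).1 -!scompA e.
move=> i j; rewrite -(odd_fp_prP i).2.
by rewrite -!gpull_comp e.
Qed.

(* Over N, the (p+1)-fold fibre power of R^{0|n} x N is R^{0|(p+1)n} x N. *)
Definition odd_fibre_power : fibre_power piM p :=
  FibrePower odd_fp_eq odd_fp_liftK odd_fp_pr_uniq.

End OddFibrePower.

Definition jet_ob (n : nat) (N : sm R) : ssm R :=
  SSM (odd_product_submersion n N) (odd_fibre_power n N).

Definition jet_mor (n : nat) (N N' : sm R) (b : smor N N') :
    square (jet_ob n N) (jet_ob n N') :=
  @Square _ (jet_ob n N) (jet_ob n N') (odd_product_map n b) b
    (odd_product_map_proj n b).

(* The presheaf N |-> F(R^{0|n} x N -> N) underlying the n-jet of F. *)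
Section Jet.
Variables (n : nat) (F : presheaf (SSM_cat R)).
Let jact (N N' : sm R) (b : smor N N') (s : F (jet_ob n N')) : F (jet_ob n N) :=
  @act _ F (jet_ob n N) (jet_ob n N') (jet_mor n b) s.
Lemma jet_act1 (N : sm R) (s : F (jet_ob n N)) : jact (sid N) s = s.
Proof.
rewrite /jact -[RHS](@act1 _ F (jet_ob n N)); congr act.
by apply: square_ext => //; exact: odd_product_map_id.
Qed.
Lemma jet_actM (N N' N'' : sm R) (c : smor N' N'') (b : smor N N')
    (s : F (jet_ob n N'')) : jact (scomp c b) s = jact b (jact c s).
Proof.
rewrite /jact -(@actM _ F (jet_ob n N)); congr act.
by apply: square_ext => //; exact: odd_product_map_comp.
Qed.
Definition jet : presheaf (SM_cat R) :=
  @Presheaf (SM_cat R) (fun N => F (jet_ob n N)) jact jet_act1 jet_actM.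
End Jet.

End OddCoordinates.

(* Main.v *)
(* A simplicial map phi from the nerve of R^{0|n} x N -> N to K is determined by
   psi_p(x_1, ..., x_p) = phi_p(0, x_1, ..., x_p), compatible with the operators
   [q] -> [p] that preserve 0.  The map psi_{p-1} determines the image of psi_p in
   the horn space K_{p,0}, and the restriction of psi_p to the loci where two
   consecutive arguments coincide.  Since K_p -> K_{p,0} is a submersion, K_p is
   locally K_{p,0} x R^d, so that psi_p amounts to d even functions on
   R^{0|pn} x N with prescribed restrictions to these loci.  The freedom is that of
   the coefficients of the monomials containing an odd coordinate from each of the
   p blocks.  For p >= m there is no choice left.  Hence over a coordinate domain of
   K_0 the presheaf is represented by an open part of R^{a|b}, where a and b do not
   depend on the domain, and these local representing objects are glued. *)
Require Import Defs.
From HB Require Import structures.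
From mathcomp Require Import all_boot all_order all_algebra.
From mathcomp Require Import all_classical all_reals all_analysis.
From mathcomp Require Import ring lra zify.

Set Implicit Arguments.
Unset Strict Implicit.
Unset Printing Implicit Defensive.

Import Order.TTheory GRing.Theory Num.Theory numFieldNormedType.Exports.
Local Open Scope classical_set_scope.
Local Open Scope ring_scope.


(** * Calculus in several variables *)

(** The targets K_p and the horn spaces have odd dimension 0, so odd variables enter only through
    the sources, and the analysis of the targets is classical. A map from a supermanifold to R^e is
    an e-tuple of even functions; uniqueness holds because a section that lies in the (q+1)-st power
    of the maximal ideal at every point vanishes in odd dimension q. Working in charts requires that
    psi_p stays inside a chart of K_p. The space R^(0|pn) x N has the same points as N, and on
    points psi_p is the totally degenerate simplex on psi_0. One open set of K_0, on which finitely
    many degeneracies land in chosen charts, therefore controls the whole family. The odd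
    coordinates of psi_p are successive differences of the arguments, which turns the coincidence
    loci into coordinate subspaces and their joint extension problem into one about monomials. In
    high degree the horn map is bijective on points only by hypothesis. That T-points lift uniquely
    is deduced from the submersion property: no free coordinate is left. The glued object has F(pt)
    as its set of points. Its charts are indexed by all points of K_0, so second countability has to
    come from K_0. *)

Section Calculus.
Context {R : realType}.

Lemma MVT_unordered (h dh : R -> R) (a b : R) :
  (forall t, Num.min a b <= t <= Num.max a b -> is_derive t 1 h (dh t)) ->
  exists2 c, Num.min a b <= c <= Num.max a b & h b - h a = dh c * (b - a).
Proof.
have aux (u v : R) : u <= v -> (forall t, u <= t <= v -> is_derive t 1 h (dh t)) ->
    exists2 c, u <= c <= v & h v - h u = dh c * (v - u).
  move=> uv hd.
  have [t tI||c cI e] := @MVT_segment R h dh u v uv.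
  - by apply: hd; move: tI; rewrite in_itv /= => /andP[ut tv]; rewrite !ltW.
  - apply: derivable_within_continuous => t; rewrite in_itv /= => tI.
    by have [] := hd _ tI.
  by exists c => //; move: cI; rewrite in_itv.
move=> hd; have [ab|/ltW ba] := leP a b.
  by move: hd; rewrite (min_l ab) (max_r ab); exact: aux.
move: hd; rewrite (min_r ba) (max_l ba) => /(aux _ _ ba)[c cI e].
by exists c => //; rewrite -opprB e -mulrN opprB.
Qed.

Lemma derivable_line p (f : 'rV[R]_p -> R) (x v : 'rV[R]_p) (t : R) :
  derivable f (x + t *: v) v ->
  is_derive t 1 (fun s : R => f (x + s *: v)) ('D_v f (x + t *: v)).
Proof.
have e : (fun h : R => h^-1 *: (((fun s : R => f (x + s *: v)) \o shift t) (h *: 1) - f (x + t *: v))) =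
    (fun h : R => h^-1 *: ((f \o shift (x + t *: v)) (h *: v) - f (x + t *: v))).
  by apply/funext => h /=; rewrite scaler1 scalerDl addrCA.
by move=> fd; apply: DeriveDef; rewrite ?/derivable ?/derive e.
Qed.

(* A substitute for Frechet differentiability that is preserved by the operations below. *)
Lemma caratheodory p (U : set 'rV[R]_p) (f : 'rV[R]_p -> R) (y : 'rV[R]_p) :
  open U -> Ck 1 U f -> U y ->
  exists g : 'I_p -> 'rV[R]_p -> R,
    (forall i, g i x @[x --> y] --> 'D_(delta_mx 0 i) f y) /\
    \forall x \near y, f x - f y = \sum_i (x 0 i - y 0 i) * g i x.
Proof.
move=> oU [_ fC] Uy.
(* [mix i x] takes its first i coordinates from x and the others from y, so that f x - f y
   telescopes along segments parallel to the axes. By the mean value theorem each quotient [g i x]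
   is a partial derivative at a point as close to y as x is. *)
pose mix (i : nat) (x : 'rV[R]_p) : 'rV[R]_p :=
  \row_j if (j < i)%N then x 0 j else y 0 j.
pose g (i : 'I_p) (x : 'rV[R]_p) : R := if x 0 i == y 0 i then 'D_(delta_mx 0 i) f (mix i x)
  else (f (mix i.+1 x) - f (mix i x)) / (x 0 i - y 0 i).
have mixS (i : 'I_p) x : mix i.+1 x = mix i x + (x 0 i - y 0 i) *: delta_mx 0 i.
  apply/rowP => j; rewrite !mxE eqxx /= ltnS.
  have [->|ji] := eqVneq j i; first by rewrite leqnn ltnn mulr1 addrC subrK.
  rewrite mulr0 addr0; have -> // : (j <= i)%N = (j < i)%N.
  by rewrite [RHS]ltn_neqAle (inj_eq val_inj) ji.
have /nbhs_ballP[e /= e0 eU] := open_nbhs_nbhs (conj oU Uy).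
have mixB i x (d : R) t : ball y d x -> Num.min 0 (x 0 i - y 0 i) <= t <= Num.max 0 (x 0 i - y 0 i) ->
    ball y d (mix i x + t *: delta_mx 0 i).
  move=> [d0 xB] tI; split => // a j; rewrite (ord1 a) !mxE eqxx /=.
  have yj (z : R) : `|y 0 j - z| < d -> ball (y 0 j) d z by [].
  apply: yj; have := xB 0 j; rewrite /ball /= /ball_ => bj.
  have [ji|ji] := eqVneq j i; last first.
    by rewrite mulr0 addr0; case: ifP => // _; rewrite subrr normr0.
  rewrite ji ltnn mulr1 opprD addNKr normrN.
  rewrite ji in bj *; move: tI bj; rewrite distrC => tI; apply: le_lt_trans.
  move: tI; have [s|s] := leP 0 (x 0 i - y 0 i) => /andP[t0 t1].
    by rewrite !ger0_norm // (le_trans t0).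
  by rewrite !ler0_norm ?lerN2 // ltW.
have gE i x d : d <= e -> ball y d x -> exists2 z, ball y d z & g i x = 'D_(delta_mx 0 i) f z.
  move=> de xB; rewrite /g; case: eqP => [xy|/eqP xy].
    exists (mix i x) => //; have := @mixB i x d 0 xB; rewrite scale0r addr0; apply.
    by rewrite xy subrr minxx maxxx lexx.
  have [t /(mixB _ _ _ _ xB)tB|c cI] := @MVT_unordered (fun s => f (mix i x + s *: delta_mx 0 i))
    (fun s => 'D_(delta_mx 0 i) f (mix i x + s *: delta_mx 0 i)) 0 (x 0 i - y 0 i).
    apply: derivable_line; apply: (fC i).1; apply: eU; exact: (le_ball de).
  rewrite -mixS scale0r addr0 subr0 => ->; exists (mix i x + c *: delta_mx 0 i); first exact: mixB.
  by rewrite mulfK // subr_eq0.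
exists g; split=> [i|].
  apply/(@cvgrPdist_lt _ _ _ (nbhs y)) => d d0.
  have Dc : {for y, continuous ('D_(delta_mx 0 i) f)} by exact: ((fC i).2.1).
  move/(@cvgrPdist_lt _ _ _ (nbhs y))/(_ d d0)/nbhs_ballP: Dc => [r /= r0 rP].
  apply/nbhs_ballP; exists (Num.min r e) => /=; first by rewrite lt_min r0 e0.
  move=> x xB; have [|z zB ->] := gE i x (Num.min r e) _ xB; first by rewrite ge_min lexx orbT.
  by apply: rP; apply: le_ball zB; rewrite ge_min lexx.
apply/nbhs_ballP; exists e => //= x xB.
have -> : f x - f y = \sum_(i < p) (f (mix i.+1 x) - f (mix i x)).
  rewrite -(big_mkord xpredT (fun i => f (mix i.+1 x) - f (mix i x))) telescope_sumr //.
  congr (f _ - f _); apply/rowP => j; rewrite mxE ?ltn_ord //.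
apply: eq_bigr => i _; rewrite /g mixS; case: eqP => [->|/eqP xy].
  by rewrite subrr scale0r addr0 subrr mul0r.
by rewrite mulrC divfK // subr_eq0.
Qed.

Lemma row_cvg p (T : Type) (F : set_system T) {FF : Filter F} (u : 'I_p -> T -> R) (l : 'rV[R]_p) :
  (forall i, u i z @[z --> F] --> l 0 i) -> (\row_i u i z) @[z --> F] --> l.
Proof.
move=> h; apply/cvg_ballP => e e0.
suff : \forall z \near F, forall i, `|l 0 i - u i z| < e.
  apply: filterS => z hz; split => // a j; rewrite (ord1 a) mxE; exact: hz.
by apply: filter_forall => i; move/cvgrPdist_lt: (h i); apply.
Qed.

Lemma cvg_sum_ord n (T : Type) (F : set_system T) {FF : Filter F} (u : 'I_n -> T -> R)
    (l : 'I_n -> R) :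
  (forall i, u i z @[z --> F] --> l i) -> \sum_i u i z @[z --> F] --> \sum_i l i.
Proof.
elim: n u l => [|n IH] u l h.
  by rewrite big_ord0; under eq_fun do rewrite big_ord0; exact: cvg_cst.
rewrite big_ord_recl; under eq_fun do rewrite big_ord_recl.
by apply: cvgD; [exact: h|apply: IH => i; exact: h].
Qed.

(** The factorization of [caratheodory] makes the difference quotient of the composite a sum of
    products [g i * q h i], whose limits are taken factor by factor. Only directional derivability
    of the inner functions enters. *)
Lemma is_derive_comp_row p (V : normedModType R) (U : set 'rV[R]_p) (f : 'rV[R]_p -> R)
    (u : 'I_p -> V -> R) (x v : V) :
  open U -> Ck 1 U f -> U (\row_i u i x) -> (forall i, derivable (u i) x v) ->
  is_derive x v (fun z => f (\row_i u i z))
    (\sum_i 'D_(delta_mx 0 i) f (\row_i u i x) * 'D_v (u i) x).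
Proof.
move=> oU fC Ux ud; have [g [gc fE]] := caratheodory oU fC Ux.
pose q (h : R) i := h^-1 * (u i (h *: v + x) - u i x).
have qc i : q h i @[h --> 0^'] --> 'D_v (u i) x by exact: ud.
have uc : \row_i u i (h *: v + x) @[h --> (0 : R)^'] --> \row_i u i x.
  apply: row_cvg => i; rewrite mxE.
  have : u i x + h * q h i @[h --> 0^'] --> u i x + 0 * 'D_v (u i) x.
    apply: cvgD; first exact: cvg_cst.
    by apply: cvgM (qc i); exact: nbhs_dnbhs.
  rewrite mul0r addr0; apply: cvg_trans; apply: near_eq_cvg.
  near=> h; rewrite /q mulrA mulfV ?mul1r 1?addrC ?subrK //; near: h.
  exact: nbhs_dnbhs_neq.
have L : h^-1 *: (f (\row_i u i (h *: v + x)) - f (\row_i u i x)) @[h --> (0 : R)^'] -->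
    \sum_i 'D_(delta_mx 0 i) f (\row_i u i x) * 'D_v (u i) x.
  have : (\sum_i g i (\row_i u i (h *: v + x)) * q h i) @[h --> (0 : R)^'] -->
      \sum_i 'D_(delta_mx 0 i) f (\row_i u i x) * 'D_v (u i) x.
    apply: cvg_sum_ord => i; apply: cvgM (qc i).
    exact: cvg_comp uc (gc i).
  apply: cvg_trans; apply: near_eq_cvg; near=> h.
  have -> : f (\row_i u i (h *: v + x)) - f (\row_i u i x) =
    \sum_i ((\row_i u i (h *: v + x)) 0 i - (\row_i u i x) 0 i) * g i (\row_i u i (h *: v + x)).
    by near: h; exact: uc fE.
  rewrite [RHS]mulr_sumr; apply: eq_bigr => i _; rewrite !mxE /q.
  by rewrite mulrC mulrA.
apply: DeriveDef; first by apply/cvg_ex; eexists; exact: L.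
by apply/cvg_lim => //; exact: L.
Unshelve. all: by end_near. Qed.


Lemma Ck1 p k (U : set 'rV[R]_p) f : Ck k.+1 U f -> Ck 1 U f.
Proof. by elim: k => // k IH /CkS /IH. Qed.

Lemma Ck_sum k p (U : set 'rV[R]_p) n (f : 'I_n -> 'rV[R]_p -> R) : open U ->
  (forall i, Ck k U (f i)) -> Ck k U (fun x => \sum_i f i x).
Proof.
move=> oU; elim: n f => [|n IH] f h.
  by under eq_fun do rewrite big_ord0; exact: Ck_cst.
under eq_fun do rewrite big_ord_recl.
by apply: CkD => //; apply: IH => i; exact: h.
Qed.

Lemma Ck_coord k p (U : set 'rV[R]_p) i : Ck k U (fun x => x 0 i).
Proof.
have c : continuous (fun x : 'rV[R]_p => x 0 i) by exact: coord_continuous.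
have d (j : 'I_p) x : is_derive x (delta_mx 0 j) (fun x : 'rV[R]_p => x 0 i) ((j == i)%:R).
  have L : h^-1 *: ((h *: delta_mx 0 j + x) 0 i - x 0 i) @[h --> (0 : R)^'] --> ((j == i)%:R : R).
    apply: (@cvg_trans _ (cst ((j == i)%:R : R) @ (0 : R)^')); last exact: cvg_cst.
  apply: near_eq_cvg; near=> h.
    rewrite !mxE eqxx /= addrK eq_sym [RHS]mulrA mulVf ?mul1r //.
    by near: h; exact: nbhs_dnbhs_neq.
  apply: DeriveDef; first by apply/cvg_ex; eexists; exact: L.
  by apply/cvg_lim => //; exact: L.
case: k => [|k]; first by split=> // x _; exact: c.
split; first by move=> x _; exact: c.
move=> j.
split=> [x _|]; first by have [] := d j x.
have -> : (fun x => 'D_(delta_mx 0 j) (fun x : 'rV[R]_p => x 0 i) x) = cst ((j == i)%:R).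
  by apply/funext => x; rewrite derive_val.
exact: Ck_cst.
Unshelve. all: by end_near. Qed.

Lemma derive_coord p (i j : 'I_p) (x : 'rV[R]_p) :
  'D_(delta_mx 0 j) (fun x : 'rV[R]_p => x 0 i) x = (j == i)%:R.
Proof.
apply/cvg_lim => //; apply: (@cvg_trans _ (cst ((j == i)%:R : R) @ (0 : R)^')); last exact: cvg_cst.
  apply: near_eq_cvg; near=> h.
rewrite /= !mxE eqxx /= addrK eq_sym [RHS]mulrA mulVf ?mul1r //.
by near: h; exact: nbhs_dnbhs_neq.
Unshelve. all: by end_near. Qed.

Lemma continuous_row p q (u : 'I_p -> 'rV[R]_q -> R) x :
  (forall i, {for x, continuous (u i)}) ->
  {for x, continuous (fun z => \row_i u i z)}.
Proof. by move=> h; apply: (@row_cvg _ _ (nbhs x)) => i; rewrite mxE; exact: h. Qed.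

Lemma Ck_comp_row k p q (U : set 'rV[R]_q) (V : set 'rV[R]_p) (f : 'rV[R]_p -> R)
    (u : 'I_p -> 'rV[R]_q -> R) : open U -> open V ->
  (forall x, U x -> V (\row_i u i x)) -> Ck k V f -> (forall i, Ck k U (u i)) ->
  Ck k U (fun x => f (\row_i u i x)).
Proof.
move=> oU oV UV; elim: k f => [|k IH] f fC uC.
  split=> // x Ux; apply: (@continuous_comp _ _ _ (fun z => \row_i u i z) f).
    by apply: continuous_row => i; exact: (uC i).1.
  exact: fC.1 (UV _ Ux).
have D (x : 'rV[R]_q) (j : 'I_q) : U x -> is_derive x (delta_mx 0 j) (fun z => f (\row_i u i z))
    (\sum_i 'D_(delta_mx 0 i) f (\row_i u i x) * 'D_(delta_mx 0 j) (u i) x).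
  move=> Ux; apply: (is_derive_comp_row oV (Ck1 fC) (UV _ Ux)) => i.
  exact: ((uC i).2 j).1.
split.
  move=> x Ux; apply: (@continuous_comp _ _ _ (fun z => \row_i u i z) f).
    by apply: continuous_row => i; exact: (uC i).1.
  exact: fC.1 (UV _ Ux).
move=> j; split; first by move=> x Ux; have [] := D x j Ux.
apply: (@Ck_eq _ _ _ _ (fun x => \sum_i 'D_(delta_mx 0 i) f (\row_i u i x) * 'D_(delta_mx 0 j) (u i) x)) => //.
  by move=> x; rewrite inE => Ux; have [_ ->] := D x j Ux.
apply: Ck_sum => // i; apply: CkM => //; last exact: ((uC i).2 j).2.
by apply: (IH _ (fC.2 i).2) => i'; exact: CkS.
Qed.

Lemma CkN k p (U : set 'rV[R]_p) f : open U -> Ck k U f -> Ck k U (fun x => - f x).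
Proof.
move=> oU h; apply: (@Ck_eq _ _ _ _ (cst (-1) \* f)) => //.
  by move=> x _ /=; rewrite mulN1r.
by apply: CkM => //; exact: (@Ck_cst _ _ k _ (-1)).
Qed.

Lemma CkV k p (U : set 'rV[R]_p) (f : 'rV[R]_p -> R) : open U ->
  (forall x, U x -> f x != 0) -> Ck k U f -> Ck k U (fun x => (f x)^-1).
Proof.
move=> oU f0; elim: k => [|k IH] fC.
  by split=> // x Ux; apply: continuousV (f0 _ Ux) _; exact: fC.1.
split; first by move=> x Ux; apply: continuousV (f0 _ Ux) _; exact: fC.1.
move=> j; split; first by move=> x Ux; apply: derivableV (f0 _ Ux) _; exact: (fC.2 j).1.
have iC := IH (CkS fC).
apply: (@Ck_eq _ _ _ _ (fun x => - ((f x)^-1 * (f x)^-1 * 'D_(delta_mx 0 j) f x))) => //.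
  move=> x; rewrite inE => Ux; rewrite deriveV; last exact: (fC.2 j).1.
    by rewrite expr2 scaleNr invfM.
  exact: f0.
apply: CkN => //; apply: CkM => //; first exact: CkM.
exact: (fC.2 j).2.
Qed.


Lemma is_derive_affine (c d t : R) : is_derive t 1 (fun t : R => c + t * d) d.
Proof.
have L : h^-1 *: ((c + (h *: 1 + t) * d) - (c + t * d)) @[h --> (0 : R)^'] --> (d : R).
  apply: (@cvg_trans _ (cst (d : R) @ (0 : R)^')); last exact: cvg_cst.
  apply: near_eq_cvg; near=> h.
  rewrite /= scaler1 mulrDl opprD addrACA subrr add0r addrK [RHS]mulrA mulVf ?mul1r //.
  by near: h; exact: nbhs_dnbhs_neq.
apply: DeriveDef; first by apply/cvg_ex; eexists; exact: L.
by apply/cvg_lim => //; exact: L.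
Unshelve. all: by end_near. Qed.

(** * Integrals along rays and Hadamard's lemma *)

Section RayIntegral.
Variables (p : nat) (y : 'rV[R]_p) (r : R).
Local Notation B := (ball y r).
Local Notation mu := (@lebesgue_measure R).
Let ray (x : 'rV[R]_p) (t : R) := y + t *: (x - y).

Lemma ball_ray x t : B x -> 0 <= t <= 1 -> B (ray x t).
Proof.
move=> [r0 xB] /andP[t0 t1]; split => // i j; have := xB i j.
rewrite /ray /ball /= /ball_ !mxE opprD addNKr normrN normrM (ger0_norm t0) distrC.
by apply: le_lt_trans; rewrite ler_piMl.
Qed.

(** Compactness of [0, 1] makes the neighbourhood of x uniform in t. Continuity of the ray integrals
    and differentiation under the integral sign both rest on this uniformity. *)
Lemma ray_near (f : 'rV[R]_p -> R) x e : (forall z, B z -> {for z, continuous f}) -> B x ->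
  0 < e -> \forall x' \near x, B x' /\ forall t, 0 <= t <= 1 -> `|f (ray x t) - f (ray x' t)| < e.
Proof.
move=> fc Bx e0; have oB : open B by apply: ball_open; case: Bx.
have /compact_near_coveringP c := @segment_compact R 0 1.
have rc (t : R) : 0 <= t <= 1 ->
    f (ray z.2 z.1) @[z --> (nbhs t, nbhs x)] --> f (ray x t).
  move=> t01; have h := fc _ (ball_ray Bx t01).
  suff rl : ray z.2 z.1 @[z --> (nbhs t, nbhs x)] --> ray x t by exact: cvg_comp rl h.
  apply: cvgD; first exact: cvg_cst.
  apply: cvgZ; first exact: cvg_fst.
  by apply: cvgB; [exact: cvg_snd|exact: cvg_cst].
have cov (t : R) : `[0, 1]%classic t ->
    \forall t' \near t & x' \near nbhs x, `|f (ray x t') - f (ray x' t')| < e.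
  rewrite /= in_itv /= => t01.
  have e2 : 0 < e / 2 by rewrite divr_gt0.
  have /cvgrPdist_lt/(_ _ e2) n1 := rc t t01.
  have n2 : \forall t' \near t, `|f (ray x t) - f (ray x t')| < e / 2.
    have [[P Q] /= [Pt Qx] PQ] := n1; apply: filterS Pt => t' Pt'.
    exact: (PQ (t', x) (conj Pt' (nbhs_singleton Qx))).
  have n3 : \forall z \near (nbhs t, nbhs x), `|f (ray x t) - f (ray x z.1)| < e / 2.
    exists ([set t' | `|f (ray x t) - f (ray x t')| < e / 2], setT) => /=.
      by split=> //; exact: filterT.
    by move=> z [].
  near=> z; rewrite /=.
  have -> : f (ray x z.1) - f (ray z.2 z.1) = (f (ray x t) - f (ray z.2 z.1)) - (f (ray x t) - f (ray x z.1)).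
    by ring.
  rewrite (splitr e) (le_lt_trans (ler_normB _ _)) // ltrD //; near: z; first exact: n1.
  exact: n3.
have {}c := c _ (nbhs x) (fun x' t => `|f (ray x t) - f (ray x' t)| < e) _ cov.
near=> x'; split; first by near: x'; exact: open_nbhs_nbhs (conj oB Bx).
move=> t t01; suff : `[0, 1]%classic `<=` (fun t => `|f (ray x t) - f (ray x' t)| < e).
  by apply; rewrite /= in_itv.
by near: x'; exact: c.
Unshelve. all: by end_near. Qed.

(** The weight t^a is there because differentiation in x brings out a factor t: the integrals for
    all exponents together are closed under partial derivatives. *)
Let ray_int (a : nat) (f : 'rV[R]_p -> R) x := (\int[mu]_(t in `[0%R, 1%R]) (t ^+ a * f (ray x t)))%R.

Lemma ray_integrable a (f : 'rV[R]_p -> R) x : (forall z, B z -> {for z, continuous f}) -> B x ->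
  mu.-integrable `[0%R, 1%R] (EFin \o (fun t => t ^+ a * f (ray x t))).
Proof.
move=> fc Bx; apply: continuous_compact_integrable; first exact: segment_compact.
apply: continuous_in_subspaceT => t; rewrite inE /= in_itv /= => t01.
suff : {for t : R, continuous (fun t : R => t ^+ a * f (ray x t))} by [].
apply: continuousM; first exact: exprn_continuous.
apply: (@continuous_comp _ _ _ (ray x) f); last exact/fc/ball_ray.
by apply: cvgD; [exact: cvg_cst|apply: cvgZr_tmp; exact: cvg_id].
Qed.

Lemma ray_int_continuous a (f : 'rV[R]_p -> R) : (forall z, B z -> {for z, continuous f}) ->
  forall x, B x -> {for x, continuous (ray_int a f)}.
Proof.
move=> fc x Bx; apply/(@cvgrPdist_le _ _ _ (nbhs x)) => e e0.
have := ray_near fc Bx e0; apply: filterS => x' [Bx' h].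
have i := ray_integrable a fc Bx; have i' := ray_integrable a fc Bx'.
rewrite /ray_int -RintegralB //.
apply: (le_trans (le_normr_Rintegral _ _)) => //.
  by have := integrableB _ i i'; apply.
have -> : e = (\int[mu]_(t in `[0%R, 1%R]) e)%R.
  have m1 : mu `[0%R, 1%R] = 1%E.
    by rewrite lebesgue_measure_itv /= lte_fin ltr01 oppr0 adde0.
  transitivity (e * fine (mu `[0%R, 1%R])); first by rewrite m1 /= mulr1.
  by rewrite Rintegral_cst.
apply: le_Rintegral => //.
- by apply: (@integrable_norm _ _ _ mu); have := integrableB _ i i'; apply.
- by apply: continuous_compact_integrable; [exact: segment_compact|exact: cst_continuous].
move=> t; rewrite /= in_itv /= => t01; rewrite -mulrBr normrM.
have /andP[t0 t1] := t01.
rewrite (le_trans _ (ltW (h t t01))) // ler_piMl // normrX (ger0_norm t0).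
exact: exprn_ile1.
Qed.


Lemma ray_int_derive a (f : 'rV[R]_p -> R) j : Ck 1 B f ->
  forall x, B x -> is_derive x (delta_mx 0 j) (ray_int a f)
    (ray_int a.+1 (fun z => 'D_(delta_mx 0 j) f z) x).
Proof.
move=> fC x Bx; have oB : open B by apply: ball_open; case: Bx.
have fc := fC.1; have [fd [dfc _]] := fC.2 j.
pose df := fun z => 'D_(delta_mx 0 j) f z.
have [M M0 Mb] : exists2 M, 0 <= M & forall t, 0 <= t <= 1 -> `|df (ray x t)| <= M.
  have [|c c01 cM] := @EVT_max R (fun t => `|df (ray x t)|) 0 1 ler01.
    apply: continuous_in_subspaceT => t; rewrite inE /= in_itv /= => t01.
    suff : {for t : R, continuous (fun t : R => df (ray x t))}.
      by move=> h; apply: (@continuous_comp _ _ _ (fun t => df (ray x t)) Num.norm) => //; exact: norm_continuous.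
    apply: (@continuous_comp _ _ _ (ray x) df); last exact/dfc/ball_ray.
    by apply: cvgD; [exact: cvg_cst|apply: cvgZr_tmp; exact: cvg_id].
  by exists `|df (ray x c)| => // t t01; apply: cM; rewrite in_itv.
(* [ray_near] with tolerance 1 carries the bound M from the ray through x to all neighbouring rays;
   the constant M + 1 is the dominating function for differentiation under the integral. *)
have [e e0 eP] : exists2 e : R, 0 < e & forall s : R, `|s| < e ->
    B (x + s *: delta_mx 0 j) /\ forall t, 0 <= t <= 1 -> `|df (ray (x + s *: delta_mx 0 j) t)| <= M + 1.
  have /nbhs_ballP[e /= e0 eP] := ray_near dfc Bx ltr01.
  exists e => // s se; have [|Bs h] := eP (x + s *: delta_mx 0 j).
    split=> // i k; rewrite (ord1 i) /ball /= /ball_ !mxE eqxx /= opprD addNKr normrN normrM.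
    by case: eqVneq => _; rewrite ?normr1 ?mulr1 // normr0 mulr0.
  split=> // t t01; have := h t t01; rewrite -/df => {}h.
  have -> : df (ray (x + s *: delta_mx 0 j) t) = df (ray x t) - (df (ray x t) - df (ray (x + s *: delta_mx 0 j) t)).
    by rewrite subKr.
  by rewrite (le_trans (ler_normB _ _)) // lerD ?Mb // ltW.
pose F (s t : R) := t ^+ a * f (ray (x + s *: delta_mx 0 j) t).
have rayE s t : ray (x + s *: delta_mx 0 j) t = ray x t + (s * t) *: delta_mx 0 j.
  by rewrite /ray addrAC scalerDr scalerA addrA (mulrC t).
have Fd (s t : R) : `]- e, e[%classic s -> `[0%R, 1%R]%classic t -> is_derive s 1 (F ^~ t) (t ^+ a.+1 * df (ray (x + s *: delta_mx 0 j) t)).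
  rewrite /= !in_itv /= => se t01; rewrite /F.
  have [Bs _] : B (x + s *: delta_mx 0 j) /\ forall t, 0 <= t <= 1 -> `|df (ray (x + s *: delta_mx 0 j) t)| <= M + 1.
    by apply: eP; rewrite ltr_norml.
  have h : is_derive (s * t : R) 1 (fun q => f (ray x t + q *: delta_mx 0 j)) (df (ray (x + s *: delta_mx 0 j) t)).
    rewrite rayE; apply: derivable_line; apply: fd; rewrite -rayE; exact: ball_ray.
  have h2 : is_derive (s : R) 1 (fun s : R => s * t) t.
    have -> : *%R^~ t = (fun s => 0 + s * t) by apply/funext => q; rewrite add0r.
    exact: is_derive_affine.
  have := is_deriveZ (t ^+ a) (@is_derive1_comp _ (fun q => f (ray x t + q *: delta_mx 0 j)) (fun s : R => s * t) s _ _ h h2).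
  have -> : (fun s : R => t ^+ a * f (ray (x + s *: delta_mx 0 j) t)) =
      t ^+ a \*: ((fun q : R => f (ray x t + q *: delta_mx 0 j)) \o *%R^~ t).
    by apply/funext => q /=; rewrite rayE.
  by rewrite exprSr -mulrA (mulrC t).
have I0 : `]- e, e[%classic (0 : R) by rewrite /= in_itv /= oppr_lt0 e0.
have Fc s : `]- e, e[%classic s -> mu.-integrable `[0%R, 1%R] (EFin \o F s).
  rewrite /= in_itv /= => se; apply: ray_integrable => //.
  by apply: (eP _ _).1; rewrite ltr_norml.
have dFE s t : `]- e, e[%classic s -> `[0%R, 1%R]%classic t ->
    partial1of2 F s t = t ^+ a.+1 * df (ray (x + s *: delta_mx 0 j) t).
  by move=> si ti; rewrite partial1of2E; have [_ ->] := Fd s t si ti.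
have gub s t : `]- e, e[%classic s -> `[0%R, 1%R]%classic t -> `|partial1of2 F s t| <= M + 1.
  move=> si ti; rewrite dFE // normrM.
  move: si ti; rewrite /= !in_itv /= => si ti; have /andP[t0 t1] := ti.
  have [_ h] : B (x + s *: delta_mx 0 j) /\ forall t, 0 <= t <= 1 -> `|df (ray (x + s *: delta_mx 0 j) t)| <= M + 1.
    by apply: eP; rewrite ltr_norml.
  rewrite (le_trans _ (h t ti)) // ler_piMl // normrX (ger0_norm t0).
  exact: exprn_ile1.
have G0 : R -> 0 <= M + 1 by move=> _; rewrite addr_ge0.
have intG : mu.-integrable `[0%R, 1%R] (EFin \o (fun _ : R => M + 1)).
  by apply: continuous_compact_integrable; [exact: segment_compact|exact: cst_continuous].
have dF s : `]- e, e[%classic s -> `[0%R, 1%R]%classic `<=` (fun t => derivable (F ^~ t) s 1).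
  by move=> si t ti; have [] := Fd s t si ti.
have L := @cvg_differentiation_under_integral R _ _ mu F `[0%R, 1%R] (measurable_itv _) 0 (- e) e I0 Fc
  (fun s t si ti => dF s si t ti) _ G0 intG gub.
have L' : h^-1 *: (ray_int a f (h *: delta_mx 0 j + x) - ray_int a f x) @[h --> (0 : R)^'] -->
    ray_int a.+1 (fun z => 'D_(delta_mx 0 j) f z) x.
  have -> : ray_int a.+1 (fun z => 'D_(delta_mx 0 j) f z) x = (\int[mu]_(t in `[0%R, 1%R]) partial1of2 F 0 t)%R.
    apply: eq_Rintegral => t; rewrite inE => ti; rewrite dFE //.
    by rewrite scale0r addr0.
  apply: cvg_trans L; apply: near_eq_cvg; near=> h.
  by rewrite /F /ray_int /= scale0r !addr0 (addrC x).
apply: DeriveDef; first by apply/cvg_ex; eexists; exact: L'.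
by apply/cvg_lim => //; exact: L'.
Unshelve. all: by end_near. Qed.

Lemma ray_int_Ck a k (f : 'rV[R]_p -> R) : 0 < r -> (forall k, Ck k B f) -> Ck k B (ray_int a f).
Proof.
move=> r0; have oB : open B by exact: ball_open.
elim: k a f => [|k IH] a f fC.
  by split=> // x Bx; apply: ray_int_continuous => //; exact: (fC 0%N).1.
split; first by move=> x Bx; apply: ray_int_continuous => //; exact: (fC 0%N).1.
move=> j; split; first by move=> x Bx; have [] := ray_int_derive a j (fC 1%N) Bx.
apply: (@Ck_eq _ _ _ _ (ray_int a.+1 (fun z => 'D_(delta_mx 0 j) f z))) => //.
  by move=> x; rewrite inE => Bx; have [_ ->] := ray_int_derive a j (fC 1%N) Bx.
by apply: IH => l; exact: ((fC l.+1).2 j).2.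
Qed.

(** The fundamental theorem of calculus along the ray from y to x, with [g i] the integral of the
    i-th partial derivative over the ray. The value of [g i] at y is recorded because it is all that
    a point derivation at y sees of [g i]. *)
Lemma hadamard (f : 'rV[R]_p -> R) : 0 < r -> smooth_on B f ->
  exists g : 'I_p -> 'rV[R]_p -> R, (forall i, smooth_on B (g i)) /\
    (forall i, g i y = 'D_(delta_mx 0 i) f y) /\
    forall x, B x -> f x = f y + \sum_i (x 0 i - y 0 i) * g i x.
Proof.
move=> r0 fC; have oB : open B by exact: ball_open.
pose D i := 'D_(delta_mx 0 i) f.
have DC i k : Ck k B (D i) by exact: ((fC k.+1).2 i).2.
have m1 : mu `[0%R, 1%R] = 1%E by rewrite lebesgue_measure_itv /= lte_fin ltr01 oppr0 adde0.
exists (fun i => ray_int 0 (D i)); split; first by move=> i k; exact: ray_int_Ck.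
split=> [i|x Bx].
  rewrite /ray_int; transitivity (\int[mu]_(t in `[0%R, 1%R]) D i y)%R.
    by apply: eq_Rintegral => t _; rewrite /ray subrr scaler0 addr0 expr0 mul1r.
  rewrite Rintegral_cst //; transitivity (D i y * 1) => //; last by rewrite mulr1.
  by congr (_ * _); rewrite [X in fine X]m1.
pose h (t : R) := \sum_i D i (ray x t) * (x 0 i - y 0 i).
have rowray (t : R) : \row_i (y 0 i + t * (x 0 i - y 0 i)) = ray x t.
  by apply/rowP => i; rewrite !mxE.
have dlin (t : R) i : is_derive t 1 (fun t : R => y 0 i + t * (x 0 i - y 0 i)) (x 0 i - y 0 i).
  exact: is_derive_affine.
have fd (t : R) : 0 <= t <= 1 -> is_derive t 1 (fun t : R => f (ray x t)) (h t).
  move=> t01.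
  have := @is_derive_comp_row p R B f (fun i t => y 0 i + t * (x 0 i - y 0 i)) t 1 oB (fC 1%N).
  rewrite rowray => /(_ (ball_ray Bx t01)) [|dd de].
    by move=> i; have [] := dlin t i.
  have e : (fun z : R => f (\row_i (y 0 i + z * (x 0 i - y 0 i)))) = (fun t => f (ray x t)).
    by apply/funext => z; rewrite rowray.
  rewrite e in dd de; apply: DeriveDef => //; rewrite de; apply: eq_bigr => i _.
  by have [_ ->] := dlin t i.
have rc (t : R) : {for t, continuous (ray x : R -> _)}.
  by apply: cvgD; [exact: cvg_cst|apply: cvgZr_tmp; exact: cvg_id].
have hc (t : R) : 0 <= t <= 1 -> {for t, continuous h}.
  move=> t01; apply: (@cvg_sum_ord _ _ (nbhs t)) => i; apply: cvgM; last exact: cvg_cst.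
  apply: (@continuous_comp _ _ _ (ray x) (D i)) (rc t) _.
  exact: (DC i 0%N).1 _ (ball_ray Bx t01).
have fr (t : R) : 0 <= t <= 1 -> {for t, continuous (fun t => f (ray x t))}.
  move=> t01; apply: (@continuous_comp _ _ _ (ray x) f) (rc t) _.
  exact: (fC 0%N).1 _ (ball_ray Bx t01).
rewrite addrC; apply/eqP; rewrite -subr_eq; apply/eqP.
have e0 : f y = f (ray x 0) by rewrite /ray scale0r addr0.
have e1 : f x = f (ray x 1) by rewrite /ray scale1r addrC subrK.
have F2 : (\int[mu]_(t in `[0%R, 1%R]) (h t)%:E = (f (ray x 1))%:E - (f (ray x 0))%:E)%E.
  apply: (@continuous_FTC2 _ h (fun t => f (ray x t))) => //.
  - apply: continuous_in_subspaceT => t; rewrite inE /= in_itv /=; exact: hc.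
  - split.
    + by move=> t; rewrite in_itv /= => /andP[t0 t1]; have [] := fd t; rewrite ?(ltW t0) ?(ltW t1).
    + by apply: cvg_at_right_filter; apply: fr; rewrite lexx ler01.
    + by apply: cvg_at_left_filter; apply: fr; rewrite lexx ler01.
  - move=> t; rewrite in_itv /= => /andP[t0 t1]; rewrite derive1E.
    have t01 : 0 <= t <= 1 by rewrite !ltW.
    by have [_ ->] := fd t t01.
transitivity (\int[mu]_(t in `[0%R, 1%R]) h t)%R; first by rewrite /Rintegral F2 -EFinB /= e0 e1.
(* Linearity of the integral by induction on the number n of summands, which u selects; the claim is
   the case n = p with u the identity. *)
have hi n (u : 'I_n -> 'I_p) : 
  (\int[mu]_(t in `[0%R, 1%R]) (\sum_(i < n) D (u i) (ray x t) * (x 0 (u i) - y 0 (u i))))%R =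
  \sum_(i < n) (x 0 (u i) - y 0 (u i)) * ray_int 0 (D (u i)) x.
  elim: n u => [|n IH] u.
    rewrite big_ord0; under eq_Rintegral do rewrite big_ord0.
    by rewrite Rintegral_cst // mul0r.
  have intD i : mu.-integrable `[0%R, 1%R] (EFin \o (fun t => D i (ray x t) * (x 0 i - y 0 i))).
    apply: continuous_compact_integrable; first exact: segment_compact.
    apply: continuous_in_subspaceT => t; rewrite inE /= in_itv /= => t01.
    suff : {for t : R, continuous (fun t : R => D i (ray x t) * (x 0 i - y 0 i))} by [].
    apply: cvgM; last exact: cvg_cst.
    apply: (@continuous_comp _ _ _ (ray x) (D i)) (rc t) _.
    exact: (DC i 0%N).1 _ (ball_ray Bx t01).
  rewrite big_ord_recl -(IH (fun i => u (lift ord0 i))).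
  under eq_Rintegral do rewrite big_ord_recl.
  rewrite RintegralD //.
  - congr (_ + _); rewrite /ray_int -RintegralZl //.
      by apply: eq_Rintegral => t _; rewrite expr0 mul1r mulrC.
    by apply: ray_integrable => // z; exact: (DC _ 0%N).1.
  apply: continuous_compact_integrable; first exact: segment_compact.
  apply: continuous_in_subspaceT => t; rewrite inE /= in_itv /= => t01.
  suff : {for t : R, continuous (fun t : R => \sum_(i < n) D (u (lift ord0 i)) (ray x t) * (x 0 (u (lift ord0 i)) - y 0 (u (lift ord0 i))))} by [].
  apply: (@cvg_sum_ord _ _ (nbhs t)) => i; apply: cvgM; last exact: cvg_cst.
  apply: (@continuous_comp _ _ _ (ray x) (D _)) (rc t) _.
  exact: (DC _ 0%N).1 _ (ball_ray Bx t01).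
exact: hi p id.
Qed.

End RayIntegral.

(** * Exchanging one coordinate for a function *)

Definition upd p (x : 'rV[R]_p) (k : 'I_p) (c : R) : 'rV[R]_p :=
  \row_j if j == k then c else x 0 j.

Lemma updE p (x : 'rV[R]_p) k c : upd x k c = upd x k 0 + c *: delta_mx 0 k.
Proof.
apply/rowP => j; rewrite !mxE eqxx /=; case: eqVneq => _; rewrite ?mulr1 ?mulr0 ?add0r ?addr0 //.
Qed.

Lemma upd_upd p (x : 'rV[R]_p) k c d : upd (upd x k c) k d = upd x k d.
Proof. by apply/rowP => j; rewrite !mxE; case: eqP. Qed.

Lemma upd_id p (x : 'rV[R]_p) k : upd x k (x 0 k) = x.
Proof. by apply/rowP => j; rewrite !mxE; case: eqP => // ->. Qed.

Lemma continuous_scale (T : topologicalType) (c : R) (h : T -> R) x :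
  {for x, continuous h} -> {for x, continuous (fun z => c * h z)}.
Proof. by move=> hc; apply: (@cvgM _ _ (nbhs x)) => //; exact: cvg_cst. Qed.

Section ImplicitCoordinate.
Variables (p : nat) (U : set 'rV[R]_p) (f : 'rV[R]_p -> R) (x0 : 'rV[R]_p) (k : 'I_p).
Hypotheses (oU : open U) (fC : smooth_on U f) (Ux0 : U x0).
Local Notation D := ('D_(delta_mx 0 k) f).
Hypothesis Dx0 : D x0 != 0.

(** Multiplying by w makes [w * f] strictly increasing in the k-th coordinate, whatever the sign of
    the derivative at x0. *)
Let w := D x0.
Let DC i n : Ck n U ('D_(delta_mx 0 i) f). Proof. exact: ((fC n.+1).2 i).2. Qed.

Let box : exists2 e : R, 0 < e & forall z, ball x0 e z -> U z /\ 0 < w * D z.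
Proof.
have c : {for x0, continuous (fun z => w * D z)}.
  by apply: continuous_scale; exact: (DC k 0%N).1.
have n0 : 0 < w * D x0 by rewrite lt_def mulf_neq0 //= -expr2 sqr_ge0.
have n1 : \forall z \near x0, 0 < w * D z.
  by apply: (c (fun r => 0 < r)); exact: lt_nbhsr.
have n2 : \forall z \near x0, U z /\ 0 < w * D z.
  by apply: filterI => //; exact: (open_nbhs_nbhs (conj oU Ux0)).
by have /nbhs_ballP[e e0 eP] := n2; exists e.
Qed.

Let e := projT1 (cid2 box).
Let e0 : 0 < e. Proof. by rewrite /e; case: cid2. Qed.
Let eU z : ball x0 e z -> U z. Proof. by rewrite /e; case: cid2 => /= d _ h /h []. Qed.
Let eD z : ball x0 e z -> 0 < w * D z. Proof. by rewrite /e; case: cid2 => /= d _ h /h []. Qed.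
(** Half the radius of the box on which the derivative keeps its sign: the closed interval from [lo]
    to [hi], on which the intermediate value theorem is applied, then stays inside the box. *)
Let r := e / 2.
Let r0 : 0 < r. Proof. by rewrite divr_gt0. Qed.
Let re : r < e. Proof. by rewrite /r; have := e0; lra. Qed.
Let lo := x0 0 k - r.
Let hi := x0 0 k + r.
(** Every coordinate but the k-th is constrained: on the target side the k-th coordinate is a value
    of f and not a position. *)
Let near_box : set 'rV[R]_p := [set y | ball x0 r (upd y k (x0 0 k))].

Let upd_ball y c : near_box y -> lo <= c <= hi -> ball x0 e (upd y k c).
Proof.
move=> [_ h] /andP[c1 c2]; split=> // i j; have := h i j; rewrite /ball /= /ball_ !mxE.
case: eqP => [->|_] hj; last by rewrite (ord1 i) in hj *; exact: lt_trans re.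
have := re; rewrite (ord1 i); rewrite -/lo /lo /hi in c1 c2 *.
by rewrite ltr_norml => ?; apply/andP; split; lra.
Qed.

Let mono y c d : near_box y -> lo <= c -> c < d -> d <= hi ->
  w * f (upd y k c) < w * f (upd y k d).
Proof.
move=> yb c1 cd d1.
have [t|t /andP[t1 t2]] := @MVT_unordered (fun s => f (upd y k 0 + s *: delta_mx 0 k))
    (fun s => D (upd y k 0 + s *: delta_mx 0 k)) c d.
  rewrite min_l ?max_r ?(ltW cd) // => /andP[t1 t2].
  apply: derivable_line; apply: ((fC 1%N).2 k).1; apply: eU; rewrite -updE.
  by apply: upd_ball => //; rewrite (le_trans c1) ?(le_trans t2).
move: t1 t2; rewrite min_l ?max_r ?(ltW cd) // -!updE => t1 t2 E.
rewrite -subr_gt0 -mulrBr E mulrA mulr_gt0 ?subr_gt0 //; apply: eD; apply: upd_ball => //.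
by rewrite (le_trans c1) ?(le_trans t2).
Qed.

Let upd_cont c y : {for y, continuous (fun z : 'rV[R]_p => upd z k c)}.
Proof.
apply: continuous_row => i; case: eqP => _; first exact: cst_continuous.
exact: coord_continuous.
Qed.

Let fupd_cont c y : near_box y -> lo <= c <= hi -> {for y, continuous (fun z => w * f (upd z k c))}.
Proof.
move=> yb cI; apply: continuous_scale.
apply: (@continuous_comp _ _ _ (fun z => upd z k c) f); first exact: upd_cont.
by apply: (fC 0%N).1; apply: eU; exact: upd_ball.
Qed.

Let lohi : lo <= hi. Proof. by rewrite /lo /hi; have := r0; lra. Qed.

Let A := ball x0 r.
Let B : set 'rV[R]_p := [set y | near_box y /\ w * f (upd y k lo) < w * y 0 k < w * f (upd y k hi)].

Let A_near x : A x -> near_box x.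
Proof.
move=> [_ h]; split=> // i j; have := h i j; rewrite /ball /= /ball_ !mxE (ord1 i).
by case: eqP => // ->; rewrite subrr normr0.
Qed.

Let A_coord x : A x -> lo < x 0 k < hi.
Proof.
move=> [_ h]; have := h 0 k; rewrite /ball /= /ball_ ltr_norml /lo /hi => /andP[a b].
by apply/andP; split; lra.
Qed.

Let near_A y c : near_box y -> lo < c < hi -> A (upd y k c).
Proof.
move=> [_ h] /andP[c1 c2]; split=> // i j; have := h i j; rewrite /ball /= /ball_ !mxE (ord1 i).
case: eqP => // -> _; rewrite ltr_norml; move: c1 c2; rewrite /lo /hi => c1 c2.
by apply/andP; split; lra.
Qed.

Let oB : open B.
Proof.
have onb : open near_box.
  have oA : open A by exact: ball_open.
  rewrite openE => y yb; rewrite /interior.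
  exact: upd_cont (open_nbhs_nbhs (conj oA yb)).
rewrite openE => y [yb /andP[y1 y2]]; rewrite /interior.
have cl := fupd_cont yb (c := lo); have ch := fupd_cont yb (c := hi).
have cy : {for y, continuous (fun z : 'rV[R]_p => w * z 0 k)}.
  by apply: continuous_scale; exact: coord_continuous.
have n1 : nbhs y [set z : 'rV[R]_p | 0 < w * z 0 k - w * f (upd z k lo)].
  have c : {for y, continuous (fun z : 'rV[R]_p => w * z 0 k - w * f (upd z k lo))}.
    by apply: cvgB cy (cl _); rewrite lexx lohi.
  by apply: (c (fun r => 0 < r)); apply: lt_nbhsr; rewrite subr_gt0.
have n2 : nbhs y [set z : 'rV[R]_p | 0 < w * f (upd z k hi) - w * z 0 k].
  have c : {for y, continuous (fun z : 'rV[R]_p => w * f (upd z k hi) - w * z 0 k)}.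
    by apply: cvgB (ch _) cy; rewrite lexx lohi.
  by apply: (c (fun r => 0 < r)); apply: lt_nbhsr; rewrite subr_gt0.
near=> z; split; first by near: z; exact: open_nbhs_nbhs.
apply/andP; split; rewrite -subr_gt0; by near: z.
Unshelve. all: by end_near. Qed.

(** Inversion in the single variable c: the intermediate value theorem applies because B asks for a
    value strictly between those at [lo] and [hi], and [mono] pins the solution down. *)
Let g_ex y : exists c, B y -> lo < c < hi /\ f (upd y k c) = y 0 k.
Proof.
have [[yb /andP[y1 y2]]|nB] := pselect (B y); last by exists 0.
have [||c] := @IVT R (fun c => w * f (upd y k c)) lo hi (w * y 0 k) lohi.
- apply: continuous_in_subspaceT => c; rewrite inE /= in_itv /= => cI.
  suff : {for c : R, continuous (fun c : R => w * f (upd y k c))} by [].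
  apply: cvgM; first exact: cvg_cst.
  apply: (@continuous_comp _ _ _ (upd y k) f).
    have -> : upd y k = (fun c => upd y k 0 + c *: delta_mx 0 k) by apply/funext => d; exact: updE.
    by apply: cvgD; [exact: cvg_cst|apply: cvgZr_tmp; exact: cvg_id].
  by apply: (fC 0%N).1; apply: eU; exact: upd_ball.
- have lt := ltW (lt_trans y1 y2).
  by rewrite (min_l lt) (max_r lt) !ltW.
rewrite in_itv /= => /andP[c1 c2] E; exists c => _; split.
  rewrite !lt_neqAle c1 c2 !andbT; apply/andP; split; apply/eqP => cE.
    by move: y1; rewrite cE E ltxx.
  by move: y2; rewrite -cE E ltxx.
by apply: (mulfI Dx0); exact: E.
Qed.

Let g y := projT1 (cid (g_ex y)).
Let gP y : B y -> lo < g y < hi /\ f (upd y k (g y)) = y 0 k.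
Proof. by rewrite /g; case: cid. Qed.

Let g_cmp y c : B y -> lo <= c <= hi -> (c < g y <-> w * f (upd y k c) < w * y 0 k) /\
  (g y < c <-> w * y 0 k < w * f (upd y k c)).
Proof.
move=> By /andP[c1 c2]; have [/andP[g1 g2] <-] := gP By; have [yb _] := By.
have [cg|gc|->] := ltrgtP c (g y); last by rewrite ltxx.
- by have m := mono yb c1 cg (ltW g2); rewrite m (lt_gtF m); split; split.
- by have m := mono yb (ltW g1) gc c2; rewrite m (lt_gtF m); split; split.
Qed.

Let g_cont y : B y -> {for y, continuous g}.
Proof.
move=> By; apply/(@cvgrPdist_lt _ _ _ (nbhs y)) => d d0.
have [/andP[g1 g2] _] := gP By; have [yb _] := By.
pose c1 := Num.max lo (g y - d / 2); pose c2 := Num.min hi (g y + d / 2).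
have d2 : 0 < d / 2 by rewrite divr_gt0.
have c1I : lo <= c1 <= hi.
  by rewrite /c1 le_max lexx /= ge_max lohi /=; have := d2; have := g2; lra.
have c2I : lo <= c2 <= hi.
  by rewrite /c2 ge_min lexx /= andbT le_min lohi /=; have := d2; have := g1; lra.
have l1 : w * f (upd y k c1) < w * y 0 k.
  by apply: (g_cmp By c1I).1.1; rewrite gt_max g1 /=; have := d2; lra.
have l2 : w * y 0 k < w * f (upd y k c2).
  by apply: (g_cmp By c2I).2.1; rewrite lt_min g2 /=; have := d2; lra.
have cy : {for y, continuous (fun z : 'rV[R]_p => w * z 0 k)}.
  by apply: continuous_scale; exact: coord_continuous.
have n1 : nbhs y [set z : 'rV[R]_p | 0 < w * z 0 k - w * f (upd z k c1)].
  have c : {for y, continuous (fun z : 'rV[R]_p => w * z 0 k - w * f (upd z k c1))}.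
    exact: cvgB cy (fupd_cont yb c1I).
  by apply: (c (fun r => 0 < r)); apply: lt_nbhsr; rewrite subr_gt0.
have n2 : nbhs y [set z : 'rV[R]_p | 0 < w * f (upd z k c2) - w * z 0 k].
  have c : {for y, continuous (fun z : 'rV[R]_p => w * f (upd z k c2) - w * z 0 k)}.
    exact: cvgB (fupd_cont yb c2I) cy.
  by apply: (c (fun r => 0 < r)); apply: lt_nbhsr; rewrite subr_gt0.
near=> z.
have Bz : B z by near: z; exact: open_nbhs_nbhs.
have a1 : c1 < g z by apply: (g_cmp Bz c1I).1.2; rewrite -subr_gt0; near: z.
have a2 : g z < c2 by apply: (g_cmp Bz c2I).2.2; rewrite -subr_gt0; near: z.
move: a1 a2; rewrite gt_max lt_min => /andP[_ a1] /andP[_ a2].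
by rewrite ltr_norml; apply/andP; split; have := d2; lra.
Unshelve. all: by end_near. Qed.

Let Psi y := upd y k (g y).
Let Psi_A y : B y -> A (Psi y).
Proof. by move=> By; apply: near_A; [case: By|case: (gP By)]. Qed.
Let AU x : A x -> ball x0 e x. Proof. by apply: le_ball; exact: ltW. Qed.

(** The equation f (Psi y) = y_k is differentiated through the expansion of f at Psi y given by
    [caratheodory]. Along the j-th axis only the terms of index k and j survive, and the increment
    of g is solved for. *)
Let g_derive j y : B y -> is_derive y (delta_mx 0 j) g
  ((if j == k then 1 else - 'D_(delta_mx 0 j) f (Psi y)) * (D (Psi y))^-1).
Proof.
move=> By; have Uz := eU (AU (Psi_A By)).
have Dz : D (Psi y) != 0.
  by apply/eqP => z; have := eD (AU (Psi_A By)); rewrite z mulr0 ltxx.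
have [G [Gc GE]] := caratheodory oU (fC 1%N) Uz.
have lc : h *: delta_mx 0 j + y @[h --> (0 : R)^'] --> y.
  have : h *: (delta_mx 0 j : 'rV[R]_p) + y @[h --> (0 : R)^'] --> 0 *: (delta_mx 0 j : 'rV[R]_p) + y.
    by apply: cvgD; [apply: cvgZr_tmp; exact: nbhs_dnbhs|exact: cvg_cst].
  by rewrite scale0r add0r.
have PsiC : Psi (h *: delta_mx 0 j + y) @[h --> (0 : R)^'] --> Psi y.
  suff c : Psi z @[z --> y] --> Psi y by exact: cvg_comp lc c.
  apply: continuous_row => i; case: eqP => _; first exact: g_cont.
  exact: coord_continuous.
have GC i : G i (Psi (h *: delta_mx 0 j + y)) @[h --> (0 : R)^'] --> 'D_(delta_mx 0 i) f (Psi y).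
  exact: cvg_comp PsiC (Gc i).
have L : h^-1 *: (g (h *: delta_mx 0 j + y) - g y) @[h --> (0 : R)^'] -->
    (if j == k then 1 else - 'D_(delta_mx 0 j) f (Psi y)) * (D (Psi y))^-1.
  have : (if j == k then 1 else - G j (Psi (h *: delta_mx 0 j + y))) * (G k (Psi (h *: delta_mx 0 j + y)))^-1
     @[h --> (0 : R)^'] --> (if j == k then 1 else - 'D_(delta_mx 0 j) f (Psi y)) * (D (Psi y))^-1.
    apply: cvgM; last by apply: cvgV Dz (GC k).
    by case: eqP => _; [exact: cvg_cst|apply: cvgN; exact: GC].
  apply: cvg_trans; apply: near_eq_cvg; near=> h.
  have h0 : h != 0 by near: h; exact: nbhs_dnbhs_neq.
  have Bh : B (h *: delta_mx 0 j + y) by near: h; exact: (lc _ (open_nbhs_nbhs (conj oB By))).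
  have Gk : G k (Psi (h *: delta_mx 0 j + y)) != 0.
    by near: h; exact: cvgr_neq0 (GC k) Dz.
  have E : f (Psi (h *: delta_mx 0 j + y)) - f (Psi y) =
     \sum_i ((Psi (h *: delta_mx 0 j + y)) 0 i - (Psi y) 0 i) * G i (Psi (h *: delta_mx 0 j + y)).
    by near: h; exact: PsiC GE.
  move: E; rewrite /Psi (gP Bh).2 (gP By).2 -/(Psi _) -/(Psi y) (bigD1 k) //= !mxE !eqxx /= addrK.
  set S := \sum_(i | _) _.
  have -> : S = if j == k then 0 else h * G j (Psi (h *: delta_mx 0 j + y)).
    rewrite /S; case: (eqVneq j k) => [jk|jk].
      apply: big1 => i ik; rewrite !mxE (negbTE ik) jk (negbTE ik) mulr0 add0r subrr mul0r //.
    rewrite (bigD1 j) //= big1 ?addr0.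
      by rewrite !mxE (negbTE jk) !eqxx /= mulr1 addrK.
    by move=> i /andP[ik ij]; rewrite !mxE (negbTE ik) (negbTE ij) mulr0 add0r subrr mul0r.
  transitivity (h^-1 * (g (h *: delta_mx 0 j + y) - g y)); last by [].
  move: E; case: (eqVneq k j) => [kj|kj]; rewrite ?eqxx ?[j == k]eq_sym ?(negbTE kj) /=.
    rewrite mulr1 addr0 => E; by apply: (mulIf Gk); rewrite divfK // -mulrA -E mulVf.
  rewrite mulr0 => /esym/eqP; rewrite addr_eq0 => /eqP E.
  by apply: (mulIf Gk); rewrite divfK // -mulrA E mulrN mulrA mulVf // mul1r.
apply: DeriveDef; first by apply/cvg_ex; eexists; exact: L.
by apply/cvg_lim => //; exact: L.
Unshelve. all: by end_near. Qed.

(** Bootstrapping: the partial derivatives of g are quotients of partial derivatives of f evaluated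
    at Psi, and Psi has coordinates as regular as g. Each round gains one order. *)
Let g_Ck n : Ck n B g.
Proof.
elim: n => [|n IH]; first by split=> // y By; exact: g_cont.
split; first by move=> y By; exact: g_cont.
move=> j; split; first by move=> y By; have [] := g_derive j By.
apply: (@Ck_eq _ _ _ _ (fun y => (if j == k then 1 else - 'D_(delta_mx 0 j) f (Psi y)) * (D (Psi y))^-1)) => //.
  by move=> y; rewrite inE => By; have [_ ->] := g_derive j By.
have PsiC i : Ck n B (fun y : 'rV[R]_p => if i == k then g y else y 0 i).
  by case: eqP => _ //; exact: Ck_coord.
have PU (x : 'rV[R]_p) : B x -> U (\row_i if i == k then g x else x 0 i).
  by move=> Bx; exact: eU (AU (Psi_A Bx)).
apply: CkM => //.
  case: eqP => _; first exact: Ck_cst.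
  by apply: CkN => //; exact: (Ck_comp_row oB oU PU (DC j n) PsiC).
apply: CkV => //; last exact: (Ck_comp_row oB oU PU (DC k n) PsiC).
by move=> y By; apply/eqP => z; have := eD (AU (Psi_A By)); rewrite z mulr0 ltxx.
Qed.

(** The maps x to [upd x k (f x)] and y to [upd y k (g y)] are inverse to each other between A and
    B, so f can serve as k-th coordinate near x0 while the other coordinates stay. It is applied
    once for each coordinate of the target of a submersion. *)
Lemma implicit_coordinate : exists (A B : set 'rV[R]_p) (g : 'rV[R]_p -> R),
  [/\ open A, open B, A x0, A `<=` U & smooth_on B g] /\
  (forall x, A x -> B (upd x k (f x)) /\ g (upd x k (f x)) = x 0 k) /\
  (forall y, B y -> A (upd y k (g y)) /\ f (upd y k (g y)) = y 0 k).
Proof.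
exists A, B, g; split.
  split=> //; [exact: ball_open|exact: (ballxx _ r0)|by move=> x /AU /eU].
split=> [x Ax|y By]; last by split; [exact: Psi_A|case: (gP By)].
have xb := A_near Ax; have /andP[x1 x2] := A_coord Ax.
have Bx : B (upd x k (f x)).
  split; first by rewrite /near_box /= upd_upd.
  rewrite !upd_upd mxE eqxx.
  have m1 := mono xb (lexx lo) x1 (ltW x2); have m2 := mono xb (ltW x1) x2 (lexx hi).
  by rewrite upd_id in m1 m2; rewrite m1 m2.
split=> //; have [/andP[g1 g2]] := gP Bx; rewrite upd_upd mxE eqxx => E.
have [lt|gt|//] := ltrgtP (g (upd x k (f x))) (x 0 k).
  have := mono xb (ltW g1) lt (ltW x2).
  by rewrite E upd_id ltxx.
have := mono xb (ltW x1) gt (ltW g2).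
by rewrite E upd_id ltxx.
Qed.

End ImplicitCoordinate.

End Calculus.


(** * Open subspaces and gluing of morphisms *)

Section Restrictions.
Context {R : realType}.
Implicit Types M N P T A : superspace R.

(* Restriction and pullback made total, so that no inclusion or openness proof
   occurs in terms; they are only meaningful when [V `<=` U], resp. [open V]. *)
Definition rs M (U V : set M) (s : sec M U) : sec M V :=
  if pselect (V `<=` U) is left VU then res VU s else 0.
Definition pl M N (f : smor M N) (V : set N) (s : sec N V) : sec M (f @^-1` V) :=
  if pselect (open V) is left oV then pull f oV s else 0.
Arguments rs {M U} V s.
Arguments pl {M N} f {V} s.

Lemma rsE M (U V : set M) (VU : V `<=` U) (s : sec M U) : rs V s = res VU s.
Proof.
by rewrite /rs; case: pselect => // h; rewrite (Prop_irrelevance h VU).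
Qed.

Lemma plE M N (f : smor M N) (V : set N) (oV : open V) (s : sec N V) :
  pl f s = pull f oV s.
Proof.
by rewrite /pl; case: pselect => // h; rewrite (Prop_irrelevance h oV).
Qed.

Lemma rs_id M (U : set M) (s : sec M U) : rs U s = s.
Proof. by rewrite (rsE (@subset_refl _ U)) res_id. Qed.

Lemma rs_rs M (U V W : set M) (s : sec M U) : V `<=` U -> W `<=` V ->
  rs W (rs V s) = rs W s.
Proof.
move=> VU WV; rewrite (rsE VU) (rsE WV) (rsE (subset_trans WV VU)).
exact: res_comp.
Qed.

Lemma rs_alg M (U V : set M) : V `<=` U -> superalg_morphism (@rs M U V).
Proof.
move=> VU; have -> : @rs M U V = res VU by apply/funext => s; exact: rsE.
exact: res_alg.
Qed.

Lemma pl_alg M N (f : smor M N) (V : set N) : open V -> superalg_morphism (@pl M N f V).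
Proof.
move=> oV; have -> : @pl M N f V = pull f oV by apply/funext => s; exact: plE.
exact: pull_alg.
Qed.

Lemma pl_rs M N (f : smor M N) (U V : set N) (s : sec N U) : open U -> open V ->
  V `<=` U -> pl f (rs V s) = rs (f @^-1` V) (pl f s).
Proof.
move=> oU oV VU; rewrite (rsE VU) (plE f oV) (plE f oU) (rsE (preimage_subset VU)).
exact: pull_res.
Qed.

Lemma pl_comp M N P (g : smor N P) (f : smor M N) (V : set P) (s : sec P V) : open V ->
  pl (scomp g f) s = pl f (pl g s) :> sec M (scomp g f @^-1` V).
Proof.
move=> oV; rewrite (plE _ oV) (plE g oV) (plE f (smor_cont g oV)) /=.
by congr pull; exact: Prop_irrelevance.
Qed.

Lemma pl_id M (V : set M) (s : sec M V) : open V -> pl (sid M) s = s :> sec M V.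
Proof. by move=> oV; rewrite (plE _ oV). Qed.

Lemma pl_eq M N (f g : smor M N) (V : set N) (W : set M) (s : sec N V) : f = g ->
  rs W (pl f s) = rs W (pl g s).
Proof. by move=> ->. Qed.

Lemma smor_open M N (f : smor M N) (V : set N) : open V -> open (f @^-1` V).
Proof. exact: smor_cont. Qed.

Lemma sec_ext M (U : set M) (s t : sec M U) : open U ->
  (forall x, U x -> exists W, [/\ open W, W x, W `<=` U & rs W s = rs W t]) -> s = t.
Proof.
move=> oU h; pose I := {x | U x}; pose F (i : I) := projT1 (cid (h _ (projT2 i))).
have FP (i : I) : [/\ open (F i), F i (projT1 i), F i `<=` U & rs (F i) s = rs (F i) t].
  by rewrite /F; case: cid.
have oF i : open (F i) by case: (FP i).
have FU i : F i `<=` U by case: (FP i).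
have BU : \bigcup_i F i `<=` U by move=> x [i _]; exact: FU.
have UB : U `<=` \bigcup_i F i by move=> x Ux; exists (exist _ x Ux) => //; case: (FP (exist _ x Ux)).
have [|t0 [_ tu]] := @sec_glue _ M I F oF (fun i => rs (F i) s).
  by move=> i j; rewrite -!rsE !rs_rs.
have FB i : F i `<=` \bigcup_i F i by exact: bigcup_sup.
have e1 : t0 = rs _ s by apply: tu => i; rewrite -rsE rs_rs.
have e2 : t0 = rs _ t.
  by apply: tu => i; rewrite -rsE rs_rs //; case: (FP i).
by rewrite -[s]rs_id -[t]rs_id -(rs_rs _ BU UB) -(rs_rs t BU UB) -e1 -e2.
Qed.

Lemma sec_glue_on M (U : set M) (I : Type) (F : I -> set M) (s : forall i, sec M (F i)) :
  open U -> (forall i, open (F i)) -> (forall i, F i `<=` U) ->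
  (forall x, U x -> exists i, F i x) ->
  (forall i j x, F i x -> F j x -> exists W, [/\ open W, W x, W `<=` F i, W `<=` F j &
     rs W (s i) = rs W (s j)]) ->
  exists t : sec M U, forall i, rs (F i) t = s i.
Proof.
move=> oU oF FU UF agree.
have BU : \bigcup_i F i `<=` U by move=> x [i _]; exact: FU.
have UB : U `<=` \bigcup_i F i by move=> x /UF[i Fx]; exists i.
have FB i : F i `<=` \bigcup_i F i by exact: bigcup_sup.
have [|t0 [t0P _]] := @sec_glue _ M I F oF s.
  move=> i j; rewrite -!rsE; apply: sec_ext; first exact: openI.
  move=> x [xi xj]; have [W [oW Wx Wi Wj e]] := agree i j x xi xj.
  have Wij : W `<=` F i `&` F j by move=> y Wy; split; [exact: Wi|exact: Wj].
  by exists W; split=> //; rewrite !rs_rs //; move=> y [].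
exists (rs U t0) => i; rewrite rs_rs //.
by rewrite -(t0P i) (rsE (@FB i)); congr res; exact: Prop_irrelevance.
Qed.

(** Pullbacks are compared after restriction to an open set contained in both preimages, so that no
    section is transported along the equality of the underlying maps, as it is in [smor_ext]. *)
Lemma smor_eqP M N (f g : smor M N) : (forall x, f x = g x) ->
  (forall (V : set N) (s : sec N V) x, open V -> V (f x) ->
    exists W, [/\ open W, W x, W `<=` f @^-1` V, W `<=` g @^-1` V & rs W (pl f s) = rs W (pl g s)]) ->
  f = g.
Proof.
move=> fg h; have e : smor_fun f = smor_fun g by apply/funext.
case: f g fg h e => [f fc fp fa fr fl] [g gc gp ga gr gl] /= fg h e; subst g.
apply: (@smor_ext _ _ _ (Smor fc fa fr fl) (Smor gc ga gr gl) erefl) => V oV s /=.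
have oE := fc V oV; apply: sec_ext => //.
by move=> x Vx; have [W [oW Wx Wf _]] := h V s x oV Vx; rewrite !(plE _ oV) => E; exists W.
Qed.

Lemma invertible_morph (A B : superAlgebra R) (f : A -> B) x :
  superalg_morphism f -> invertible x -> invertible (f x).
Proof.
by move=> fm [y [xy yx]]; exists (f y); rewrite -!(samM fm) xy yx (sam1 fm).
Qed.

Lemma invertible_atP M (x : M) (U : set M) (s : sec M U) :
  invertible_at x s <-> exists W, [/\ open W, W x, W `<=` U & invertible (rs W s)].
Proof.
split; first by move=> [W [WU [oW Wx h]]]; exists W; rewrite (rsE WU).
by move=> [W [oW Wx WU h]]; exists W, WU; rewrite -(rsE WU).
Qed.

Lemma invertible_at_rs M (x : M) (U V : set M) (s : sec M U) : open V -> V x -> V `<=` U ->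
  invertible_at x (rs V s) <-> invertible_at x s.
Proof.
move=> oV Vx VU; split=> /invertible_atP[W [oW Wx WU h]]; apply/invertible_atP.
  by exists W; split=> //; [exact: subset_trans VU|rewrite -(rs_rs s VU WU)].
exists (W `&` V); split=> //; [exact: openI|].
rewrite rs_rs // -(rs_rs s WU) //.
by apply: invertible_morph h; exact: rs_alg.
Qed.

Lemma invertible_at_pl M N (f : smor M N) (x : M) (V : set N) (s : sec N V) : open V -> V (f x) ->
  invertible_at x (pl f s) <-> invertible_at (f x) s.
Proof.
move=> oV Vx; split; first by rewrite (plE f oV); exact: pull_local.
move=> /invertible_atP[W [oW Wx WV h]]; apply/invertible_atP.
exists (f @^-1` W); split; [exact: smor_open|exact: Wx|exact: preimage_subset|rewrite -pl_rs //].
by apply: invertible_morph h; exact: pl_alg.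
Qed.

Lemma value_at_rs M (x : M) (U V : set M) (s : sec M U) a : open V -> V x -> V `<=` U ->
  value_at x (rs V s) a <-> value_at x s a.
Proof.
move=> oV Vx VU; rewrite /value_at -(invertible_at_rs _ oV Vx VU).
have h := rs_alg VU; by rewrite (samD h) (samN h) (samZ h) (sam1 h).
Qed.

Lemma value_at_pl M N (f : smor M N) (x : M) (V : set N) (s : sec N V) a : open V -> V (f x) ->
  value_at x (pl f s) a <-> value_at (f x) s a.
Proof.
move=> oV Vx; rewrite /value_at; have h := pl_alg f oV.
have <- : pl f (s - a *: (1 : sec N V)) = pl f s - a *: (1 : sec M _) by rewrite (samD h) (samN h) (samZ h) (sam1 h).
by split=> n i; apply: n; apply/invertible_at_pl.
Qed.

End Restrictions.
Arguments rs {R M U} V s.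
Arguments pl {R M N} f {V} s.

(** * Open subspaces and open immersions *)

Section OpenSubspace.
Context {R : realType} (M : superspace R) (U : set M) (oU : open U).

Lemma open_image_val (V : set U) : open V -> open (set_val @` V : set M).
Proof.
move=> [W oW <-]; have -> : set_val @` (set_val @^-1` W : set U) = W `&` U.
  apply/seteqP; split; first by move=> _ [x Wx <-]; split => //; exact: set_valP.
  by move=> x [Wx Ux]; exists (exist _ x (mem_set Ux)).
exact: openI.
Qed.

Let osec (V : set U) : superAlgebra R := sec M (set_val @` V).
Let ores (V W : set U) (WV : W `<=` V) (s : osec V) : osec W := res (image_subset set_val WV) s.

Lemma osub_res_alg (V W : set U) (WV : W `<=` V) : superalg_morphism (@ores V W WV).
Proof. exact: res_alg. Qed.
Lemma osub_res_id (V : set U) (VV : V `<=` V) s : ores VV s = s.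
Proof. exact: res_id. Qed.
Lemma osub_res_comp (V W X : set U) (WV : W `<=` V) (XW : X `<=` W) (XV : X `<=` V) s :
  ores XW (ores WV s) = ores XV s.
Proof. exact: res_comp. Qed.
Lemma osub_glue (I : Type) (F : I -> set U) (oF : forall i, open (F i))
    (s : forall i, osec (F i)) :
  (forall i j, ores (@subIsetl _ (F i) (F j)) (s i) = ores (@subIsetr _ (F i) (F j)) (s j)) ->
  exists! t : osec (\bigcup_i F i), forall i, ores (bigcup_sup Logic.I) t = s i.
Proof.
move=> agree.
have oF' i : open (set_val @` F i : set M) by exact: open_image_val.
have FU i : set_val @` F i `<=` (set_val @` (\bigcup_i F i) : set M).
  by apply: image_subset; exact: bigcup_sup.
have oB : open (set_val @` (\bigcup_i F i) : set M).
  by apply: open_image_val; exact: bigcup_open.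
have cov x : (set_val @` (\bigcup_i F i) : set M) x -> exists i, (set_val @` F i : set M) x.
  by move=> [y [i _ Fy] <-]; exists i, y.
have [i j x|t tP] := sec_glue_on (s := s) oB oF' FU cov.
  move=> Fi Fj; exists (set_val @` (F i `&` F j)); split.
  - by apply: open_image_val; exact: openI.
  - case: Fi Fj => [y Fy <-] [z Fz /val_inj zy]; exists y => //; split=> //.
    by rewrite -zy.
  - by apply: image_subset => ? [].
  - by apply: image_subset => ? [].
  - have := agree i j; rewrite /ores -!rsE; exact.
exists t; split; first by move=> i; rewrite /ores -rsE tP.
move=> t' t'P; apply: sec_ext => // x /cov[i Fx]; exists (set_val @` F i); split=> //.
by rewrite tP -(t'P i) /ores -rsE.
Qed.

Definition osub : superspace R :=
  @Superspace R U osec ores osub_res_alg osub_res_id osub_res_comp osub_glue.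

End OpenSubspace.

Section OpenImmersions.
Context {R : realType}.
Implicit Types M N P T A : superspace R.

Lemma osub_incl_subset M (U : set M) (V : set M) : (set_val @` (set_val @^-1` V : set U)) `<=` V.
Proof. by move=> _ [x Vx <-]. Qed.

Lemma open_preimage_val M (U V : set M) : open V -> open (set_val @^-1` V : set U).
Proof. by move=> oV; exists V. Qed.

Section Incl.
Variables (M : superspace R) (U : set M) (oU : open U).
Let ipull (V : set M) (oV : open V) (s : sec M V) : sec (osub oU) (set_val @^-1` V) :=
  res (@osub_incl_subset M U V) s.
Lemma osub_incl_res (V W : set M) (oV : open V) (oW : open W) (WV : W `<=` V) s :
  ipull oW (res WV s) = @res R (osub oU) _ _ (preimage_subset WV) (ipull oV s).
Proof.
rewrite /ipull /= -!rsE rs_rs //; last exact: osub_incl_subset.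
by rewrite rs_rs //; [exact: osub_incl_subset|apply: image_subset; exact: preimage_subset].
Qed.
Lemma osub_incl_local (V : set M) (oV : open V) (x : osub oU) (s : sec M V) :
  V (set_val x) -> @invertible_at R (osub oU) x _ (ipull oV s) -> invertible_at (set_val x) s.
Proof.
move=> Vx [W [WV [oW Wx h]]]; apply/invertible_atP; exists (set_val @` W); split.
- exact: open_image_val.
- by exists x.
- by move=> _ [y /WV Vy <-].
- by move: h; rewrite /= /ipull -!rsE rs_rs //; [exact: osub_incl_subset|exact: image_subset].
Qed.
Definition osub_incl : smor (osub oU) M :=
  @Smor R (osub oU) M set_val (@open_preimage_val M U) ipull
   (fun V oV => res_alg _) osub_incl_res osub_incl_local.
End Incl.

Section Inverse.
Variables (A M : superspace R) (j : smor A M).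
Hypothesis jo : open_immersion j.

Lemma oi_inj : injective j. Proof. by case: jo. Qed.
Lemma oi_open (V : set A) : open V -> open (j @` V). Proof. by case: jo => _ h _; exact: h. Qed.
Lemma oi_range_open : open (range j). Proof. by apply: oi_open; exact: openT. Qed.
Lemma oi_preimage (V : set A) : j @^-1` (j @` V) = V.
Proof. by apply/seteqP; split=> [x [y Vy /oi_inj <-//]|x Vx]; exists x. Qed.

(** Provides the inverse of pullback along j. The restriction [rs V] is there because V and the
    preimage of its image are only propositionally equal. *)
Lemma oi_push_ex (V : set A) (s : sec A V) : exists t : sec M (j @` V), open V -> rs V (pl j t) = s.
Proof.
have [oV|nV] := pselect (open V); last by exists 0.
have [g gK Kg] : bijective (pull j (oi_open oV)).
  by case: jo => _ _; apply; move=> _ [x _ <-]; exists x.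
exists (g (rs (j @^-1` (j @` V)) s)) => _.
have VV : V `<=` j @^-1` (j @` V) by rewrite oi_preimage.
have VV' : j @^-1` (j @` V) `<=` V by rewrite oi_preimage.
by rewrite (plE _ (oi_open oV)) Kg rs_rs // rs_id.
Qed.

Definition push (V : set A) (s : sec A V) : sec M (j @` V) := projT1 (cid (oi_push_ex s)).

Lemma pushK (V : set A) (s : sec A V) : open V -> rs V (pl j (push s)) = s.
Proof. by rewrite /push; case: cid. Qed.

Lemma pl_push (V : set A) (s : sec A V) : open V -> pl j (push s) = rs _ s.
Proof.
by move=> oV; rewrite -[in RHS](pushK s oV) rs_rs ?oi_preimage // rs_id.
Qed.

Lemma oi_pl_inj (W : set M) (s t : sec M W) : open W -> W `<=` range j -> pl j s = pl j t -> s = t.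
Proof.
move=> oW Wj; have [g gK _] : bijective (pull j oW) by case: jo => _ _; exact.
by rewrite !(plE _ oW) => e; rewrite -(gK s) e gK.
Qed.

Lemma oi_local_inj (W : set M) (V : set A) (s t : sec M W) : open W -> open V -> j @` V `<=` W ->
  rs V (pl j s) = rs V (pl j t) -> rs (j @` V) s = rs (j @` V) t.
Proof.
move=> oW oV VW e; have oj := oi_open oV.
apply: oi_pl_inj => //; first by move=> _ [x _ <-]; exists x.
rewrite !pl_rs //.
have VV : j @^-1` (j @` V) `<=` V by rewrite oi_preimage.
have VV' : V `<=` j @^-1` W by move=> x Vx; apply: VW; exists x.
by rewrite -(rs_rs (pl j s) VV' VV) e rs_rs.
Qed.

Lemma pushE (V : set A) (s : sec A V) (t : sec M (j @` V)) : open V -> rs V (pl j t) = s -> push s = t.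
Proof.
move=> oV e; have := @oi_local_inj _ V (push s) t (oi_open oV) oV (@subset_refl _ _).
by rewrite pushK // e !rs_id; apply.
Qed.

Lemma push_rs (V W : set A) (s : sec A V) : open V -> open W -> W `<=` V ->
  push (rs W s) = rs (j @` W) (push s).
Proof.
move=> oV oW WV; apply: pushE => //.
have jj : j @` W `<=` j @` V by exact: image_subset.
rewrite pl_rs //; [|exact: oi_open|exact: oi_open].
rewrite rs_rs ?oi_preimage // -{2}(pushK s oV) rs_rs // ?oi_preimage //.
Qed.

Lemma push_alg (V : set A) : open V -> superalg_morphism (@push V).
Proof.
move=> oV; have m : superalg_morphism (fun t : sec M (j @` V) => rs V (pl j t)).
  apply: (superalg_morphism_comp (pl_alg j (oi_open oV))).
  by apply: rs_alg; rewrite oi_preimage.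
split.
- by move=> a s t; apply: pushE => //; rewrite (sam_linear m) !pushK.
- by split=> [|s t]; apply: pushE => //; rewrite ?(sam1 m) // (samM m) !pushK.
- by move=> s; apply: pushE => //; rewrite (samP m) pushK.
Qed.

Lemma invertible_at_push (V : set A) (s : sec A V) x : open V -> V x ->
  invertible_at (j x) (push s) <-> invertible_at x s.
Proof.
move=> oV Vx; rewrite -(invertible_at_pl (f := j) _ (oi_open oV)); last by exists x.
by rewrite -{2}(pushK s oV) invertible_at_rs // oi_preimage.
Qed.

Lemma oi_cancel T (g h : smor T A) : scomp j g = scomp j h -> g = h.
Proof.
move=> e; have gh x : g x = h x.
  by apply: oi_inj; have := congr1 (fun f : smor T M => f x) e.
apply: smor_eqP => // V s x oV Vx; exists (g @^-1` V).
have gE : g @^-1` V = h @^-1` V by apply/seteqP; split=> y /=; rewrite gh.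
split=> //; [exact: smor_open|by rewrite gE|].
have VV : V `<=` j @^-1` (j @` V) by rewrite oi_preimage.
have oj := oi_open oV; have oW := smor_open j oj.
have E := pl_eq (g @^-1` V) (push s) e; rewrite !pl_comp // in E.
have := pushK s oV; move: E; set u := push s => E <-.
have P1 : g @^-1` V `<=` g @^-1` (j @^-1` (j @` V)) by exact: preimage_subset.
have P2 : h @^-1` V `<=` h @^-1` (j @^-1` (j @` V)) by exact: preimage_subset.
have P3 : g @^-1` V `<=` h @^-1` V by rewrite gE.
by rewrite !pl_rs // !rs_rs.
Qed.

Section Factor.
Variables (T : superspace R) (f : smor T M).
Hypothesis fj : forall t, range j (f t).
Let fac_fun (t : T) : A := projT1 (cid2 (fj t)).
Let fac_funE t : j (fac_fun t) = f t.
Proof. by rewrite /fac_fun; case: cid2. Qed.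
Let fac_pre (V : set A) : fac_fun @^-1` V = f @^-1` (j @` V).
Proof.
apply/seteqP; split=> [t Vt|t]; first by exists (fac_fun t).
by move=> [x Vx]; rewrite -fac_funE => /oi_inj xt; rewrite /= -xt.
Qed.
Let fac_open (V : set A) : open V -> open (fac_fun @^-1` V).
Proof. by move=> oV; rewrite fac_pre; apply: smor_open; exact: oi_open. Qed.
Let fac_pull (V : set A) (oV : open V) (s : sec A V) : sec T (fac_fun @^-1` V) :=
  rs _ (pl f (push s)).
Let fac_alg (V : set A) (oV : open V) : superalg_morphism (@fac_pull V oV).
Proof.
have h : fac_fun @^-1` V `<=` f @^-1` (j @` V) by rewrite fac_pre.
exact: (superalg_morphism_comp (superalg_morphism_comp (push_alg oV) (pl_alg f (oi_open oV))) (rs_alg h)).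
Qed.
Let fac_res (V W : set A) (oV : open V) (oW : open W) (WV : W `<=` V) s :
  fac_pull oW (res WV s) = res (preimage_subset WV) (fac_pull oV s).
Proof.
rewrite /fac_pull -!rsE push_rs // pl_rs; [|exact: oi_open|exact: oi_open|exact: image_subset].
rewrite !rs_rs ?fac_pre //; apply: preimage_subset; exact: image_subset.
Qed.
Let fac_local (V : set A) (oV : open V) (t : T) (s : sec A V) : V (fac_fun t) ->
  invertible_at t (fac_pull oV s) -> invertible_at (fac_fun t) s.
Proof.
move=> Vt; rewrite invertible_at_rs ?fac_pre //; last first.
- by exists (fac_fun t).
- by rewrite -fac_pre; exact: fac_open.
rewrite invertible_at_pl; [|exact: oi_open|by exists (fac_fun t)].
by rewrite -fac_funE invertible_at_push.
Qed.
Definition factor : smor T A := @Smor R T A fac_fun fac_open fac_pull fac_alg fac_res fac_local.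

Lemma factorK : scomp j factor = f.
Proof.
apply: smor_eqP => [t|V s t oV Vt]; first exact: fac_funE.
have ojV := smor_open j oV.
have fE : scomp j factor @^-1` V = f @^-1` V by apply/seteqP; split=> y /=; rewrite fac_funE.
exists (f @^-1` V); split => //; [exact: smor_open| |by rewrite fE|].
  by move: Vt; rewrite /= fac_funE.
rewrite pl_comp // (plE factor ojV) /= /fac_pull.
have -> : push (pl j s) = rs (j @` (j @^-1` V)) s.
  apply: pushE => //; rewrite pl_rs //; [|exact: oi_open|exact: image_preimage_subset].
  by rewrite rs_rs ?rs_id // oi_preimage.
rewrite pl_rs //; [|exact: oi_open|exact: image_preimage_subset].
have Q1 : fac_fun @^-1` (j @^-1` V) `<=` f @^-1` (j @` (j @^-1` V)) by rewrite fac_pre.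
have Q2 : f @^-1` V `<=` fac_fun @^-1` (j @^-1` V) by move=> y; rewrite /= fac_funE.
have Q3 : f @^-1` (j @` (j @^-1` V)) `<=` f @^-1` V by apply: preimage_subset; exact: image_preimage_subset.
have Q4 := subset_trans Q2 Q1; have Q5 := subset_trans Q1 Q3.
by rewrite !rs_rs.
Qed.
End Factor.

Lemma factor_ex T (f : smor T M) : (forall t, range j (f t)) -> exists g, scomp j g = f.
Proof. by move=> fj; exists (factor fj); exact: factorK. Qed.

End Inverse.

Lemma open_immersion_incl M (U : set M) (oU : open U) : open_immersion (osub_incl oU).
Proof.
split; [exact: val_inj|exact: open_image_val|] => V oV VU.
have VV : V `<=` set_val @` (set_val @^-1` V : set U).
  move=> x Vx; have [y _ yx] := VU x Vx; have E : set_val y = x := yx.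
  by exists y => //; rewrite /= E.
exists (res VV) => s; rewrite /= -!rsE rs_rs ?rs_id //; exact: osub_incl_subset.
Qed.

Lemma range_osub_incl M (U : set M) (oU : open U) : range (osub_incl oU) = U.
Proof.
apply/seteqP; split=> [_ [x _ <-]|x Ux]; first exact: set_valP.
by exists (exist _ x (mem_set Ux)).
Qed.

Lemma open_immersion_comp A M N (g : smor M N) (f : smor A M) :
  open_immersion g -> open_immersion f -> open_immersion (scomp g f).
Proof.
move=> go fo; have [gi gop gb] := go; have [fi fop fb] := fo; split.
- by move=> x y /gi /fi.
- move=> V oV; have -> : scomp g f @` V = g @` (f @` V) by rewrite image_comp.
  by apply: gop; exact: fop.
move=> V oV Vr; apply: bij_comp; first apply: fb.
  by move=> y Vgy; have [x _ xy] := Vr _ Vgy; exists x => //; exact: gi.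
by apply: gb => y Vy; have [x _ <-] := Vr y Vy; exists (f x).
Qed.

Lemma iso_open_immersion M N (f : smor M N) (g : smor N M) :
  scomp f g = sid N -> scomp g f = sid M -> open_immersion f.
Proof.
move=> fg gf.
have gK x : g (f x) = x by have := congr1 (fun h : smor M M => h x) gf.
have fK x : f (g x) = x by have := congr1 (fun h : smor N N => h x) fg.
split; first exact: (can_inj gK).
  move=> U oU; have -> : f @` U = g @^-1` U; last exact: smor_open.
  by apply/seteqP; split=> [_ [x Ux <-]|y Uy] /=; [rewrite gK|exists (g y)].
move=> V oV _; have E : g @^-1` (f @^-1` V) = V by apply/seteqP; split=> y /=; rewrite fK.
have ofV := smor_open f oV.
exists (fun s => rs V (pl g s)) => s; rewrite -plE.
  have := pl_eq V s fg; rewrite pl_comp // pl_id // rs_id; exact.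
rewrite pl_rs //; [|exact: smor_open|by rewrite E].
have := pl_eq (f @^-1` V) s gf; rewrite pl_comp // pl_id // rs_id; exact.
Qed.

Lemma open_immersion_factor A B M (f : smor A M) (g : smor B M) (h : smor A B) :
  open_immersion g -> open_immersion f -> scomp g h = f -> open_immersion h.
Proof.
move=> go fo E; have [fi fop fb] := fo; have gh x : g (h x) = f x by rewrite -E.
have hi (U : set A) : h @` U = g @^-1` (f @` U).
  apply/seteqP; split=> [_ [x Ux <-]|y [x Ux]] /=; first by rewrite gh; exists x.
  by rewrite -gh => /(oi_inj go) <-; exists x.
split; first by move=> x y xy; apply: fi; rewrite -!gh xy.
  by move=> U oU; rewrite hi; apply: smor_open; exact: fop.
move=> V oV Vh.
have ogV := oi_open go oV.
have gVf : g @` V `<=` range f by move=> _ [y /Vh[x _ <-] <-]; rewrite gh; exists x.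
have [k kK Kk] := fb _ ogV gVf.
have hf : h @^-1` V = f @^-1` (g @` V).
  by apply/seteqP; split=> x /=; rewrite -gh; [exists (h x)|move=> [y Vy /(oi_inj go) <-]].
have gVV : V `<=` g @^-1` (g @` V) by rewrite (oi_preimage go).
have hE (s : sec M (g @` V)) : pl h (rs V (pl g s)) = rs (h @^-1` V) (pl f s).
  rewrite pl_rs //; last exact: smor_open.
  by have := pl_eq (h @^-1` V) s E; rewrite pl_comp.
exists (fun s => rs V (pl g (k (rs _ s)))) => s; rewrite -plE.
  rewrite -{1}(pushK go s oV) hE rs_rs ?hf // rs_id.
  by rewrite (plE f ogV) kK pushK.
rewrite hE (plE f ogV) Kk rs_rs ?hf // -?hf ?rs_id //.
Qed.

End OpenImmersions.

(** * Gluing of morphisms, and charts of supermanifolds *)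

Section Gluing.
Context {R : realType}.
Implicit Types M N P T : superspace R.

Lemma smor_ext_cover M N (I : Type) (A : I -> superspace R) (j : forall i, smor (A i) M)
    (f g : smor M N) : (forall i, open_immersion (j i)) ->
  (forall x, exists i, range (j i) x) -> (forall i, scomp f (j i) = scomp g (j i)) -> f = g.
Proof.
move=> jo cov fg; have fgx x : f x = g x.
  have [i [a _ <-]] := cov x; exact: (congr1 (fun h : smor (A i) N => h a) (fg i)).
apply: smor_eqP => // V s x oV Vx; have [i [a _ ax]] := cov x.
pose O := f @^-1` V `&` g @^-1` V.
have oO : open O by apply: openI; exact: smor_open.
have Of : O `<=` f @^-1` V by move=> ? [].
have Og : O `<=` g @^-1` V by move=> ? [].
have jO : j i @` (j i @^-1` O) `<=` O by exact: image_preimage_subset.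
have ojO := smor_open (j i) oO.
exists (j i @` (j i @^-1` O)); split; [exact: oi_open|..].
- by exists a => //; rewrite /= ax; split=> //=; rewrite -fgx.
- exact: subset_trans Of.
- exact: subset_trans Og.
have := @oi_local_inj _ _ _ _ (jo i) O _ (rs O (pl f s)) (rs O (pl g s)) oO ojO jO.
rewrite !rs_rs //; apply.
have of' := smor_open f oV; have og := smor_open g oV.
have P1 : j i @^-1` O `<=` j i @^-1` (f @^-1` V) by exact: preimage_subset.
have P2 : j i @^-1` O `<=` j i @^-1` (g @^-1` V) by exact: preimage_subset.
rewrite !pl_rs // !rs_rs //.
by have := pl_eq (j i @^-1` O) s (fg i); rewrite !pl_comp.
Qed.

Section Glue.
Variables (M N : superspace R) (I : Type) (A : I -> superspace R).
Variables (j : forall i, smor (A i) M) (f : forall i, smor (A i) N).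
Hypothesis jo : forall i, open_immersion (j i).
Hypothesis cov : forall x, exists i, range (j i) x.
Hypothesis overlap : forall i k (W : set M) (oW : open W) (u : smor (osub oW) (A i))
  (v : smor (osub oW) (A k)), scomp (j i) u = scomp (j k) v -> scomp (f i) u = scomp (f k) v.

Let meet i k := range (j i) `&` range (j k).
Let omeet i k : open (meet i k).
Proof. by apply: openI; exact: oi_range_open. Qed.
Let meetE i k : exists (u : smor (osub (omeet i k)) (A i)) (v : smor (osub (omeet i k)) (A k)),
  [/\ scomp (j i) u = osub_incl (omeet i k), scomp (j k) v = osub_incl (omeet i k) &
      scomp (f i) u = scomp (f k) v].
Proof.
have [t|u uE] := factor_ex (jo i) (f := osub_incl (omeet i k)); first by case: (set_valP t).
have [t|v vE] := factor_ex (jo k) (f := osub_incl (omeet i k)); first by case: (set_valP t).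
by exists u, v; split=> //; apply: overlap; rewrite uE.
Qed.

Let point x : exists y : N, forall i a, j i a = x -> f i a = y.
Proof.
have [i [a _ ax]] := cov x; exists (f i a) => k b bx.
have [u [v [uE vE uv]]] := meetE i k.
have mx : meet i k x by split; [exists a|exists b].
pose z : osub (omeet i k) := exist _ x (mem_set mx).
have ua : u z = a.
  by apply: (oi_inj (jo i)); rewrite ax; exact: (congr1 (fun h : smor (osub (omeet i k)) M => h z) uE).
have vb : v z = b.
  by apply: (oi_inj (jo k)); rewrite bx; exact: (congr1 (fun h : smor (osub (omeet i k)) M => h z) vE).
by rewrite -ua -vb; symmetry; exact: (congr1 (fun h : smor (osub (omeet i k)) N => h z) uv).
Qed.

Let h x := projT1 (cid (point x)).
Let hE i a : h (j i a) = f i a.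
Proof. by rewrite /h; case: cid => y /= /(_ i a erefl). Qed.

Let F (V : set N) i := j i @` (f i @^-1` V).
Let oF V i : open V -> open (F V i).
Proof. by move=> oV; apply: oi_open => //; exact: smor_open. Qed.
Let Fh V i : F V i `<=` h @^-1` V.
Proof. by move=> _ [a Va <-]; rewrite /= hE. Qed.
Let hF V x : (h @^-1` V) x -> exists i, F V i x.
Proof.
move=> /= hx; have [i [a _ ax]] := cov x; exists i, a => //=.
by rewrite -hE ax.
Qed.
Let h_open V : open V -> open (h @^-1` V).
Proof.
move=> oV; have -> : h @^-1` V = \bigcup_i F V i; last by apply: bigcup_open => i _; exact: oF.
by apply/seteqP; split=> [x /hF[i Fx]|x [i _ /Fh //]]; exists i.
Qed.

Let pull_ex V (s : sec N V) : exists t : sec M (h @^-1` V), open V ->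
  forall i, rs (F V i) t = push (jo i) (pl (f i) s).
Proof.
have [oV|nV] := pselect (open V); last by exists 0.
have [i k x xi xk|t tP] := sec_glue_on (s := fun i => push (jo i) (pl (f i) s))
  (h_open oV) (fun i => oF i oV) (@Fh V) (@hF V); last by exists t.
have [u [v [uE vE uv]]] := meetE i k.
exists (F V i `&` F V k); split=> //; try by move=> ? [].
  by apply: openI; exact: oF.
set W := F V i `&` F V k; have oW : open W by apply: openI; exact: oF.
pose io := osub_incl (omeet i k).
have oi : open_immersion io by exact: open_immersion_incl.
have oV' := smor_open io oW; have ofi := smor_open (f i) oV; have ofk := smor_open (f k) oV.
have oFi := oF i oV; have oFk := oF k oV.
have Wio : io @` (io @^-1` W) `<=` W by exact: image_preimage_subset.
have WW : W `<=` io @` (io @^-1` W).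
  move=> y Wy; have my : meet i k y.
    by case: Wy => [[a _ ay] [b _ bz]]; split; [exists a|exists b].
  by exists (exist _ y (mem_set my)).
have Wi : W `<=` F V i by move=> ? [].
have Wk : W `<=` F V k by move=> ? [].
have P1 : io @^-1` W `<=` io @^-1` F V i by exact: preimage_subset.
have P2 : io @^-1` W `<=` io @^-1` F V k by exact: preimage_subset.
have e : rs (io @^-1` W) (pl io (rs W (push (jo i) (pl (f i) s)))) =
         rs (io @^-1` W) (pl io (rs W (push (jo k) (pl (f k) s)))).
  rewrite !pl_rs // !rs_rs //.
  have e1 := pl_eq (io @^-1` W) (push (jo i) (pl (f i) s)) uE.
  have e2 := pl_eq (io @^-1` W) (push (jo k) (pl (f k) s)) vE.
  rewrite -/io in e1 e2; rewrite -e1 -e2 !pl_comp // !pl_push //.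
  have o1 : open (j i @^-1` F V i) by exact: smor_open.
  have o2 : open (j k @^-1` F V k) by exact: smor_open.
  have J1 : j i @^-1` F V i `<=` f i @^-1` V by rewrite /F oi_preimage.
  have J2 : j k @^-1` F V k `<=` f k @^-1` V by rewrite /F oi_preimage.
  have L1 : io @^-1` W `<=` u @^-1` (j i @^-1` F V i).
    by move=> y /P1 Py; suff : F V i (scomp (j i) u y) by []; rewrite uE.
  have L2 : io @^-1` W `<=` v @^-1` (j k @^-1` F V k).
    by move=> y /P2 Py; suff : F V k (scomp (j k) v y) by []; rewrite vE.
  have L3 : u @^-1` (j i @^-1` F V i) `<=` u @^-1` (f i @^-1` V) := preimage_subset J1.
  have L4 : v @^-1` (j k @^-1` F V k) `<=` v @^-1` (f k @^-1` V) := preimage_subset J2.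
  rewrite !pl_rs // !rs_rs //.
  by have := pl_eq (io @^-1` W) s uv; rewrite !pl_comp.
have := oi_local_inj oi oW oV' Wio e.
have WioW : io @` (io @^-1` W) = W by apply/seteqP.
by move=> /(congr1 (rs W)); rewrite !rs_rs.
Qed.

Let hp V (s : sec N V) := projT1 (cid (pull_ex s)).
Let hpE V (s : sec N V) i : open V -> rs (F V i) (hp s) = push (jo i) (pl (f i) s).
Proof. by move=> oV; rewrite /hp; case: cid => t /= /(_ oV). Qed.

Let hp_uniq V (s : sec N V) (t : sec M (h @^-1` V)) : open V ->
  (forall i, rs (F V i) t = push (jo i) (pl (f i) s)) -> hp s = t.
Proof.
move=> oV tP; apply: sec_ext; first exact: h_open.
move=> x /hF[i Fx]; exists (F V i); split; [exact: oF|exact: Fx|exact: (@Fh V i)|].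
by rewrite tP hpE.
Qed.

Let hp_alg V (oV : open V) : superalg_morphism (@hp V).
Proof.
have m i := rs_alg (@Fh V i).
have m' i := superalg_morphism_comp (pl_alg (f i) oV) (push_alg (jo i) (smor_open (f i) oV)).
split.
- move=> a s t; apply: hp_uniq => // i; rewrite (sam_linear (m i)) !hpE //.
  by symmetry; exact: (sam_linear (m' i)).
- split=> [|s t]; apply: hp_uniq => // i.
    by rewrite (sam1 (m i)); symmetry; exact: (sam1 (m' i)).
  by rewrite (samM (m i)) !hpE //; symmetry; exact: (samM (m' i)).
- move=> s; apply: hp_uniq => // i; rewrite (samP (m i)) hpE //.
  by symmetry; exact: (samP (m' i)).
Qed.

Let hp_res (U V : set N) (oU : open U) (oV : open V) (VU : V `<=` U) s :
  hp (res VU s) = res (preimage_subset VU) (hp s).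
Proof.
apply: hp_uniq => // i; rewrite -!rsE.
have P1 : f i @^-1` V `<=` f i @^-1` U by exact: preimage_subset.
have P2 : F V i `<=` F U i by exact: image_subset.
have P3 := @Fh U i; have P4 := @Fh V i.
have P5 : h @^-1` V `<=` h @^-1` U by exact: preimage_subset.
have P6 := smor_open (f i) oU; have P7 := smor_open (f i) oV.
by rewrite pl_rs // push_rs // -(hpE s i oU) !rs_rs.
Qed.

Let hp_local V (oV : open V) x (s : sec N V) : V (h x) -> invertible_at x (hp s) ->
  invertible_at (h x) s.
Proof.
move=> /[dup] Vx /hF[i [a Va ax]].
have ofi := smor_open (f i) oV.
have Fx : F V i x by exists a.
rewrite -(invertible_at_rs _ (oF i oV) Fx (@Fh V i)) hpE // -ax hE.
by rewrite invertible_at_push // invertible_at_pl.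
Qed.

(** Agreement on overlaps is asked for pairs of morphisms out of open subspaces of M. When M is a
    supermanifold so are these, and the uniqueness results for supermanifolds can be used to check
    it. *)
Lemma glue_smor : exists g : smor M N, forall i, scomp g (j i) = f i.
Proof.
pose g := @Smor R M N h h_open (fun V _ => @hp V) (fun V oV => hp_alg oV) hp_res hp_local.
exists g => i; have gE a : scomp g (j i) a = f i a by exact: hE.
apply: smor_eqP => // V s a oV Va.
have ofi := smor_open (f i) oV; have E : scomp g (j i) @^-1` V = f i @^-1` V.
  by apply/seteqP; split=> b; rewrite /= hE.
exists (f i @^-1` V); split=> //; [by rewrite -E|by rewrite E|].
rewrite pl_comp // (plE g oV) /=.
have jF : f i @^-1` V `<=` j i @^-1` F V i by rewrite /F oi_preimage.
have Fg : j i @^-1` F V i `<=` j i @^-1` (h @^-1` V) by apply: preimage_subset; exact: Fh.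
have P1 := oF i oV; have P2 := h_open oV; have P3 := @Fh V i.
have := pushK (jo i) (pl (f i) s) ofi; rewrite -hpE // pl_rs //.
by rewrite rs_rs // => ->; rewrite rs_id.
Qed.

End Glue.

Lemma osub_supermanifold p q M (U : set M) (oU : open U) :
  is_supermanifold p q M -> is_supermanifold p q (osub oU).
Proof.
move=> [hM [B cB [Bo Bb]] lM]; split.
- rewrite open_hausdorff => x y xy.
  have xy' : set_val x != set_val y by apply: contra_neq xy => /val_inj.
  move: hM; rewrite open_hausdorff => /(_ _ _ xy')[[V W] /= [Vx Wy] [oV oW /eqP VW]].
  exists (set_val @^-1` V, set_val @^-1` W); first by rewrite !inE in Vx Wy *.
  split; [by exists V|by exists W|].
  by apply/eqP; rewrite -preimage_setI VW preimage_set0.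
- exists [set set_val @^-1` V | V in B]; first exact: card_le_trans (card_image_le _ _) cB.
  split; first by move=> _ [V BV <-]; exists V => //; exact: Bo.
  move=> x O /= [W [ [Q oQ QE] Wx] WO].
  have [V [BV Vx] VQ] : filter_from [set V | B V /\ V (set_val x)] id Q.
    by apply: Bb; apply: open_nbhs_nbhs; split=> //; rewrite -QE in Wx.
  exists (set_val @^-1` V); first by split=> //; exists V.
  by move=> y Vy; apply: WO; rewrite -QE; exact: VQ.
- move=> x; have [A [f [g [fo go [a _ ax]]]]] := lM (set_val x).
  have oW := smor_open f oU.
  have [t|k kE] := factor_ex (open_immersion_incl oU) (f := scomp f (osub_incl oW)).
    by rewrite range_osub_incl; exact: (set_valP t).
  exists (osub oW), k, (scomp g (osub_incl oW)); split.
  + apply: open_immersion_factor kE; first exact: open_immersion_incl.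
    by apply: open_immersion_comp => //; exact: open_immersion_incl.
  + by apply: open_immersion_comp => //; exact: open_immersion_incl.
  have Wa : (f @^-1` U) a by rewrite /= ax; exact: (set_valP x).
  exists (exist _ a (mem_set Wa)) => //; apply: val_inj.
  have := congr1 (fun h : smor (osub oW) M => h (exist _ a (mem_set Wa))) kE.
  by move=> e; transitivity (f a); [exact: e|exact: ax].
Qed.

Definition osub_sm (M : sm R) (U : set M) (oU : open U) : sm R :=
  @SM R (osub oU) (let: ex_intro p (ex_intro q h) := smP M in
    ex_intro _ p (ex_intro _ q (osub_supermanifold oU h))).

Fixpoint odd_iter_map q M N (f : smor M N) :
    smor (iter q (@odd_superspace R) M) (iter q (@odd_superspace R) N) :=
  if q is q'.+1 then odd_map (odd_iter_map q' f) else f.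

Lemma odd_iter_immersion q M N (f : smor M N) : open_immersion f ->
  open_immersion (odd_iter_map q f).
Proof. by move=> fo; elim: q => //= q IH; exact: odd_map_immersion. Qed.

(** Adjoining odd variables leaves the underlying space unchanged, so an open set of the thickening
    is an open set of the base. *)
Lemma odd_iter_range q N (O : set (iter q (@odd_superspace R) N)) : open O ->
  exists (D : set N) (oD : open D), range (odd_iter_map q (osub_incl oD)) = O.
Proof.
elim: q O => [|q IH] O oO; last exact: IH.
by exists O, oO; exact: range_osub_incl.
Qed.

(** Straightens the span of open immersions in [locally_iso] into a chart whose domain is an open
    set of R^p with q odd variables adjoined; statements about charts can then be proved by
    induction on q. *)
Lemma chart_at p q M (x : M) : is_supermanifold p q M ->
  exists (D : set (Rsuper R p 0)) (oD : open D)
    (r : smor (iter q (@odd_superspace R) (osub oD)) M), open_immersion r /\ range r x.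
Proof.
move=> [_ _ /(_ x)[A [f [g [fo go [a _ ax]]]]]].
have [D [oD DE]] := odd_iter_range (oi_range_open go).
have io := odd_iter_immersion q (open_immersion_incl oD).
have [t|k kE] := factor_ex go (f := odd_iter_map q (osub_incl oD)).
  by rewrite -DE; exists t.
exists D, oD, (scomp f k); split.
  by apply: open_immersion_comp => //; exact: open_immersion_factor kE.
have : range g (g a) by exists a.
rewrite -DE => -[y _ ya]; exists y => //; rewrite -ax /=; congr (f _).
apply: (oi_inj go); rewrite -ya.
exact: (congr1 (fun h : smor (iter q (@odd_superspace R) (osub oD)) (Rsuper R p q) => h y) kE).
Qed.

End Gluing.


(** * Values of sections and maps to affine space *)

Section Values.
Context {R : realType}.
Implicit Types M N P T A : superspace R.

(** Says that the stalks are local with residue field R: [ev] is the residue character. The relation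
    [value_at], defined through failure of invertibility, thereby becomes the graph of an algebra
    morphism. *)
Definition valued M := forall (x : M) (U : set M), open U -> U x ->
  exists ev : sec M U -> R,
    [/\ forall s, invertible_at x s <-> ev s != 0,
        forall a s t, ev (a *: s + t) = a * ev s + ev t,
        forall s t, ev (s * t) = ev s * ev t, ev 1 = 1 & forall s, ev (parity s) = ev s].

Section ValuedTheory.
Variables (M : superspace R) (vM : valued M) (x : M) (U : set M) (oU : open U) (Ux : U x).
Implicit Types s t : sec M U.

Lemma valuedP : exists ev : sec M U -> R, (forall s a, value_at x s a <-> ev s = a) /\
    [/\ forall s, invertible_at x s <-> ev s != 0,
        forall a s t, ev (a *: s + t) = a * ev s + ev t,
        forall s t, ev (s * t) = ev s * ev t, ev 1 = 1 & forall s, ev (parity s) = ev s].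
Proof.
have [ev [ei el em e1 ep]] := vM oU Ux; exists ev; split; last by [].
move=> s a; rewrite /value_at ei.
have -> : s - a *: (1 : sec M U) = (- a) *: (1 : sec M U) + s by rewrite scaleNr addrC.
rewrite el e1 mulr1 addrC subr_eq0; split=> [/negP|->]; last by rewrite eqxx.
by rewrite negbK => /eqP.
Qed.

Lemma value_ex s : exists a, value_at x s a.
Proof. by have [ev [h _]] := valuedP; exists (ev s); apply/h. Qed.
Lemma value_uniq s a b : value_at x s a -> value_at x s b -> a = b.
Proof. by have [ev [h _]] := valuedP => /h <- /h <-. Qed.
Lemma value_lin c s t a b : value_at x s a -> value_at x t b -> value_at x (c *: s + t) (c * a + b).
Proof. by have [ev [h [_ l _ _ _]]] := valuedP => /h <- /h <-; apply/h. Qed.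
Lemma value_mul s t a b : value_at x s a -> value_at x t b -> value_at x (s * t) (a * b).
Proof. by have [ev [h [_ _ l _ _]]] := valuedP => /h <- /h <-; apply/h. Qed.
Lemma value_one : value_at x (1 : sec M U) 1.
Proof. by have [ev [h [_ _ _ l _]]] := valuedP; apply/h. Qed.
Lemma value_parity s a : value_at x s a -> value_at x (parity s) a.
Proof. by have [ev [h [_ _ _ _ l]]] := valuedP => /h <-; apply/h. Qed.
Lemma value_zero : value_at x (0 : sec M U) 0.
Proof.
by have := value_lin (c := -1) value_one value_one; rewrite scaleN1r addNr mulN1r addNr.
Qed.
Lemma value_add s t a b : value_at x s a -> value_at x t b -> value_at x (s + t) (a + b).
Proof. by move=> sa tb; have := value_lin (c := 1) sa tb; rewrite scale1r mul1r. Qed.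
Lemma value_sub s t a b : value_at x s a -> value_at x t b -> value_at x (s - t) (a - b).
Proof. by move=> sa tb; have := value_lin (c := -1) tb sa; rewrite scaleN1r mulN1r addrC [X in value_at _ _ X]addrC. Qed.
Lemma value_scale c s a : value_at x s a -> value_at x (c *: s) (c * a).
Proof. by move=> sa; have := value_lin (c := c) sa value_zero; rewrite !addr0. Qed.
End ValuedTheory.

Lemma valued_odd M : valued M -> valued (odd_superspace M).
Proof.
move=> vM x U oU Ux; have [ev [ei el em e1 ep]] := vM x U oU Ux.
exists (fun s : sec (odd_superspace M) U => ev s.1); split.
- by move=> s; rewrite odd_invertible_at.
- by move=> a s t; exact: el.
- by move=> s t; exact: em.
- exact: e1.
- by move=> s; exact: ep.
Qed.

Lemma valued_push A M (j : smor A M) : open_immersion j -> valued M -> valued A.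
Proof.
move=> jo vM x U oU Ux.
have jx : (j @` U) (j x) by exists x.
have [ev [ei el em e1 ep]] := vM (j x) _ (oi_open jo oU) jx.
have m := push_alg jo oU; exists (fun s => ev (push jo s)); split.
- by move=> s; rewrite -ei invertible_at_push.
- by move=> a s t; rewrite (sam_linear m).
- by move=> s t; rewrite (samM m).
- by rewrite (sam1 m).
- by move=> s; rewrite (samP m).
Qed.

Lemma valued_cover M : (forall x, exists A (j : smor A M), [/\ open_immersion j, range j x & valued A]) ->
  valued M.
Proof.
move=> h x U oU; have [A [j [jo [a _ <-] vA]]] := h x => Ua.
have [ev [ei el em e1 ep]] := vA a _ (smor_open j oU) Ua.
have m := pl_alg j oU; exists (fun s => ev (pl j s)); split.
- by move=> s; rewrite -ei invertible_at_pl.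
- by move=> b s t; rewrite (sam_linear m).
- by move=> s t; rewrite (samM m).
- by rewrite (sam1 m).
- by move=> s; rewrite (samP m).
Qed.

Local Notation RS p := (Rsuper R p 0).

Lemma RS_rs p (U V : set (RS p)) (s : sec (RS p) U) x : V `<=` U -> V x ->
  (rs V s : smoothSection V) x = (s : smoothSection U) x.
Proof. by move=> VU Vx; rewrite (rsE VU) /= patchT // inE. Qed.

Lemma RS_ext p (U : set (RS p)) (s t : sec (RS p) U) :
  (forall x, U x -> (s : smoothSection U) x = (t : smoothSection U) x) -> s = t.
Proof.
move=> h; apply: smooth_ext => x; have [Ux|Ux] := pselect (U x); first exact: h.
by rewrite !smooth0.
Qed.

Lemma RS_one p (U : set (RS p)) x : U x -> ((1 : sec (RS p) U) : smoothSection U) x = 1.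
Proof. by move=> Ux /=; rewrite /GRing.one /= patchT // inE. Qed.

Lemma RS_mul p (U : set (RS p)) (s t : sec (RS p) U) x :
  ((s * t : sec (RS p) U) : smoothSection U) x = (s : smoothSection U) x * (t : smoothSection U) x.
Proof. by []. Qed.
Lemma RS_add p (U : set (RS p)) (s t : sec (RS p) U) x :
  ((s + t : sec (RS p) U) : smoothSection U) x = (s : smoothSection U) x + (t : smoothSection U) x.
Proof. by []. Qed.
Lemma RS_scale p (U : set (RS p)) (s : sec (RS p) U) a x :
  ((a *: s : sec (RS p) U) : smoothSection U) x = a * (s : smoothSection U) x.
Proof. by []. Qed.
Lemma RS_opp p (U : set (RS p)) (s : sec (RS p) U) x :
  ((- s : sec (RS p) U) : smoothSection U) x = - (s : smoothSection U) x.
Proof. by []. Qed.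
Lemma RS_parity p (U : set (RS p)) (s : sec (RS p) U) : parity s = s.
Proof. by []. Qed.

Lemma open_interiorE (T : topologicalType) (U : set T) : open U -> interior U = U.
Proof. by move=> oU; apply/seteqP; split; [exact: interior_subset|move: oU; rewrite openE]. Qed.

(** Total, with default value 0 when f is not smooth on U, so that sections can be written down
    before smoothness is proved. *)
Definition RS_sec p (U : set 'rV[R]_p) (f : 'rV[R]_p -> R) : sec (RS p) U :=
  if pselect (f \_ U \in smooth_section_pred U) is left h then SmoothSection h : smoothSection U
  else 0.

Lemma RS_secE p (U : set 'rV[R]_p) (f : 'rV[R]_p -> R) x : smooth_on U f -> U x ->
  (RS_sec U f : smoothSection U) x = f x.
Proof.
move=> fs Ux; rewrite /RS_sec; case: pselect => [h|[]]; first by rewrite /= patchT // inE.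
by apply/asboolP; apply: smooth_patch fs _; exact: interior_subset.
Qed.

Lemma RS_smooth p (U : set (RS p)) (s : sec (RS p) U) : open U -> smooth_on U (s : smoothSection U).
Proof. by move=> oU; have := @smooth_in _ _ _ (s : smoothSection U); rewrite open_interiorE. Qed.

Lemma RS_invertible p (x : RS p) (U : set (RS p)) (s : sec (RS p) U) : open U -> U x ->
  invertible_at x s <-> (s : smoothSection U) x != 0.
Proof.
move=> oU Ux; rewrite invertible_atP; split.
  move=> [W [oW Wx WU [t [st _]]]].
  have := congr1 (fun f : sec (RS p) W => (f : smoothSection W) x) st.
  rewrite RS_mul RS_one // RS_rs // => e; apply/eqP => s0.
  by move: e; rewrite s0 mul0r => /esym/eqP; rewrite oner_eq0.
move=> s0; have sS := RS_smooth s oU.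
pose W := [set y | U y /\ (s : smoothSection U) y != 0].
have oW : open W.
  rewrite openE => y [Uy sy]; rewrite /interior; near=> z; split.
    by near: z; exact: open_nbhs_nbhs.
  by near: z; apply: cvgr_neq0 sy; exact: (sS 0%N).1.
have WU : W `<=` U by move=> ? [].
have tS : smooth_on W (fun y => ((s : smoothSection U) y)^-1).
  move=> k; apply: CkV => //; first by move=> y [].
  exact: Ck_sub WU (sS k).
exists W; split=> //; exists (RS_sec W (fun y => ((s : smoothSection U) y)^-1)).
have e : rs W s * RS_sec W (fun y => ((s : smoothSection U) y)^-1) = 1.
  apply: RS_ext => y Wy; rewrite RS_mul RS_rs // RS_secE // RS_one // mulfV //.
  by case: Wy.
split=> //; rewrite -e; apply: RS_ext => y _; rewrite !RS_mul; exact: mulrC.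
Unshelve. all: by end_near. Qed.

Lemma valued_RS p : valued (RS p).
Proof.
move=> x U oU Ux; exists (fun s => (s : smoothSection U) x); split=> //.
- by move=> s; exact: RS_invertible.
- exact: RS_one.
Qed.

Lemma RS_value p (x : RS p) (U : set (RS p)) (s : sec (RS p) U) : open U -> U x ->
  value_at x s ((s : smoothSection U) x).
Proof.
move=> oU Ux; rewrite /value_at RS_invertible //.
have -> : ((s - (s : smoothSection U) x *: (1 : sec (RS p) U) : sec (RS p) U) : smoothSection U) x =
   (s : smoothSection U) x - (s : smoothSection U) x * ((1 : sec (RS p) U) : smoothSection U) x by [].
by rewrite RS_one // mulr1 subrr eqxx.
Qed.

Lemma valued_iter q M : valued M -> valued (iter q (@odd_superspace R) M).
Proof. by move=> vM; elim: q => //= q IH; exact: valued_odd. Qed.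

Lemma valued_osub M (U : set M) (oU : open U) : valued M -> valued (osub oU).
Proof. by apply: valued_push; exact: open_immersion_incl. Qed.

Lemma valued_supermanifold p q M : is_supermanifold p q M -> valued M.
Proof.
move=> sM; apply: valued_cover => x; have [D [oD [r [ro rx]]]] := chart_at x sM.
exists (iter q (@odd_superspace R) (osub oD)), r; split=> //.
by apply: valued_iter; apply: valued_osub; exact: valued_RS.
Qed.

Lemma valued_sm (M : sm R) : valued M.
Proof. by have [p [q h]] := smP M; exact: valued_supermanifold h. Qed.

End Values.

(** * Powers of the maximal ideals *)

Section MaxIdealPowers.
Context {R : realType}.
Implicit Types M N P T A : superspace R.
Local Notation RS p := (Rsuper R p 0).

(* The germ of s at x lies in the k-th power of the maximal ideal. *)
Fixpoint mpow M (x : M) (k : nat) (U : set M) (s : sec M U) : Prop :=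
  if k is k'.+1 then exists W, [/\ open W, W x, W `<=` U &
    exists l : seq (sec M W * sec M W), rs W s = \sum_(p <- l) p.1 * p.2 /\
      forall p, p \in l -> value_at x p.1 0 /\ mpow x k' p.2]
  else True.

Lemma sam_sum (A B : superAlgebra R) (f : A -> B) (I : Type) (r : seq I) (F : I -> A) :
  superalg_morphism f -> f (\sum_(i <- r) F i) = \sum_(i <- r) f (F i).
Proof.
move=> fm; apply: (big_morph f (id1 := 0) (op1 := +%R)); [exact: (samD fm)|exact: (sam0 fm)].
Qed.

Lemma mpow_of_rs M (x : M) k (U V : set M) (s : sec M U) : open V -> V x -> V `<=` U ->
  mpow x k (rs V s) -> mpow x k s.
Proof.
case: k => // k oV Vx VU [W [oW Wx WV]]; rewrite rs_rs // => h.
by exists W; split=> //; exact: subset_trans VU.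
Qed.

Lemma mpow_rs M (x : M) k (U V : set M) (s : sec M U) : open V -> V x -> V `<=` U ->
  mpow x k s -> mpow x k (rs V s).
Proof.
elim: k U V s => // k IH U V s oV Vx VU [W [oW Wx WU [l [sl lP]]]].
have oWV : open (W `&` V) by exact: openI.
have WW : W `&` V `<=` W by move=> ? [].
have WV : W `&` V `<=` V by move=> ? [].
have m := rs_alg WW.
exists (W `&` V); split=> //; exists [seq (rs (W `&` V) p.1, rs (W `&` V) p.2) | p <- l]; split.
  rewrite big_map rs_rs // -(rs_rs s WU WW) sl (sam_sum _ _ m).
  by apply: eq_bigr => p _; rewrite (samM m).
move=> _ /mapP[p pl ->] /=; have [p0 pk] := lP p pl; split.
  by apply/value_at_rs.
exact: IH.
Qed.

Lemma mpow_pl M N (f : smor M N) (x : M) k (U : set N) (s : sec N U) : open U -> U (f x) ->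
  mpow (f x) k s -> mpow x k (pl f s).
Proof.
elim: k U s => // k IH U s oU Ux [W [oW Wx WU [l [sl lP]]]].
have oW' := smor_open f oW; have m := pl_alg f oW.
exists (f @^-1` W); split=> //; first exact: preimage_subset.
exists [seq (pl f p.1, pl f p.2) | p <- l]; split.
  rewrite big_map -pl_rs // sl (sam_sum _ _ m).
  by apply: eq_bigr => p _; rewrite (samM m).
move=> _ /mapP[p pl ->] /=; have [p0 pk] := lP p pl; split.
  by apply/value_at_pl.
exact: IH.
Qed.

Lemma mpow_le M (x : M) k (U : set M) (s : sec M U) : mpow x k.+1 s -> mpow x k s.
Proof.
elim: k U s => // k IH U s [W [oW Wx WU [l [sl lP]]]].
exists W; split=> //; exists l; split=> // p pl; have [p0 pk] := lP p pl.
by split=> //; exact: IH.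
Qed.

Lemma mpow0 M (x : M) k (U : set M) : open U -> U x -> mpow x k (0 : sec M U).
Proof.
case: k => // k oU Ux; exists U; split=> //; exists [::].
by rewrite big_nil rs_id.
Qed.

Lemma mpowD M (x : M) k (U : set M) (s t : sec M U) : mpow x k s -> mpow x k t ->
  mpow x k (s + t).
Proof.
case: k => // k [W [oW Wx WU [l [sl lP]]]] [V [oV Vx VU [r [tr rP]]]].
have oWV : open (W `&` V) by exact: openI.
have WW : W `&` V `<=` W by move=> ? [].
have WV : W `&` V `<=` V by move=> ? [].
have m := rs_alg WW; have m' := rs_alg WV; have mU := rs_alg (subset_trans WW WU).
exists (W `&` V); split=> //; [exact: subset_trans WU|].
exists ([seq (rs (W `&` V) p.1, rs (W `&` V) p.2) | p <- l] ++
        [seq (rs (W `&` V) p.1, rs (W `&` V) p.2) | p <- r]); split.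
  rewrite big_cat !big_map (samD mU) -(rs_rs s WU WW) -(rs_rs t VU WV) sl tr (sam_sum _ _ m) (sam_sum _ _ m').
  by congr (_ + _); apply: eq_bigr => p _; rewrite ?(samM m) ?(samM m').
move=> p; rewrite mem_cat => /orP[] /mapP[p' p'l ->] /=.
  by have [p0 pk] := lP _ p'l; split; [apply/value_at_rs|exact: mpow_rs].
by have [p0 pk] := rP _ p'l; split; [apply/value_at_rs|exact: mpow_rs].
Qed.

Lemma mpow_sum M (x : M) k (U : set M) (I : eqType) (r : seq I) (F : I -> sec M U) : open U -> U x ->
  (forall i, i \in r -> mpow x k (F i)) -> mpow x k (\sum_(i <- r) F i).
Proof.
move=> oU Ux; elim: r => [|i r IH] h; first by rewrite big_nil; exact: mpow0.
rewrite big_cons; apply: mpowD; first by apply: h; rewrite mem_head.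
by apply: IH => j jr; apply: h; rewrite inE jr orbT.
Qed.

Lemma mpow_mul M (x : M) k (U : set M) (s t : sec M U) : open U -> U x ->
  value_at x s 0 -> mpow x k t -> mpow x k.+1 (s * t).
Proof.
move=> oU Ux s0 tk; exists U; split=> //; exists [:: (s, t)]; split.
  by rewrite big_seq1 rs_id.
by move=> p; rewrite inE => /eqP ->.
Qed.

Lemma mpow_mull M (x : M) k (U : set M) (s t : sec M U) : valued M -> open U -> U x ->
  mpow x k t -> mpow x k (s * t).
Proof.
move=> vM oU Ux; case: k => // k [W [oW Wx WU [l [sl lP]]]].
exists W; split=> //; exists [seq (rs W s * p.1, p.2) | p <- l]; split.
  rewrite big_map (samM (rs_alg WU)) sl mulr_sumr.
  by apply: eq_bigr => p _; rewrite mulrA.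
move=> _ /mapP[p pl ->] /=; have [p0 pk] := lP p pl; split=> //.
have [a sa] := value_ex vM oW Wx (rs W s).
by have := value_mul vM oW Wx sa p0; rewrite mulr0.
Qed.

Lemma mpow_parity M (x : M) k (U : set M) (s : sec M U) : valued M -> open U -> U x ->
  mpow x k s -> mpow x k (parity s).
Proof.
move=> vM; elim: k U s => // k IH U s oU Ux [W [oW Wx WU [l [sl lP]]]].
exists W; split=> //; exists [seq (parity p.1, parity p.2) | p <- l]; split.
  rewrite big_map (samP (rs_alg WU)) sl.
  rewrite (big_morph (@parity R _) (@parityD R _) (@parity0 R _)).
  by apply: eq_bigr => p _; rewrite parityM.
move=> _ /mapP[p pl ->] /=; have [p0 pk] := lP p pl; split; last exact: IH.
exact: value_parity.
Qed.

Lemma rs_odd M (U V : set M) (s : sec (odd_superspace M) U) : V `<=` U ->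
  @rs R (odd_superspace M) U V s = (rs V s.1, rs V s.2).
Proof. by move=> VU; rewrite (@rsE R (odd_superspace M) _ _ VU) !(rsE VU). Qed.

Lemma value_at_odd M (x : M) (U : set M) (s : sec (odd_superspace M) U) a :
  @value_at R (odd_superspace M) x U s a <-> value_at x s.1 a.
Proof. by rewrite /value_at odd_invertible_at. Qed.

(** One order is lost on the theta-component since theta itself lies in the maximal ideal: a factor
    with value 0 may have any theta-component, and the product then keeps only the order of the
    other factor. *)
Lemma mpow_odd M (x : M) k (U : set M) (s : sec (odd_superspace M) U) : valued M ->
  @mpow (odd_superspace M) x k.+1 U s -> mpow x k.+1 s.1 /\ mpow x k s.2.
Proof.
move=> vM; elim: k U s => [|k IH] U s [W [oW Wx WU [l]]]; rewrite rs_odd // => -[sl lP].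
  split=> //; exists W; split=> //; exists [seq (p.1.1, p.2.1) | p <- l]; split.
    have := congr1 fst sl; rewrite /= => ->.
    rewrite (big_morph (fun z : sec (odd_superspace M) W => z.1) (id1 := 0) (op1 := +%R)) //.
    by rewrite big_map.
  by move=> _ /mapP[p pl ->] /=; have [/value_at_odd p0 _] := lP p pl.
have s1 := congr1 fst sl; have s2 := congr1 snd sl; rewrite /= in s1 s2.
rewrite (big_morph (fun z : sec (odd_superspace M) W => z.1) (id1 := 0) (op1 := +%R)) // in s1.
rewrite (big_morph (fun z : sec (odd_superspace M) W => z.2) (id1 := 0) (op1 := +%R)) // in s2.
split; first apply: (@mpow_of_rs M x k.+2 U W s.1 oW Wx WU); last apply: (@mpow_of_rs M x k.+1 U W s.2 oW Wx WU).
  rewrite s1; apply: mpow_sum => // p pl; have [/value_at_odd p0 /IH[pk _]] := lP p pl.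
  exact: mpow_mul.
rewrite s2; apply: mpow_sum => // p pl; have [/value_at_odd p0 /IH[pk pk']] := lP p pl.
apply: mpowD; first exact: mpow_mul.
by apply: mpow_mull => //; exact: mpow_parity.
Qed.

Lemma mpow_value M (x : M) k (U : set M) (s : sec M U) : valued M -> open U -> U x ->
  mpow x k.+1 s -> value_at x s 0.
Proof.
move=> vM oU Ux [W [oW Wx WU [l [sl lP]]]]; apply/(value_at_rs _ _ oW Wx WU); rewrite sl.
elim: l lP {sl} => [|p l IH] lP; first by rewrite big_nil; exact: value_zero.
have [p0 _] := lP p (mem_head _ _); have [b pb] := value_ex vM oW Wx p.2.
have p12 := value_mul vM oW Wx p0 pb; rewrite mul0r in p12.
rewrite big_cons; have := value_add vM oW Wx p12 (IH _); rewrite addr0; apply.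
by move=> q ql; apply: lP; rewrite inE ql orbT.
Qed.

Lemma osub_push M (U : set M) (oU : open U) (V : set U) (s : sec (osub oU) V) : open V ->
  push (open_immersion_incl oU) s = s :> sec M (set_val @` V).
Proof.
move=> oV; apply: (@pushE _ _ _ _ (open_immersion_incl oU) V s s) => //.
have oV' : open (set_val @` V : set M) by exact: open_image_val.
have VV : V `<=` set_val @^-1` (set_val @` V : set M) by exact: preimage_image.
rewrite (@rsE R (osub oU) _ _ VV) (plE _ oV') /= -!rsE.
rewrite rs_rs ?rs_id //; [exact: osub_incl_subset|exact: image_subset].
Qed.

(** Induction on the number of odd variables: by [mpow_odd] each of them uses up one power of the
    ideal. What remains is a smooth function whose value is 0 at every point. *)
Lemma mpow_zero_model p q (D : set (RS p)) (oD : open D)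
    (U : set (iter q (@odd_superspace R) (osub oD))) (s : sec (iter q (@odd_superspace R) (osub oD)) U) :
  open U -> (forall x, U x -> mpow x q.+1 s) -> s = 0.
Proof.
have vD : valued (osub oD) by apply: valued_osub; exact: valued_RS.
move=> oU; elim: q U oU s => [|q IH] U oU s h.
  have oU' : open (set_val @` U : set (RS p)) by exact: open_image_val.
  apply: (@RS_ext _ p (set_val @` U)) => _ [x Ux <-].
  have := mpow_value vD oU Ux (h x Ux).
  rewrite /value_at scale0r subr0 -(invertible_at_push (open_immersion_incl oD)) // osub_push //.
  have ix : (set_val @` U : set (RS p)) (set_val x) by exists x.
  move=> ni; apply: contrapT => /eqP n0; apply: ni.
  exact: (@RS_invertible R p (set_val x) (set_val @` U) s oU' ix).2 n0.
have vM := @valued_iter _ q _ vD.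
case: s h => s1 s2 h; congr pair; apply: IH => // x Ux; have [h1 h2] := mpow_odd vM (h x Ux) => //.
exact: mpow_le.
Qed.

Lemma mpow_zero p q M (U : set M) (s : sec M U) : is_supermanifold p q M -> open U ->
  (forall x, U x -> mpow x q.+1 s) -> s = 0.
Proof.
move=> sM oU h; apply: sec_ext => // x Ux; have [D [oD [r [ro [a _ ax]]]]] := chart_at x sM.
have oV := smor_open r oU.
have rU : r @` (r @^-1` U) `<=` U by exact: image_preimage_subset.
exists (r @` (r @^-1` U)); split=> //; [exact: oi_open|by exists a; rewrite //= ax|].
apply: oi_local_inj => //; rewrite !rs_id.
transitivity (0 : sec (iter q (@odd_superspace R) (osub oD)) (r @^-1` U)); last by rewrite (sam0 (pl_alg r oU)).
apply: mpow_zero_model => // b Ub; apply: mpow_pl => //; exact: h.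
Qed.

End MaxIdealPowers.

(** * Coordinates and partial derivatives on affine space *)

Section Coordinates.
Context {R : realType}.
Implicit Types M N P T A : superspace R.
Local Notation RS p := (Rsuper R p 0).

Lemma smooth_coord p (U : set 'rV[R]_p) i : smooth_on U (fun x : 'rV[R]_p => x 0 i).
Proof. by move=> k; exact: Ck_coord. Qed.

Definition xcoord p (i : 'I_p) : sec (RS p) setT := RS_sec setT (fun x : 'rV[R]_p => x 0 i).

Lemma xcoordE p (i : 'I_p) x : (xcoord i : smoothSection setT) x = x 0 i.
Proof. by rewrite RS_secE //; exact: smooth_coord. Qed.

Lemma value_xcoord p (i : 'I_p) (x : RS p) : value_at x (xcoord i) (x 0 i).
Proof. by have := RS_value (s := xcoord i) openT (I : setT x); rewrite xcoordE. Qed.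

Lemma gpull_pl M N (f : smor M N) s : gpull f s = pl f s :> sec M setT.
Proof. by rewrite /gpull (plE f openT). Qed.

Lemma value_gpull M N (f : smor M N) (x : M) (s : sec N setT) a :
  value_at (f x) s a -> value_at x (gpull f s) a.
Proof.
move=> h; rewrite gpull_pl; apply/(@value_at_pl _ _ _ f x setT s a openT) => //.
Qed.

Lemma RS_hadamard p (V : set (RS p)) (s : sec (RS p) V) (y : RS p) : open V -> V y ->
  exists (B : set (RS p)) (g : 'I_p -> sec (RS p) B), [/\ open B, B y, B `<=` V &
    rs B s = (s : smoothSection V) y *: (1 : sec (RS p) B) + \sum_i (rs B (xcoord i) - y 0 i *: (1 : sec (RS p) B)) * g i].
Proof.
move=> oV Vy; have /nbhs_ballP[r /= r0 rV] : nbhs (y : 'rV[R]_p) V by exact: open_nbhs_nbhs.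
have oB : open (ball (y : 'rV[R]_p) r) by exact: ball_open.
have sB : smooth_on (ball (y : 'rV[R]_p) r) (s : smoothSection V).
  by move=> k; apply: Ck_sub rV _; exact: RS_smooth.
have [g [gs [_ gE]]] := hadamard r0 sB.
exists (ball (y : 'rV[R]_p) r), (fun i => RS_sec _ (g i)); split=> //; first exact: ballxx.
apply: RS_ext => x Bx; rewrite RS_rs // gE // RS_add RS_scale RS_one // mulr1; congr (_ + _).
have sumE (n : nat) (F : 'I_n -> sec (RS p) (ball (y : 'rV[R]_p) r)) :
    ((\sum_i F i : sec (RS p) _) : smoothSection (ball (y : 'rV[R]_p) r)) x =
    \sum_i (F i : smoothSection (ball (y : 'rV[R]_p) r)) x.
  elim: n F => [|n IH] F; first by rewrite !big_ord0.
  by rewrite !big_ord_recl RS_add IH.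
rewrite sumE; apply: eq_bigr => i _.
by rewrite RS_mul RS_add RS_opp RS_scale RS_rs // RS_one // mulr1 xcoordE RS_secE.
Qed.

Lemma smor_RS_fun p q e M (h h' : smor M (RS e)) : is_supermanifold p q M ->
  (forall i, gpull h (xcoord i) = gpull h' (xcoord i)) -> forall x, h x = h' x.
Proof.
move=> sM hh x; apply/rowP => i.
have v := value_gpull (@value_xcoord e i (h x)); have v' := value_gpull (@value_xcoord e i (h' x)).
rewrite hh in v.
exact: (value_uniq (valued_supermanifold sM) openT (I : setT x) v v').
Qed.

(** Both pullbacks of a Hadamard expansion of s at h t share the coordinate differences, which lie
    in the maximal ideal at t, and differ only in the pullbacks of the coefficients. Hence the
    difference of the two pullbacks of s lies in every power of the maximal ideal, and [mpow_zero]
    applies. *)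
Lemma smor_RS_uniq p q e M (h h' : smor M (RS e)) : is_supermanifold p q M ->
  (forall i, gpull h (xcoord i) = gpull h' (xcoord i)) -> h = h'.
Proof.
move=> sM hh; have hx := smor_RS_fun sM hh.
have key k (V : set (RS e)) (s : sec (RS e) V) (t : M) : open V -> V (h t) ->
    mpow t k (rs (h @^-1` V) (pl h s) - rs (h @^-1` V) (pl h' s)).
  elim: k V s t => // k IH V s t oV Vt.
  have [B [g [oB By BV sB]]] := RS_hadamard s oV Vt.
  have oW := smor_open h oV; have oU := smor_open h oB; have oU' := smor_open h' oB.
  have Ut : (h @^-1` B) t by [].
  have UW : h @^-1` B `<=` h @^-1` V by exact: preimage_subset.
  have UU' : h @^-1` B `<=` h' @^-1` B by move=> z; rewrite /= hx.
  have WW' : h @^-1` V `<=` h' @^-1` V by move=> z; rewrite /= hx.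
  have U'W' : h' @^-1` B `<=` h' @^-1` V by exact: preimage_subset.
  apply: (mpow_of_rs oU Ut UW); have m := rs_alg UW; have mU := rs_alg UU'.
  have mp := pl_alg h oB; have mp' := pl_alg h' oB.
  rewrite (samD m) (samN m) !rs_rs //.
  have -> : rs (h @^-1` B) (pl h s) = pl h (rs B s) by rewrite pl_rs.
  have -> : rs (h @^-1` B) (pl h' s) = rs (h @^-1` B) (pl h' (rs B s)) by rewrite pl_rs // rs_rs.
  rewrite sB (samD mp) (samD mp') (samD mU) (samZ mp) (samZ mp') (samZ mU) (sam1 mp) (sam1 mp') (sam1 mU).
  rewrite opprD addrACA subrr add0r !(sam_sum _ _ mp) !(sam_sum _ _ mp') !(sam_sum _ _ mU) -sumrB.
  apply: mpow_sum => // i _.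
  rewrite (samM mp) (samM mp') (samM mU) !(samD mp) !(samN mp) !(samZ mp) !(sam1 mp).
  rewrite !(samD mp') !(samN mp') !(samZ mp') !(sam1 mp') !(samD mU) !(samN mU) !(samZ mU) !(sam1 mU).
  have hc : rs (h @^-1` B) (pl h' (rs B (xcoord i))) = pl h (rs B (xcoord i)).
    by rewrite !pl_rs //; try exact: openT; rewrite rs_rs // -!gpull_pl hh.
  rewrite hc -mulrBr; apply: mpow_mul => //.
    have v0 : value_at (h t) (rs B (xcoord i) - (h t) 0 i *: (1 : sec (RS e) B)) 0.
      rewrite -[X in value_at _ _ X](subrr ((h t) 0 i)); have vR := @valued_RS R e.
      apply: (value_sub vR oB By); first by apply/value_at_rs => //; exact: value_xcoord.
      have := value_scale (c := (h t) 0 i) vR oB By (value_one vR oB By); rewrite mulr1; exact.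
    have := (@value_at_pl _ _ _ h t B _ 0 oB By).2 v0.
    by rewrite !(samD mp) !(samN mp) !(samZ mp) !(sam1 mp).
  have := IH B (g i) t oB By; rewrite rs_id; exact.
apply: smor_eqP => // V s x oV Vx; exists (h @^-1` V); split=> //.
- exact: smor_open.
- by move=> z; rewrite /= hx.
have oW := smor_open h oV.
apply/eqP; rewrite -subr_eq0; apply/eqP; apply: (mpow_zero sM oW) => t Vt.
exact: key.
Qed.

Section DerivativeSection.
Variables (e : nat).

Definition dsec (i : 'I_e) (V : set (RS e)) (s : sec (RS e) V) : sec (RS e) V :=
  RS_sec V (fun x => 'D_(delta_mx 0 i) (s : smoothSection V) x).

Lemma dsecE i (V : set (RS e)) (s : sec (RS e) V) x : open V -> V x ->
  (dsec i s : smoothSection V) x = 'D_(delta_mx 0 i) (s : smoothSection V) x.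
Proof.
by move=> oV Vx; rewrite RS_secE // => k; exact: ((RS_smooth s oV k.+1).2 i).2.
Qed.

Lemma RS_derivable i (V : set (RS e)) (s : sec (RS e) V) (x : 'rV[R]_e) : open V -> V x ->
  derivable (s : smoothSection V) x (delta_mx 0 i).
Proof. by move=> oV Vx; exact: ((RS_smooth s oV 1%N).2 i).1. Qed.

Lemma dsec_rs i (U V : set (RS e)) (s : sec (RS e) U) : open U -> open V -> V `<=` U ->
  dsec i (rs V s) = rs V (dsec i s).
Proof.
move=> oU oV VU; apply: RS_ext => x Vx; rewrite RS_rs // !dsecE //; last exact: VU.
apply: near_eq_derive; have : \forall y \near (x : 'rV[R]_e), V y by exact: open_nbhs_nbhs.
by apply: filterS => y Vy; rewrite RS_rs.
Qed.

Lemma dsec_linear i (V : set (RS e)) a (s t : sec (RS e) V) : open V ->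
  dsec i (a *: s + t) = a *: dsec i s + dsec i t.
Proof.
move=> oV; apply: RS_ext => x Vx; rewrite RS_add RS_scale !dsecE //.
have ds := RS_derivable (i := i) (s := s) oV Vx; have dt := RS_derivable (i := i) (s := t) oV Vx.
have -> : ((a *: s + t : sec (RS e) V) : 'rV[R]_e -> R) = (a \*: ((s : smoothSection V) : 'rV[R]_e -> R)) \+ ((t : smoothSection V) : 'rV[R]_e -> R) by [].
by rewrite deriveD ?deriveZ //; exact: derivableZ.
Qed.

Lemma dsecM i (V : set (RS e)) (s t : sec (RS e) V) : open V ->
  dsec i (s * t) = s * dsec i t + dsec i s * t.
Proof.
move=> oV; apply: RS_ext => x Vx; rewrite RS_add !RS_mul !dsecE //.
have ds := RS_derivable (i := i) (s := s) oV Vx; have dt := RS_derivable (i := i) (s := t) oV Vx.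
have -> : ((s * t : sec (RS e) V) : 'rV[R]_e -> R) = ((s : smoothSection V) : 'rV[R]_e -> R) \* ((t : smoothSection V) : 'rV[R]_e -> R) by [].
by rewrite deriveM // [X in _ + X]mulrC.
Qed.

Lemma dsec1 i (V : set (RS e)) : open V -> dsec i (1 : sec (RS e) V) = 0.
Proof.
move=> oV; apply: RS_ext => x Vx; rewrite dsecE //.
transitivity ('D_(delta_mx 0 i) (cst (1 : R)) (x : 'rV[R]_e)); last by rewrite derive_cst.
apply: near_eq_derive; have : \forall y \near (x : 'rV[R]_e), V y by exact: open_nbhs_nbhs.
by apply: filterS => y Vy; rewrite RS_one.
Qed.

Lemma dsec_coord i j : dsec i (xcoord j) = (i == j)%:R *: (1 : sec (RS e) setT).
Proof.
apply: RS_ext => x _; rewrite RS_scale RS_one // mulr1 dsecE //; last exact: openT.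
have -> : ((xcoord j : smoothSection setT) : 'rV[R]_e -> R) = (fun y => y 0 j).
  by apply/funext => y; exact: xcoordE.
exact: derive_coord.
Qed.

End DerivativeSection.

End Coordinates.

(** * Even functions as maps to affine space *)

Section MapsToAffine.
Context {R : realType}.
Implicit Types M N P T A : superspace R.
Local Notation RS p := (Rsuper R p 0).

Definition affine_maps M := forall e (u : 'I_e -> sec M setT), (forall i, parity (u i) = u i) ->
  exists h : smor M (RS e), forall i, gpull h (xcoord i) = u i.

Section ModelBase.
Variables (p : nat) (D : set (RS p)) (oD : open D) (e : nat).
Variable u : 'I_e -> sec (osub oD) setT.
Local Notation M := (osub oD).
Let D' : set (RS p) := set_val @` (setT : set D).
Let oD' : open D'. Proof. exact: (open_image_val oD openT). Qed.
Let val_D' (x : M) : D' (set_val x). Proof. by exists x. Qed.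
Let uf i : 'rV[R]_p -> R := (u i : smoothSection D').
Let uS i : smooth_on D' (uf i). Proof. exact: (@RS_smooth _ p D' (u i) oD'). Qed.
Let hf (z : 'rV[R]_p) : 'rV[R]_e := \row_i uf i z.
Let hfun (x : M) : RS e := hf (set_val x).

Let hf_open (V : set (RS e)) : open V -> open (D' `&` hf @^-1` V).
Proof.
move=> oV; rewrite openE => z [Dz Vz]; rewrite /interior.
have hc : {for z, continuous hf} by apply: continuous_row => i; exact: (uS i 0%N).1.
apply: filterI; first exact: open_nbhs_nbhs.
by apply: hc; exact: open_nbhs_nbhs.
Qed.

Let h_open (V : set (RS e)) : open V -> open (hfun @^-1` V).
Proof.
move=> oV; exists (D' `&` hf @^-1` V); first exact: hf_open.
by apply/seteqP; split=> x /=; [case|split; [exact: val_D'|]].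
Qed.

Let im (V : set (RS e)) : set (RS p) := set_val @` (hfun @^-1` V).
Let imE (V : set (RS e)) z : im V z -> D' z /\ V (hf z).
Proof. by move=> [x Vx <-]; split=> //; exact: val_D'. Qed.

Let hpull (V : set (RS e)) (oV : open V) (s : sec (RS e) V) : sec M (hfun @^-1` V) :=
  RS_sec (im V) (fun z => (s : smoothSection V) (hf z)).

Let oim (V : set (RS e)) : open V -> open (im V).
Proof. by move=> oV; apply: (open_image_val oD); exact: h_open. Qed.

Let hpullE (V : set (RS e)) (oV : open V) (s : sec (RS e) V) z : im V z ->
  (hpull oV s : smoothSection (im V)) z = (s : smoothSection V) (hf z).
Proof.
move=> Vz; rewrite RS_secE // => k.
apply: (@Ck_comp_row _ k e p (im V) V (s : smoothSection V) uf) => //.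
- exact: oim.
- by move=> x /imE[].
- exact: RS_smooth.
- by move=> i; apply: Ck_sub (uS i k) => x /imE[].
Qed.

Let hpull_alg (V : set (RS e)) (oV : open V) : superalg_morphism (hpull oV).
Proof.
split.
- move=> a s t; apply: (@RS_ext _ p (im V)) => z Vz.
  by rewrite (@RS_add _ p (im V)) (@RS_scale _ p (im V)) !hpullE.
- split; last by move=> s t; apply: (@RS_ext _ p (im V)) => z Vz; rewrite (@RS_mul _ p (im V)) !hpullE.
  apply: (@RS_ext _ p (im V)) => z Vz; rewrite hpullE // RS_one; last by case: (imE Vz).
  by rewrite (@RS_one _ p (im V)).
- by [].
Qed.

Let hpull_res (U V : set (RS e)) (oU : open U) (oV : open V) (VU : V `<=` U) s :
  hpull oV (res VU s) = @res R M _ _ (preimage_subset VU) (hpull oU s).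
Proof.
have UV : im V `<=` im U by apply: image_subset; exact: preimage_subset.
apply: (@RS_ext _ p (im V)) => z Vz; rewrite hpullE // /= patchT ?inE; last by case: (imE Vz).
by rewrite patchT ?inE // hpullE //; exact: UV.
Qed.

Let hpull_local (V : set (RS e)) (oV : open V) (x : M) (s : sec (RS e) V) : V (hfun x) ->
  invertible_at x (hpull oV s) -> invertible_at (hfun x) s.
Proof.
move=> Vx; have ix : im V (set_val x) by exists x.
rewrite -(invertible_at_push (open_immersion_incl oD)) //; last exact: h_open.
rewrite osub_push; last exact: h_open.
move=> /(@RS_invertible R p (set_val x) (im V) (hpull oV s) (oim oV) ix).1.
by rewrite hpullE // => s0; apply/RS_invertible.
Qed.

Lemma affine_map_model : exists h : smor M (RS e), forall i, gpull h (xcoord i) = u i.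
Proof.
exists (@Smor R M (RS e) hfun h_open hpull hpull_alg hpull_res hpull_local) => i.
apply: (@RS_ext _ p D') => z [x _ <-]; have ix : im setT (set_val x) by exists x.
rewrite /gpull /= (@hpullE setT openT (xcoord i)) //.
by rewrite xcoordE mxE.
Qed.
End ModelBase.

Section OddStep.
Variables (M : superspace R) (aM : affine_maps M) (e : nat).
Variable u : 'I_e -> sec (odd_superspace M) setT.
Hypothesis ue : forall i, parity (u i) = u i.
Let a i := (u i).1.
Let b i := (u i).2.
Let ae i : parity (a i) = a i. Proof. by have := congr1 fst (ue i). Qed.
Let bo i : parity (b i) = - b i.
Proof. by have /= := congr1 snd (ue i) => /(congr1 -%R); rewrite /= opprK. Qed.
Let h0 := projT1 (cid (aM ae)).
Let h0E i : gpull h0 (xcoord i) = a i.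
Proof. by rewrite /h0; case: cid. Qed.

(** The theta-component of s evaluated at a + b theta. The Taylor expansion stops at first order
    because theta squares to 0; multiplicativity is then the Leibniz rule, with no sign since
    pullbacks of s along [h0] are even. *)
Let d (V : set (RS e)) (s : sec (RS e) V) : sec M (h0 @^-1` V) :=
  \sum_i pl h0 (dsec i s) * rs (h0 @^-1` V) (b i).

Let even_pl (V : set (RS e)) (oV : open V) (s : sec (RS e) V) : parity (pl h0 s) = pl h0 s.
Proof. by rewrite -(samP (pl_alg h0 oV)) RS_parity. Qed.

Let b_odd i (V : set (RS e)) : parity (rs (h0 @^-1` V) (b i)) = - rs (h0 @^-1` V) (b i).
Proof.
have m : superalg_morphism (@rs R M setT (h0 @^-1` V)) by apply: rs_alg; exact: subsetT.
by rewrite -(samP m) bo (samN m).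
Qed.

Let opull (V : set (RS e)) (oV : open V) (s : sec (RS e) V) : sec (odd_superspace M) (h0 @^-1` V) :=
  (pl h0 s, d s).

Let opull_alg (V : set (RS e)) (oV : open V) : superalg_morphism (opull oV).
Proof.
have m := pl_alg h0 oV; split.
- move=> c s t; congr pair; first exact: (sam_linear m).
  rewrite /d /= scaler_sumr -big_split; apply: eq_bigr => i _.
  by rewrite dsec_linear // (sam_linear m) mulrDl scaleAl.
- split.
    congr pair; first exact: (sam1 m).
    by rewrite /d big1 // => i _; rewrite dsec1 // (sam0 m) mul0r.
  move=> s t; congr pair; first exact: (samM m).
  rewrite /d /= mulr_sumr mulr_suml -big_split; apply: eq_bigr => i _.
  rewrite dsecM // (samD m) !(samM m) mulrDl mulrA even_pl //; congr (_ + _).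
  by rewrite -!mulrA (odd_commute (pl h0 t) (b_odd i V)) even_pl.
- move=> s; congr pair; first exact: (samP m).
  rewrite /d /= (big_morph (@parity R _) (@parityD R _) (@parity0 R _)) -sumrN.
  by apply: eq_bigr => i _; rewrite parityM even_pl // b_odd mulrN opprK.
Qed.

Let opull_res (U V : set (RS e)) (oU : open U) (oV : open V) (VU : V `<=` U) s :
  opull oV (res VU s) = @res R (odd_superspace M) _ _ (@preimage_subset _ _ h0 _ _ VU) (opull oU s).
Proof.
have UV : h0 @^-1` V `<=` h0 @^-1` U by exact: preimage_subset.
have m := rs_alg UV.
rewrite -(@rsE R (odd_superspace M)) rs_odd // -rsE; congr pair; first by rewrite /= pl_rs.
rewrite /d /= (sam_sum _ _ m); apply: eq_bigr => i _.
by rewrite dsec_rs // pl_rs // (samM m) rs_rs.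
Qed.

Let opull_local (V : set (RS e)) (oV : open V) (x : odd_superspace M) (s : sec (RS e) V) : V (h0 x) ->
  invertible_at x (opull oV s) -> invertible_at (h0 x) s.
Proof.
by move=> Vx /odd_invertible_at /= /(@invertible_at_pl R M (RS e) h0 x V s oV Vx).1.
Qed.

Lemma affine_map_odd : exists h : smor (odd_superspace M) (RS e), forall i, gpull h (xcoord i) = u i.
Proof.
exists (@Smor R (odd_superspace M) (RS e) h0 (@smor_cont _ _ _ h0) opull opull_alg opull_res opull_local) => i.
rewrite /gpull /= /opull; case E: (u i) => [ai bi]; congr pair.
  by have := h0E i; rewrite gpull_pl /a E.
rewrite /d (bigD1 i) //= big1 ?addr0.
  rewrite dsec_coord eqxx scale1r (sam1 (pl_alg h0 openT)) mul1r /b E /=.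
  exact: rs_id.
move=> j ji; rewrite dsec_coord (negbTE ji) scale0r (sam0 (pl_alg h0 openT)).
by rewrite mul0r.
Qed.
End OddStep.

Lemma affine_maps_model p q (D : set (RS p)) (oD : open D) :
  affine_maps (iter q (@odd_superspace R) (osub oD)).
Proof.
elim: q => [|q IH] e u ue; first exact: affine_map_model.
exact: (affine_map_odd IH ue).
Qed.

(** The maps exist on charts by [affine_maps_model], and [smor_RS_uniq] supplies their agreement on
    overlaps. *)
Lemma affine_maps_supermanifold p q M : is_supermanifold p q M -> affine_maps M.
Proof.
move=> sM e u ue.
pose I := M : Type.
have ch (x : M) := chart_at x sM.
pose D (x : M) := projT1 (cid (ch x)).
have ch2 x : exists (oD : open (D x)) (r : smor (iter q (@odd_superspace R) (osub oD)) M), open_immersion r /\ range r x.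
  by rewrite /D; case: cid.
pose oD x := projT1 (cid (ch2 x)).
have ch3 x : exists r : smor (iter q (@odd_superspace R) (osub (oD x))) M, open_immersion r /\ range r x.
  by rewrite /oD; case: cid.
pose r x := projT1 (cid (ch3 x)).
have rP x : open_immersion (r x) /\ range (r x) x by rewrite /r; case: cid.
have loc x : exists h : smor (iter q (@odd_superspace R) (osub (oD x))) (RS e),
    forall i, gpull h (xcoord i) = gpull (r x) (u i).
  apply: affine_maps_model => i; rewrite -[LHS](samP (pull_alg (r x) openT)).
  by rewrite ue.
pose f x := projT1 (cid (loc x)).
have fP x i : gpull (f x) (xcoord i) = gpull (r x) (u i) by rewrite /f; case: cid.
have [|x|x y W oW a b ab|h hP] := glue_smor (j := r) (f := f).
- by move=> x; case: (rP x).
- by exists x; case: (rP x).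
- apply: (smor_RS_uniq (osub_supermanifold oW sM)) => i.
  by rewrite !gpull_comp !fP -!gpull_comp ab.
exists h => i; apply: sec_ext; first exact: openT.
move=> x _; have [ro [y _ yx]] := rP x; exists (range (r x)); split=> //.
- exact: oi_range_open.
- by exists y.
apply: oi_local_inj => //; try exact: openT.
by rewrite -!gpull_pl -gpull_comp hP fP.
Qed.

Lemma affine_maps_sm (T : sm R) : affine_maps T.
Proof. by have [p [q h]] := smP T; exact: affine_maps_supermanifold h. Qed.

Lemma affine_uniq_sm (T : sm R) e (h h' : smor T (RS e)) :
  (forall i, gpull h (xcoord i) = gpull h' (xcoord i)) -> h = h'.
Proof. by have [p [q sT]] := smP T; exact: smor_RS_uniq sT. Qed.

End MapsToAffine.


(** * Charts of submersions *)

Section Reduced.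
Context {R : realType}.
Implicit Types M N P T A : superspace R.
Local Notation RS p := (Rsuper R p 0).

(** For q = 0 the first power of the maximal ideal is enough in [mpow_zero]. This reduces identities
    between sections on the K_p and on horn spaces to computations with values. *)
Lemma reduced_ext p M (U : set M) (s t : sec M U) : is_supermanifold p 0 M -> open U ->
  (forall x, U x -> exists a, value_at x s a /\ value_at x t a) -> s = t.
Proof.
move=> sM oU h; apply/eqP; rewrite -subr_eq0; apply/eqP.
apply: (mpow_zero sM oU) => x Ux; have [a [sa ta]] := h x Ux.
exists U; split=> //; exists [:: (s - t, 1)]; split.
  by rewrite rs_id big_seq1 mulr1.
move=> q; rewrite inE => /eqP -> /=; split=> //.
by rewrite -[X in value_at _ _ X](subrr a); apply: value_sub => //; exact: valued_supermanifold sM.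
Qed.

Lemma osub_value p (D : set (RS p)) (oD : open D) (V : set D) (s : sec (osub oD) V) (z : osub oD) :
  open V -> V z -> value_at z s ((s : smoothSection (set_val @` V)) (set_val z)).
Proof.
move=> oV Vz; have oV' : open (set_val @` V : set (RS p)) by exact: (open_image_val oD).
have iz : (set_val @` V : set (RS p)) (set_val z) by exists z.
have := @RS_value R p (set_val z) (set_val @` V) s oV' iz.
rewrite /value_at -(invertible_at_push (open_immersion_incl oD)) //.
by rewrite osub_push.
Qed.

Lemma row_second_countable p : @second_countable 'rV[R]_p.
Proof.
pose b (z : 'rV[rat]_p * rat) : set 'rV[R]_p := ball (map_mx (ratr : rat -> R) z.1 : 'rV[R]_p) (ratr z.2).
exists (range b); first exact: card_le_trans (card_image_le _ _) (countableP _).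
split.
  move=> _ [[z r] _ <-]; rewrite /b /=; case: (ltP 0 (ratr r : R)) => r0; first exact: ball_open.
  suff -> : ball (map_mx (ratr : rat -> R) z : 'rV[R]_p) (ratr r) = set0 by exact: open0.
  by apply/seteqP; split=> // y [r1 _]; rewrite ltNge r0 in r1.
move=> x O /nbhs_ballP[e /= e0 eO].
have [r rI] : exists r : rat, ratr r \in `]0, (e / 2)[ by apply: rat_in_itvoo; rewrite divr_gt0.
move: rI; rewrite in_itv /= => /andP[r0 re].
have qP i : exists q : rat, ratr q \in `](x 0 i - ratr r), (x 0 i + ratr r)[.
  by apply: rat_in_itvoo; move: r0; lra.
pose q : 'rV[rat]_p := \row_i projT1 (cid (qP i)).
have qE i : `|ratr (q 0 i) - x 0 i| < ratr r.
  rewrite mxE; case: cid => c /=; rewrite in_itv /= => /andP[c1 c2].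
  by rewrite ltr_norml; apply/andP; split; lra.
exists (b (q, r)).
  split; first by exists (q, r).
  by split=> // i j; rewrite (ord1 i) mxE; exact: qE.
move=> y [_ yq]; apply: eO; split=> // i j; rewrite (ord1 i) /ball /=.
have := yq 0 j; rewrite mxE /ball /= => h; have := qE j => h'.
have -> : x 0 j - y 0 j = (ratr (q 0 j) - y 0 j) - (ratr (q 0 j) - x 0 j) by ring.
by rewrite (le_lt_trans (ler_normB _ _)) //; move: h h' re; rewrite /ball_; lra.
Qed.

Lemma RS_supermanifold p : is_supermanifold p 0 (RS p).
Proof.
split; [exact: norm_hausdorff|exact: row_second_countable|].
move=> x; exists (RS p), (sid _), (sid _); split.
- exact: (iso_open_immersion (scomp1 (sid _)) (scomp1 _)).
- exact: (iso_open_immersion (scomp1 (sid _)) (scomp1 _)).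
- by exists x.
Qed.

Lemma osub_RS_supermanifold p (D : set (RS p)) (oD : open D) : is_supermanifold p 0 (osub oD).
Proof. by apply: osub_supermanifold; exact: RS_supermanifold. Qed.

Lemma osub_shrink M (D D' : set M) (oD : open D) (oD' : open D') : D' `<=` D ->
  exists k : smor (osub oD') (osub oD), open_immersion k /\ scomp (osub_incl oD) k = osub_incl oD'.
Proof.
move=> DD; have [t|k kE] := factor_ex (open_immersion_incl oD) (f := osub_incl oD').
  by rewrite range_osub_incl; apply: DD; exact: (set_valP t).
exists k; split=> //; apply: open_immersion_factor kE; exact: open_immersion_incl.
Qed.

Definition coord_on p (D : set (RS p)) (oD : open D) (i : 'I_p) : sec (osub oD) setT :=
  gpull (osub_incl oD) (xcoord i).

Lemma coord_on_value p (D : set (RS p)) (oD : open D) (i : 'I_p) (z : osub oD) :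
  value_at z (coord_on oD i) (set_val z 0 i).
Proof. exact: (value_gpull (@value_xcoord R p i (osub_incl oD z))). Qed.

Lemma affine_value e M (h : smor M (RS e)) i (x : M) : value_at x (gpull h (xcoord i)) (h x 0 i).
Proof. exact: (value_gpull (@value_xcoord R e i (h x))). Qed.

(* [fnc s] is the local expression of [s] in the chart [r]. *)
Section Chart.
Variables (p : nat) (D : set (RS p)) (oD : open D) (M : superspace R) (r : smor (osub oD) M).
Hypothesis ro : open_immersion r.

Definition fnc (V : set M) (s : sec M V) : 'rV[R]_p -> R :=
  (pl r s : smoothSection (set_val @` (r @^-1` V : set D))).

Definition fdom (V : set M) : set 'rV[R]_p := set_val @` (r @^-1` V : set D).

Lemma fdom_open (V : set M) : open V -> open (fdom V).
Proof. by move=> oV; apply: (open_image_val oD); exact: (smor_open r oV). Qed.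

Lemma fnc_smooth (V : set M) (s : sec M V) : open V -> smooth_on (fdom V) (fnc s).
Proof. by move=> oV; exact: (@RS_smooth R p (fdom V) (pl r s) (fdom_open oV)). Qed.

Lemma fnc_value (V : set M) (s : sec M V) (z : osub oD) : open V -> V (r z) ->
  value_at (r z) s (fnc s (set_val z)).
Proof.
move=> oV Vz; apply/(@value_at_pl R _ _ r z V s _ oV Vz).
by apply: osub_value => //; exact: (smor_open r oV).
Qed.

Lemma fnc_chart (V : set M) (s : sec M V) (z : osub oD) a : valued M -> open V -> V (r z) ->
  value_at (r z) s a -> fnc s (set_val z) = a.
Proof. by move=> vM oV Vz sa; exact: (value_uniq vM oV Vz (fnc_value (s := s) oV Vz) sa). Qed.

Definition range_coord (i : 'I_p) : sec M (r @` setT) := push ro (coord_on oD i).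

Lemma range_coord_value i (z : osub oD) : value_at (r z) (range_coord i) (set_val z 0 i).
Proof.
have oj : open (r @` setT) by apply: oi_open => //; exact: openT.
have jz : (r @` setT) (r z) by exists z.
apply/(@value_at_pl R _ _ r z _ _ _ oj jz).
have oj' := smor_open r oj.
have e := pushK ro (coord_on oD i) openT.
have TT : [set: osub oD] `<=` r @^-1` (r @` setT) by move=> y _; exists y.
apply/(@value_at_rs R _ z _ _ _ _ openT I TT); rewrite e.
exact: coord_on_value.
Qed.

Hypothesis sM : is_supermanifold p 0 M.
Let vM : valued M. Proof. exact: valued_supermanifold sM. Qed.

(** In the Hadamard expansion of s at a, a derivation kills the constant, and the Leibniz rule at a
    keeps of each remaining product only the derivative of the coordinate times the value of its
    cofactor, which is the partial derivative. So [al k] is the value of v on the k-th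
    coordinate. *)
Lemma tangent_chart (a : osub oD) (v : forall V : set M, sec M V -> R) : tangent (r a) v ->
  exists al : 'I_p -> R, forall (V : set M) (s : sec M V), open V -> V (r a) ->
    v V s = \sum_k al k * 'D_(delta_mx 0 k) (fnc s) (set_val a).
Proof.
move=> tv; exists (fun k => v _ (range_coord k)) => V s oV Va.
pose y : 'rV[R]_p := set_val a.
have Vy : fdom V y by exists a.
have [e /= e0 eV] : exists2 e : R, 0 < e & ball y e `<=` fdom V.
  by apply/nbhs_ballP; apply: open_nbhs_nbhs; split=> //; exact: fdom_open.
have sB : smooth_on (ball y e) (fnc s) by move=> k; apply: Ck_sub eV _; exact: fnc_smooth.
have [g [gs [gy gE]]] := hadamard e0 sB.
have oB : open (ball y e) by exact: ball_open.
pose B' : set D := set_val @^-1` (ball y e).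
have oB' : open B' by exists (ball y e).
pose Q := r @` B'.
have oQ : open Q by exact: (oi_open ro oB').
have Qa : Q (r a) by exists a => //; exact: ballxx.
have QV : Q `<=` V.
  move=> _ [z Bz <-]; have [z' Vz' zz] := eV _ Bz.
  by have <- : z' = z by exact: val_inj.
have QT : Q `<=` r @` setT by exact: image_subset.
have iB : set_val @` B' `<=` ball y e by move=> _ [z Bz <-].
pose G k : sec (osub oD) B' := RS_sec (set_val @` B') (g k).
pose ga k : sec M Q := push ro (G k).
have gaV k (z : osub oD) : B' z -> value_at (r z) (ga k) (g k (set_val z)).
  move=> Bz; have Qz : Q (r z) by exists z.
  apply/(@value_at_pl R _ _ r z _ _ _ oQ Qz).
  have BB : B' `<=` r @^-1` Q by move=> w Bw; exists w.
  apply/(@value_at_rs R _ z _ _ _ _ oB' Bz BB); rewrite pushK //.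
  have iz : (set_val @` B' : set 'rV[R]_p) (set_val z) by exists z.
  have gsB : smooth_on (set_val @` B' : set 'rV[R]_p) (g k).
    by move=> n; apply: Ck_sub iB _; exact: gs.
  by have := osub_value (s := G k) oB' Bz; rewrite /G (RS_secE gsB iz).
pose xi k : sec M Q := rs Q (range_coord k) - y 0 k *: (1 : sec M Q).
have xiV k (z : osub oD) : B' z -> value_at (r z) (xi k) (set_val z 0 k - y 0 k).
  move=> Bz; have Qz : Q (r z) by exists z.
  apply: (value_sub vM oQ Qz).
    by apply/(value_at_rs _ _ oQ Qz QT); exact: range_coord_value.
  by have := value_scale (c := y 0 k) vM oQ Qz (value_one vM oQ Qz); rewrite mulr1.
have E : rs Q s = fnc s y *: (1 : sec M Q) + \sum_k xi k * ga k.
  apply: (reduced_ext sM oQ) => _ [z Bz <-].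
  have Qz : Q (r z) by exists z.
  have Vz : V (r z) by exact: QV.
  exists (fnc s (set_val z)); split.
    by apply/(value_at_rs _ _ oQ Qz QV); exact: fnc_value.
  rewrite (gE _ Bz); apply: (value_add vM oQ Qz).
    by have := value_scale (c := fnc s y) vM oQ Qz (value_one vM oQ Qz); rewrite mulr1.
  elim/big_ind2: _ => [|b1 s1 b2 s2|k _]; first exact: value_zero.
    exact: value_add.
  apply: (value_mul vM oQ Qz); [exact: xiV|exact: gaV].
have [vl vr vm] := tv Q oQ Qa.
have [_ vr' _] := tv V oV Va; have oT : open (r @` setT) by apply: oi_open => //; exact: openT.
have [_ vrT _] := tv _ oT (QT _ Qa).
rewrite -(vr' Q QV s oQ Qa) -rsE E.
have v1 : v Q 1 = 0.
  have := vm 1 1 1 1 (value_one vM oQ Qa) (value_one vM oQ Qa).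
  by rewrite !mulr1 !mul1r => /eqP; rewrite -subr_eq0 opprD addNKr oppr_eq0 => /eqP.
have v0 : v Q 0 = 0.
  by have := vl (-1) 1 1; rewrite scaleN1r addNr v1 mulr0 add0r.
have vD (u w : sec M Q) : v Q (u + w) = v Q u + v Q w by have := vl 1 u w; rewrite scale1r mul1r.
rewrite vl v1 mulr0 add0r (big_morph (v Q) vD v0); apply: eq_bigr => k _.
have xi0 : value_at (r a) (xi k) 0.
  by have := xiV k a (ballxx _ e0); rewrite subrr.
rewrite (vm _ _ 0 (g k y) xi0 (gaV k a (ballxx _ e0))) mul0r add0r gy; congr (_ * _).
have -> : xi k = (- y 0 k) *: (1 : sec M Q) + rs Q (range_coord k) by rewrite scaleNr addrC.
by rewrite vl v1 mulr0 add0r (rsE QT) vrT.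
Qed.

Lemma tangent_partial (a : osub oD) (l : 'I_p) :
  tangent (r a) (fun V s => 'D_(delta_mx 0 l) (fnc s) (set_val a)).
Proof.
move=> V oV Va; have oF := fdom_open oV; have Fa : fdom V (set_val a) by exists a.
have de (s : sec M V) : derivable (fnc s) (set_val a) (delta_mx 0 l).
  exact: ((fnc_smooth s oV 1%N).2 l).1.
have m := pl_alg r oV; split.
- move=> c s t.
  have -> : fnc (c *: s + t) = (c \*: fnc s) \+ fnc t.
    by rewrite /fnc (sam_linear m); apply/funext => z.
  by rewrite deriveD ?deriveZ //; exact: derivableZ.
- move=> W WV s oW Wa; apply: near_eq_derive.
  have oFW := fdom_open oW; have FWa : fdom W (set_val a) by exists a.
  have : \forall z \near (set_val a : 'rV[R]_p), fdom W z by exact: open_nbhs_nbhs.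
  apply: filterS => _ [z Wz <-]; have Vz : V (r z) by exact: WV.
  apply: fnc_chart => //; rewrite -rsE; apply/(value_at_rs _ _ oW Wz WV); exact: fnc_value.
- move=> s t b c sb tc.
  have <- := fnc_chart vM oV Va sb; have <- := fnc_chart vM oV Va tc.
  have -> : fnc (s * t) = fnc s \* fnc t.
    by rewrite /fnc (samM m); apply/funext => z.
  by rewrite deriveM // [X in _ + X]mulrC.
Qed.

End Chart.

(* A chart in which [r] is the projection away from the coordinates [c]: a map to [A]
   is a map [h] to the target of [r] together with values [c'] for [c], as soon as
   this makes sense on points. *)
Definition lift_chart M N (r : smor M N) (d : nat) A (j : smor A M) (c : 'I_d -> sec A setT) :=
  [/\ open_immersion j, forall i, parity (c i) = c i &
   forall (T : sm R) (h : smor T N) (c' : 'I_d -> sec T setT),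
    (forall i, parity (c' i) = c' i) ->
    (forall t, exists a, r (j a) = h t /\ forall i w, value_at a (c i) w -> value_at t (c' i) w) ->
    exists! g : smor T A, scomp r (scomp j g) = h /\ forall i, gpull g (c i) = c' i].

Lemma affine_point p (D : set (RS p)) (oD : open D) e (h : smor (osub oD) (RS e)) u (z : osub oD) :
  (forall i, gpull h (xcoord i) = u i) ->
  h z = \row_i (u i : smoothSection (set_val @` (setT : set D))) (set_val z).
Proof.
move=> hu; apply/rowP => i; rewrite mxE.
have := affine_value (h := h) (i := i) (x := z); rewrite hu => v1.
have v2 := osub_value (s := u i) (z := z) openT I.
have vM := valued_supermanifold (osub_RS_supermanifold oD).
exact: (value_uniq vM openT (I : setT z) v1 v2).
Qed.

Section RecoordinatizeStep.
Variables (p : nat) (D : set (RS p)) (oD : open D) (f : 'rV[R]_p -> R) (a : osub oD) (k : 'I_p).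
Hypothesis fC : smooth_on D f.
Hypothesis Df : 'D_(delta_mx 0 k) f (set_val a) != 0.

(** Turns the two maps of [implicit_coordinate] into morphisms by way of
    [affine_maps_supermanifold]; that they are inverse is checked on points, which suffices in odd
    dimension 0. *)
Lemma recoordinatize : exists (B : set (RS p)) (oB : open B) (psi : smor (osub oB) (osub oD)) (b : osub oB),
  [/\ open_immersion psi, psi b = a,
      forall (y : osub oB) i, i != k -> set_val (psi y) 0 i = set_val y 0 i &
      forall y : osub oB, f (set_val (psi y)) = set_val y 0 k].
Proof.
have Da : D (set_val a) := set_valP a.
have [A [B [g [[oA0 oB0 Aa AD gB] [PhiP PsiP]]]]] := implicit_coordinate oD fC Da Df.
have oA : open (A : set (RS p)) := oA0; have oB : open (B : set (RS p)) := oB0.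
have up e (E : set (RS p)) (oE : open E) (u : 'I_e -> 'rV[R]_p -> R) : (forall i, smooth_on E (u i)) ->
    exists h : smor (osub oE) (RS e), forall z, h z = \row_i u i (set_val z).
  move=> uE; pose E' : set (RS p) := set_val @` (setT : set E).
  have EE : E' `<=` E by move=> _ [z _ <-]; exact: (set_valP z).
  have [|h hP] := @affine_maps_supermanifold R p 0 _ (osub_RS_supermanifold oE) e
    (fun i => RS_sec E' (u i)) _ => //.
  exists h => z; rewrite (affine_point z hP); apply/rowP => i; rewrite !mxE.
  have iz : E' (set_val z) by exists z.
  by apply: (RS_secE _ iz) => n; apply: Ck_sub EE _; exact: uE.
have [psi0 psi0E] := up p B oB (fun i y => if i == k then g y else y 0 i)
   (fun i => if i == k as b return smooth_on B (fun y => if b then g y else y 0 i) then gB else @smooth_coord R p B i).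
have [phi0 phi0E] := up p A oA (fun i y => if i == k then f y else y 0 i)
   (fun i => if i == k as b return smooth_on A (fun y => if b then f y else y 0 i)
      then (fun n => Ck_sub AD (fC n)) else @smooth_coord R p A i).
have [|psi1 psi1E] := factor_ex (open_immersion_incl oA) (f := psi0).
  by move=> z; rewrite range_osub_incl psi0E; case: (PsiP _ (set_valP z)).
have [|phi1 phi1E] := factor_ex (open_immersion_incl oB) (f := phi0).
  by move=> z; rewrite range_osub_incl phi0E; case: (PhiP _ (set_valP z)).
have psi1v z : set_val (psi1 z) = upd (set_val z) k (g (set_val z)).
  have := congr1 (fun h : smor (osub oB) (RS p) => h z) psi1E; rewrite psi0E; exact.
have phi1v z : set_val (phi1 z) = upd (set_val z) k (f (set_val z)).
  have := congr1 (fun h : smor (osub oA) (RS p) => h z) phi1E; rewrite phi0E; exact.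
have pt (E : set (RS p)) (oE : open E) (u v : smor (osub oE) (osub oE)) : (forall z, set_val (u z) = set_val (v z)) -> u = v.
  move=> uv; apply: (oi_cancel (open_immersion_incl oE)).
  apply: (smor_RS_uniq (osub_RS_supermanifold oE)) => i.
  apply: (reduced_ext (osub_RS_supermanifold oE) openT) => z _.
  exists (set_val (u z) 0 i); split; first exact: affine_value.
  by rewrite uv; exact: (affine_value (h := scomp (osub_incl oE) v)).
have e1 : scomp phi1 psi1 = sid _.
  apply: pt => z /=; rewrite phi1v psi1v upd_upd (PsiP _ (set_valP z)).2 upd_id //.
have e2 : scomp psi1 phi1 = sid _.
  apply: pt => z /=; rewrite psi1v phi1v upd_upd (PhiP _ (set_valP z)).2 upd_id //.
have [kk [ko kE]] := osub_shrink oD oA AD.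
have kv z : set_val (kk z) = set_val z.
  exact: (congr1 (fun h : smor (osub oA) (RS p) => h z) kE).
pose a' : osub oA := exist _ (set_val a) (mem_set Aa).
have sv y : set_val (scomp kk psi1 y) = upd (set_val y) k (g (set_val y)).
  by rewrite -psi1v -kv.
exists B, oB, (scomp kk psi1), (phi1 a'); split.
- apply: open_immersion_comp => //; exact: iso_open_immersion e2 e1.
- apply: val_inj; rewrite /= -[LHS]/(set_val (kk (psi1 (phi1 a')))) kv.
  by have := congr1 (fun h : smor (osub oA) (osub oA) => h a') e2 => /= ->.
- by move=> y i ik; rewrite sv mxE (negbTE ik).
- move=> y; rewrite sv; exact: (PsiP _ (set_valP y)).2.
Qed.

End RecoordinatizeStep.

(** * Submersions as coordinate projections *)

Section SubmersionChart.
Variables (p e : nat) (M N : superspace R) (r : smor M N) (x : M).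
Hypotheses (sM : is_supermanifold p 0 M) (sN : is_supermanifold e 0 N).
Hypothesis rt : forall w : forall V : set N, sec N V -> R, tangent (r x) w ->
    exists v : forall U : set M, sec M U -> R, tangent x v /\
      forall (V : set N) (oV : open V) (s : sec N V), V (r x) ->
        v (r @^-1` V) (pull r oV s) = w V s.
Let vM : valued M. Proof. exact: valued_supermanifold sM. Qed.
Let vN : valued N. Proof. exact: valued_supermanifold sN. Qed.

Section Target.
Variables (D' : set (RS e)) (oD' : open D') (sg : smor (osub oD') N) (b : osub oD').
Hypotheses (sgo : open_immersion sg) (sgb : sg b = r x).
Let W := sg @` setT.
Let oW : open W. Proof. by apply: oi_open => //; exact: openT. Qed.
Let eta l : sec N W := range_coord sgo l.
Let f l : sec M (r @^-1` W) := pl r (eta l).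
Let orW := smor_open r oW.

Let eta_value l (z : osub oD') : value_at (sg z) (eta l) (set_val z 0 l).
Proof. exact: range_coord_value. Qed.

(* The first [n] coordinates of the target are, in the chart [rho], coordinates of the source. *)
Let adapted (n : nat) := exists (D : set (RS p)) (oD : open D) (rho : smor (osub oD) M) (a : osub oD)
    (tau : 'I_e -> option 'I_p),
  [/\ open_immersion rho, rho a = x, forall z, W (r (rho z)),
      forall l l' : 'I_e, (l < n)%N -> (l' < n)%N -> tau l = tau l' -> l = l' &
      forall l : 'I_e, (l < n)%N -> exists2 k, tau l = Some k &
        forall z, value_at (rho z) (f l) (set_val z 0 k)].

Let fxW : W (r x). Proof. by exists b. Qed.

Let adapted0 : adapted 0.
Proof.
have [D0 [oD0 [r0 [r0o [a0 _ a0x]]]]] := chart_at x sM.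
have oP := smor_open r0 orW.
have oD := open_image_val oD0 oP.
have [|k [ko kE]] := osub_shrink oD0 oD; first by move=> _ [z _ <-]; exact: (set_valP z).
have kv z : set_val (k z) = set_val z.
  exact: (congr1 (fun h : smor (osub oD) (RS p) => h z) kE).
have Da : (set_val @` (r0 @^-1` (r @^-1` W)) : set (RS p)) (set_val a0).
  by exists a0 => //; rewrite /= a0x.
pose a : osub oD := exist _ (set_val a0) (mem_set Da).
have ka : k a = a0 by apply: val_inj; exact: kv.
exists _, oD, (scomp r0 k), a, (fun _ => None); split=> //.
- exact: open_immersion_comp.
- by rewrite /= ka.
- move=> z; have [z' Wz' zz] := set_valP z.
  have kz : k z = z' by apply: val_inj; exact: (etrans (kv z) (esym zz)).
  by move: Wz'; rewrite -kz.
Qed.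

(** Surjectivity on tangent spaces enters here: v lifts the l-th partial derivative of the target,
    so it is dual to the pulled back coordinates [f k]. *)
Let vs (l : 'I_e) : exists v : forall U : set M, sec M U -> R, tangent x v /\
  forall k : 'I_e, v (r @^-1` W) (f k) = (k == l)%:R.
Proof.
have tg := tangent_partial (r := sg) sN (a := b) l.
rewrite sgb in tg; have [v [tv vE]] := rt tg; exists v; split=> // k.
rewrite /f (plE r oW) vE //.
have E : {in fdom sg W, fnc sg (eta k) =1 (fun z : 'rV[R]_e => z 0 k)}.
  move=> _ /set_mem [z Wz <-].
  exact: (fnc_chart (r := sg) (s := eta k) (z := z) vN oW Wz (@eta_value k z)).
have oF := fdom_open (r := sg) oW.
have Fb : fdom sg W (set_val b) by exists b => //; rewrite /= sgb.
rewrite eq_sym -(derive_coord k l (set_val b)); apply: near_eq_derive.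
have : \forall z \near (set_val b : 'rV[R]_e), fdom sg W z by exact: open_nbhs_nbhs.
by apply: filterS => z Fz; apply: E; rewrite inE.
Qed.

Let adaptedS (n : nat) : (n < e)%N -> adapted n -> adapted n.+1.
Proof.
move=> ne [D [oD [rho [a [tau [ro ra rW ti tv]]]]]]; pose l0 := Ordinal ne.
have [v [tvv vf]] := vs l0.
have tvv' : tangent (rho a) v by rewrite ra.
have [al alE] := tangent_chart ro sM tvv'.
have fr l : v (r @^-1` W) (f l) = \sum_k al k * 'D_(delta_mx 0 k) (fnc rho (f l)) (set_val a).
  by apply: alE => //; exact: rW.
have Fdom : fdom rho (r @^-1` W) = D.
  by apply/seteqP; split=> [_ [z _ <-]|z Dz]; [exact: (set_valP z)|exists (exist _ z (mem_set Dz)) => //; exact: rW].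
have al0 (l : 'I_e) k : (l < n)%N -> tau l = Some k -> al k = 0.
  move=> ln tk; have := vf l; rewrite fr (_ : (l == l0) = false); last first.
    by apply/eqP => ll; move: ln; rewrite ll ltnn.
  have [k' tk' lv] := tv l ln; have kk : k' = k by move: tk'; rewrite tk => -[].
  rewrite kk in lv.
  have E : \forall z \near (set_val a : 'rV[R]_p), fnc rho (f l) z = (fun z : 'rV[R]_p => z 0 k) z.
    have : \forall z \near (set_val a : 'rV[R]_p), D z by apply: open_nbhs_nbhs; split=> //; exact: (set_valP a).
    apply: filterS => z Dz; exact: (fnc_chart (r := rho) (s := f l) (z := exist _ z (mem_set Dz)) vM orW (rW _) (lv _)).
  under eq_bigr do rewrite (near_eq_derive _ E) derive_coord.
  rewrite (bigD1 k) //= eqxx mulr1 big1 ?addr0 // => i ik.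
  by rewrite (negbTE ik) mulr0.
have [k [alk Dk]] : exists k, al k != 0 /\ 'D_(delta_mx 0 k) (fnc rho (f l0)) (set_val a) != 0.
  apply: contrapT => nk; have := vf l0; rewrite eqxx fr big1; last first.
    move=> k _; apply/eqP; rewrite mulf_eq0; apply/negPn/negP; rewrite negb_or => /andP[k1 k2].
    by apply: nk; exists k.
  by move=> /esym/eqP; rewrite oner_eq0.
have sF : smooth_on D (fnc rho (f l0)).
  by have := fnc_smooth rho (f l0) orW; rewrite Fdom.
have [B [oB [psi [b' [po pb pv pf]]]]] := recoordinatize sF Dk.
exists B, oB, (scomp rho psi), b', (fun l => if l == l0 then Some k else tau l); split.
- exact: open_immersion_comp.
- by rewrite /= pb.
- by move=> z; exact: rW.
- move=> l l'; have lt (i : 'I_e) : i != l0 -> (i < n.+1)%N -> (i < n)%N.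
    move=> il; rewrite ltnS leq_eqVlt => /orP[/eqP ie|//].
    by move: il; rewrite -(inj_eq val_inj) /= ie eqxx.
  case: (eqVneq l l0) => [->|ll]; case: (eqVneq l' l0) => [->|ll'] // l1 l2.
  + by move=> /esym tk; move: alk; rewrite (al0 l' k) ?eqxx // lt.
  + by move=> tk; move: alk; rewrite (al0 l k) ?eqxx // lt.
  + by apply: ti; exact: lt.
- move=> l l1; case: (eqVneq l l0) => [->|ll].
    exists k => // z; rewrite -pf; exact: (fnc_value (r := rho) (s := f l0) (z := psi z) orW (rW _)).
  have ln : (l < n)%N.
    by move: l1; rewrite ltnS leq_eqVlt => /orP[/eqP ie|//]; move: ll; rewrite -(inj_eq val_inj) /= ie eqxx.
  have [k' tk' lv] := tv l ln; exists k' => // z.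
  rewrite -pv; first exact: lv.
  by apply/eqP => kk; move: alk; rewrite -kk (al0 l k') ?eqxx.
Qed.

Let adapted_all : adapted e.
Proof.
have: (e <= e)%N by []. elim: {1 3}e => [_|n IH ne]; first exact: adapted0.
by apply: adaptedS => //; apply: IH; exact: ltnW.
Qed.

Section Lifts.
Variables (D : set (RS p)) (oD : open D) (rho : smor (osub oD) M) (a : osub oD) (tau : 'I_e -> 'I_p).
Hypotheses (ro : open_immersion rho) (ra : rho a = x) (rW : forall z, W (r (rho z))).
Hypotheses (ti : injective tau) (tv : forall l z, value_at (rho z) (f l) (set_val z 0 (tau l))).

Let compl := [predC codom tau].
Let card_compl : #|compl| = (p - e)%N.
Proof.
have := cardC (mem (codom tau)); rewrite card_codom // !card_ord => E.
have -> : #|compl| = #|[predC mem (codom tau)]| by apply: eq_card.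
by rewrite -[in RHS]E addKn.
Qed.
Let kap (i : 'I_(p - e)) : 'I_p := enum_val (cast_ord (esym card_compl) i).
Let kapP i : kap i \notin codom tau.
Proof. exact: (enum_valP (cast_ord (esym card_compl) i)). Qed.
Let kap_inj : injective kap.
Proof. by move=> i i' /enum_val_inj /cast_ord_inj. Qed.
Let kap_or k : (exists l, k = tau l) \/ exists i, k = kap i.
Proof.
have [/codomP[l ->]|nk] := boolP (k \in codom tau); first by left; exists l.
right; exists (cast_ord card_compl (enum_rank_in (A := compl) nk k)).
by rewrite /kap cast_ordK enum_rankK_in.
Qed.
Let ncod (l : 'I_e) i : kap i != tau l.
Proof. by apply: contraNneq (kapP i) => ->; exact: codom_f. Qed.

Let c i : sec (osub oD) setT := coord_on oD (kap i).
Let vD : valued (osub oD). Proof. exact: valued_supermanifold (osub_RS_supermanifold oD). Qed.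

Let range_r z (y : osub oD') : r (rho z) = sg y -> forall l, set_val y 0 l = set_val z 0 (tau l).
Proof.
move=> zy l; have v1 := @eta_value l y.
have v2 : value_at (r (rho z)) (eta l) (set_val z 0 (tau l)).
  by apply/(@value_at_pl R _ _ r (rho z) _ _ _ oW (rW z)); exact: tv.
by rewrite zy in v2; apply: (value_uniq vN oW _ v1 v2); exists y.
Qed.

Let plf l : rs setT (pl rho (f l)) = coord_on oD (tau l).
Proof.
apply: (reduced_ext (osub_RS_supermanifold oD) openT) => z _; exists (set_val z 0 (tau l)).
have oz := smor_open rho orW; split; last exact: coord_on_value.
apply/(@value_at_rs R _ z _ _ _ _ openT I (fun z _ => rW z)).
by apply/(@value_at_pl R _ _ rho z _ _ _ orW (rW z)); exact: tv.
Qed.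

Let pull_eta (T : sm R) (h : smor T (osub oD')) l :
  rs setT (pl (scomp sg h) (eta l)) = gpull (scomp (osub_incl oD') h) (xcoord l).
Proof.
have TT : [set: osub oD'] `<=` sg @^-1` W by move=> y _; exists y.
rewrite gpull_comp -[gpull (osub_incl oD') _]/(coord_on oD' l) -(pushK sgo (coord_on oD' l) openT).
rewrite gpull_pl pl_rs //; [|exact: (smor_open sg oW)|exact: openT].
rewrite pl_comp //; congr rs.
Qed.

Let pull_chart (T : sm R) (g : smor T (osub oD)) l :
  rs setT (pl (scomp r (scomp rho g)) (eta l)) = gpull (scomp (osub_incl oD) g) (xcoord (tau l)).
Proof.
have TT : [set: osub oD] `<=` rho @^-1` (r @^-1` W) by move=> y _; exact: rW.
rewrite gpull_comp -[gpull (osub_incl oD) _]/(coord_on oD (tau l)) -plf.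
rewrite gpull_pl pl_rs //; [|exact: (smor_open rho orW)|exact: openT].
by rewrite (pl_comp r (scomp rho g)) // (pl_comp rho g).
Qed.

(** A map into the chart is a p-tuple of even functions: the entries at [tau l] are forced by h,
    those at [kap i] are the given c'. The hypothesis on points says that the tuple takes its values
    in D. *)
Let lifts : lift_chart r rho c.
Proof.
split; [exact: ro| |]; [move=> i|move=> T h c' c'P hc].
  by apply: (reduced_ext (osub_RS_supermanifold oD) openT) => z _; have [w vw] := value_ex vD openT (I : setT z) (c i);
    exists w; split=> //; exact: value_parity.
have hW t : W (h t) by have [z [<- _]] := hc t; exact: rW.
have TT : [set: T] `<=` h @^-1` W by move=> t _; exact: hW.
have ohW := smor_open h oW.
have etaP l : parity (eta l) = eta l.
  apply: (reduced_ext sN oW) => z Wz; have [w vw] := value_ex vN oW Wz (eta l).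
  by exists w; split=> //; exact: value_parity.
pose u0 l := rs [set: T] (pl h (eta l)).
have u0P l : parity (u0 l) = u0 l.
  by rewrite /u0 -(samP (rs_alg TT)) -(samP (pl_alg h oW)) etaP.
pose inv k : ('I_e + 'I_(p - e))%type -> Prop := fun s => match s with inl l => k = tau l | inr i => k = kap i end.
have ex k : exists s, inv k s.
  by case: (kap_or k) => [[l ->]|[i ->]]; [exists (inl l)|exists (inr i)].
pose pick k := projT1 (cid (ex k)).
have pickP k : inv k (pick k) by exact: projT2 (cid (ex k)).
pose u k := match pick k with inl l => u0 l | inr i => c' i end.
have uT l : u (tau l) = u0 l.
  rewrite /u; have := pickP (tau l); case: (pick _) => [l' /ti -> //|i /esym/eqP].
  by rewrite (negbTE (ncod _ _)).
have uK i : u (kap i) = c' i.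
  rewrite /u; have := pickP (kap i); case: (pick _) => [l' /eqP|i' /kap_inj -> //].
  by rewrite (negbTE (ncod _ _)).
have uP k : parity (u k) = u k by case: (kap_or k) => [[l ->]|[i ->]]; rewrite ?uT ?uK.
have [g0 g0E] := affine_maps_sm uP.
have vT := @valued_sm R T.
have g0D t : range (osub_incl oD) (g0 t).
  rewrite range_osub_incl; have [z [zh zc]] := hc t.
  have -> : g0 t = set_val z; last exact: (set_valP z).
  apply/rowP => k; have := affine_value (h := g0) (i := k) (x := t); rewrite g0E => vk.
  apply: (value_uniq vT openT (I : setT t) vk).
  case: (kap_or k) => [[l ->]|[i ->]]; rewrite ?uT ?uK; last by apply: zc; exact: coord_on_value.
  apply/(@value_at_rs R _ t _ _ _ _ openT I TT).
  apply/(@value_at_pl R _ _ h t _ _ _ oW (hW t)); rewrite -zh.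
  by apply/(@value_at_pl R _ _ r (rho z) _ _ _ oW (rW z)); exact: tv.
have [g gE] := factor_ex (open_immersion_incl oD) g0D.
have [h1 h1E] := factor_ex sgo hW.
exists g; split.
  split; last by move=> i; rewrite /c /coord_on -gpull_comp gE g0E uK.
  have gW t : W (scomp r (scomp rho g) t) by exact: rW.
  have [g1 g1E] := factor_ex sgo gW.
  rewrite -g1E -h1E; congr scomp; apply: (oi_cancel (open_immersion_incl oD')).
  apply: affine_uniq_sm => l; rewrite -!pull_eta g1E h1E pull_chart gE g0E uT //.
move=> g' [g'h g'c]; apply: (oi_cancel (open_immersion_incl oD)); rewrite gE.
apply: affine_uniq_sm => k; rewrite g0E; case: (kap_or k) => [[l ->]|[i ->]]; rewrite ?uT ?uK.
  by rewrite -pull_chart g'h.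
by rewrite -g'c gpull_comp.
Qed.

(** If e < p, a free coordinate can be moved by eps / 2 inside D without changing the image under
    r. *)
Let inj_dim : injective r -> p = e.
Proof.
move=> ri; have ep : (e <= p)%N by have := leq_card _ ti; rewrite !card_ord.
apply/eqP; rewrite eqn_leq ep andbT -subn_eq0; apply: contraT; rewrite -lt0n => d0.
pose k := kap (Ordinal d0).
have : \forall z \near (set_val a : 'rV[R]_p), D z by apply: open_nbhs_nbhs; split=> //; exact: (set_valP a).
move=> /nbhs_ballP[eps /= e0 eD].
pose y : 'rV[R]_p := upd (set_val a) k (set_val a 0 k + eps / 2).
have yE j : y 0 j = if j == k then set_val a 0 k + eps / 2 else set_val a 0 j.
  by rewrite mxE.
have Dy : D y.
  apply: eD; split=> // i i'; rewrite (ord1 i) /ball /= yE; have [->|ik] := eqVneq i' k.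
    by rewrite opprD addNKr normrN gtr0_norm; lra.
  by rewrite subrr normr0.
pose y' : osub oD := exist _ y (mem_set Dy).
have [b1 _ b1E] := rW y'; have [b2 _ b2E] := rW a.
have b12 : b1 = b2.
  apply: val_inj; apply/rowP => l.
  rewrite -[LHS]/(set_val b1 0 l) -[RHS]/(set_val b2 0 l) (range_r (esym b1E)) (range_r (esym b2E)).
  by rewrite -[set_val y']/y yE eq_sym (negbTE (ncod _ _)).
have ya : y' = a by apply: (oi_inj ro); apply: ri; rewrite -b1E -b2E b12.
have := congr1 (fun z : osub oD => set_val z 0 k) ya; rewrite -[set_val y']/y yE eqxx.
by move=> /eqP; rewrite -subr_eq0 addrAC subrr add0r; lra.
Qed.

(** [em] inserts the coordinates of the target at [tau] and freezes the free coordinates at their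
    values at a; [lifts] with these constants produces the section. *)
Let loc_section : exists (G : set N) (oG : open G) (s : smor (osub oG) M),
  G (r x) /\ scomp r s = osub_incl oG.
Proof.
pose pick (k : 'I_p) := if pselect (exists l, k = tau l) is left h then Some (projT1 (cid h)) else None.
have pickT l : pick (tau l) = Some l.
  rewrite /pick; case: pselect => [h|[]]; last by exists l.
  by have /ti <- := projT2 (cid h).
have pickK i : pick (kap i) = None.
  rewrite /pick; case: pselect => // h.
  by have [l' /eqP] := h; rewrite (negbTE (ncod _ _)).
pose em (y : 'rV[R]_e) : 'rV[R]_p := \row_k (if pick k is Some l then y 0 l else set_val a 0 k).
have em_cont : continuous em.
  move=> y; apply: continuous_row => k; case: (pick k) => [l'|]; last exact: cst_continuous.
  exact: coord_continuous.
pose G0 : set (osub oD') := [set y | D (em (set_val y))].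
have oG0 : open G0.
  exists (em @^-1` D) => //; exact: open_comp (fun y _ => @em_cont y) oD.
have oG : open (sg @` G0) by exact: oi_open.
have emb : em (set_val b) = set_val a.
  apply/rowP => k; rewrite mxE; case: (kap_or k) => [[l' ->]|[i' ->]]; last by rewrite pickK.
  rewrite pickT; by apply: range_r; rewrite ra.
exists (sg @` G0), oG.
have sT : is_supermanifold e 0 (osub oG) by exact: osub_supermanifold.
pose T : sm R := SM (ex_intro _ e (ex_intro _ 0%N sT)).
pose c' (i : 'I_(p - e)) : sec T setT := set_val a 0 (kap i) *: (1 : sec T setT).
have [_ _ /(_ T (osub_incl oG) c')[]] := lifts.
- by move=> i; rewrite parityZ parity1.
- move=> t; have [y Gy yt] := set_valP t.
  pose z : osub oD := exist _ (em (set_val y)) (mem_set Gy).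
  exists z; split.
    rewrite -[RHS]yt; have [y' _ y'z] := rW z; rewrite -y'z; congr (sg _).
    apply: val_inj; apply/rowP => l; rewrite -[LHS]/(set_val y' 0 l) (range_r (esym y'z)).
    by rewrite -[set_val z]/(em (set_val y)) mxE pickT.
  move=> i w cw; have := value_uniq vD openT (I : setT z) cw (@coord_on_value p D oD (kap i) z).
  rewrite -[set_val z]/(em (set_val y)) mxE pickK => ->.
  have := value_scale (c := set_val a 0 (kap i)) (@valued_sm R T) openT (I : setT t) (value_one (@valued_sm R T) openT (I : setT t)).
  by rewrite mulr1.
move=> g [[gE _] _]; exists (scomp rho g); split=> //.
by exists b => //; rewrite /G0 /= emb; exact: (set_valP a).
Qed.

Lemma submersion_chart_of : exists (A : superspace R) (j : smor A M) (c : 'I_(p - e) -> sec A setT),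
  [/\ lift_chart r j c, range j x, injective r -> p = e &
   exists (G : set N) (oG : open G) (s : smor (osub oG) M), G (r x) /\ scomp r s = osub_incl oG].
Proof. exists (osub oD), rho, c; split; [exact: lifts|by exists a|exact: inj_dim|exact: loc_section]. Qed.

End Lifts.

Lemma submersion_chart_target : exists (A : superspace R) (j : smor A M) (c : 'I_(p - e) -> sec A setT),
  [/\ lift_chart r j c, range j x, injective r -> p = e &
   exists (G : set N) (oG : open G) (s : smor (osub oG) M), G (r x) /\ scomp r s = osub_incl oG].
Proof.
have [D [oD [rho [a [tau [ro ra rW ti tv]]]]]] := adapted_all.
have ex (l : 'I_e) : exists k, tau l = Some k by have [k ? _] := tv l (ltn_ord l); exists k.
pose tau' l := projT1 (cid (ex l)); have tauE l : tau l = Some (tau' l) by exact: projT2 (cid (ex l)).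
apply: (@submersion_chart_of D oD rho a tau') => //.
- by move=> l l' ll; apply: ti => //; rewrite !tauE ll.
- by move=> l z; have [k + kv] := tv l (ltn_ord l); rewrite tauE => -[->].
Qed.

End Target.

Lemma submersion_chart : exists (A : superspace R) (j : smor A M) (c : 'I_(p - e) -> sec A setT),
  [/\ lift_chart r j c, range j x, injective r -> p = e &
   exists (G : set N) (oG : open G) (s : smor (osub oG) M), G (r x) /\ scomp r s = osub_incl oG].
Proof.
have [D' [oD' [sg [sgo [b _ sgb]]]]] := chart_at (r x) sN.
exact: (submersion_chart_target sgo sgb).
Qed.

End SubmersionChart.

Lemma local_factor A M T (j : smor A M) (jo : open_immersion j) (g : smor T M) :
  exists k : smor (osub (smor_open g (oi_range_open jo))) A,
    scomp j k = scomp g (osub_incl (smor_open g (oi_range_open jo))).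
Proof. by have [t|k kE] := factor_ex jo (f := scomp g (osub_incl (smor_open g (oi_range_open jo)))); [exact: (set_valP t)|exists k]. Qed.

Lemma osub_cover M (I : Type) (V : I -> set M) (oV : forall i, open (V i)) (x : M) i :
  V i x -> exists i, range (osub_incl (oV i)) x.
Proof. by move=> Vx; exists i; rewrite range_osub_incl. Qed.

(** * Bijective submersions *)

Section InjectiveSubmersion.
Variables (p e : nat) (M N : superspace R) (r : smor M N).
Hypotheses (sM : is_supermanifold p 0 M) (sN : is_supermanifold e 0 N).
Hypotheses (rs : surjective_submersion r) (ri : injective r).

Let chart x := submersion_chart sM sN (rs.2 x).

Let empty_coord : M -> 'I_(p - e) -> False.
Proof. by move=> x [i]; have [A [j [c [_ _ -> //]]]] := chart x; rewrite subnn. Qed.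

(** Injectivity concerns points only. For T-points the dimension count is used: charts of r have no
    free coordinate, so the uniqueness in [lift_chart] makes r monomorphic on each of them. *)
Lemma injective_submersion_mono (T : sm R) (g g' : smor T M) : scomp r g = scomp r g' -> g = g'.
Proof.
move=> rg; have gg t : g t = g' t by apply: ri; exact: (congr1 (fun h : smor T N => h t) rg).
pose A t := projT1 (cid (chart (g t))); pose jt t := projT1 (cid (projT2 (cid (chart (g t))))).
have cP t : exists c : 'I_(p - e) -> sec (A t) setT, lift_chart r (jt t) c /\ range (jt t) (g t).
  by have [c []] := projT2 (cid (projT2 (cid (chart (g t))))); exists c.
have jo t : open_immersion (jt t) by have [c [[]]] := cP t.
pose V t := g @^-1` (range (jt t)); pose oV t : open (V t) := smor_open g (oi_range_open (jo t)).
apply: (@smor_ext_cover R T M T (fun t => osub (oV t)) (fun t => osub_incl (oV t))).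
- by move=> t; exact: open_immersion_incl.
- by move=> t; apply: (@osub_cover T T V oV t t); have [c []] := cP t.
move=> t; have [c [[_ _ lc] _]] := cP t.
have [k kE] := local_factor (jo t) g.
have [s|k' kE'] := factor_ex (jo t) (f := scomp g' (osub_incl (oV t))).
  by rewrite /= -gg; exact: (set_valP s).
have [||w [_ wu]] := lc (osub_sm (oV t)) (scomp r (scomp (jt t) k)) (fun i => gpull k (c i)).
- by move=> i; case: (empty_coord (g t) i).
- move=> s; exists (k s); split=> // i; by case: (empty_coord (g t) i).
rewrite -[LHS]kE -kE' -(wu k) ?(wu k') //; split=> [|i]; last by case: (empty_coord (g t) i).
by rewrite kE kE' !scompA rg.
Qed.

(** Lifts exist locally by composing with local sections of r; they agree on overlaps since r is a
    monomorphism. *)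
Lemma injective_submersion_lift (T : sm R) (h : smor T N) : exists! g : smor T M, scomp r g = h.
Proof.
have sect (y : N) : exists (G : set N) (oG : open G) (s : smor (osub oG) M), G y /\ scomp r s = osub_incl oG.
  by have [x <-] := rs.1 y; have [A [j [c [_ _ _ ?]]]] := chart x.
have loc t : exists V : set T, exists oV : open V, exists f : smor (osub oV) M, V t /\ scomp r f = scomp h (osub_incl oV).
  have [G [oG [s [Gt rsE]]]] := sect (h t).
  exists (h @^-1` G), (smor_open h oG).
  have [|k kE] := factor_ex (open_immersion_incl oG) (f := scomp h (osub_incl (smor_open h oG))).
    by move=> z; rewrite range_osub_incl; exact: (set_valP z).
  by exists (scomp s k); split=> //; rewrite scompA rsE kE.
have [V VP] := choice loc.
pose oV t := projT1 (cid (VP t)); pose f t := projT1 (cid (projT2 (cid (VP t)))).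
have fP t : V t t /\ scomp r (f t) = scomp h (osub_incl (oV t)) by exact: projT2 (cid (projT2 (cid (VP t)))).
have io t := open_immersion_incl (oV t).
have cov t : exists t', range (osub_incl (oV t')) t by apply: (@osub_cover T T V oV t t); exact: (fP t).1.
have [t t' W oW u v uv|g gE] := glue_smor io cov (f := f).
  apply: (@injective_submersion_mono (osub_sm oW)).
  by rewrite !scompA !(fP _).2 -!scompA uv.
exists g; split; last by move=> g' g'h; apply: injective_submersion_mono; rewrite g'h; apply: (smor_ext_cover io cov) => t; rewrite -scompA gE (fP t).2.
by apply: (smor_ext_cover io cov) => t; rewrite -scompA gE (fP t).2.
Qed.

End InjectiveSubmersion.

End Reduced.



(** * Based simplicial maps *)

Section OddPoints.
Context {R : realType}.

(** Projection to the odd part. Building it into [bpt] makes the latter total, so that T-points can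
    be manipulated without carrying proofs of oddness. *)
Definition oddp (A : superAlgebra R) (x : A) : A := 2^-1 *: (x - parity x).

Lemma oddp_odd (A : superAlgebra R) (x : A) : odd_elt (oddp x).
Proof. by rewrite /odd_elt /oddp parityZ parityD parityN parityK -scalerN opprB. Qed.

Lemma oddp_id (A : superAlgebra R) (x : A) : odd_elt x -> oddp x = x.
Proof.
by move=> xo; rewrite /oddp xo opprK scalerDr -scalerDl -div1r -splitr scale1r.
Qed.

Lemma oddp0 (A : superAlgebra R) : oddp (0 : A) = 0.
Proof. by rewrite /oddp parity0 subrr scaler0. Qed.

Lemma oddpB (A : superAlgebra R) (x y : A) : oddp (x - y) = oddp x - oddp y.
Proof. by rewrite /oddp -scalerBr parityD parityN; congr (_ *: _); rewrite !opprD !opprK addrACA. Qed.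

Lemma gpull_alg (M N : superspace R) (h : smor M N) : superalg_morphism (gpull h).
Proof. exact: pull_alg. Qed.

Lemma gpull_oddp (M N : superspace R) (h : smor M N) (s : sec N setT) :
  gpull h (oddp s) = oddp (gpull h s).
Proof.
have m := gpull_alg h.
by rewrite /oddp (samZ m) (samD m) (samN m) (samP m).
Qed.

Lemma gpullB (M N : superspace R) (h : smor M N) (s t : sec N setT) :
  gpull h (s - t) = gpull h s - gpull h t.
Proof. by rewrite (samD (gpull_alg h)) (samN (gpull_alg h)). Qed.

Lemma gpull_map_theta k (N N' : sm R) (b : smor N N') i :
  gpull (odd_product_map k b) (odd_product_theta N' i) = odd_product_theta N i.
Proof.
elim: k i => [|k IH] i; first by case: i.
rewrite /=; case: unliftP => [j _|_]; rewrite /gpull /= /aodd_map /=.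
  by congr pair; [exact: IH|exact: (sam0 (gpull_alg _))].
by congr pair; [exact: (sam0 (gpull_alg _))|exact: (sam1 (gpull_alg _))].
Qed.

Variable n : nat.
(** [blocks p.+1 N] is convertible to the space of p-simplices of [nerve (jet_ob n N)], while
    [blocks p N] is the source of the p-th map of a family: one block is saved by taking
    differences. *)
Definition blocks (p : nat) (N : sm R) : sm R := odd_product (p * n) N.
Definition btheta (p : nat) (N : sm R) (l : 'I_p) (j : 'I_n) : sec (blocks p N) setT :=
  odd_product_theta N (mxvec_index l j).
Definition bproj (p : nat) (N : sm R) : smor (blocks p N) N := odd_product_proj (p * n) N.
Definition bmap (p : nat) (N N' : sm R) (f : smor N N') : smor (blocks p N) (blocks p N') :=
  odd_product_map (p * n) f.

Lemma btheta_odd p N l j : odd_elt (@btheta p N l j).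
Proof. exact: (odd_product_coordinates _ _).1. Qed.

Lemma bproj_map p (N N' : sm R) (f : smor N N') : scomp (bproj p N') (bmap p f) = scomp f (bproj p N).
Proof. exact: odd_product_map_proj. Qed.

Lemma bmap_theta p (N N' : sm R) (f : smor N N') l j : gpull (bmap p f) (btheta N' l j) = btheta N l j.
Proof. exact: gpull_map_theta. Qed.

Lemma bpt_ex p (N T : sm R) (b : smor T N) (y : 'I_p -> 'I_n -> sec T setT) :
  exists h : smor T (blocks p N), scomp (bproj p N) h = b /\
    forall l j, gpull h (btheta N l j) = oddp (y l j).
Proof.
have [g gK Kg] := curry_mxvec_bij p n.
have [h [[hf ht] _]] := (odd_product_coordinates (p * n) N).2 T b
  (fun k => oddp (y (g k).1 (g k).2)) (fun k => oddp_odd _).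
exists h; split=> // l j; rewrite /btheta ht.
by have -> : g (mxvec_index l j) = (l, j) by exact: (gK (l, j)).
Qed.

(* The [T]-point of [R^(0|pn) x N] over [b] whose odd coordinates are the odd parts of [y]. *)
Definition bpt p (N T : sm R) (b : smor T N) (y : 'I_p -> 'I_n -> sec T setT) : smor T (blocks p N) :=
  projT1 (cid (bpt_ex b y)).

Lemma bpt_proj p (N T : sm R) (b : smor T N) (y : 'I_p -> 'I_n -> sec T setT) :
  scomp (bproj p N) (bpt b y) = b.
Proof. by rewrite /bpt; case: cid => h []. Qed.

Lemma bpt_theta p (N T : sm R) (b : smor T N) (y : 'I_p -> 'I_n -> sec T setT) l j :
  gpull (bpt b y) (btheta N l j) = oddp (y l j).
Proof. by rewrite /bpt; case: cid => h []. Qed.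

Lemma blocks_uniq p (N T : sm R) (h h' : smor T (blocks p N)) :
  scomp (bproj p N) h = scomp (bproj p N) h' ->
  (forall l j, gpull h (btheta N l j) = gpull h' (btheta N l j)) -> h = h'.
Proof.
move=> e et; have [tho univ] := odd_product_coordinates (p * n) N.
have [k [_ ku]] := univ T (scomp (bproj p N) h) (fun k => gpull h (odd_product_theta N k))
  (fun k => gpull_odd h (tho k)).
rewrite -(ku h) // -(ku h') //; split=> // k'.
by case/mxvec_indexP: k' => i j; rewrite [RHS]et.
Qed.

Lemma bptP p (N T : sm R) (b : smor T N) (y : 'I_p -> 'I_n -> sec T setT) (h : smor T (blocks p N)) :
  scomp (bproj p N) h = b -> (forall l j, gpull h (btheta N l j) = oddp (y l j)) -> h = bpt b y.
Proof.
by move=> hb hy; apply: blocks_uniq => [|l j]; rewrite ?bpt_proj ?bpt_theta.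
Qed.

Lemma bpt_eta p (N T : sm R) (h : smor T (blocks p N)) :
  h = bpt (scomp (bproj p N) h) (fun l j => gpull h (btheta N l j)).
Proof.
apply: bptP => // l j; rewrite oddp_id //; exact: gpull_odd (btheta_odd _ _ _).
Qed.

Lemma bpt_eq p (N T : sm R) (b : smor T N) (y y' : 'I_p -> 'I_n -> sec T setT) :
  (forall l j, oddp (y l j) = oddp (y' l j)) -> bpt b y = bpt b y'.
Proof. by move=> yy; apply: bptP => [|l j]; rewrite ?bpt_proj // bpt_theta. Qed.

Lemma bpt_comp p (N T T' : sm R) (b : smor T N) (y : 'I_p -> 'I_n -> sec T setT) (g : smor T' T) :
  scomp (bpt b y) g = bpt (scomp b g) (fun l j => gpull g (y l j)).
Proof.
apply: bptP => [|l j]; first by rewrite scompA bpt_proj.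
by rewrite gpull_comp bpt_theta gpull_oddp.
Qed.

Lemma bmap_bpt p (N N' T : sm R) (f : smor N N') (b : smor T N) (y : 'I_p -> 'I_n -> sec T setT) :
  scomp (bmap p f) (bpt b y) = bpt (scomp f b) y.
Proof.
apply: bptP => [|l j]; first by rewrite scompA bproj_map -scompA bpt_proj.
by rewrite gpull_comp bmap_theta bpt_theta.
Qed.

(** On T-points a simplicial operator of the nerve is mere reindexing of the odd points. All
    simplicial computations below are reduced to this. *)
Lemma nerve_bpt (N T : sm R) p q (f : delta q p) (b : smor T N) (x : 'I_p.+1 -> 'I_n -> sec T setT) :
  scomp (@nerve_op R (jet_ob n N) q p f) (bpt b x) = bpt b (fun i => x (f i)).
Proof.
have opE i : scomp (odd_fp_pr n N i) (@nerve_op R (jet_ob n N) q p f) = odd_fp_pr n N (f i) by exact: nerve_opE.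
have th (i : 'I_q.+1) j : gpull (@nerve_op R (jet_ob n N) q p f) (btheta N i j) = btheta N (f i) j.
  rewrite -[btheta N i j]/(odd_fp_theta N i j) -(@odd_fp_prP R n N q i).2 -gpull_comp.
  by rewrite opE (@odd_fp_prP R n N p (f i)).2.
apply: bptP => [|i j]; last by rewrite gpull_comp th bpt_theta.
rewrite -[bproj _ _]/(odd_product_proj (q.+1 * n) N) -(@odd_fp_prP R n N q ord0).1 -!scompA.
rewrite (scompA (odd_fp_pr _ _ _)) opE scompA (@odd_fp_prP R n N p _).1.
exact: bpt_proj.
Qed.

Lemma nerve_map_bmap (N N' : sm R) (f : smor N N') p :
  nerve_map_at (jet_mor n f) p = bmap p.+1 f.
Proof.
have mapE i : scomp (odd_fp_pr n N' i) (nerve_map_at (jet_mor n f) p) = scomp (odd_product_map n f) (odd_fp_pr n N i).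
  exact: (@nerve_map_atE R _ _ (jet_mor n f) p i).
apply: (@odd_fp_uniq R n N' p).
  rewrite -(@odd_fp_prP R n N' p ord0).1 -!scompA mapE.
  rewrite (scompA _ (odd_product_map n f)) odd_product_map_proj -scompA (@odd_fp_prP R n N p ord0).1.
  by rewrite scompA (@odd_fp_prP R n N' p ord0).1 -bproj_map.
move=> i j; rewrite -(@odd_fp_prP R n N' p i).2 -!gpull_comp mapE.
transitivity (gpull (odd_fp_pr n N i) (gpull (odd_product_map n f) (odd_product_theta N' j))); first exact: gpull_comp.
have -> : gpull (odd_product_map n f) (odd_product_theta N' j) = odd_product_theta N j by exact: gpull_map_theta.
rewrite (@odd_fp_prP R n N p i).2.
by rewrite gpull_comp (@odd_fp_prP R n N' p i).2 bmap_theta.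
Qed.

End OddPoints.

(** * Monotone maps that preserve 0 *)

Lemma delta_ext q p (f g : delta q p) : (forall i, f i = g i :> nat) -> f = g.
Proof.
case: f g => [f fm] [g gm] /= h; have e : f = g by apply/funext => i; exact/ord_inj/h.
by subst g; rewrite (Prop_irrelevance fm gm).
Qed.

Section BasedMaps.
Variable p : nat.

Lemma coface_sub (a : 'I_p.+1) (i : 'I_p.+1) : (i + (a < i) < p.+2)%N.
Proof. by have := ltn_ord i; case: (a < i)%N => /=; lia. Qed.
Lemma codeg_sub (a : 'I_p.+1) (i : 'I_p.+2) : (i - (a < i) < p.+1)%N.
Proof. by have := ltn_ord i; have := ltn_ord a; case: ltnP => /=; lia. Qed.

Lemma coface_mono (a : 'I_p.+1) (i j : 'I_p.+1) : (i <= j -> i + (a < i) <= j + (a < j))%N.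
Proof. by move=> ij; case: (ltnP a i) => ai; case: (ltnP a j) => aj /=; lia. Qed.
Lemma codeg_mono (a : 'I_p.+1) (i j : 'I_p.+2) : (i <= j -> i - (a < i) <= j - (a < j))%N.
Proof. by move=> ij; case: (ltnP a i) => ai; case: (ltnP a j) => aj /=; lia. Qed.

(* The face map missing [a.+1] and the degeneracy collapsing [a] and [a.+1]. *)
Definition coface (a : 'I_p.+1) : delta p p.+1 := @Delta p p.+1 (fun i => Ordinal (coface_sub a i)) (coface_mono a).
Definition codeg (a : 'I_p.+1) : delta p.+1 p := @Delta p.+1 p (fun i => Ordinal (codeg_sub a i)) (codeg_mono a).

Lemma cofaceE a i : coface a i = (i + (a < i))%N :> nat. Proof. by []. Qed.
Lemma codegE a i : codeg a i = (i - (a < i))%N :> nat. Proof. by []. Qed.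
Lemma delta_compE r' q' p' (f : delta q' p') (g : delta r' q') i : delta_comp f g i = f (g i).
Proof. by []. Qed.
Lemma coface0 a : coface a ord0 = ord0. Proof. exact: val_inj. Qed.
Lemma codeg0 a : codeg a ord0 = ord0. Proof. exact: val_inj. Qed.

Lemma coface_codeg (a : 'I_p.+1) (i : 'I_p.+2) : i != a.+1 :> nat -> coface a (codeg a i) = i.
Proof. by move=> ia; apply: ord_inj; rewrite cofaceE codegE; move: ia; case: (ltnP a i) => ai /=; case: ltnP => /=; lia. Qed.
Lemma coface_codegS (a : 'I_p.+1) (i : 'I_p.+2) : i = a.+1 :> nat -> coface a (codeg a i) = a :> nat.
Proof. by move=> ia; rewrite cofaceE codegE ia; case: (ltnP a a.+1) => /= ai; case: ltnP => /=; lia. Qed.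

End BasedMaps.
Arguments coface : simpl never.
Arguments codeg : simpl never.

(** * Simplicial maps encoded by families of based maps *)

Section Families.
Context {R : realType} (n : nat) (K : simplicial R).
Local Notation B := (blocks n).
Local Notation pts T p := ('I_p.+1 -> 'I_n -> sec T setT).

(** Consecutive differences, rather than differences with x 0: the locus where two consecutive
    arguments agree is then the vanishing of a single block. *)
Definition diffs (T : sm R) p (x : pts T p) (l : 'I_p) (j : 'I_n) : sec T setT :=
  x (lift ord0 l) j - x (widen_ord (leqnSn p) l) j.

(* A simplicial map [phi] is encoded by maps [psi p] with
   [ev (psi p) b x = phi p (b, x - x 0)]; only the differences of the odd points
   enter, and [phi p (b, x)] is the face of [ev (psi p.+1) b (0, x)] opposite to 0. *)
Definition ev p (N T : sm R) (psi : smor (B p N) (K p)) (b : smor T N) (x : pts T p) : smor T (K p) :=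
  scomp psi (bpt b (diffs x)).

Lemma ev_comp p (N T T' : sm R) (psi : smor (B p N) (K p)) (b : smor T N) (x : pts T p) (g : smor T' T) :
  scomp (ev psi b x) g = ev psi (scomp b g) (fun i j => gpull g (x i j)).
Proof.
rewrite /ev -scompA bpt_comp; congr (scomp _ (bpt _ _)).
by apply/funext => l; apply/funext => j; rewrite /diffs gpullB.
Qed.

Definition based q p (f : delta q p) := f ord0 = ord0.

(** Formulated on T-points, so that it can be applied at points with coinciding arguments, where
    degeneracies are visible. *)
Definition based_compat q p (N : sm R) (psi : smor (B p N) (K p)) (psi' : smor (B q N) (K q)) :=
  forall (f : delta q p), based f -> forall (T : sm R) (b : smor T N) (x : pts T p),
    scomp (sop K f) (ev psi b x) = ev psi' b (fun i => x (f i)).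

Definition good p (N : sm R) (psi : smor (B p N) (K p)) := based_compat psi psi.

(** The faces opposite to the nonzero vertices, and the degeneracies. Along a chain these conditions
    imply compatibility with every based operator, see [chain_compat]; the degeneracies appear as a
    condition at points whose entries a and a + 1 agree. *)
Definition link p (N : sm R) (psi : smor (B p N) (K p)) (psi' : smor (B p.+1 N) (K p.+1)) :=
  (forall (a : 'I_p.+1) (T : sm R) (b : smor T N) (x : pts T p.+1),
    scomp (sop K (coface a)) (ev psi' b x) = ev psi b (fun i => x (coface a i))) /\
  (forall (a : 'I_p.+1) (T : sm R) (b : smor T N) (x : pts T p.+1),
    (forall i, x (coface a (codeg a i)) = x i) ->
    ev psi' b x = scomp (sop K (codeg a)) (ev psi b (fun i => x (coface a i)))).

(** If no two consecutive values agree, f increases strictly from 0; the first place where f jumps,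
    or else the end of its image, exhibits a missed vertex unless f is the identity. *)
Lemma delta_inj_sur q p (f : delta q p) : based f ->
  [\/ exists a : 'I_p, forall i, f i != a.+1 :> nat, exists j : 'I_q, f (lift ord0 j) = f (widen_ord (leqnSn q) j) |
    p = q /\ forall i, f i = i :> nat].
Proof.
move=> f0; have [[a h]|h1] := pselect (exists a : 'I_p, forall i, f i != a.+1 :> nat); first by constructor 1; exists a.
have [[j h]|h2] := pselect (exists j : 'I_q, f (lift ord0 j) = f (widen_ord (leqnSn q) j)); first by constructor 2; exists j.
have sm (i : nat) (iq : (i.+1 < q.+1)%N) (iq' : (i < q.+1)%N) : (f (Ordinal iq') < f (Ordinal iq))%N.
  rewrite ltn_neqAle delta_mono //= andbT; apply/negP => /eqP e; apply: h2.
  exists (Ordinal (iq : (i < q)%N)); apply: val_inj => /=; rewrite (_ : lift _ _ = Ordinal iq); last exact: val_inj.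
  by rewrite (_ : widen_ord _ _ = Ordinal iq') ?e //; exact: val_inj.
have fi (i : nat) (iq : (i < q.+1)%N) : f (Ordinal iq) = i :> nat.
  elim/ltn_ind: i iq => -[|i] IH iq; first by rewrite (_ : Ordinal iq = ord0) ?f0 //; exact: val_inj.
  have iq' : (i < q.+1)%N by lia.
  have e := IH i (ltnSn i) iq'; have lt := sm i iq iq'; rewrite e in lt.
  apply/eqP; rewrite eqn_leq lt andbT leqNgt; apply/negP => gt; apply: h1.
  have ip : (i < p)%N by have := ltn_ord (f (Ordinal iq)); lia.
  exists (Ordinal ip) => -[k kq] /=; case: (leqP k i) => ki.
    by have := @delta_mono _ _ f (Ordinal kq) (Ordinal iq') ki; rewrite e; lia.
  have := @delta_mono _ _ f (Ordinal iq) (Ordinal kq) ki; lia.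
constructor 3; split; last by case.
have qp : (q <= p)%N by have := ltn_ord (f (Ordinal (ltnSn q))); rewrite fi.
apply/eqP; rewrite eqn_leq qp andbT leqNgt; apply/negP => pq; apply: h1.
exists (Ordinal pq) => -[k kq] /=; rewrite fi; lia.
Qed.

Lemma factor_coface q p (f : delta q p.+1) (a : 'I_p.+1) : (forall i, f i != a.+1 :> nat) ->
  f = delta_comp (coface a) (delta_comp (codeg a) f).
Proof. by move=> fa; apply: delta_ext => i /=; rewrite -{1}(coface_codeg (fa i)). Qed.

Lemma factor_codeg q p (f : delta q.+1 p) (j : 'I_q.+1) : f (lift ord0 j) = f (widen_ord (leqnSn q.+1) j) ->
  f = delta_comp (delta_comp f (coface j)) (codeg j).
Proof.
move=> fj; apply: delta_ext => i; rewrite !delta_compE; have [ij|ij] := eqVneq (i : nat) j.+1; last by rewrite coface_codeg.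
have -> : i = lift ord0 j by exact: val_inj.
by rewrite fj; congr (nat_of_ord (f _)); apply: val_inj; rewrite [RHS]coface_codegS.
Qed.

Lemma delta_collapse q p (f : delta q p) : (p < q)%N ->
  exists j : 'I_q, f (lift ord0 j) = f (widen_ord (leqnSn q) j).
Proof.
move=> pq; apply: contrapT => h.
have fi (i : nat) (iq : (i < q.+1)%N) : (i <= f (Ordinal iq))%N.
  elim: i iq => // i IH iq; have iq' : (i < q.+1)%N by lia.
  apply: (leq_ltn_trans (IH iq')); rewrite ltn_neqAle delta_mono //= andbT; apply/negP => /eqP e; apply: h.
  exists (Ordinal (iq : (i < q)%N)); apply: val_inj => /=; rewrite (_ : lift _ _ = Ordinal iq); last exact: val_inj.
  by rewrite (_ : widen_ord _ _ = Ordinal iq') ?e //; exact: val_inj.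
have := fi q (ltnSn q); have := ltn_ord (f (Ordinal (ltnSn q))); lia.
Qed.

Lemma based_endo p (f : delta p.+1 p.+1) : based f ->
  (exists a : 'I_p.+1, forall i, f i != a.+1 :> nat) \/ f = delta_id p.+1.
Proof.
move=> f0; case: (delta_inj_sur f0) => [h|[j fj]|[_ h]]; [by left| |by right; exact: delta_ext].
left; apply: contrapT => nm.
have sur k : exists i, f i = k.
  case: (unliftP ord0 k) => [a ->|->]; last by exists ord0.
  apply: contrapT => na; apply: nm; exists a => i; apply/negP => /eqP fa.
  by apply: na; exists i; exact: val_inj.
have [g gK] := choice sur.
have [h gh hg] := injF_bij (can_inj gK).
have fh i : f i = h i by rewrite -{1}(hg i) gK.
by have := congr1 g fj; rewrite !fh !hg => /(congr1 val) /=; rewrite /bump /=; lia.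
Qed.

(** A based endomorphism of [p+1] other than the identity misses some a + 1 and therefore also
    collapses some j and j + 1. Splitting off this coface and this codegeneracy leaves an
    endomorphism [gd] of [p], to which goodness of psi applies. *)
Lemma good_link p (N : sm R) (psi : smor (B p N) (K p)) (psi' : smor (B p.+1 N) (K p.+1)) :
  good psi -> link psi psi' -> good psi'.
Proof.
move=> gp [l1 l2] f f0 T b x; case: (based_endo f0) => [[a fa]|->]; last by rewrite sop_id scomp1.
have fE := factor_coface fa.
have [j gj] := delta_collapse (delta_comp (codeg a) f) (ltnSn p).
have fj : f (lift ord0 j) = f (widen_ord (leqnSn p.+1) j).
  by rewrite fE; exact: (congr1 (coface a) gj).
have fjE := factor_codeg fj.
have fji i : f (coface j (codeg j i)) = f i by rewrite [in RHS]fjE.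
rewrite (l2 j _ _ (fun i => x (f i))); last by move=> i; rewrite fji.
pose gd := delta_comp (delta_comp (codeg a) f) (coface j).
have fE' : f = delta_comp (coface a) (delta_comp gd (codeg j)).
  by rewrite {1}fE; apply: delta_ext => i /=; rewrite fji.
have gd0 : based gd by rewrite /based !delta_compE coface0 f0 codeg0.
have gdE i : coface a (gd i) = f (coface j i) by rewrite [in RHS]fE.
clearbody gd; rewrite {1}fE' !sop_comp -!scompA l1 gp //; congr (scomp _ (ev _ _ _)).
by apply/funext => i; rewrite gdE.
Qed.

Definition chain (N : sm R) (psi : forall p, smor (B p N) (K p)) := forall p, link (psi p) (psi p.+1).

(** Induction on q + p: [delta_inj_sur] splits off a coface on the left or a codegeneracy on the
    right, and either one lowers the sum. *)
Lemma chain_compat (N : sm R) (psi : forall p, smor (B p N) (K p)) q p :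
  chain psi -> based_compat (psi p) (psi q).
Proof.
move=> ch; have [k] := ubnP (q + p)%N; elim: k q p => // k IH q p qp f f0 T b x.
case: (delta_inj_sur f0) => [[a fa]|[j fj]|[e fi]].
- case: p qp f f0 x a fa => [|p] qp f f0 x a fa; first by case: a fa.
  have fE := factor_coface fa; rewrite {1}fE sop_comp -scompA (ch p).1 IH; [|lia|by rewrite /based delta_compE f0 codeg0].
  by congr ev; apply/funext => i; rewrite [in RHS]fE.
- case: q qp f f0 j fj => [|q] qp f f0 j fj; first by case: j fj.
  have fE := factor_codeg fj; rewrite {1}fE sop_comp -scompA IH; [|lia|by rewrite /based delta_compE coface0 f0].
  by rewrite ((ch q).2 j _ _ (fun i => x (f i))) // => i; rewrite [in RHS]fE.
- subst q; have -> : f = delta_id p by exact: delta_ext.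
  by rewrite sop_id scomp1.
Qed.

Lemma good0 (N : sm R) (psi : smor (B 0 N) (K 0)) : good psi.
Proof.
move=> f f0 T b x; have -> : f = delta_id 0.
  by apply: delta_ext => i; rewrite !ord1.
by rewrite sop_id scomp1.
Qed.

Lemma chain_good (N : sm R) (psi : forall p, smor (B p N) (K p)) p : chain psi -> good (psi p).
Proof. by move=> ch; exact: chain_compat. Qed.

Lemma oddp_idem (A : superAlgebra R) (x : A) : oddp (oddp x) = oddp x.
Proof. by rewrite oddp_id //; exact: oddp_odd. Qed.

Lemma oddp_sum (A : superAlgebra R) (I : finType) (P : pred I) (F : I -> A) :
  oddp (\sum_(i | P i) F i) = \sum_(i | P i) oddp (F i).
Proof.
apply: (big_morph (@oddp R A)) => [x y|]; last exact: oddp0.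
by rewrite /oddp -scalerDr parityD opprD addrACA.
Qed.

Lemma ev_oddp p (N T : sm R) (psi : smor (B p N) (K p)) (b : smor T N) (x x' : pts T p) :
  (forall i j, oddp (x i j) = oddp (x' i j)) -> ev psi b x = ev psi b x'.
Proof.
by move=> xx; rewrite /ev; congr scomp; apply: bpt_eq => l j; rewrite /diffs !oddpB !xx.
Qed.

Lemma bpt_id p (N : sm R) : bpt (bproj n p N) (@btheta R n p N) = sid _.
Proof.
rewrite [RHS]bpt_eta scomp1r; apply: bpt_eq => l j.
by congr oddp; rewrite /gpull.
Qed.

(** The tautological point: its consecutive differences are the odd coordinates themselves, so a map
    is recovered from its [ev] at this point. *)
Definition partial_sums p (N : sm R) : pts (B p N) p := fun i j => \sum_(l < p | (l < i)%N) btheta N l j.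

Lemma diffs_partial_sums p (N : sm R) : diffs (@partial_sums p N) = @btheta R n p N.
Proof.
apply/funext => l; apply/funext => j; rewrite /diffs /partial_sums (bigD1 l) /=; last by rewrite /bump /=; lia.
rewrite (eq_bigl (fun i : 'I_p => (i < l)%N)) ?addrK // => i.
by rewrite -(inj_eq val_inj) /= /bump /=; lia.
Qed.

Lemma ev_id p (N : sm R) (psi : smor (B p N) (K p)) : ev psi (bproj n p N) (@partial_sums p N) = psi.
Proof. by rewrite /ev diffs_partial_sums bpt_id scomp1r. Qed.

Lemma sum_diffs (T : sm R) p (x : pts T p) (i : 'I_p.+1) j :
  \sum_(l < p | (l < i)%N) diffs x l j = x i j - x ord0 j.
Proof.
pose f (k : nat) := x (inord k) j.
have -> : x i j = f i by rewrite /f inord_val.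
have -> : x ord0 j = f 0%N by rewrite /f; congr (x _ _); apply: val_inj; rewrite /= inordK.
have ip : (i <= p)%N by have := ltn_ord i; lia.
rewrite -(telescope_sumr f (leq0n i)) big_mkord (big_ord_widen_cond _ (fun _ => true) (fun l => f l.+1 - f l) ip).
apply: eq_big => l //= li; rewrite /diffs /f; congr (x _ _ - x _ _); apply: val_inj; rewrite /= inordK //.
  by have := ltn_ord l; lia.
by have := ltn_ord l; lia.
Qed.

Definition first_coface p : delta p p.+1 := @Delta p p.+1 (lift ord0) (fun i j ij => ij : (lift ord0 i <= lift ord0 j)%N).

Definition prepend0 (T : sm R) p (x : pts T p) : pts T p.+1 :=
  fun i j => if unlift ord0 i is Some k then x k j else 0.

Definition simp_family (N : sm R) (psi : forall p, smor (B p N) (K p)) p : smor (nerve (jet_ob n N) p) (K p) :=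
  scomp (sop K (first_coface p)) (ev (psi p.+1) (bproj n p.+1 N) (prepend0 (@btheta R n p.+1 N))).

Lemma simp_family_bpt (N T : sm R) (psi : forall p, smor (B p N) (K p)) p (b : smor T N) (x : pts T p) :
  scomp (simp_family psi p) (bpt b x) = scomp (sop K (first_coface p)) (ev (psi p.+1) b (prepend0 x)).
Proof.
rewrite /simp_family -scompA ev_comp bpt_proj; congr scomp; apply: ev_oddp => i j.
rewrite /prepend0; case: unliftP => [k _|_]; first by rewrite bpt_theta oddp_idem.
by rewrite (sam0 (gpull_alg _)).
Qed.

Lemma simp_nat (N : sm R) (psi : forall p, smor (B p N) (K p)) : chain psi -> forall q p (f : delta q p),
  scomp (sop K f) (simp_family psi p) = scomp (simp_family psi q) (sop (nerve (jet_ob n N)) f).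
Proof.
move=> ch q p f; rewrite -[sop (nerve _) f]scomp1r -bpt_id.
have -> : scomp (sop (nerve (jet_ob n N)) f) (bpt (bproj n p.+1 N) (@btheta R n p.+1 N)) =
  bpt (bproj n p.+1 N) (fun i => @btheta R n p.+1 N (f i)) by exact: nerve_bpt.
rewrite simp_family_bpt.
(* f with a new initial vertex adjoined and sent to the new initial vertex: any operator becomes
   based in this way. *)
pose f' (i : 'I_q.+2) : 'I_p.+2 := if unlift ord0 i is Some k then lift ord0 (f k) else ord0.
have f'm (i j : 'I_q.+2) : (i <= j)%N -> (f' i <= f' j)%N.
  rewrite /f'; case: unliftP => [k ->|->]; case: unliftP => [k' ->|->] //=.
  by rewrite /bump /= !add1n !ltnS; exact: delta_mono.
have fd : delta_comp (Delta f'm) (first_coface q) = delta_comp (first_coface p) f.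
  by apply: delta_ext => i; rewrite !delta_compE /= /f' liftK.
rewrite /simp_family scompA -sop_comp -fd sop_comp -scompA (@chain_compat N psi q.+1 p.+1 ch (Delta f'm)).
  congr (scomp _ (ev _ _ _)); apply/funext => i; apply/funext => j.
  by rewrite /prepend0 /= /f'; case: (unliftP ord0 i) => [k _|_]; rewrite ?liftK ?unlift_none.
by rewrite /based /= /f' unlift_none.
Qed.

Definition simp_of (N : sm R) (psi : forall p, smor (B p N) (K p)) (ch : chain psi) :
  simplicial_map (nerve (jet_ob n N)) K := SimplicialMap (simp_nat ch).

Definition family_of (N : sm R) (phi : simplicial_map (nerve (jet_ob n N)) K) p : smor (B p N) (K p) :=
  scomp (phi p) (bpt (bproj n p N) (@partial_sums p N) : smor (B p N) (nerve (jet_ob n N) p)).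

Lemma ev_family_of (N T : sm R) (phi : simplicial_map (nerve (jet_ob n N)) K) p (b : smor T N) (x : pts T p) :
  ev (family_of phi p) b x =
  scomp (phi p) (bpt b (fun i j => x i j - x ord0 j) : smor T (nerve (jet_ob n N) p)).
Proof.
rewrite /ev /family_of -scompA; congr scomp; rewrite bpt_comp bpt_proj; apply: bpt_eq => i j.
rewrite /partial_sums.
rewrite (big_morph (gpull _) (samD (gpull_alg _)) (sam0 (gpull_alg _))).
under eq_bigr do rewrite bpt_theta.
by rewrite -oddp_sum sum_diffs oddp_idem.
Qed.

Lemma smap_bpt (N T : sm R) (phi : simplicial_map (nerve (jet_ob n N)) K) q p (f : delta q p) (b : smor T N) (x : pts T p) :
  scomp (sop K f) (scomp (phi p) (bpt b x : smor T (nerve (jet_ob n N) p))) =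
  scomp (phi q) (bpt b (fun i => x (f i)) : smor T (nerve (jet_ob n N) q)).
Proof. by rewrite scompA smap_nat -scompA; congr scomp; exact: nerve_bpt. Qed.

Lemma family_chain (N : sm R) (phi : simplicial_map (nerve (jet_ob n N)) K) : chain (family_of phi).
Proof.
move=> p; split=> [a T b x|a T b x xa]; rewrite !ev_family_of smap_bpt.
  by congr (scomp _ (bpt _ _)); rewrite coface0.
congr (scomp _ (bpt _ _)); apply/funext => i; apply/funext => j.
by rewrite xa coface0.
Qed.

Lemma family_simp (N : sm R) (psi : forall p, smor (B p N) (K p)) (ch : chain psi) p :
  family_of (simp_of ch) p = psi p.
Proof.
rewrite /family_of /= simp_family_bpt.
(* The first partial sum is 0, so putting 0 in front repeats the first vertex; the result is a
   degeneracy, which the face opposite to 0 undoes. *)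
have -> : prepend0 (@partial_sums p N) = fun i => @partial_sums p N (codeg ord0 i).
  apply/funext => i; apply/funext => j; rewrite /prepend0; case: unliftP => [k ->|->].
    by have -> : codeg ord0 (lift ord0 k) = k by apply: ord_inj; rewrite codegE lift0 subn1.
  by rewrite /partial_sums big_pred0.
rewrite -(@chain_compat N psi p.+1 p ch (codeg ord0) (codeg0 _)) ev_id scompA -sop_comp.
have -> : delta_comp (codeg ord0) (first_coface p) = delta_id p.
  by apply: delta_ext => i; rewrite delta_compE codegE /= /bump /=; lia.
by rewrite sop_id scomp1.
Qed.

Lemma simp_family_of (N : sm R) (phi : simplicial_map (nerve (jet_ob n N)) K) :
  simp_of (family_chain phi) = phi.
Proof.
apply: smap_ext => p; rewrite /= /simp_family ev_family_of smap_bpt -[RHS]scomp1r -bpt_id.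
congr (scomp _ (bpt _ _)); apply/funext => i; apply/funext => j.
by rewrite /prepend0 /= liftK unlift_none subr0.
Qed.

Lemma family_act (N N' : sm R) (phi : simplicial_map (nerve (jet_ob n N')) K) (f : smor N N') p :
  family_of (nerve_act (jet_mor n f) phi) p = scomp (family_of phi p) (bmap n p f).
Proof.
rewrite /family_of /= nerve_map_bmap -!scompA; congr scomp.
rewrite bmap_bpt bpt_comp bproj_map; apply: bpt_eq => i j; congr oddp.
rewrite /partial_sums (big_morph (gpull _) (samD (gpull_alg _)) (sam0 (gpull_alg _))).
by apply: eq_bigr => l _; rewrite bmap_theta.
Qed.


Section Swap.
Variables (p : nat) (a a' : 'I_p.+1) (aa : (a < a')%N).

(** The retraction onto the face missing a + 1, read inside the face missing a' + 1. It sends a + 1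
    to a, so for a < a' it stays inside that face; for the opposite order it could hit a' + 1. *)
Definition swap : delta p p := delta_comp (codeg a') (delta_comp (delta_comp (coface a) (codeg a)) (coface a')).

Lemma swapE i : coface a' (swap i) = coface a (codeg a (coface a' i)).
Proof. by apply: ord_inj; rewrite !delta_compE !(cofaceE, codegE); move: aa; lia. Qed.

Lemma swap_based : based swap.
Proof. by rewrite /based !delta_compE !(coface0, codeg0). Qed.

Lemma swap_codeg (i : 'I_p.+2) : i != a.+1 :> nat -> i != a'.+1 :> nat -> swap (codeg a' i) = codeg a' i.
Proof. by move=> ia ia'; apply: ord_inj; rewrite !delta_compE !(cofaceE, codegE); move: aa ia ia'; lia. Qed.

Lemma swap_degen (i : 'I_p.+2) : swap (codeg a' (coface a (codeg a i))) = swap (codeg a' i).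
Proof.
have [ia|ia] := eqVneq (i : nat) a.+1; last by rewrite coface_codeg.
have : codeg a' (coface a (codeg a i)) = a :> nat by rewrite codegE (coface_codegS ia); move: aa; lia.
have : codeg a' i = a.+1 :> nat by rewrite codegE ia; move: aa; lia.
move: (codeg a' i) (codeg a' (coface a (codeg a i))) => j1 j2 e1 e2.
by apply: ord_inj; rewrite !delta_compE !(cofaceE, codegE) e1 e2; move: aa; lia.
Qed.

End Swap.

Lemma in_horn0P p q (f : delta q p.+1) : in_horn ord0 f <-> exists a : 'I_p.+1, forall i, f i != a.+1 :> nat.
Proof.
split=> [h|[a fa] h].
  apply: contrapT => na; apply: h => k; case: (unliftP ord0 k) => [a -> _|->]; last by rewrite eqxx.
  apply: contrapT => nj; apply: na; exists a => i; apply/negP => /eqP fa.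
  by apply: nj; exists i; exact: ord_inj.
have [|j fj] := h (lift ord0 a) => //.
by have := fa j; rewrite fj /= /bump /= eqxx.
Qed.

(** * The horn of a family and the extension problem *)

Section Horns.
Variables (p : nat) (N : sm R) (psi : smor (B p N) (K p)).
Hypothesis gp : good psi.

(** An operator missing both vertices is fixed by [swap], and goodness of psi then identifies its
    two descriptions. This makes the horn attached to psi well defined, whichever missed vertex is
    chosen. *)
Lemma face_indep (T : sm R) (b : smor T N) (x : pts T p.+1) q (f : delta q p.+1) (a a' : 'I_p.+1) :
  (forall i, f i != a.+1 :> nat) -> (forall i, f i != a'.+1 :> nat) ->
  scomp (sop K (delta_comp (codeg a) f)) (ev psi b (fun i => x (coface a i))) =
  scomp (sop K (delta_comp (codeg a') f)) (ev psi b (fun i => x (coface a' i))).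
Proof.
wlog aa : a a' / (a < a')%N.
  move=> wl fa fa'; case: (ltngtP a a') => [aa|aa|/ord_inj ->] //; [exact: wl|by rewrite (wl a' a)].
move=> fa fa'.
have -> : delta_comp (codeg a) f = delta_comp (delta_comp (codeg a) (coface a')) (delta_comp (codeg a') f).
  by apply: delta_ext => i; rewrite !delta_compE (coface_codeg (fa' i)).
have e : delta_comp (codeg a') f = delta_comp (swap a a') (delta_comp (codeg a') f).
  by apply: delta_ext => i; exact: (congr1 (@nat_of_ord _) (esym (swap_codeg aa (fa i) (fa' i)))).
rewrite [in RHS]e !(sop_comp K _ (delta_comp (codeg a') f)) -!scompA !gp.
- by congr (scomp _ (ev _ _ _)); apply/funext => i; rewrite swapE.
- exact: swap_based.
- by rewrite /based delta_compE coface0 codeg0.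
Qed.

Definition horn_face_of (T : sm R) (b : smor T N) (x : pts T p.+1) q (f : delta q p.+1) (hf : in_horn ord0 f) :
  smor T (K q) :=
  let a := projT1 (cid ((in_horn0P f).1 hf)) in
  scomp (sop K (delta_comp (codeg a) f)) (ev psi b (fun i => x (coface a i))).

Lemma horn_face_ofE (T : sm R) (b : smor T N) (x : pts T p.+1) q (f : delta q p.+1) (hf : in_horn ord0 f) (a : 'I_p.+1) :
  (forall i, f i != a.+1 :> nat) ->
  horn_face_of b x hf = scomp (sop K (delta_comp (codeg a) f)) (ev psi b (fun i => x (coface a i))).
Proof. by move=> fa; rewrite /horn_face_of; case: cid => a' fa' /=; exact: face_indep. Qed.

Lemma horn_of_nat (T : sm R) (b : smor T N) (x : pts T p.+1) r q (g : delta r q) (f : delta q p.+1)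
    (hf : in_horn ord0 f) (hfg : in_horn ord0 (delta_comp f g)) :
  horn_face_of b x hfg = scomp (sop K g) (horn_face_of b x hf).
Proof.
have [a fa] := (in_horn0P f).1 hf.
rewrite (horn_face_ofE b x hf fa) (@horn_face_ofE T b x _ _ hfg a) => [|i]; last exact: fa.
rewrite scompA -sop_comp; congr (scomp (sop K _) _); exact: delta_ext.
Qed.

Definition horn_of (T : sm R) (b : smor T N) (x : pts T p.+1) : horn K ord0 T :=
  Horn (horn_of_nat b x).

Variables (H : sm R) (u : horn K (ord0 : 'I_p.+2) H) (r : smor (K p.+1) H).
Hypotheses (uH : is_horn_space u)
  (ur : forall q (f : delta q p.+1) (hf : in_horn ord0 f), scomp (horn_face u hf) r = sop K f).

Definition horn_ev (T : sm R) (b : smor T N) (x : pts T p.+1) : smor T H := projT1 (cid (uH (horn_of b x))).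

Lemma horn_ev_face (T : sm R) (b : smor T N) (x : pts T p.+1) q (f : delta q p.+1) (hf : in_horn ord0 f) :
  scomp (horn_face u hf) (horn_ev b x) = horn_face_of b x hf.
Proof. by rewrite /horn_ev; case: cid => h [/= hP _]; rewrite -hP. Qed.

Lemma horn_ev_uniq (T : sm R) (b : smor T N) (x : pts T p.+1) (h : smor T H) :
  (forall q (f : delta q p.+1) (hf : in_horn ord0 f), horn_face_of b x hf = scomp (horn_face u hf) h) -> h = horn_ev b x.
Proof. by move=> hP; rewrite /horn_ev; case: cid => h' [/= _ hu]; rewrite (hu h). Qed.

Lemma horn_evP (T : sm R) (b : smor T N) (x : pts T p.+1) (g : smor T (K p.+1)) :
  scomp r g = horn_ev b x <-> forall a, scomp (sop K (coface a)) g = ev psi b (fun i => x (coface a i)).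
Proof.
have dla (a : 'I_p.+1) i : coface a i != a.+1 :> nat by rewrite cofaceE; lia.
split=> [rg a|ga].
  have ha : in_horn ord0 (coface a) by apply/in_horn0P; exists a; exact: dla.
  rewrite -(ur ha) -scompA rg horn_ev_face (horn_face_ofE b x ha (dla a)).
  have -> : delta_comp (codeg a) (coface a) = delta_id p.
    by apply: delta_ext => i; rewrite delta_compE codegE cofaceE /=; lia.
  by rewrite sop_id scomp1.
apply: horn_ev_uniq => q f hf; have [a fa] := (in_horn0P f).1 hf.
by rewrite (horn_face_ofE b x hf fa) -ga scompA -sop_comp -(factor_coface fa) scompA ur.
Qed.

Lemma horn_ev_comp (T T' : sm R) (b : smor T N) (x : pts T p.+1) (g : smor T' T) :
  scomp (horn_ev b x) g = horn_ev (scomp b g) (fun i j => gpull g (x i j)).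
Proof.
apply: horn_ev_uniq => q f hf; rewrite scompA horn_ev_face.
have [a fa] := (in_horn0P f).1 hf.
by rewrite !(horn_face_ofE _ _ hf fa) -scompA ev_comp.
Qed.

Lemma horn_ev_diff (T : sm R) (b : smor T N) (x : pts T p.+1) :
  horn_ev b x = scomp (horn_ev (bproj n p.+1 N) (@partial_sums p.+1 N)) (bpt b (diffs x)).
Proof.
rewrite horn_ev_comp bpt_proj; apply: horn_ev_uniq => q f hf; rewrite horn_ev_face.
have [a fa] := (in_horn0P f).1 hf; rewrite !(horn_face_ofE _ _ hf fa); congr scomp.
rewrite /ev; congr scomp; apply: bpt_eq => l j; rewrite /diffs /partial_sums -gpullB -gpull_oddp.
rewrite oddp_id; last first.
  by rewrite /odd_elt parityD parityN; rewrite !(big_morph (@parity R _) (@parityD R _) (@parity0 R _)) opprD -!sumrN;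
    congr (_ + _); apply: eq_bigr => i _; rewrite btheta_odd.
have cE i : gpull (bpt b (diffs x)) (\sum_(l < p.+1 | (l < i)%N) btheta N l j) = oddp (\sum_(l < p.+1 | (l < i)%N) diffs x l j).
  rewrite (big_morph (gpull _) (samD (gpull_alg _)) (sam0 (gpull_alg _))).
  by under eq_bigr do rewrite bpt_theta; rewrite -oddp_sum.
by rewrite gpullB !cE !sum_diffs -oddpB; congr oddp; rewrite opprB addrA subrK.
Qed.

(** The value that [link] forces on the next map where the entries a and a + 1 of x agree. *)
Definition degen_ev (a : 'I_p.+1) (T : sm R) (b : smor T N) (x : pts T p.+1) : smor T (K p.+1) :=
  scomp (sop K (codeg a)) (ev psi b (fun i => x (coface a i))).

Lemma degen_ev_comp (a : 'I_p.+1) (T T' : sm R) (b : smor T N) (x : pts T p.+1) (g : smor T' T) :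
  scomp (degen_ev a b x) g = degen_ev a (scomp b g) (fun i j => gpull g (x i j)).
Proof. by rewrite /degen_ev -scompA ev_comp. Qed.

Lemma degen_ev_horn (a : 'I_p.+1) (T : sm R) (b : smor T N) (x : pts T p.+1) :
  (forall i, x (coface a (codeg a i)) = x i) -> scomp r (degen_ev a b x) = horn_ev b x.
Proof.
move=> xa; apply/horn_evP => a'; rewrite /degen_ev scompA -sop_comp gp; last by rewrite /based delta_compE coface0 codeg0.
by congr ev; apply/funext => i; rewrite delta_compE xa.
Qed.

(** The cocycle condition for prescribing the next map on all coincidence loci at once. As in
    [face_indep], [swap] compares the two degeneracies, here through the operator identity
    [swap_degen]. *)
Lemma degen_ev_compat (a a' : 'I_p.+1) (T : sm R) (b : smor T N) (x : pts T p.+1) :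
  (forall i, x (coface a (codeg a i)) = x i) -> (forall i, x (coface a' (codeg a' i)) = x i) -> degen_ev a b x = degen_ev a' b x.
Proof.
wlog aa : a a' / (a < a')%N.
  move=> wl xa xa'; case: (ltngtP a a') => [aa|aa|/ord_inj ->] //; [exact: wl|by rewrite (wl a' a)].
move=> xa xa'; rewrite /degen_ev.
have -> : (fun i => x (coface a i)) = (fun i => x (coface a' (delta_comp (codeg a') (coface a) i))).
  by apply/funext => i; rewrite delta_compE xa'.
have b1 : based (delta_comp (codeg a') (coface a)) by rewrite /based delta_compE coface0 codeg0.
rewrite -(gp b1 b (fun i => x (coface a' i))).
have <- : scomp (sop K (swap a a')) (ev psi b (fun i => x (coface a' i))) = ev psi b (fun i => x (coface a' i)).
  by rewrite (gp (swap_based _ _)); congr ev; apply/funext => i; rewrite swapE // xa.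
move: (ev psi b _) => X; rewrite !scompA -!sop_comp; congr scomp; congr sop.
by apply: delta_ext => i; rewrite -[RHS]/(nat_of_ord (swap a a' (codeg a' i))) -(swap_degen aa).
Qed.

(** Continuing a family by one level is a lifting problem along r with values prescribed on the
    coincidence loci. *)
Lemma linkP (psi' : smor (B p.+1 N) (K p.+1)) : link psi psi' <->
  scomp r psi' = horn_ev (bproj n p.+1 N) (@partial_sums p.+1 N) /\
  forall (a : 'I_p.+1) (T : sm R) (b : smor T N) (x : pts T p.+1),
    (forall i, x (coface a (codeg a i)) = x i) -> ev psi' b x = degen_ev a b x.
Proof.
split=> -[l1 l2]; split=> //; first by apply/horn_evP => a; rewrite -l1 ev_id.
by move=> a T b x; move: a; apply/horn_evP; rewrite horn_ev_diff -l1 -scompA.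
Qed.

End Horns.

End Families.



(** * Coefficients of sections of odd products *)

Section Coefficients.
Context {R : realType}.
Implicit Types N T : sm R.

Definition bcons k (b : bool) (S : 'I_k -> bool) (i : 'I_k.+1) : bool :=
  if unlift ord0 i is Some j then S j else b.

Lemma bcons_eta k (S : 'I_k.+1 -> bool) : bcons (S ord0) (fun i => S (lift ord0 i)) = S.
Proof. by apply/funext => i; rewrite /bcons; case: unliftP => [j ->|->]. Qed.

(** The coefficient of the monomial in those odd coordinates whose index satisfies S. *)
Fixpoint coef k N : ('I_k -> bool) -> sec (odd_product k N) setT -> sec N setT :=
  if k is k'.+1 return ('I_k -> bool) -> sec (odd_product k N) setT -> sec N setT
  then fun S s => @coef k' N (fun i => S (lift ord0 i)) (if S ord0 then s.2 else s.1)
  else fun _ s => s.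

Fixpoint of_coefs k N : (('I_k -> bool) -> sec N setT) -> sec (odd_product k N) setT :=
  if k is k'.+1 return (('I_k -> bool) -> sec N setT) -> sec (odd_product k N) setT
  then fun c => (@of_coefs k' N (fun S => c (bcons false S)), @of_coefs k' N (fun S => c (bcons true S)))
  else fun c => c (fun _ => false).

Lemma coef_of_coefs k N (c : ('I_k -> bool) -> sec N setT) S : coef S (of_coefs c) = c S.
Proof.
elim: k c S => [|k IH] c S /=; first by congr c; apply/funext => -[].
by case E : (S ord0); rewrite IH -[in RHS](bcons_eta S) E.
Qed.

Lemma coef_bcons k N b (S : 'I_k -> bool) (s : sec (odd_product k.+1 N) setT) :
  coef (bcons b S) s = coef S (if b then s.2 else s.1).
Proof.
rewrite /= {2}/bcons unlift_none; congr coef.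
by apply/funext => i; rewrite /bcons liftK.
Qed.

Lemma theta_lift k N (i : 'I_k) : odd_product_theta N (lift ord0 i) = odd_incl (odd_product_theta N i).
Proof. by rewrite /= liftK. Qed.

Lemma theta0 k N : @odd_product_theta R k.+1 N ord0 = odd_theta (odd_product k N).
Proof. by rewrite /= unlift_none. Qed.

Lemma coef_ext k N (s t : sec (odd_product k N) setT) : (forall S, coef S s = coef S t) -> s = t.
Proof.
elim: k s t => [|k IH] s t st; first exact: (st (fun _ => false)).
case: s t st => [s0 s1] [t0 t1] st; congr pair; apply: IH => S.
  by have := st (bcons false S); rewrite !coef_bcons.
by have := st (bcons true S); rewrite !coef_bcons.
Qed.

Definition bsum k (S : 'I_k -> bool) : bool := \big[addb/false]_i S i.

Lemma coef_parity k N (S : 'I_k -> bool) (s : sec (odd_product k N) setT) :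
  coef S (parity s) = (-1) ^+ bsum S *: parity (coef S s).
Proof.
have coefN k' (S' : 'I_k' -> bool) (t : sec (odd_product k' N) setT) : coef S' (- t) = - coef S' t.
  elim: k' S' t => //= k' IH S' [t0 t1]; case: (S' ord0) => /=; exact: IH.
elim: k S s => [|k IH] S s; first by rewrite /bsum big_ord0 scale1r.
case: s => s0 s1; rewrite /= /bsum big_ord_recl; case: (S ord0) => /=.
  by rewrite coefN IH signrN scaleNr.
by rewrite IH.
Qed.

Lemma coef_pull k N N' (f : smor N N') (S : 'I_k -> bool) (s : sec (odd_product k N') setT) :
  coef S (gpull (odd_product_map k f) s) = gpull f (coef S s).
Proof.
move: k S s; elim => [S s|k IH S [s0 s1]] //=.
by case: (S ord0); exact: IH.
Qed.

Lemma coef0 k N (S : 'I_k -> bool) : coef S (0 : sec (odd_product k N) setT) = 0.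
Proof. by elim: k S => //= k IH S; case: (S ord0); exact: IH. Qed.

Lemma kill_ex k N (Z : 'I_k -> bool) : exists h : smor (odd_product k N) (odd_product k N),
  [/\ scomp (odd_product_proj k N) h = odd_product_proj k N,
    forall i, gpull h (odd_product_theta N i) = if Z i then 0 else odd_product_theta N i &
    forall S s, coef S (gpull h s) = if [exists i, S i && Z i] then 0 else coef S s].
Proof.
elim: k Z => [|k IH] Z.
  exists (sid _); split=> [|[]//|S s]; first exact: scomp1r.
  by rewrite ifF //; apply/existsP => -[[]].
have [h [hp ht hc]] := IH (fun i => Z (lift ord0 i)).
have zo : odd_elt (if Z ord0 then 0 else odd_theta (odd_product k N)).
  case: (Z ord0); first by rewrite /odd_elt parity0 oppr0.
  by rewrite /odd_elt /odd_theta; congr pair; rewrite /= ?parity0 ?oppr0 ?parity1.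
pose f := scomp h (odd_proj (odd_product k N)).
have fE s : gpull f s = (gpull h s, 0) by rewrite /f gpull_comp.
exists (odd_lift f zo); split.
- by rewrite /= -scompA odd_lift_proj /f scompA hp.
- move=> i; case: (unliftP ord0 i) => [j ->|->].
    rewrite theta_lift gpull_odd_lift (sam0 (gpull_alg f)) mul0r addr0 fE ht.
    by case: (Z _).
  rewrite theta0 gpull_odd_lift (sam0 (gpull_alg f)) (sam1 (gpull_alg f)) mul1r add0r //.
move=> S [s0 s1]; rewrite gpull_odd_lift !fE.
transitivity (coef S ((gpull h s0, if Z ord0 then 0 else gpull h s1) : sec (odd_product k.+1 N) setT)).
  congr coef; case: (Z ord0); first by rewrite mulr0 addr0.
  change ((gpull h s0 + gpull h s1 * 0, 0 + (gpull h s1 * 1 + 0 * parity 0)) = (gpull h s0, gpull h s1) :> sec (odd_product k N) setT * sec (odd_product k N) setT).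
  by rewrite mulr0 mulr1 mul0r !addr0 add0r.
have -> : [exists i, S i && Z i] = (S ord0 && Z ord0) || [exists i, S (lift ord0 i) && Z (lift ord0 i)].
  apply/existsP/orP => [[i]|[h0|/existsP[i hi]]]; last by exists (lift ord0 i).
    by case: (unliftP ord0 i) => [j ->|->] hi; [right; apply/existsP; exists j|left].
  by exists ord0.
rewrite /=; case: (S ord0) => /=; last exact: hc.
by case: (Z ord0) => /=; [exact: coef0|exact: hc].
Qed.

Section Blocks.
Variable n : nat.

(** An idempotent onto the locus where block a vanishes. Pulling back along it stands for
    restriction to this locus, which need not be introduced as a space. *)
Definition kill_block p N (a : 'I_p) : smor (blocks n p N) (blocks n p N) :=
  bpt (bproj n p N) (fun l j => if l == a then 0 else @btheta R n p N l j).

Definition meets p (S : 'I_(p * n) -> bool) (a : 'I_p) : bool := [exists j : 'I_n, S (mxvec_index a j)].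
Definition meets_all p (S : 'I_(p * n) -> bool) : bool := [forall a, meets S a].

Lemma kill_block_coef p N (a : 'I_p) (S : 'I_(p * n) -> bool) s :
  coef S (gpull (kill_block N a) s) = if meets S a then 0 else coef S s.
Proof.
have [g gK Kg] := curry_mxvec_bij p n.
have gE l j : g (mxvec_index l j) = (l, j) by exact: (gK (l, j)).
have [h [hp ht hc]] := kill_ex N (fun i : 'I_(p * n) => (g i).1 == a).
have -> : kill_block N a = h.
  symmetry; apply: bptP => // l j; rewrite /btheta ht gE /=.
  by case: eqP => _; rewrite ?oddp0 // oddp_id //; exact: btheta_odd.
rewrite hc; congr (if _ then _ else _); apply/existsP/existsP => [[i]|[j Sj]].
  by case/mxvec_indexP: i => l j; rewrite gE /= => /andP[Sj /eqP <-]; exists j.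
by exists (mxvec_index a j); rewrite gE /= Sj eqxx.
Qed.

Lemma block_uniq p N (c c' : sec (blocks n p N) setT) :
  (forall a, gpull (kill_block N a) c = gpull (kill_block N a) c') ->
  (forall S, meets_all S -> coef S c = coef S c') -> c = c'.
Proof.
move=> cc zz; apply: coef_ext => S; have [/zz //|/forallPn[a /negbTE Sa]] := boolP (meets_all S).
by have := congr1 (coef S) (cc a); rewrite !kill_block_coef Sa.
Qed.

(** The coefficient of a monomial that avoids block a is dictated by [d a], and when it avoids
    several blocks the choices agree by the condition on double restrictions. Monomials that meet
    all blocks are unconstrained and receive z, whose parity is the one forced by evenness of the
    section. *)
Lemma block_extension p N (d : 'I_p -> sec (blocks n p N) setT) (z : ('I_(p * n) -> bool) -> sec N setT) :
  (forall a, parity (d a) = d a) ->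
  (forall a a', gpull (kill_block N a) (gpull (kill_block N a') (d a)) = gpull (kill_block N a) (gpull (kill_block N a') (d a'))) ->
  (forall S, meets_all S -> parity (z S) = (-1) ^+ bsum S *: z S) ->
  exists c, [/\ parity c = c, forall a, gpull (kill_block N a) c = gpull (kill_block N a) (d a) &
    forall S, meets_all S -> coef S c = z S].
Proof.
move=> dp dd zp.
pose w S := if [pick a | ~~ meets S a] is Some a then coef S (d a) else z S.
have wf S : meets_all S -> w S = z S.
  by move=> /forallP fS; rewrite /w; case: pickP => // a; rewrite fS.
have wa S a : ~~ meets S a -> w S = coef S (d a).
  move=> Sa; rewrite /w; case: pickP => [a' Sa'|/(_ a)]; last by rewrite Sa.
  have := congr1 (coef S) (dd a a').
  by rewrite !kill_block_coef (negbTE Sa) (negbTE Sa').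
exists (of_coefs w); split; last by move=> S fS; rewrite coef_of_coefs wf.
- apply: coef_ext => S; rewrite coef_parity coef_of_coefs.
  have [fS|/forallPn[a Sa]] := boolP (meets_all S).
    by rewrite wf // zp // scalerA -signr_addb addbb scale1r.
  by rewrite (wa _ _ Sa) -coef_parity dp.
- move=> a; apply: coef_ext => S; rewrite !kill_block_coef coef_of_coefs; case: ifPn => // Sa.
  exact: wa.
Qed.

Lemma kill_block_fix p N (T : sm R) (b : smor T N) (y : 'I_p -> 'I_n -> sec T setT) a :
  (forall j, y a j = 0) -> scomp (kill_block N a) (bpt b y) = bpt b y.
Proof.
move=> ya; rewrite bpt_comp bpt_proj; apply: bpt_eq => l j.
by case: eqP => [->|_]; rewrite ?(sam0 (gpull_alg _)) ?ya // bpt_theta oddp_idem.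
Qed.

Lemma bproj_inj p N : injective (bproj n p N).
Proof.
have h k : injective (odd_product_proj k N) by elim: k => [|k IH] x y //=; exact: IH.
exact: h.
Qed.

Lemma kill_block_point p N a (x : blocks n p N) : kill_block N a x = x.
Proof.
apply: bproj_inj; have := congr1 (fun h : smor _ N => h x) (bpt_proj (bproj n p N) (fun l j => if l == a then 0 else @btheta R n p N l j)).
exact.
Qed.

End Blocks.

End Coefficients.



(** * Extensions along horn maps *)

Section Stage.
Context {R : realType} (n : nat) (K : simplicial R).
Local Notation B := (blocks n).
Local Notation pts T p := ('I_p.+1 -> 'I_n -> sec T setT).

Lemma lift_chart_uniq (M N A : superspace R) (r : smor M N) d (j : smor A M) (c : 'I_d -> sec A setT) (T : sm R)
    (g g' : smor T A) : lift_chart r j c -> scomp r (scomp j g) = scomp r (scomp j g') ->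
  (forall i, gpull g (c i) = gpull g' (c i)) -> g = g'.
Proof.
move=> [_ cp lc] rg gc; have [i|t|k [_ ku]] := lc T (scomp r (scomp j g)) (fun i => gpull g (c i)).
- by rewrite -(samP (gpull_alg g)) cp.
- by exists (g t); split=> // i w; exact: value_gpull.
by transitivity k; [symmetry; exact: ku|apply: ku; split=> [|i]; [rewrite rg|rewrite gc]].
Qed.

Lemma gpull_partial_sums p (N T : sm R) (b : smor T N) (x : pts T p) i j :
  gpull (bpt b (diffs x)) (@partial_sums R n p N i j) = oddp (x i j - x ord0 j).
Proof.
rewrite /partial_sums (big_morph (gpull _) (samD (gpull_alg _)) (sam0 (gpull_alg _))).
by under eq_bigr do rewrite bpt_theta; rewrite -oddp_sum sum_diffs.
Qed.

Lemma ev_translate p (N T : sm R) (psi : smor (B p N) (K p)) (b : smor T N) (x y : pts T p) (t : 'I_n -> sec T setT) :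
  (forall i j, y i j = oddp (x i j - t j)) -> ev psi b y = ev psi b x.
Proof.
move=> yx; rewrite /ev; congr scomp; apply: bpt_eq => l j.
by rewrite /diffs !yx -oddpB oddp_idem; congr oddp; rewrite opprB addrA subrK.
Qed.

Lemma degen_ev_diff p (N T : sm R) (psi : smor (B p N) (K p)) a (b : smor T N) (x : pts T p.+1) :
  degen_ev psi a b x = scomp (degen_ev psi a (bproj n p.+1 N) (@partial_sums R n p.+1 N)) (bpt b (diffs x)).
Proof.
rewrite degen_ev_comp bpt_proj /degen_ev; congr scomp; symmetry; apply: (@ev_translate _ _ _ _ _ _ _ (x ord0)) => i j.
by rewrite gpull_partial_sums.
Qed.

Definition fixed (T : sm R) p (a : 'I_p.+1) (x : pts T p.+1) := forall i, x (coface a (codeg a i)) = x i.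

Lemma fixedP (T : sm R) p (a : 'I_p.+1) (x : pts T p.+1) : fixed a x <-> forall j, diffs x a j = 0.
Proof.
have wE : widen_ord (leqnSn p.+1) a = coface a (codeg a (lift ord0 a)).
  by apply: ord_inj; rewrite coface_codegS.
split=> [xa j|xa i]; first by rewrite /diffs wE xa subrr.
have [ia|ia] := eqVneq (i : nat) a.+1; last by rewrite coface_codeg.
have -> : i = lift ord0 a by exact: ord_inj.
by rewrite -wE; apply/funext => j; apply/esym/eqP; rewrite -subr_eq0; apply/eqP; exact: xa.
Qed.

Lemma diffs_gpull (T T' : sm R) p (g : smor T' T) (x : pts T p) l j :
  diffs (fun i j => gpull g (x i j)) l j = gpull g (diffs x l j).
Proof. by rewrite /diffs gpullB. Qed.

Lemma fixed_kill_block p (N T : sm R) (a : 'I_p.+1) (g : smor T (B p.+1 N)) :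
  fixed a (fun i j => gpull (scomp (kill_block n N a) g) (@partial_sums R n p.+1 N i j)).
Proof.
apply/fixedP => j; rewrite diffs_gpull diffs_partial_sums gpull_comp bpt_theta eqxx.
by rewrite oddp0 (sam0 (gpull_alg _)).
Qed.

Lemma fixed_kill_block2 p (N : sm R) (a a' : 'I_p.+1) :
  fixed a (fun i j => gpull (scomp (kill_block n N a') (kill_block n N a)) (@partial_sums R n p.+1 N i j)).
Proof.
apply/fixedP => j; rewrite diffs_gpull diffs_partial_sums gpull_comp bpt_theta.
case: eqP => _; first by rewrite oddp0 (sam0 (gpull_alg _)).
by rewrite oddp_id ?bpt_theta ?eqxx ?oddp0 //; exact: btheta_odd.
Qed.

Definition to_vertex p : delta p 0 := @Delta p 0 (fun _ => ord0) (fun _ _ _ => leqnn 0).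

(** All arguments coincide on points, since [blocks p N] has the same points as N; there psi can
    only be the totally degenerate simplex on f. This is how a condition on f alone keeps psi in a
    chart. *)
Definition over p (N : sm R) (f : smor N (K 0)) (psi : smor (B p N) (K p)) :=
  forall t, psi t = sop K (to_vertex p) (f (bproj n p N t)).

(** * Continuing a family by one level *)

Section Step.
Variables (p : nat) (H : sm R) (u : horn K (ord0 : 'I_p.+2) H) (r : smor (K p.+1) H).
Hypotheses (uH : is_horn_space u)
  (ur : forall q (f : delta q p.+1) (hf : in_horn ord0 f), scomp (horn_face u hf) r = sop K f).
Variables (N : sm R) (f : smor N (K 0)) (psi : smor (B p N) (K p)).
Hypotheses (gp : good psi) (op : over f psi).

Let h := horn_ev gp uH (bproj n p.+1 N) (@partial_sums R n p.+1 N).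
Let dg a := degen_ev psi a (bproj n p.+1 N) (@partial_sums R n p.+1 N).

Let dg_over a t : dg a t = sop K (to_vertex p.+1) (f (bproj n p.+1 N t)).
Proof.
rewrite /dg /degen_ev -[LHS]/(sop K (codeg a) (psi (bpt (bproj n p.+1 N) (diffs (fun i => @partial_sums R n p.+1 N (coface a i))) t))).
rewrite op; have -> : bproj n p N (bpt (bproj n p.+1 N) (diffs (fun i => @partial_sums R n p.+1 N (coface a i))) t) = bproj n p.+1 N t.
  exact: (congr1 (fun h : smor (B p.+1 N) N => h t) (bpt_proj (bproj n p.+1 N) _)).
have <- : delta_comp (to_vertex p) (codeg a) = to_vertex p.+1 by exact: delta_ext.
by rewrite sop_comp.
Qed.

Let dg_kap a (T : sm R) (g : smor T (B p.+1 N)) :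
  scomp r (scomp (dg a) (scomp (kill_block n N a) g)) = scomp h (scomp (kill_block n N a) g).
Proof. by rewrite /dg /h degen_ev_comp horn_ev_comp; apply: degen_ev_horn => //; exact: fixed_kill_block. Qed.

Let dg_r a t : r (dg a t) = h t.
Proof.
have := congr1 (fun k : smor (B p.+1 N) H => k t) (dg_kap a (sid _)).
by rewrite /= kill_block_point.
Qed.

Let dg_compat a a' : scomp (dg a) (scomp (kill_block n N a') (kill_block n N a)) = scomp (dg a') (scomp (kill_block n N a') (kill_block n N a)).
Proof.
rewrite /dg !degen_ev_comp; apply: degen_ev_compat => //; [exact: fixed_kill_block2|exact: fixed_kill_block].
Qed.

(** [linkP] at the tautological point: T-points with two coinciding arguments are those fixed by
    [kill_block], so finitely many equations between morphisms replace the quantification over T. *)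
Let link_kap psi' : link psi psi' <-> scomp r psi' = h /\ forall a, scomp psi' (kill_block n N a) = scomp (dg a) (kill_block n N a).
Proof.
split=> [/(linkP gp uH ur)[rpsi hd]|[rpsi hd]].
  split=> // a; rewrite -(ev_id psi') ev_comp /dg degen_ev_comp; apply: hd.
  by rewrite -[kill_block n N a]scomp1r; exact: fixed_kill_block.
apply/(linkP gp uH ur); split=> // a T b x /fixedP xa.
by rewrite degen_ev_diff /ev -(kill_block_fix b xa) !scompA hd.
Qed.

Lemma link_over psi' : link psi psi' -> over f psi'.
Proof.
move=> /link_kap[_ hd] t; rewrite -(dg_over ord0); have := congr1 (fun k : smor (B p.+1 N) (K p.+1) => k t) (hd ord0).
by rewrite /= kill_block_point.
Qed.

Section InjectiveStage.
Hypothesis rinj : forall (T : sm R) (h : smor T H), exists! g : smor T (K p.+1), scomp r g = h.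

(** The prescribed values on the loci hold automatically, because they and the restriction of the
    unique lift have the same image in the horn space. *)
Lemma injective_step : exists! psi', link psi psi'.
Proof.
have [psi' [rpsi pu]] := rinj h.
exists psi'; split; last by move=> psi'' /link_kap[rpsi' _]; exact: pu.
apply/link_kap; split=> // a.
have [g [gE gu]] := rinj (scomp h (kill_block n N a)); rewrite -(gu (scomp psi' (kill_block n N a))); last by rewrite scompA rpsi.
by apply: gu; have := dg_kap a (sid _); rewrite !scomp1r.
Qed.
End InjectiveStage.

Section ChartStage.
Variables (A : superspace R) (j : smor A (K p.+1)) (d : nat) (c : 'I_d -> sec A setT).
Hypotheses (lc : lift_chart r j c) (fj : forall t, range j (sop K (to_vertex p.+1) (f t))).

Definition chart_coef (psi' : smor (B p.+1 N) (K p.+1)) (i : 'I_d) (S : 'I_(p.+1 * n) -> bool) : sec N setT :=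
  if pselect (exists g, scomp j g = psi') is left e then coef S (gpull (projT1 (cid e)) (c i)) else 0.

Lemma chart_coefE g i S : chart_coef (scomp j g) i S = coef S (gpull g (c i)).
Proof.
have [jo _ _] := lc.
rewrite /chart_coef; case: pselect => [e|[]]; last by exists g.
by rewrite (oi_cancel jo (projT2 (cid e))).
Qed.

Let dgf a : exists g, scomp j g = dg a.
Proof. by have [jo _ _] := lc; apply: factor_ex => // t; rewrite dg_over. Qed.
Let G a := projT1 (cid (dgf a)).
Let GE a : scomp j (G a) = dg a. Proof. exact: projT2 (cid (dgf a)). Qed.

(** In a lift chart the next map is the horn map together with d even functions; [block_extension]
    and [block_uniq] apply to each of these functions separately. *)
Lemma chart_step (z : 'I_d -> ('I_(p.+1 * n) -> bool) -> sec N setT) :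
  (forall i S, meets_all S -> parity (z i S) = (-1) ^+ bsum S *: z i S) ->
  exists! psi', link psi psi' /\ forall i S, meets_all S -> chart_coef psi' i S = z i S.
Proof.
move=> zp; have [jo cp lP] := lc.
have ex i : exists c', [/\ parity c' = c', forall a, gpull (kill_block n N a) c' = gpull (kill_block n N a) (gpull (G a) (c i)) &
    forall S, meets_all S -> coef S c' = z i S].
  apply: block_extension => [a|a a'|S]; [by rewrite -(samP (gpull_alg _)) cp| |exact: zp].
  rewrite -!gpull_comp; congr (gpull _ (c i)); apply: (oi_cancel jo).
  by rewrite !(scompA j) !GE dg_compat.
have [c' c'P] := choice ex.
have [|t|g [[rg gc] _]] := lP (B p.+1 N) h c'; first by move=> i; case: (c'P i).
  (* There is at least one block, and [kill_block] is the identity on points, so the required point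
     of the chart is the one given by the degenerate value for the first block. *)
  exists (G ord0 t); split.
    by rewrite -(dg_r ord0 t) -(GE ord0).
  move=> i w cw; have [c1 c2 _] := c'P i.
  have [w' cw'] := value_ex (@valued_sm R _) openT (I : setT t) (c' i).
  have e1 : value_at t (gpull (kill_block n N ord0) (c' i)) w' by apply: value_gpull; rewrite kill_block_point.
  have e2 : value_at t (gpull (kill_block n N ord0) (c' i)) w.
    by rewrite c2; apply: value_gpull; rewrite kill_block_point; exact: value_gpull.
  by rewrite -(value_uniq (@valued_sm R _) openT (I : setT t) e1 e2).
have lk : link psi (scomp j g).
  apply/link_kap; split=> // a; rewrite -GE -!scompA; congr scomp.
  apply: (lift_chart_uniq lc).
    by rewrite !(scompA j) GE; have := dg_kap a (sid _); rewrite !scomp1r => ->; rewrite !scompA in rg *; rewrite rg.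
  by move=> i; rewrite !gpull_comp gc; case: (c'P i).
exists (scomp j g); split; first by split=> // i S fS; rewrite chart_coefE gc; case: (c'P i) => _ _; exact.
move=> psi' [lk' zE].
have [g' g'E] : exists g', scomp j g' = psi'.
  by apply: factor_ex => // t; rewrite (link_over lk').
rewrite -g'E; congr scomp; rewrite -g'E in lk' zE.
have [rg' hd'] := (link_kap _).1 lk'; have [_ hd] := (link_kap _).1 lk.
apply: (lift_chart_uniq lc); first by rewrite rg' rg.
move=> i; apply: block_uniq => [a|S fS].
  rewrite -!gpull_comp; congr (gpull _ (c i)); apply: (oi_cancel jo).
  by rewrite !scompA hd hd'.
rewrite -(chart_coefE g') zE // gc; by case: (c'P i) => _ _ ->.
Qed.

End ChartStage.
End Step.

(** * Coordinates of a whole family *)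

Section Coordinates.
Variables (m : nat) (d : nat -> nat).
(** A coordinate is given by a level p < m, a free coordinate of K_(p+1) over its horn space, and a
    monomial that meets all p + 1 blocks. Truncation makes this set finite. *)
Definition cidx : finType := {p : 'I_m & ('I_(d p) * {S : {ffun 'I_(p.+1 * n) -> bool} | meets_all S})%type}.
Definition cpar (x : cidx) : bool := bsum (val (tagged x).2).

Variables (H : nat -> sm R) (u : forall p, horn K (ord0 : 'I_p.+2) (H p)) (r : forall p, smor (K p.+1) (H p)).
Hypotheses (uH : forall p, is_horn_space (u p))
  (ur : forall p q (f : delta q p.+1) (hf : in_horn ord0 f), scomp (horn_face (u p) hf) (r p) = sop K f).
Variables (A : nat -> superspace R) (j : forall p, smor (A p) (K p.+1)) (c : forall p, 'I_(d p) -> sec (A p) setT).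
Hypotheses (lc : forall p, (p < m)%N -> lift_chart (r p) (j p) (@c p))
  (rinj : forall p, (m <= p)%N -> forall (T : sm R) (h : smor T (H p)), exists! g : smor T (K p.+1), scomp (r p) g = h).

(** By [over], a base map with values here keeps the map of level p + 1 inside the chart [j p] for
    every p < m. *)
Definition cdom : set (K 0) := [set k | forall p, (p < m)%N -> range (j p) (sop K (to_vertex p.+1) k)].

Definition fcoord N (psi : forall p, smor (B p N) (K p)) (x : cidx) : sec N setT :=
  chart_coef (j (tag x)) (@c (tag x)) (psi (tag x).+1) (tagged x).1 (val (tagged x).2).

Lemma chain_over (N : sm R) (psi : forall p, smor (B p N) (K p)) p : chain psi -> @over p N (psi 0%N) (psi p).
Proof.
move=> ch; elim: p => [|p IH].
  move=> t; have -> : to_vertex 0 = delta_id 0 by apply: delta_ext => i; rewrite (ord1 i).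
  by rewrite sop_id; congr (psi 0%N _).
exact: (link_over (@uH p) (@ur p) (chain_good ch) IH (ch p)).
Qed.

Lemma chain_range (N : sm R) (psi : forall p, smor (B p N) (K p)) p : chain psi -> (forall t, cdom (psi 0%N t)) -> (p < m)%N ->
  exists g, scomp (j p) g = psi p.+1.
Proof.
move=> ch pU pm; have [jo _ _] := lc pm; apply: factor_ex => // t.
by rewrite (@chain_over N psi p.+1 ch t); exact: pU.
Qed.

Lemma fcoord_parity (N : sm R) (psi : forall p, smor (B p N) (K p)) x : chain psi -> (forall t, cdom (psi 0%N t)) ->
  parity (fcoord psi x) = (-1) ^+ cpar x *: fcoord psi x.
Proof.
move=> ch pU; have [g gE] := chain_range ch pU (ltn_ord (tag x)).
have [_ cp _] := lc (ltn_ord (tag x)).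
rewrite /fcoord -gE (chart_coefE (lc (ltn_ord (tag x)))) /cpar.
have {2}<- : parity (gpull g (c (tagged x).1)) = gpull g (c (tagged x).1) by rewrite -(samP (gpull_alg g)) cp.
by rewrite coef_parity scalerA -signr_addb addbb scale1r.
Qed.

Lemma fcoord_nat (N N' : sm R) (phi : smor N' N) (psi : forall p, smor (B p N) (K p)) x : chain psi -> (forall t, cdom (psi 0%N t)) ->
  fcoord (fun p => scomp (psi p) (bmap n p phi)) x = gpull phi (fcoord psi x).
Proof.
move=> ch pU; have [g gE] := chain_range ch pU (ltn_ord (tag x)).
by rewrite /fcoord -gE -scompA !(chart_coefE (lc (ltn_ord (tag x)))) gpull_comp coef_pull.
Qed.

Section Solve.
Variables (N : sm R) (f : smor N (K 0)) (fU : forall t, cdom (f t)).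
Variable z : cidx -> sec N setT.
Hypothesis zp : forall x, parity (z x) = (-1) ^+ cpar x *: z x.

(** The coordinates indexed by level, set to 0 outside the range of [cidx], so that [step] has one
    form for all p. *)
Let zat p (i : 'I_(d p)) (S : 'I_(p.+1 * n) -> bool) : sec N setT :=
  if pselect (p < m)%N is left pm then
    (if insub [ffun k => S k] is Some S' then
      z (@Tagged 'I_m (Ordinal pm) (fun p : 'I_m => ('I_(d p) * {S : {ffun 'I_(p.+1 * n) -> bool} | meets_all S})%type) (i, S')) else 0)
  else 0.

Let zatE (x : cidx) : zat (tagged x).1 (val (tagged x).2) = z x.
Proof.
case: x => -[p pm] [i S] /=; rewrite /zat; case: pselect => // pm'.
have -> : [ffun k => val S k] = val S by apply/ffunP => k; rewrite ffunE.
by rewrite valK (bool_irrelevance pm' pm).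
Qed.

Let zat_ex p (pm : (p < m)%N) (i : 'I_(d p)) (S : 'I_(p.+1 * n) -> bool) : meets_all S ->
  exists x : cidx, exists e : tag x = p :> nat, cpar x = bsum S /\ zat i S = z x /\
   forall psi' : forall p, smor (B p N) (K p), chart_coef (j p) (@c p) (psi' p.+1) i S = fcoord psi' x.
Proof.
move=> fS; have SE : ([ffun k => S k] : _ -> _) = S by apply/funext => k; rewrite ffunE.
have fS' : meets_all ([ffun k => S k] : {ffun _ -> _}) by rewrite SE.
exists (@Tagged 'I_m (Ordinal pm) (fun p : 'I_m => ('I_(d p) * {S : {ffun 'I_(p.+1 * n) -> bool} | meets_all S})%type) (i, Sub [ffun k => S k] fS' : {S : {ffun 'I_(p.+1 * n) -> bool} | meets_all S})).
exists erefl; split; first by rewrite /cpar /= SE.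
split; last by move=> psi'; rewrite /fcoord /= SE.
rewrite /zat; case: pselect => // pm'; rewrite insubT (bool_irrelevance pm' pm); congr z; congr Tagged; congr pair.
Qed.

Let step p (psi : smor (B p N) (K p)) : good psi -> over f psi ->
  exists! psi', link psi psi' /\ ((p < m)%N -> forall i S, meets_all S -> chart_coef (j p) (@c p) psi' i S = zat i S).
Proof.
move=> gp op; case: (ltnP p m) => pm.
  have fj t : range (j p) (sop K (to_vertex p.+1) (f t)) by exact: fU.
  have [i S fS|psi' [[lk zE] pu]] := chart_step (@uH p) (@ur p) gp op (lc pm) fj (z := @zat p).
  - have [x [e [xS [-> _]]]] := zat_ex pm i fS; by rewrite -xS.
  - by exists psi'; split=> // psi'' [lk' zE']; apply: pu; split=> //; exact: zE'.
have [psi' [lk pu]] := injective_step (@uH p) (@ur p) gp (rinj pm).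
by exists psi'; split=> // psi'' [lk' _]; exact: pu.
Qed.

(** The invariants of the recursion: [good] is what defines the next horn, [over] is what keeps the
    next map in its chart. *)
Let state p := {psi : smor (B p N) (K p) | good psi /\ over f psi}.
Let next p (s : state p) : state p.+1 :=
  let gs := proj2_sig s in let e := cid (step gs.1 gs.2) in
  exist _ (projT1 e) (conj (good_link gs.1 (projT2 e).1.1) (link_over (@uH p) (@ur p) gs.1 gs.2 (projT2 e).1.1)).

Lemma family_solve : exists psi : forall p, smor (B p N) (K p),
  [/\ chain psi, psi 0%N = f & forall x, fcoord psi x = z x].
Proof.
have over0 : @over 0 N f f.
  by move=> t; have -> : to_vertex 0 = delta_id 0; [apply: delta_ext => i; rewrite (ord1 i)|rewrite sop_id].
pose s0 : state 0 := exist _ (f : smor (B 0 N) (K 0)) (conj (@good0 _ _ _ _ f) over0).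
pose st := fix st p : state p := if p is p'.+1 then next (st p') else s0.
exists (fun p => proj1_sig (st p)).
have stP p : link (proj1_sig (st p)) (proj1_sig (st p.+1)) /\
    ((p < m)%N -> forall i S, meets_all S -> chart_coef (j p) (@c p) (proj1_sig (st p.+1)) i S = zat i S).
  exact: (projT2 (cid (step (proj2_sig (st p)).1 (proj2_sig (st p)).2))).1.
split=> // [p|x]; first by case: (stP p).
by rewrite /fcoord (stP _).2 ?zatE //; exact: (valP (tagged x).2).
Qed.

Lemma family_unique (psi psi' : forall p, smor (B p N) (K p)) : chain psi -> chain psi' -> psi 0%N = f -> psi' 0%N = f ->
  (forall x, fcoord psi x = z x) -> (forall x, fcoord psi' x = z x) -> forall p, psi p = psi' p.
Proof.
move=> ch ch' p0 p0' pz pz'; elim=> [|p IH]; first by rewrite p0 p0'.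
have op : over f (psi p) by rewrite -p0; exact: chain_over.
have [psi2 [_ pu]] := step (chain_good ch) op.
rewrite -(pu (psi p.+1)); last first.
  split; [exact: ch|move=> pm i S fS]; have [x [e [_ [-> ->]]]] := zat_ex pm i fS; exact: pz.
apply: pu; split; first by rewrite IH; exact: ch'.
move=> pm i S fS; have [x [e [_ [-> ->]]]] := zat_ex pm i fS; exact: pz'.
Qed.

End Solve.
End Coordinates.

Lemma open_bigcap_lt (X : topologicalType) (V : nat -> set X) m : (forall p, open (V p)) ->
  open [set x | forall p, (p < m)%N -> V p x].
Proof.
move=> oV; elim: m => [|m IH].
  by rewrite (_ : [set x | _] = setT); [exact: openT|apply/seteqP; split].
rewrite (_ : [set x | _] = V m `&` [set x | forall p, (p < m)%N -> V p x]); first exact: openI.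
apply/seteqP; split=> [x h|x [xm h] p]; first by split=> [|p pm]; apply: h => //; exact: ltnW.
by rewrite ltnS leq_eqVlt => /orP[/eqP ->|/h].
Qed.

Section LocalCoordinates.
Variable m : nat.
Hypotheses (K_manifold : forall p, is_manifold (K p)) (K_kan : kan K) (K_truncated : truncated m K).

(** [kan] and [truncated] each come with their own horn space. The universal property of H' shows
    that r' is r followed by the comparison map from H to H', so r inherits injectivity from r'. *)
Lemma horn_data p : exists (H : sm R) (u : horn K (ord0 : 'I_p.+2) H) (r : smor (K p.+1) H),
  [/\ is_manifold H, is_horn_space u,
    forall q (f : delta q p.+1) (hf : in_horn ord0 f), scomp (horn_face u hf) r = sop K f,
    surjective_submersion r & (m <= p)%N -> injective r].
Proof.
have [H [u [r [mH uH ur rsub]]]] := @K_kan p.+1 ord0 (ltn0Sn p).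
exists H, u, r; split=> // mp x y xy.
have [H' [u' [r' [_ uH' ur' rb]]]] := @K_truncated p.+1 ord0 (ltn0Sn p) (leqW mp).
have [x' [_ xu]] := uH' (K p.+1) (@Horn R K p.+1 ord0 (K p.+1) (fun q f _ => sop K f) (fun r q g f _ _ => sop_comp K f g)).
have [g [gE _]] := uH' H u.
apply: (bij_inj rb); have e1 := xu r' (fun q f hf => esym (ur' q f hf)).
have e2 : x' = scomp g r by apply: xu => q f hf; rewrite scompA -gE ur.
by rewrite -e1 e2 /= xy.
Qed.

Definition base_map (N : sm R) (phi : simplicial_map (nerve (jet_ob n N)) K) : smor N (K 0) := family_of phi 0.

Lemma local_coordinates : exists d : nat -> nat, forall k0 : K 0,
  exists (U : set (K 0)) (z : forall N : sm R, simplicial_map (nerve (jet_ob n N)) K -> cidx m d -> sec N setT),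
  [/\ open U, U k0,
    forall (N : sm R) (phi : simplicial_map (nerve (jet_ob n N)) K) x, (forall t, U (base_map phi t)) ->
      parity (z N phi x) = (-1) ^+ cpar x *: z N phi x,
    forall (N N' : sm R) (f : smor N' N) (phi : simplicial_map (nerve (jet_ob n N)) K) x, (forall t, U (base_map phi t)) ->
      z N' (nerve_act (jet_mor n f) phi) x = gpull f (z N phi x) &
    forall (N : sm R) (f : smor N (K 0)) (w : cidx m d -> sec N setT), (forall t, U (f t)) ->
      (forall x, parity (w x) = (-1) ^+ cpar x *: w x) ->
      exists! phi : simplicial_map (nerve (jet_ob n N)) K, base_map phi = f /\ forall x, z N phi x = w x].
Proof.
have [dK dKP] := choice K_manifold.
have [H HP] := choice horn_data.
pose u p : horn K (ord0 : 'I_p.+2) (H p) := projT1 (cid (HP p)).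
pose r p : smor (K p.+1) (H p) := projT1 (cid (projT2 (cid (HP p)))).
have hP p : [/\ is_manifold (H p), is_horn_space (u p),
    forall q (f : delta q p.+1) (hf : in_horn ord0 f), scomp (horn_face (u p) hf) (r p) = sop K f,
    surjective_submersion (r p) & (m <= p)%N -> injective (r p)].
  exact: (projT2 (cid (projT2 (cid (HP p))))).
have mH p : exists e, is_supermanifold e 0 (H p) by case: (hP p).
have [dH dHP] := choice mH; clearbody u r.
exists (fun p => dK p.+1 - dH p)%N => k0.
have ch p := submersion_chart (dKP p.+1) (dHP p) (let: And5 _ _ _ (conj _ rt) _ := hP p in rt (sop K (to_vertex p.+1) k0)).
have [A AP] := choice ch.
pose j p : smor (A p) (K p.+1) := projT1 (cid (AP p)).
pose c p : 'I_(dK p.+1 - dH p) -> sec (A p) setT := projT1 (cid (projT2 (cid (AP p)))).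
have cP p : lift_chart (r p) (j p) (c p) /\ range (j p) (sop K (to_vertex p.+1) k0).
  by have [? ? _ _] := projT2 (cid (projT2 (cid (AP p)))).
have uH p : is_horn_space (u p) by case: (hP p).
have ur p q (f : delta q p.+1) (hf : in_horn ord0 f) : scomp (horn_face (u p) hf) (r p) = sop K f by case: (hP p).
have lc p : (p < m)%N -> lift_chart (r p) (j p) (c p) by case: (cP p).
have rinj p : (m <= p)%N -> forall (T : sm R) (h : smor T (H p)), exists! g : smor T (K p.+1), scomp (r p) g = h.
  move=> mp T h; have [_ _ _ rsub ri] := hP p.
  exact: (injective_submersion_lift (dKP p.+1) (dHP p) rsub (ri mp)).
exists (cdom m j), (fun N phi => fcoord j c (family_of phi)); split.
- apply: open_bigcap_lt => p.
  by apply: smor_open; apply: oi_range_open; case: (cP p) => -[].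
- by move=> p _; case: (cP p).
- by move=> N phi x phiU; apply: (fcoord_parity uH ur lc); [exact: family_chain|exact: phiU].
- move=> N N' f phi x phiU; rewrite -(fcoord_nat uH ur lc f x (family_chain phi) phiU).
  by congr (fcoord j c _ x); apply: functional_extensionality_dep => p; exact: family_act.
move=> N f w fU wp.
have [psi [cpsi psi0 psiw]] := family_solve uH ur lc rinj fU wp.
have E : family_of (simp_of cpsi) = psi by apply: functional_extensionality_dep => p; exact: family_simp.
exists (simp_of cpsi); split; first by split=> [|x]; rewrite ?E // /base_map E.
move=> phi [phi0 phiw]; rewrite -(simp_family_of phi).
have := family_unique uH ur lc rinj fU wp (family_chain (simp_of cpsi)) (family_chain phi).
rewrite E => /(_ psi0 phi0 psiw phiw) => e.
by apply: smap_ext => p; rewrite /= /simp_family e.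
Qed.

End LocalCoordinates.
End Stage.



(** * Gluing local representing objects *)

Section SubProduct.
Context {R : realType} (I : Type) (A : I -> superAlgebra R) (P : (forall i, A i) -> Prop).
Hypotheses (P0 : P (fun i => 0)) (PD : forall s t, P s -> P t -> P (fun i => s i + t i))
  (PZ : forall a s, P s -> P (fun i => a *: s i)) (P1 : P (fun i => 1))
  (PM : forall s t, P s -> P t -> P (fun i => s i * t i)) (PP : forall s, P s -> P (fun i => parity (s i))).

(** Serves for the sections of the glued space: families of sections on the charts, cut out by a
    compatibility condition stable under the operations. *)
Record subprod := SubProd { sp_comp : forall i, A i; sp_compP : P sp_comp }.

Lemma subprod_ext (s t : subprod) : (forall i, sp_comp s i = sp_comp t i) -> s = t.
Proof.
case: s t => [s sP] [t tP] /= st; have e : s = t by apply: functional_extensionality_dep.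
by subst t; rewrite (Prop_irrelevance sP tP).
Qed.

HB.instance Definition _ := gen_eqMixin subprod.
HB.instance Definition _ := gen_choiceMixin subprod.

Let PN s : P s -> P (fun i => - s i).
Proof.
move=> /(PZ (-1)); rewrite (_ : (fun i => -1 *: s i) = (fun i => - s i)) //.
by apply: functional_extensionality_dep => i; rewrite scaleN1r.
Qed.

Definition sp_zero := SubProd P0.
Definition sp_add s t := SubProd (PD (sp_compP s) (sp_compP t)).
Definition sp_opp s := SubProd (PN (sp_compP s)).
Definition sp_scale a s := SubProd (PZ a (sp_compP s)).
Definition sp_one := SubProd P1.
Definition sp_mul s t := SubProd (PM (sp_compP s) (sp_compP t)).
Definition sp_parity s := SubProd (PP (sp_compP s)).

Lemma sp_addA : associative sp_add.
Proof. by move=> s t u; apply: subprod_ext => i; exact: addrA. Qed.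
Lemma sp_addC : commutative sp_add.
Proof. by move=> s t; apply: subprod_ext => i; exact: addrC. Qed.
Lemma sp_add0 : left_id sp_zero sp_add.
Proof. by move=> s; apply: subprod_ext => i; exact: add0r. Qed.
Lemma sp_addN : left_inverse sp_zero sp_opp sp_add.
Proof. by move=> s; apply: subprod_ext => i; exact: addNr. Qed.
HB.instance Definition _ := GRing.isZmodule.Build subprod sp_addA sp_addC sp_add0 sp_addN.

Lemma sp_scaleA a b s : sp_scale a (sp_scale b s) = sp_scale (a * b) s.
Proof. by apply: subprod_ext => i; exact: scalerA. Qed.
Lemma sp_scale1 : left_id 1 sp_scale.
Proof. by move=> s; apply: subprod_ext => i; exact: scale1r. Qed.
Lemma sp_scaleDr : right_distributive sp_scale +%R.
Proof. by move=> a s t; apply: subprod_ext => i; exact: scalerDr. Qed.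
Lemma sp_scaleDl s : {morph sp_scale^~ s : a b / a + b}.
Proof. by move=> a b; apply: subprod_ext => i; exact: scalerDl. Qed.
HB.instance Definition _ := GRing.Zmodule_isLmodule.Build R subprod sp_scaleA sp_scale1 sp_scaleDr sp_scaleDl.

Definition subprod_algebra : superAlgebra R.
Proof.
refine (@SuperAlgebra R subprod sp_one sp_mul _ _ _ _ _ _ _ sp_parity _ _ _ _ _).
- by move=> s t u; apply: subprod_ext => i; exact: mulrA.
- by move=> s; apply: subprod_ext => i; exact: mul1r.
- by move=> s; apply: subprod_ext => i; exact: mulr1.
- by move=> s t u; apply: subprod_ext => i; exact: mulrDl.
- by move=> s t u; apply: subprod_ext => i; exact: mulrDr.
- by move=> a s t; apply: subprod_ext => i; exact: scaleAl.
- by move=> a s t; apply: subprod_ext => i; exact: scaleAr.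
- by move=> a s t; apply: subprod_ext => i; rewrite [LHS]parityD [X in X + _]parityZ.
- by apply: subprod_ext => i; exact: parity1.
- by move=> s t; apply: subprod_ext => i; exact: parityM.
- by move=> s; apply: subprod_ext => i; exact: parityK.
move=> i j s t si tj; apply: subprod_ext => k.
by apply: supercomm; [exact: (congr1 (fun u => sp_comp u k) si)|exact: (congr1 (fun u => sp_comp u k) tj)].
Defined.

Lemma sp_comp_alg i : @superalg_morphism R subprod_algebra (A i) (fun s : subprod_algebra => sp_comp (s : subprod) i).
Proof. by []. Qed.

End SubProduct.

(** * Points as morphisms from the one-point manifold *)

Section Points.
Context {R : realType}.
Local Notation RS p := (Rsuper R p 0).

Definition pt : sm R := SM (ex_intro _ 0%N (ex_intro _ 0%N (@RS_supermanifold R 0))).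
Definition pt0 : pt := (0 : 'rV[R]_0).

Lemma ptE (t : pt) : t = pt0.
Proof. by apply/rowP => -[]. Qed.

Lemma point_uniq (M : sm R) (g g' : smor pt M) : g pt0 = g' pt0 -> g = g'.
Proof.
move=> gg; have gt t : g t = g' t by rewrite (ptE t).
apply: smor_eqP => // V s x oV Vx.
have oW := smor_open g oV; have oW' := smor_open g' oV.
have WW' : g @^-1` V `<=` g' @^-1` V by move=> t; rewrite /= gt.
exists (g @^-1` V); split=> //.
apply: (reduced_ext (@RS_supermanifold R 0) oW) => t Vt.
have [a sa] := value_ex (@valued_sm R M) oV Vt s; exists a; split.
  by rewrite rs_id; apply/(@value_at_pl R _ _ g t V s a oV Vt).
have Vt' : V (g' t) by rewrite -gt.
apply/(value_at_rs _ _ oW Vt WW'); apply/(@value_at_pl R _ _ g' t V s a oV Vt').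
by rewrite -gt.
Qed.

Lemma point_ex (M : sm R) (x : M) : exists g : smor pt M, g pt0 = x.
Proof.
have [p [q sM]] := smP M; have [D [oD [r [ro [a _ ax]]]]] := chart_at x sM.
have odd q' (A : superspace R) (y : iter q' (@odd_superspace R) A) (h : forall y : A, exists g : smor pt A, g pt0 = y) :
    exists g : smor pt (iter q' (@odd_superspace R) A), g pt0 = y.
  elim: q' y => [|q' IH] y; first exact: h.
  have [g gy] := IH y.
  have z : odd_elt (0 : sec pt setT) by rewrite /odd_elt parity0 oppr0.
  by exists (odd_lift g z).
have [|g ga] := odd q (osub oD) a; last by exists (scomp r g); rewrite /= ga.
move=> y; have [i|h hP] := @affine_maps_sm R pt p (fun i => set_val y 0 i *: (1 : sec pt setT)).
  by rewrite parityZ parity1.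
have hy : h pt0 = set_val y.
  apply/rowP => i; have := affine_value (h := h) (i := i) (x := pt0); rewrite hP => v1.
  have v2 := value_scale (c := set_val y 0 i) (@valued_sm R pt) openT (I : setT pt0) (value_one (@valued_sm R pt) openT (I : setT pt0)).
  by rewrite (value_uniq (@valued_sm R pt) openT (I : setT pt0) v1 v2) mulr1.
have [t|k kE] := factor_ex (open_immersion_incl oD) (f := h).
  by rewrite range_osub_incl (ptE t) hy; exact: (set_valP y).
exists k; apply: val_inj; rewrite -[RHS]hy -kE //.
Qed.

Definition pnt (M : sm R) (x : M) : smor pt M := projT1 (cid (point_ex x)).
Lemma pntE (M : sm R) (x : M) t : pnt x t = x.
Proof. by rewrite (ptE t) /pnt; case: cid. Qed.
Lemma pnt_comp (M N : sm R) (g : smor M N) (x : M) : scomp g (pnt x) = pnt (g x).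
Proof. by apply: point_uniq; rewrite /= !pntE. Qed.
Lemma pnt_eta (M : sm R) (g : smor pt M) : g = pnt (g pt0).
Proof. by apply: point_uniq; rewrite pntE. Qed.

End Points.

(** * Construction of the glued supermanifold *)

Section Gluing.
Context {R : realType} (F : presheaf (SM_cat R)) (K0 : sm R) (ba : forall N : sm R, F N -> smor N K0).
Definition pb (N N' : sm R) (f : smor N' N) (s : F N) : F N' := @act (SM_cat R) F N' N f s.

Lemma pb_comp (N N' N'' : sm R) (g : smor N' N) (f : smor N'' N') s : pb (scomp g f) s = pb f (pb g s).
Proof. exact: (@actM (SM_cat R) F). Qed.
Hypothesis ba_nat : forall (N N' : sm R) (f : smor N' N) (s : F N), ba (pb f s) = scomp (ba s) f.
Hypothesis sheaf_sep : forall (N : sm R) (I : Type) (A : I -> sm R) (j : forall i, smor (A i) N) (s s' : F N),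
  (forall i, open_immersion (j i)) -> (forall x, exists i, range (j i) x) ->
  (forall i, pb (j i) s = pb (j i) s') -> s = s'.
Hypothesis sheaf_glue : forall (N : sm R) (I : Type) (A : I -> sm R) (j : forall i, smor (A i) N) (s : forall i, F (A i)),
  (forall i, open_immersion (j i)) -> (forall x, exists i, range (j i) x) ->
  (forall i k (T : sm R) (u : smor T (A i)) (v : smor T (A k)), scomp (j i) u = scomp (j k) v -> pb u (s i) = pb v (s k)) ->
  exists t : F N, forall i, pb (j i) t = s i.

Variables (P Q : nat) (Y : K0 -> sm R) (V : K0 -> set K0) (xi : forall k, F (Y k)).
Hypotheses (sK : exists p q, is_supermanifold p q K0) (sY : forall k, is_supermanifold P Q (Y k))
  (oV : forall k, open (V k)) (Vk : forall k, V k k)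
  (xiV : forall k y, V k (ba (xi k) y))
  (univ : forall k (N : sm R) (s : F N), (forall t, V k (ba s t)) -> exists! g : smor N (Y k), pb g (xi k) = s).

(** Forced by the goal: the points of a representing object are its morphisms from [pt], that is,
    the elements of F on a point. *)
Definition car : Type := F pt.
Definition bpoint (x : car) : K0 := ba (x : F pt) pt0.
Definition chart_pt k (y : Y k) : car := pb (pnt y) (xi k).
Definition evF (T : sm R) (s : F T) (t : T) : car := pb (pnt t) s.

Lemma evF_pb (T : sm R) k (g : smor T (Y k)) t : evF (pb g (xi k)) t = chart_pt (g t).
Proof. by rewrite /evF /chart_pt -pb_comp pnt_comp. Qed.

Lemma bpoint_chart_pt k (y : Y k) : bpoint (chart_pt y) = ba (xi k) y.
Proof. by rewrite /bpoint /chart_pt ba_nat /= pntE. Qed.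

Lemma chart_pt_inj k : injective (@chart_pt k).
Proof.
move=> y y' e; have [|g [_ gu]] := @univ k pt (chart_pt y).
  by move=> t; rewrite (ptE t) -/(bpoint _) bpoint_chart_pt; exact: xiV.
have e1 := gu _ erefl; have e2 := gu _ (esym e).
by rewrite -(pntE y pt0) -(pntE y' pt0) -e1 -e2.
Qed.

Lemma chart_pt_sur k (x : car) : V k (bpoint x) -> exists y : Y k, chart_pt y = x.
Proof.
move=> Vx; have [|g [gx _]] := @univ k pt x; first by move=> t; rewrite (ptE t).
by exists (g pt0); rewrite /chart_pt -pnt_eta.
Qed.

Lemma range_chart_pt k : range (@chart_pt k) = [set x | V k (bpoint x)].
Proof.
apply/seteqP; split=> [_ [y _ <-]|x /= /chart_pt_sur[y <-]]; last by exists y.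
by rewrite /= bpoint_chart_pt; exact: xiV.
Qed.

Lemma chart_pt_agree (T : sm R) k l (g : smor T (Y k)) (h : smor T (Y l)) : pb g (xi k) = pb h (xi l) ->
  forall t, chart_pt (g t) = chart_pt (h t).
Proof. by move=> e t; rewrite -!evF_pb e. Qed.

Definition ovl k l : set (Y k) := ba (xi k) @^-1` (V l).
Lemma ovl_open k l : open (@ovl k l). Proof. exact: smor_open. Qed.
Definition ovl_sm k l : sm R := osub_sm (@ovl_open k l).
Definition ovl_incl k l : smor (ovl_sm k l) (Y k) := osub_incl (@ovl_open k l).

Lemma trans_ex k l : exists h : smor (ovl_sm k l) (Y l), pb h (xi l) = pb (ovl_incl k l) (xi k).
Proof.
have [t|h [hE _]] := @univ l _ (pb (ovl_incl k l) (xi k)); last by exists h.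
by rewrite ba_nat; exact: (set_valP t).
Qed.
Definition trans k l : smor (ovl_sm k l) (Y l) := projT1 (cid (trans_ex k l)).
Lemma transE k l : pb (trans k l) (xi l) = pb (ovl_incl k l) (xi k).
Proof. exact: projT2 (cid (trans_ex k l)). Qed.
Lemma chart_pt_trans k l t : chart_pt (trans k l t) = chart_pt (ovl_incl k l t).
Proof. exact: (chart_pt_agree (transE k l)). Qed.

HB.instance Definition _ := gen_eqMixin car.
HB.instance Definition _ := gen_choiceMixin car.

Definition op : set_system car := fun W => forall k, open (@chart_pt k @^-1` W).
Lemma op_T : op setT. Proof. by move=> k; exact: openT. Qed.
Lemma op_I (W W' : set car) : op W -> op W' -> op (W `&` W').
Proof. by move=> oW oW' k; apply: openI; [exact: oW|exact: oW']. Qed.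
Lemma op_bigcup (I : Type) (f : I -> set car) : (forall i, op (f i)) -> op (\bigcup_i f i).
Proof. by move=> of_ k; rewrite preimage_bigcup; apply: bigcup_open => i _; exact: of_. Qed.
HB.instance Definition _ := isOpenTopological.Build car op_T op_I op_bigcup.
Local Notation X := (car : topologicalType).

Lemma openXE (W : set X) : open W = op W. Proof. by []. Qed.

Lemma chart_pt_open k (O : set (Y k)) : open O -> open (@chart_pt k @` O : set X).
Proof.
move=> oO; rewrite openXE => l.
rewrite (_ : _ @^-1` _ = set_val @` (trans l k @^-1` O : set (ovl_sm l k))).
  exact: (open_image_val (@ovl_open l k) (smor_open (trans l k) oO)).
apply/seteqP; split=> [y [z Oz zy]|_ [w Ow <-]]; last first.
  by exists (trans l k w) => //; exact: chart_pt_trans.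
have Vy : @ovl l k y by rewrite /ovl /= -bpoint_chart_pt -zy bpoint_chart_pt; exact: xiV.
exists (exist _ y (mem_set Vy)) => //=.
have -> : trans l k (exist _ y (mem_set Vy)) = z by apply: chart_pt_inj; rewrite chart_pt_trans zy.
exact: Oz.
Qed.

Lemma bpoint_open (O : set K0) : open O -> open (bpoint @^-1` O : set X).
Proof.
move=> oO; rewrite openXE => k; rewrite (_ : _ @^-1` _ = ba (xi k) @^-1` O); first exact: smor_open.
by apply/seteqP; split=> y /=; rewrite bpoint_chart_pt.
Qed.

Local Notation pre k W := (@chart_pt k @^-1` W).

(* The sections of the glued space are the families of sections on the charts that
   agree wherever two charts classify the same element of [F]. *)
Definition compat (W : set X) (s : forall k, sec (Y k) (pre k W)) : Prop :=
  forall O : set X, open O -> O `<=` W -> forall k l (T : sm R) (g : smor T (Y k)) (h : smor T (Y l)),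
    pb g (xi k) = pb h (xi l) ->
    pl g (rs (pre k O) (s k)) = rs (g @^-1` (pre k O)) (pl h (rs (pre l O) (s l))).

Lemma pre_sub k (O W : set X) : O `<=` W -> pre k O `<=` pre k W.
Proof. by move=> OW y; exact: OW. Qed.

Lemma compat_left (W O : set X) k (T : sm R) (g : smor T (Y k)) : open O -> O `<=` W ->
  superalg_morphism (fun s : sec (Y k) (pre k W) => pl g (rs (pre k O) s)).
Proof.
move=> oO OW; apply: (superalg_morphism_comp (rs_alg (pre_sub OW)) (pl_alg g _)); exact: (oO k).
Qed.

Lemma compat_right (W O : set X) k l (T : sm R) (g : smor T (Y k)) (h : smor T (Y l)) : pb g (xi k) = pb h (xi l) ->
  open O -> O `<=` W ->
  superalg_morphism (fun s : sec (Y l) (pre l W) => rs (g @^-1` (pre k O)) (pl h (rs (pre l O) s))).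
Proof.
move=> gh oO OW; apply: (superalg_morphism_comp (compat_left h oO OW)); apply: rs_alg => t.
by rewrite /= (chart_pt_agree gh).
Qed.

Section SheafSections.
Variable W : set X.
Lemma compat0 : compat (fun k => 0 : sec (Y k) (pre k W)).
Proof. by move=> O oO OW k l T g h gh; rewrite (sam0 (compat_left g oO OW)) (sam0 (compat_right gh oO OW)). Qed.
Lemma compatD (s t : forall k, sec (Y k) (pre k W)) : compat s -> compat t -> compat (fun k => s k + t k).
Proof.
move=> sc tc O oO OW k l T g h gh.
by rewrite (samD (compat_left g oO OW)) (samD (compat_right gh oO OW)) (sc O oO OW _ _ _ _ _ gh) (tc O oO OW _ _ _ _ _ gh).
Qed.
Lemma compatZ a (s : forall k, sec (Y k) (pre k W)) : compat s -> compat (fun k => a *: s k).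
Proof.
move=> sc O oO OW k l T g h gh.
by rewrite (samZ (compat_left g oO OW)) (samZ (compat_right gh oO OW)) (sc O oO OW _ _ _ _ _ gh).
Qed.
Lemma compat1 : compat (fun k => 1 : sec (Y k) (pre k W)).
Proof. by move=> O oO OW k l T g h gh; rewrite (sam1 (compat_left g oO OW)) (sam1 (compat_right gh oO OW)). Qed.
Lemma compatM (s t : forall k, sec (Y k) (pre k W)) : compat s -> compat t -> compat (fun k => s k * t k).
Proof.
move=> sc tc O oO OW k l T g h gh.
by rewrite (samM (compat_left g oO OW)) (samM (compat_right gh oO OW)) (sc O oO OW _ _ _ _ _ gh) (tc O oO OW _ _ _ _ _ gh).
Qed.
Lemma compatP (s : forall k, sec (Y k) (pre k W)) : compat s -> compat (fun k => parity (s k)).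
Proof.
move=> sc O oO OW k l T g h gh.
by rewrite (samP (compat_left g oO OW)) (samP (compat_right gh oO OW)) (sc O oO OW _ _ _ _ _ gh).
Qed.
Definition gsec : superAlgebra R := subprod_algebra compat0 compatD compatZ compat1 compatM compatP.
End SheafSections.

Lemma compat_res (W W' : set X) (s : forall k, sec (Y k) (pre k W)) : W' `<=` W -> compat s ->
  compat (fun k => rs (pre k W') (s k)).
Proof.
move=> WW sc O oO OW k l T g h gh; rewrite !rs_rs; try exact: pre_sub.
by apply: sc => //; exact: subset_trans OW WW.
Qed.

Definition gcomp (W : set X) (s : gsec W) k : sec (Y k) (pre k W) := sp_comp (s : subprod _) k.
Definition gres (W W' : set X) (WW : W' `<=` W) (s : gsec W) : gsec W' :=
  SubProd (compat_res WW (sp_compP (s : subprod _))).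

Lemma gext (W : set X) (s t : gsec W) : (forall k, gcomp s k = gcomp t k) -> s = t.
Proof. exact: subprod_ext. Qed.

Lemma gres_alg (W W' : set X) (WW : W' `<=` W) : superalg_morphism (gres WW).
Proof.
have m k := rs_alg (@pre_sub k _ _ WW); split.
- by move=> a s t; apply: gext => k; exact: (sam_linear (m k)).
- split; first by apply: gext => k; exact: (sam1 (m k)).
  by move=> s t; apply: gext => k; exact: (samM (m k)).
- by move=> s; apply: gext => k; exact: (samP (m k)).
Qed.
Lemma gres_id (W : set X) (WW : W `<=` W) s : gres WW s = s.
Proof. by apply: gext => k; exact: rs_id. Qed.
Lemma gres_comp (U V' W : set X) (VU : V' `<=` U) (WV : W `<=` V') (WU : W `<=` U) s :
  gres WV (gres VU s) = gres WU s.
Proof. by apply: gext => k; apply: rs_rs; exact: pre_sub. Qed.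

Lemma gglue (I : Type) (f : I -> set X) (of_ : forall i, open (f i)) (s : forall i, gsec (f i)) :
  (forall i j, gres (@subIsetl _ (f i) (f j)) (s i) = gres (@subIsetr _ (f i) (f j)) (s j)) ->
  exists! t : gsec (\bigcup_i f i), forall i, gres (bigcup_sup Logic.I) t = s i.
Proof.
move=> ag; set U := \bigcup_i f i.
have oU : open U by apply: bigcup_open => i _.
have fU i : f i `<=` U by move=> x fx; exists i.
have agk i j k : rs (pre k (f i `&` f j)) (gcomp (s i) k) = rs (pre k (f i `&` f j)) (gcomp (s j) k).
  exact: (congr1 (fun t : gsec _ => gcomp t k) (ag i j)).
have ex k : exists t : sec (Y k) (pre k U), forall i, rs (pre k (f i)) t = gcomp (s i) k.
  have [||||i j y fi fj|t tP] := @sec_glue_on R (Y k) (pre k U) I (fun i => pre k (f i)) (fun i => gcomp (s i) k).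
  - exact: (oU k).
  - by move=> i; exact: (of_ i k).
  - by move=> i; exact: pre_sub.
  - by move=> y [i _ fy]; exists i.
  - exists (pre k (f i `&` f j)); split=> //.
    + exact: (openI (of_ i) (of_ j) k).
    + by apply: pre_sub; exact: subIsetl.
    + by apply: pre_sub; exact: subIsetr.
  by exists t; exact: tP.
pose t k := projT1 (cid (ex k)); have tP k i : rs (pre k (f i)) (t k) = gcomp (s i) k by exact: (projT2 (cid (ex k)) i).
have tc : compat t.
  move=> O oO OU k l T g h gh.
  have sgh : g @^-1` pre k O = h @^-1` pre l O by apply/seteqP; split=> z /=; rewrite (chart_pt_agree gh).
  have ogk := smor_open g (oO k).
  apply: (sec_ext ogk) => z Oz; have [i _ fz] := OU _ Oz.
  pose O' := O `&` f i.
  have oO' : open O' by exact: openI.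
  have OO' : O' `<=` O by exact: subIsetl.
  have Of : O' `<=` f i by exact: subIsetr.
  exists (g @^-1` pre k O'); split=> //.
  - exact: (smor_open g (oO' k)).
  - by move=> y; exact: OO'.
  have e : pl g (rs (pre k O') (gcomp (s i) k)) = rs (g @^-1` (pre k O')) (pl h (rs (pre l O') (gcomp (s i) l))).
    exact: (sp_compP (s i : subprod _) O' oO' Of k l T g h gh).
  have sgh' : g @^-1` pre k O' = h @^-1` pre l O' by apply/seteqP; split=> y /=; rewrite (chart_pt_agree gh).
  have a1 : g @^-1` pre k O' `<=` g @^-1` pre k O by move=> y; exact: OO'.
  have a2 : g @^-1` pre k O `<=` h @^-1` pre l O by rewrite sgh.
  have a3 : h @^-1` pre l O' `<=` h @^-1` pre l O by move=> y; exact: OO'.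
  rewrite rs_rs // -(pl_rs _ _ (oO k) (oO' k)); last exact: pre_sub.
  rewrite rs_rs; [|exact: pre_sub|exact: pre_sub].
  have E1 : rs (pre k O') (t k) = rs (pre k O') (gcomp (s i) k).
    by rewrite -tP rs_rs //; exact: pre_sub.
  have E2 : rs (pre l O') (t l) = rs (pre l O') (gcomp (s i) l).
    by rewrite -tP rs_rs //; exact: pre_sub.
  rewrite E1 e -E2.
  rewrite -[in LHS](@rs_rs _ _ (pre l U) (pre l O) (pre l O')); [|exact: pre_sub|exact: pre_sub].
  rewrite (pl_rs _ _ (oO l) (oO' l)); last exact: pre_sub.
  by rewrite rs_rs // -sgh'.
exists (SubProd tc : gsec U); split; first by move=> i; apply: gext => k; exact: tP.
move=> t' t'P; apply: gext => k; apply: (sec_ext (oU k)) => y [i _ fy].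
exists (pre k (f i)); split=> //; [exact: (of_ i k)|exact: pre_sub|].
rewrite tP -(t'P i) //.
Qed.

Definition gspace : superspace R := @Superspace R X gsec gres gres_alg gres_id gres_comp gglue.

Lemma univ_uniq k (T : sm R) (g h : smor T (Y k)) : pb g (xi k) = pb h (xi k) -> g = h.
Proof.
move=> gh; have [|w [_ wu]] := @univ k T (pb h (xi k)); first by move=> t; rewrite ba_nat; exact: xiV.
by rewrite -(wu g gh) (wu h erefl).
Qed.

Lemma pre_ovl l k (W : set X) : W `<=` range (@chart_pt k) -> pre l W `<=` @ovl l k.
Proof. by move=> Wk y /Wk; rewrite range_chart_pt /= bpoint_chart_pt. Qed.

Lemma pre_trans l k (O : set X) : trans l k @^-1` pre k O = ovl_incl l k @^-1` pre l O.
Proof. by apply/seteqP; split=> t /=; rewrite chart_pt_trans. Qed.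

(** Over a set inside chart k every other component is the pullback of component k along the
    transition map; this gives injectivity of restriction to a chart, and [gsec_ex] gives
    surjectivity. *)
Lemma gsec_det k (W : set X) (s s' : gsec W) : open W -> W `<=` range (@chart_pt k) ->
  gcomp s k = gcomp s' k -> s = s'.
Proof.
move=> oW Wk ss; apply: gext => l.
apply: (@oi_pl_inj R _ _ _ (open_immersion_incl (@ovl_open l k)) (pre l W) _ _ (oW l)).
  by rewrite range_osub_incl; exact: pre_ovl.
have E (t : gsec W) : pl (ovl_incl l k) (gcomp t l) = rs (ovl_incl l k @^-1` pre l W) (pl (trans l k) (gcomp t k)).
  rewrite -[gcomp t l]rs_id -[gcomp t k]rs_id.
  exact: (sp_compP (t : subprod _) W oW (@subset_refl _ W) l k _ _ _ (esym (transE l k))).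
by rewrite -[LHS]/(pl (ovl_incl l k) (gcomp s l)) -[RHS]/(pl (ovl_incl l k) (gcomp s' l)) !E ss.
Qed.

Section ExtendSection.
Variables (k : K0) (W : set X) (oW : open W) (Wk : W `<=` range (@chart_pt k)) (si : sec (Y k) (pre k W)).

Lemma extend_ex l : exists t : sec (Y l) (pre l W), pl (ovl_incl l k) t = rs (ovl_incl l k @^-1` pre l W) (pl (trans l k) si).
Proof.
have [_ _ jb] := open_immersion_incl (@ovl_open l k).
have [|g gK Kg] := jb (pre l W) (oW l); first by rewrite range_osub_incl; exact: pre_ovl.
exists (g (rs (ovl_incl l k @^-1` pre l W) (pl (trans l k) si))).
by rewrite (plE _ (oW l)); exact: Kg.
Qed.
Definition extend l := projT1 (cid (extend_ex l)).
Lemma extendE l : pl (ovl_incl l k) (extend l) = rs (ovl_incl l k @^-1` pre l W) (pl (trans l k) si).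
Proof. exact: projT2 (cid (extend_ex l)). Qed.

Lemma extend_pull l (O : set X) (T : sm R) (g : smor T (Y l)) (g' : smor T (ovl_sm l k)) (W' : set T) :
  scomp (ovl_incl l k) g' = g -> open O -> O `<=` W -> W' `<=` g @^-1` pre l O ->
  rs W' (pl g (rs (pre l O) (extend l))) = rs W' (pl (scomp (trans l k) g') (rs (pre k O) si)).
Proof.
move=> gE oO OW WO; have oOl := oO l; have oOk := oO k; have oWk := oW k; have oWl := oW l.
rewrite -(pl_eq W' (rs (pre l O) (extend l)) gE).
have a1 : ovl_incl l k @^-1` pre l O `<=` ovl_incl l k @^-1` pre l W by move=> t; exact: OW.
have a2 : ovl_incl l k @^-1` pre l W `<=` trans l k @^-1` pre k W by rewrite pre_trans.
have a3 : ovl_incl l k @^-1` pre l O `<=` trans l k @^-1` pre k O by rewrite pre_trans.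
have a4 : trans l k @^-1` pre k O `<=` trans l k @^-1` pre k W by move=> t; exact: OW.
have oi := smor_open (ovl_incl l k) oOl.
have ot := smor_open (trans l k) oOk.
have E : pl (ovl_incl l k) (rs (pre l O) (extend l)) = rs (ovl_incl l k @^-1` pre l O) (pl (trans l k) (rs (pre k O) si)).
  rewrite pl_rs //; [|exact: pre_sub]; rewrite extendE rs_rs // pl_rs //; [|exact: pre_sub].
  by rewrite rs_rs.
have b1 : scomp (ovl_incl l k) g' @^-1` pre l O `<=` g' @^-1` (trans l k @^-1` pre k O) by move=> t; exact: a3.
have b2 : W' `<=` scomp (ovl_incl l k) g' @^-1` pre l O by rewrite gE.
rewrite (pl_comp (ovl_incl l k) g') // E (pl_comp (trans l k) g') // pl_rs // rs_rs //.
Qed.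

(** On the open subspace of T where the condition is to be checked, g and h both factor through the
    overlaps with chart k. There the two composites into Y k classify the same element of F and
    hence coincide. *)
Lemma extend_compat : compat extend.
Proof.
move=> O oO OW k1 l1 T g h gh.
have sgh : g @^-1` pre k1 O = h @^-1` pre l1 O by apply/seteqP; split=> z /=; rewrite (chart_pt_agree gh).
have oOg := smor_open g (oO k1); have oOh := smor_open h (oO l1).
pose T' := osub_sm oOg; pose i : smor T' T := osub_incl oOg.
have [t|g' gE] := factor_ex (open_immersion_incl (@ovl_open k1 k)) (f := scomp g i).
  by rewrite range_osub_incl; apply: (pre_ovl Wk); apply: OW; exact: (set_valP t).
have [t|h' hE] := factor_ex (open_immersion_incl (@ovl_open l1 k)) (f := scomp h i).
  have ht : (h @^-1` pre l1 O) (set_val t) by rewrite -sgh; exact: (set_valP t).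
  by rewrite range_osub_incl; apply: (pre_ovl Wk); apply: OW.
have e : scomp (trans k1 k) (g' : smor T' (ovl_sm k1 k)) = scomp (trans l1 k) (h' : smor T' (ovl_sm l1 k)).
  apply: univ_uniq; rewrite !pb_comp !transE -!pb_comp.
  rewrite -[scomp (ovl_incl k1 k) g']/(scomp (osub_incl (@ovl_open k1 k)) g') gE.
  rewrite -[scomp (ovl_incl l1 k) h']/(scomp (osub_incl (@ovl_open l1 k)) h') hE.
  by rewrite !pb_comp gh.
apply: (@oi_pl_inj R _ _ _ (open_immersion_incl oOg) _ _ _ oOg); first by rewrite range_osub_incl.
have b1 : g @^-1` pre k1 O `<=` h @^-1` pre l1 O by rewrite sgh.
rewrite (pl_rs (osub_incl oOg) _ oOh oOg b1).
rewrite -(pl_comp g i) ?oO // -(pl_comp h i) ?oO //.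
rewrite -[LHS]rs_id.
rewrite (extend_pull (g := scomp g i) (g' := g') gE oO OW (@subset_refl _ _)).
rewrite (extend_pull (g := scomp h i) (g' := h') hE oO OW); last by move=> t; exact: b1.
exact: pl_eq.
Qed.

Lemma gsec_ex : exists s : gsec W, gcomp s k = si.
Proof.
exists (SubProd extend_compat : gsec W).
apply: (@oi_pl_inj R _ _ _ (open_immersion_incl (@ovl_open k k)) (pre k W) _ _ (oW k)).
  by rewrite range_osub_incl; exact: pre_ovl.
rewrite -[LHS]/(pl (ovl_incl k k) (extend k)) extendE.
have -> : trans k k = ovl_incl k k by apply: univ_uniq; exact: transE.
exact: rs_id.
Qed.

End ExtendSection.

Lemma glued_chart_res k (U W : set X) (oU : open U) (oW : open W) (WU : W `<=` U) (s : gsec U) :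
  gcomp (gres WU s) k = res (@preimage_subset _ _ (@chart_pt k) _ _ WU) (gcomp s k).
Proof. exact: rsE. Qed.

Lemma glued_chart_local k (W : set X) (oW : open W) (x : Y k) (s : gsec W) : W (chart_pt x) ->
  invertible_at x (gcomp s k) -> @invertible_at R gspace (chart_pt x) W s.
Proof.
move=> Wx [W0 [W0W [oW0 W0x [w [sw ws]]]]].
pose O := (@chart_pt k @` W0 : set X).
have oO : open O by exact: chart_pt_open.
have OW : O `<=` W by move=> _ [y Wy <-]; exact: (W0W y Wy).
have Ok : O `<=` range (@chart_pt k) by move=> _ [y _ <-]; exists y.
have OW0 : pre k O `<=` W0 by move=> y [z Wz /chart_pt_inj <-].
have [t tE] := gsec_ex oO Ok (rs (pre k O) w).
exists O, OW; split=> //; first by exists x.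
have sE : rs (pre k O) (gcomp s k) = rs (pre k O) (res W0W (gcomp s k)) by rewrite -rsE rs_rs.
exists t; split; apply: (gsec_det oO Ok).
  change (rs (pre k O) (gcomp s k) * gcomp t k = 1).
  by rewrite tE sE -(samM (rs_alg OW0)) sw (sam1 (rs_alg OW0)).
change (gcomp t k * rs (pre k O) (gcomp s k) = 1).
by rewrite tE sE -(samM (rs_alg OW0)) ws (sam1 (rs_alg OW0)).
Qed.

Lemma glued_chart_alg k (W : set X) (oW : open W) : superalg_morphism (fun s : gsec W => gcomp s k).
Proof. exact: sp_comp_alg. Qed.

Definition glued_chart k : smor (Y k) gspace :=
  @Smor R (Y k) gspace (@chart_pt k) (fun W oW => oW k) (fun W _ s => gcomp s k)
    (@glued_chart_alg k) (@glued_chart_res k) (@glued_chart_local k).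

Lemma glued_chart_immersion k : open_immersion (glued_chart k).
Proof.
split; [exact: chart_pt_inj|exact: chart_pt_open|] => W oW Wk.
have ex si := gsec_ex oW Wk si.
exists (fun si => projT1 (cid (ex si))) => [s|si]; last exact: (projT2 (cid (ex si))).
apply: (gsec_det oW Wk); exact: (projT2 (cid (ex _))).
Qed.

Lemma glued_compat k l (T : sm R) (g : smor T (Y k)) (h : smor T (Y l)) :
  pb g (xi k) = pb h (xi l) -> scomp (glued_chart k) g = scomp (glued_chart l) h.
Proof.
move=> gh; apply: smor_eqP => [t|W s t oW Wt]; first exact: (chart_pt_agree gh).
have ogW := smor_open (scomp (glued_chart k) g) oW.
have sgh : scomp (glued_chart k) g @^-1` W `<=` scomp (glued_chart l) h @^-1` W.
  by move=> z; rewrite /= (chart_pt_agree gh).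
exists (scomp (glued_chart k) g @^-1` W); split=> //.
rewrite rs_id (pl_comp _ g) // (pl_comp _ h) // !(plE (glued_chart _) oW) /=.
have := sp_compP (s : subprod _) W oW (@subset_refl _ W) k l T g h gh.
by rewrite !rs_id.
Qed.

Lemma glued_cover (x : gspace) : exists k, range (glued_chart k) x.
Proof. by have [y yx] := @chart_pt_sur (bpoint x) x (Vk _); exists (bpoint x), y. Qed.

Lemma gspace_hausdorff : hausdorff_space gspace.
Proof.
rewrite open_hausdorff => x x' xx'.
(* Points with different base points are separated by open sets of K0; points with the same base
   point lie in a common chart. *)
have [bb|bb] := eqVneq (bpoint x) (bpoint x'); last first.
  have [p [q [hK _ _]]] := sK; move: hK; rewrite open_hausdorff => /(_ _ _ bb)[[E E'] /= [Ox Ox'] [oO oO' /eqP OO']].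
  exists (bpoint @^-1` E, bpoint @^-1` E'); first by rewrite !inE in Ox Ox' *.
  split; [exact: bpoint_open|exact: bpoint_open|].
  by apply/eqP; rewrite -preimage_setI OO' preimage_set0.
have [y yx] := @chart_pt_sur (bpoint x) x (Vk _).
have [|y' yx'] := @chart_pt_sur (bpoint x) x'; first by rewrite -bb; exact: Vk.
have yy : y != y' by apply: contra_neq xx' => yy; rewrite -yx -yx' yy.
have [hY _ _] := sY (bpoint x); move: hY; rewrite open_hausdorff => /(_ _ _ yy)[[E E'] /= [Oy Oy'] [oO oO' /eqP OO']].
exists (@chart_pt (bpoint x) @` E, @chart_pt (bpoint x) @` E'); first by rewrite !inE in Oy Oy' *; split; [exists y|exists y'].
split; [exact: chart_pt_open|exact: chart_pt_open|].
apply/eqP; apply/seteqP; split=> // _ [[z Oz <-] [z' Oz' /chart_pt_inj zz]].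
have : (E `&` E') z by split=> //; rewrite -zz.
by rewrite OO'.
Qed.

Lemma gspace_second_countable : @second_countable gspace.
Proof.
have [p [q [_ [B cB [Bo Bb]] _]]] := sK.
have bas k : exists C : set (set (Y k)), countable C /\ basis C by have [_ [C cC bC] _] := sY k; exists C.
pose C k := projT1 (cid (bas k)).
have cC k : countable (C k) by have [] := projT2 (cid (bas k)).
have bC k : basis (C k) by have [] := projT2 (cid (bas k)).
(* The charts are indexed by all points of K0. Choosing a single chart for each set of a countable
   basis of K0 that is small enough leaves countably many. *)
pose G (O : set K0) : set (set X) := if pselect (exists k, O `<=` V k) is left h
  then [set @chart_pt (projT1 (cid h)) @` U | U in C (projT1 (cid h))] else set0.
exists (\bigcup_(O in B) G O).
  apply: bigcup_countable => // O _; rewrite /G; case: pselect => h; last exact: countable0.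
  exact: card_le_trans (card_image_le _ _) (cC _).
split.
  move=> W [E BE]; rewrite /G; case: pselect => // h [U CU <-].
  by apply: chart_pt_open; have [+ _] := bC (projT1 (cid h)); apply.
move=> x W Wx.
have [ O [BO Ox] OV] : filter_from [set U | B U /\ U (bpoint x)] id (V (bpoint x)).
  by apply: Bb; apply: open_nbhs_nbhs.
have hO : exists k, O `<=` V k by exists (bpoint x).
have GO : G O = [set @chart_pt (projT1 (cid hO)) @` U | U in C (projT1 (cid hO))].
  by rewrite /G; case: pselect => // h; rewrite (Prop_irrelevance h hO).
have kP := projT2 (cid hO); move: (projT1 (cid hO)) GO kP => k GO kP.
have [y yx] := @chart_pt_sur k x (kP _ Ox).
have [W' [oW' W'x] W'W] : exists2 W', open_nbhs x W' & W' `<=` W by move: Wx; rewrite nbhsE.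
have [U [CU Uy] UW] : filter_from [set U | C k U /\ U y] id (@chart_pt k @^-1` W').
  by have [_ bk] := bC k; apply: bk; apply: open_nbhs_nbhs; split; [exact: oW'|rewrite /= yx].
exists (@chart_pt k @` U); first by split; [exists O => //; rewrite GO; exists U|exists y].
by move=> _ [z Uz <-]; apply: W'W; exact: UW.
Qed.

Lemma gspace_supermanifold : is_supermanifold P Q gspace.
Proof.
split; [exact: gspace_hausdorff|exact: gspace_second_countable|] => x.
have [k [y _ yx]] := glued_cover x.
have [_ _ /(_ y)[A [f [g [fo go [a _ ay]]]]]] := sY k.
exists A, (scomp (glued_chart k) f), g; split=> //.
  by apply: open_immersion_comp => //; exact: glued_chart_immersion.
by exists a => //; rewrite -yx -ay.
Qed.

Definition gsm : sm R := SM (ex_intro _ P (ex_intro _ Q gspace_supermanifold)).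
Local Notation J k := (glued_chart k : smor (Y k) gsm).

(** The converse of [glued_compat]: it is the agreement on overlaps under which the elements [xi k]
    glue to one element on the whole space. *)
Lemma glued_compatV k l (T : sm R) (g : smor T (Y k)) (h : smor T (Y l)) :
  scomp (J k) g = scomp (J l) h -> pb g (xi k) = pb h (xi l).
Proof.
move=> gh; have [t|w [wE _]] := @univ l T (pb g (xi k)).
  rewrite ba_nat /= -bpoint_chart_pt.
  have -> : chart_pt (g t) = chart_pt (h t) by exact: (congr1 (fun f : smor T gspace => f t) gh).
  by rewrite bpoint_chart_pt; exact: xiV.
rewrite -wE; congr pb; apply: (oi_cancel (glued_chart_immersion l)).
by rewrite (glued_compat wE) -gh.
Qed.

Lemma glued_universal : exists x : F gsm, forall k, pb (J k) x = xi k.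
Proof.
apply: sheaf_glue; [exact: glued_chart_immersion|exact: glued_cover|exact: glued_compatV].
Qed.

Lemma ba_universal (x : F gsm) : (forall k, pb (J k) x = xi k) -> forall z : gsm, ba x z = bpoint z.
Proof.
move=> xE z; have [k [y _ <-]] := glued_cover z.
rewrite -[LHS]/(scomp (ba x) (J k) y) -ba_nat xE.
exact: (esym (bpoint_chart_pt y)).
Qed.

(** The element s is classified over each open set where its base map lands in [V k], and the
    classifying maps glue. For uniqueness, any map classifying s must land in chart k there, since
    the base point of its value is that of s. *)
Lemma glued_classify (x : F gsm) : (forall k, pb (J k) x = xi k) ->
  forall (N : sm R) (s : F N), exists! g : smor N gsm, pb g x = s.
Proof.
move=> xE N s.
pose O (k : K0) := ba s @^-1` (V k); have oO k : open (O k) by exact: smor_open.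
pose U k := osub_sm (oO k); pose i k : smor (U k) N := osub_incl (oO k).
have io k : open_immersion (i k) by exact: open_immersion_incl.
have icov t : exists k, range (i k) t by exists (ba s t); rewrite range_osub_incl; exact: Vk.
have loc k : exists! g : smor (U k) (Y k), pb g (xi k) = pb (i k) s.
  by apply: univ => t; rewrite ba_nat; exact: (set_valP t).
pose g k := projT1 (cid (loc k)); have gE k : pb (g k) (xi k) = pb (i k) s by have [] := projT2 (cid (loc k)).
have [k l W oW u v uv|G GE] := glue_smor io icov (f := fun k => scomp (J k) (g k)).
  rewrite -!scompA; apply: (@glued_compat k l (osub_sm oW) (scomp (g k) u) (scomp (g l) v)).
  rewrite (@pb_comp _ _ (osub_sm oW) (g k) u) (@pb_comp _ _ (osub_sm oW) (g l) v) !gE.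
  rewrite -(@pb_comp _ _ (osub_sm oW) (i k) u) -(@pb_comp _ _ (osub_sm oW) (i l) v).
  by congr pb.
have Gx : pb (G : smor N gsm) x = s.
  apply: (sheaf_sep io icov) => k; rewrite -pb_comp -gE -xE -pb_comp; congr pb; exact: GE.
exists G; split=> // G' G'x; apply: (smor_ext_cover io icov) => k.
have fac (h : smor N gsm) : pb h x = s -> exists a, scomp (J k) a = scomp h (i k).
  move=> hx; apply: (factor_ex (glued_chart_immersion k)) => t.
  have Vt : V k (bpoint (h (i k t))).
    rewrite -(ba_universal xE) -[ba x _]/(scomp (ba x) h (i k t)) -ba_nat hx; exact: (set_valP t).
  by have [y yE] := chart_pt_sur Vt; exists y.
have [a aE] := fac G Gx; have [a' aE'] := fac G' G'x.
rewrite -aE -aE'; congr scomp; apply: univ_uniq.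
rewrite -xE -!pb_comp -[scomp (J k) a]/(scomp (glued_chart k) a) aE.
by rewrite -[scomp (J k) a']/(scomp (glued_chart k) a') aE' !pb_comp Gx G'x.
Qed.

Theorem glued_representable : representable F.
Proof.
have [x xE] := glued_universal.
pose c (N : sm R) (s : F N) := projT1 (cid (glued_classify xE s)).
have cE (N : sm R) (s : F N) : pb (c N s) x = s by have [] := projT2 (cid (glued_classify xE s)).
have cu (N : sm R) (g : smor N gsm) : c N (pb g x) = g.
  by have [_ ] := projT2 (cid (glued_classify xE (pb g x))); apply.
exists gsm, c; split=> [N|N N' b s]; first by exists (fun g => pb g x).
rewrite -[RHS](cu N') pb_comp cE //.
Qed.

End Gluing.



(** * The jet of the presheaf of simplicial maps *)

Section JetSheaf.
Context {R : realType} (n : nat) (K : simplicial R).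
Local Notation F := (jet n (F_presheaf K)).
Local Notation B := (blocks n).

Lemma base_map_nat (N N' : sm R) (f : smor N' N) (s : F N) : base_map (pb f s) = scomp (base_map s) f.
Proof. exact: (family_act s f 0). Qed.

Lemma bmap_immersion p (N N' : sm R) (f : smor N N') : open_immersion f -> open_immersion (bmap n p f).
Proof.
move=> fo; rewrite /bmap /blocks; elim: (p * n)%N => //= k IH; exact: odd_map_immersion.
Qed.

Lemma bmap_range p (N N' : sm R) (f : smor N N') x : range f (bproj n p N' x) -> range (bmap n p f) x.
Proof.
move=> [y _ yx]; have [z zy] : exists z, bproj n p N z = y.
  rewrite /bproj; exact: (odd_product_submersion (p * n) N).1.
exists z => //; apply: bproj_inj; rewrite -yx -zy.
exact: (congr1 (fun h : smor (B p N) N' => h z) (bproj_map n p f)).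
Qed.

Lemma act_at (N N' : sm R) (f : smor N' N) (s : simplicial_map (nerve (jet_ob n N)) K) p :
  nerve_act (jet_mor n f) s p = scomp (s p) (bmap n p.+1 f : smor (B p.+1 N') (nerve (jet_ob n N) p)).
Proof. by rewrite /= nerve_map_bmap. Qed.

Lemma jet_separated (N : sm R) (I : Type) (A : I -> sm R) (j : forall i, smor (A i) N) (s s' : F N) :
  (forall i, open_immersion (j i)) -> (forall x, exists i, range (j i) x) ->
  (forall i, pb (j i) s = pb (j i) s') -> s = s'.
Proof.
move=> jo cov ss; apply: smap_ext => p.
apply: (@smor_ext_cover R (B p.+1 N) (K p) I (fun i => B p.+1 (A i)) (fun i => bmap n p.+1 (j i))).
- by move=> i; exact: bmap_immersion.
- by move=> x; have [i ix] := cov (bproj n p.+1 N x); exists i; exact: bmap_range.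
move=> i; have := congr1 (fun u : simplicial_map (nerve (jet_ob n (A i))) K => u p) (ss i).
by rewrite -[X in X = _ -> _]/(nerve_act (jet_mor n (j i)) s p) -[X in _ = X -> _]/(nerve_act (jet_mor n (j i)) s' p) !act_at.
Qed.

Lemma jet_glue (N : sm R) (I : Type) (A : I -> sm R) (j : forall i, smor (A i) N) (s : forall i, F (A i)) :
  (forall i, open_immersion (j i)) -> (forall x, exists i, range (j i) x) ->
  (forall i k (T : sm R) (u : smor T (A i)) (v : smor T (A k)), scomp (j i) u = scomp (j k) v -> pb u (s i) = pb v (s k)) ->
  exists t : F N, forall i, pb (j i) t = s i.
Proof.
move=> jo cov ov.
pose S i : simplicial_map (nerve (jet_ob n (A i))) K := s i.
pose jp p i : smor (B p.+1 (A i)) (B p.+1 N) := bmap n p.+1 (j i).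
have jpo p i : open_immersion (jp p i) by exact: bmap_immersion.
have jpc p x : exists i, range (jp p i) x.
  by have [i ix] := cov (bproj n p.+1 N x); exists i; exact: bmap_range.
have ex p : exists t : smor (B p.+1 N) (K p), forall i, scomp t (jp p i) = (S i p : smor (B p.+1 (A i)) (K p)).
  apply: (glue_smor (jpo p) (jpc p)) => i k W oW u v uv.
  (* A T-point u of the thickening splits into its base part b and its odd coordinates y. The points
     u and v have the same y, so the hypothesis on overlaps is needed for the base parts b and b'
     only. *)
  pose T := osub_sm oW; pose b : smor T (A i) := scomp (bproj n p.+1 (A i)) u.
  pose b' : smor T (A k) := scomp (bproj n p.+1 (A k)) v.
  have bb : scomp (j i) b = scomp (j k) b'.
    by rewrite /b /b' !scompA -!bproj_map -!scompA uv.
  pose y l m := gpull (u : smor T (B p.+1 (A i))) (@btheta R n p.+1 (A i) l m).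
  have yE l m : gpull (v : smor T (B p.+1 (A k))) (@btheta R n p.+1 (A k) l m) = y l m.
    rewrite /y -(bmap_theta (j k)) -(bmap_theta (j i)) -!gpull_comp.
    by rewrite -[scomp (bmap _ _ _) v]/(scomp (jp p k) v) -uv.
  have uE : (u : smor T _) = scomp (bmap n p.+1 b) (bpt (sid T) y).
    by rewrite bmap_bpt scomp1r; exact: bpt_eta.
  have vE : (v : smor T _) = scomp (bmap n p.+1 b') (bpt (sid T) y).
    rewrite bmap_bpt scomp1r.
    transitivity (bpt b' (fun l m => gpull (v : smor T (B p.+1 (A k))) (@btheta R n p.+1 (A k) l m))); first exact: bpt_eta.
    congr bpt; by apply/funext => l; apply/funext => m; rewrite yE.
  have e := congr1 (fun w : simplicial_map (nerve (jet_ob n T)) K => w p) (ov i k T b b' bb).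
  have {}e : scomp (S i p) (bmap n p.+1 b : smor (B p.+1 T) (nerve (jet_ob n (A i)) p)) =
     scomp (S k p) (bmap n p.+1 b' : smor (B p.+1 T) (nerve (jet_ob n (A k)) p)).
    by rewrite -!act_at.
  rewrite -[LHS]/(scomp (S i p) (u : smor T (B p.+1 (A i)))) uE -[RHS]/(scomp (S k p) (v : smor T (B p.+1 (A k)))) vE.
  by rewrite !scompA e.
pose t p : smor (nerve (jet_ob n N) p) (K p) := projT1 (cid (ex p)).
have tE p i : scomp (t p) (jp p i : smor (B p.+1 (A i)) (nerve (jet_ob n N) p)) = S i p.
  exact: (projT2 (cid (ex p)) i).
have tnat q p (f : delta q p) : scomp (sop K f) (t p) = scomp (t q) (sop (nerve (jet_ob n N)) f).
  apply: (smor_ext_cover (jpo p) (jpc p)) => i.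
  rewrite -scompA -[scomp (t p) (jp p i)]/(scomp (t p) (jp p i : smor (B p.+1 (A i)) (nerve (jet_ob n N) p))) tE.
  rewrite (smap_nat (S i) f) -tE -!scompA; congr scomp.
  have := nerve_map_nat (jet_mor n (j i)) f; rewrite !nerve_map_bmap.
  by move=> <-.
exists (SimplicialMap tnat : simplicial_map _ _) => i; apply: smap_ext => p.
rewrite -[LHS]/(nerve_act (jet_mor n (j i)) (SimplicialMap tnat) p) act_at.
exact: tE.
Qed.

End JetSheaf.

(** * Local representing objects *)

Section JetCharts.
Context {R : realType} (n : nat) (K : simplicial R) (m : nat).
Local Notation F := (jet n (F_presheaf K)).
Local Notation RS p := (Rsuper R p 0).

Lemma odd_product_supermanifold p k (N : sm R) : is_supermanifold p 0 N -> is_supermanifold p k (odd_product k N).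
Proof. by move=> sN; elim: k => //= k IH; exact: odd_is_supermanifold. Qed.

Lemma enum_val_sum (J : finType) (A : {pred J}) (M : zmodType) (h : J -> M) (x : J) :
  \sum_(i < #|A| | enum_val i == x) h (enum_val i) = if x \in A then h x else 0.
Proof.
case: ifPn => xA; last by rewrite big_pred0 // => i; apply: contraNF xA => /eqP <-; exact: enum_valP.
rewrite (big_pred1 (enum_rank_in xA x)) ?enum_rankK_in // => i /=.
apply/eqP/eqP => [ix|->]; last by rewrite enum_rankK_in.
by apply: enum_val_inj; rewrite enum_rankK_in.
Qed.

Variables (d : nat -> nat) (p0 : nat).
Hypothesis sK0 : is_supermanifold p0 0 (K 0).
Local Notation J := (cidx n m d).
Let Jo : {pred J} := [pred x | cpar x].
Let Je : {pred J} := [pred x | ~~ cpar x].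
Let od := #|Jo|.
Let ed := #|Je|.

Section Chart.
Variables (k0 : K 0) (U : set (K 0)) (z : forall N : sm R, F N -> J -> sec N setT).
Hypotheses (oU : open U) (Uk : U k0)
  (z_parity : forall (N : sm R) (phi : F N) x, (forall t, U (base_map phi t)) ->
      parity (z phi x) = (-1) ^+ cpar x *: z phi x)
  (z_nat : forall (N N' : sm R) (f : smor N' N) (phi : F N) x, (forall t, U (base_map phi t)) ->
      z (pb f phi) x = gpull f (z phi x))
  (z_univ : forall (N : sm R) (f : smor N (K 0)) (w : J -> sec N setT), (forall t, U (f t)) ->
      (forall x, parity (w x) = (-1) ^+ cpar x *: w x) ->
      exists! phi : F N, base_map phi = f /\ forall x, z phi x = w x).

Section Model.
Variables (D : set (RS p0)) (oD : open D) (rho : smor (osub oD) (K 0)).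
Hypotheses (ro : open_immersion rho) (rU : forall y, U (rho y)).

Definition firstc (y : 'rV[R]_(p0 + ed)) : 'rV[R]_p0 := \row_i y 0 (lshift ed i).
(** The product of the chart domain D of K_0 with R^ed: the even coordinates of a family may take
    any value. *)
Definition mdom : set (RS (p0 + ed)) := firstc @^-1` D.
Lemma mdom_open : open mdom.
Proof.
apply: open_comp oD => y _; apply: continuous_row => i; exact: coord_continuous.
Qed.

Let RSsm : sm R := SM (ex_intro _ (p0 + ed)%N (ex_intro _ 0%N (@RS_supermanifold R (p0 + ed)))).
Definition base_model : sm R := @osub_sm R RSsm mdom mdom_open.
Definition model : sm R := odd_product od base_model.
Let inc : smor base_model (RS (p0 + ed)) := osub_incl mdom_open.
Let q : smor model base_model := odd_product_proj od base_model.
Let th (i : 'I_od) : sec model setT := odd_product_theta base_model i.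
Let co (i : 'I_(p0 + ed)) : sec base_model setT := gpull inc (xcoord i).

Lemma model_supermanifold : is_supermanifold (p0 + ed) od model.
Proof.
apply: odd_product_supermanifold; apply: (osub_supermanifold mdom_open).
exact: RS_supermanifold.
Qed.

Let co_even i : parity (co i) = co i.
Proof. by rewrite /co -(samP (gpull_alg inc)). Qed.

Let eta_ex : exists e : smor base_model (osub oD), forall i, gpull (scomp (osub_incl oD) e) (xcoord i) = co (lshift ed i).
Proof.
have [h hP] := @affine_maps_sm R base_model p0 (fun i => co (lshift ed i)) (fun i => co_even _).
have [y|e eE] := factor_ex (open_immersion_incl oD) (f := h); last by exists e => i; rewrite eE hP.
rewrite range_osub_incl; have -> : h y = firstc (inc y); last exact: (set_valP y).
apply/rowP => i; rewrite mxE.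
have v1 := affine_value (h := h) (i := i) (x := y); rewrite hP in v1.
have v2 := affine_value (h := inc) (i := lshift ed i) (x := y).
exact: (value_uniq (@valued_sm R base_model) openT (I : setT y) v1 v2).
Qed.
Let e := projT1 (cid eta_ex).
Let eE i : gpull (scomp (osub_incl oD) e) (xcoord i) = co (lshift ed i).
Proof. exact: (projT2 (cid eta_ex) i). Qed.

Let fY : smor model (K 0) := scomp rho (scomp e q).
(** The tautological coordinates of the model. For given x exactly one of the two sums has a term,
    according to the parity of x; the element [xi] having these coordinates is the universal one. *)
Let zY (x : J) : sec model setT :=
  \sum_(i < od | enum_val i == x) th i + \sum_(i < ed | enum_val i == x) gpull q (co (rshift p0 i)).

Let zY_parity x : parity (zY x) = (-1) ^+ cpar x *: zY x.
Proof.
rewrite /zY parityD !(big_morph (@parity R _) (@parityD R _) (@parity0 R _)) scalerDr !scaler_sumr.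
congr (_ + _); apply: eq_bigr => i /eqP ix.
  have : cpar (enum_val i) := enum_valP i; rewrite ix => ->; rewrite expr1 scaleN1r.
  exact: (odd_product_coordinates _ _).1.
have : ~~ cpar (enum_val i) := enum_valP i; rewrite ix => /negbTE ->; rewrite expr0 scale1r.
by rewrite -(samP (gpull_alg q)) co_even.
Qed.

Let xi_ex := z_univ (f := fY) (fun t => rU _) zY_parity.
Let xi : F model := projT1 (cid xi_ex).
Let xi_base : base_map xi = fY. Proof. by have [[]] := projT2 (cid xi_ex). Qed.
Let xi_z x : z xi x = zY x. Proof. by have [[_ h] _] := projT2 (cid xi_ex); exact: h. Qed.

Section Classify.
Variables (N : sm R) (g : smor N model) (f' : smor N (osub oD)) (w : J -> sec N setT).

Let pull_zY : (forall i : 'I_od, gpull g (th i) = w (enum_val i)) ->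
  (forall i : 'I_ed, gpull (scomp q g) (co (rshift p0 i)) = w (enum_val i)) -> forall x, gpull g (zY x) = w x.
Proof.
move=> go ge x; rewrite /zY (samD (gpull_alg g)) !(big_morph (gpull g) (samD (gpull_alg g)) (sam0 (gpull_alg g))).
under eq_bigr do rewrite go; under [X in _ + X]eq_bigr do rewrite -gpull_comp ge.
by rewrite !enum_val_sum !inE; case: (cpar x); rewrite ?addr0 ?add0r.
Qed.

Let pull_odd (i : 'I_od) : gpull g (th i) = gpull g (zY (enum_val i)).
Proof.
rewrite /zY (big_pred1 i) => [|i']; last by rewrite (inj_eq enum_val_inj).
rewrite big_pred0 ?addr0 // => i'; apply/eqP => h.
have : cpar (enum_val i) := enum_valP i; rewrite -h.
by have : ~~ cpar (enum_val i') := enum_valP i'; move=> /negbTE ->.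
Qed.

Let pull_even (i : 'I_ed) : gpull (scomp q g) (co (rshift p0 i)) = gpull g (zY (enum_val i)).
Proof.
rewrite /zY [X in _ + X](big_pred1 i) => [|i']; last by rewrite (inj_eq enum_val_inj).
rewrite big_pred0 ?add0r ?gpull_comp // => i'; apply/eqP => h.
have : ~~ cpar (enum_val i) := enum_valP i; rewrite -h.
by have : cpar (enum_val i') := enum_valP i'; move=> ->.
Qed.

Let pull_base (i : 'I_p0) : gpull (scomp q g) (co (lshift ed i)) = gpull (scomp (osub_incl oD) (scomp e (scomp q g))) (xcoord i).
Proof. by rewrite -eE -gpull_comp scompA. Qed.

(** An element is determined by its base map and its coordinates, and those of a pullback of [xi]
    are the pullbacks of the coordinates of the model. Existence and uniqueness of classifying maps
    are thereby turned into statements about functions on N. *)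
Lemma model_pb (s : F N) : base_map s = scomp rho f' -> (forall x, z s x = w x) ->
  pb g xi = s <->
  [/\ forall i, gpull (scomp q g) (co (lshift ed i)) = gpull (scomp (osub_incl oD) f') (xcoord i),
    forall i : 'I_ed, gpull (scomp q g) (co (rshift p0 i)) = w (enum_val i) &
    forall i : 'I_od, gpull g (th i) = w (enum_val i)].
Proof.
move=> sf sw.
have Us t : U (base_map s t) by rewrite sf; exact: rU.
have Ux t : U (base_map xi t) by rewrite xi_base; exact: rU.
split=> [gs|[g1 g2 g3]].
  have zw x : gpull g (zY x) = w x by rewrite -xi_z -z_nat // gs sw.
  split=> i; [|by rewrite pull_even zw|by rewrite pull_odd zw].
  rewrite pull_base; congr (gpull (scomp _ _) _); apply: (oi_cancel ro).
  by rewrite -sf -gs base_map_nat xi_base /fY -!scompA.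
have wp x : parity (w x) = (-1) ^+ cpar x *: w x by rewrite -sw z_parity.
have [phi [_ pu]] := z_univ (f := scomp rho f') (fun t => rU _) wp.
rewrite -(pu s) // -(pu (pb g xi)) //; split; last first.
  by move=> x; rewrite z_nat // xi_z; exact: pull_zY.
rewrite base_map_nat xi_base /fY -!scompA; congr scomp; apply: (oi_cancel (open_immersion_incl oD)).
by apply: affine_uniq_sm => i; rewrite -pull_base g1.
Qed.
End Classify.

Lemma model_universal (N : sm R) (s : F N) : (forall t, range rho (base_map s t)) ->
  exists! g : smor N model, pb g xi = s.
Proof.
move=> sV; have [f' f'E] := factor_ex ro sV.
pose w x := z s x; have sf : base_map s = scomp rho f' by [].
have Us t : U (base_map s t) by rewrite sf; exact: rU.
have wp x : parity (w x) = (-1) ^+ cpar x *: w x by exact: z_parity.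
pose u (i : 'I_(p0 + ed)) : sec N setT := match fintype.split i with
  | inl a => gpull (scomp (osub_incl oD) f') (xcoord a) | inr b => w (enum_val b) end.
have ul i : u (lshift ed i) = gpull (scomp (osub_incl oD) f') (xcoord i) by rewrite /u (unsplitK (inl i)).
have ur i : u (rshift p0 i) = w (enum_val i) by rewrite /u (unsplitK (inr i)).
have ue i : parity (u i) = u i.
  rewrite /u; case: fintype.split => [a|b]; first by rewrite -(samP (gpull_alg _)).
  by have : ~~ cpar (enum_val b) := enum_valP b; rewrite wp => /negbTE ->; rewrite expr0 scale1r.
have [g0 g0P] := affine_maps_sm ue.
have [t|g1 g1E] := factor_ex (open_immersion_incl mdom_open) (f := g0).
  rewrite range_osub_incl /mdom /=; have -> : firstc (g0 t) = set_val (f' t); last exact: (set_valP (f' t)).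
  apply/rowP => i; rewrite mxE.
  have v1 := affine_value (h := g0) (i := lshift ed i) (x := t); rewrite g0P ul in v1.
  have v2 := affine_value (h := scomp (osub_incl oD) f') (i := i) (x := t).
  exact: (value_uniq (@valued_sm R N) openT (I : setT t) v1 v2).
have wo (i : 'I_od) : odd_elt (w (enum_val i)).
  by have : cpar (enum_val i) := enum_valP i; rewrite /odd_elt wp => ->; rewrite expr1 scaleN1r.
have [g [[gq gt] gu]] := (odd_product_coordinates od base_model).2 N g1 (fun i => w (enum_val i)) wo.
have coE i : gpull g1 (co i) = u i by rewrite /co -gpull_comp -g0P -g1E.
exists g; split.
  apply/(@model_pb N g f' w s sf (fun=> erefl)); split=> // i; rewrite -[q]/(odd_product_proj od base_model) gq coE //.
move=> g' /(@model_pb N g' f' w s sf (fun=> erefl))[h1 h2 h3]; apply: gu; split; last exact: h3.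
apply: (oi_cancel (open_immersion_incl mdom_open)); apply: affine_uniq_sm => i.
rewrite gpull_comp [RHS]gpull_comp -[gpull (osub_incl mdom_open) _]/(co i) -[odd_product_proj _ _]/q coE.
case: (fintype.splitP i) => a ia.
  by have -> : i = lshift ed a; [exact: ord_inj|rewrite h1 ul].
by have -> : i = rshift p0 a; [exact: ord_inj|rewrite h2 ur].
Qed.

Lemma model_base y : range rho (base_map xi y).
Proof. by rewrite xi_base; exists (e (q y)). Qed.

Lemma model_chart : exists x : F model, (forall y, range rho (base_map x y)) /\
  forall (N : sm R) (s : F N), (forall t, range rho (base_map s t)) -> exists! g : smor N model, pb g x = s.
Proof. by exists xi; split; [exact: model_base|exact: model_universal]. Qed.

End Model.

Lemma jet_chart : exists (V : set (K 0)) (Y : sm R) (x : F Y),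
  [/\ open V, V k0, is_supermanifold (p0 + ed) od Y, forall y, V (base_map x y) &
   forall (N : sm R) (s : F N), (forall t, V (base_map s t)) -> exists! g : smor N Y, pb g x = s].
Proof.
have [D0 [oD0 [r0 [r0o [a0 _ a0x]]]]] := chart_at k0 sK0.
have oD := open_image_val oD0 (smor_open r0 oU).
have [|i [io iE]] := osub_shrink oD0 oD; first by move=> _ [y _ <-]; exact: (set_valP y).
have iv y : set_val (i y) = set_val y by exact: (congr1 (fun h : smor (osub oD) (RS p0) => h y) iE).
have rU y : U (scomp r0 i y).
  have [y' Uy' yy] := set_valP y.
  by rewrite /=; have -> : i y = y' by apply: val_inj; exact: (etrans (iv y) (esym yy)).
have ro : open_immersion (scomp r0 i) by exact: open_immersion_comp.
have [x [xb xu]] := model_chart ro rU.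
exists (range (scomp r0 i)), (model oD), x; split=> //; [exact: oi_range_open| |exact: model_supermanifold].
have Da : (set_val @` (r0 @^-1` U) : set (RS p0)) (set_val a0) by exists a0 => //; rewrite /= a0x.
exists (exist _ (set_val a0) (mem_set Da)) => //.
by rewrite -a0x /=; congr (r0 _); apply: val_inj; exact: iv.
Qed.

End Chart.
End JetCharts.

Theorem proposition9p2 (R : realType) (K : simplicial R) (m : nat)
    (K_manifold : forall p : nat, is_manifold (K p))
    (K_kan : kan K) (K_truncated : truncated m K) (n : nat) :
  representable (jet n (F_presheaf K)).
Proof.
have [d dP] := local_coordinates n K_manifold K_kan K_truncated.
have [p0 sK0] := K_manifold 0%N.
(* The dimension asserted for Y does not depend on k0; gluing requires a common one. *)
have ch k0 : exists (V : set (K 0)) (Y : sm R) (x : jet n (F_presheaf K) Y),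
  [/\ open V, V k0, is_supermanifold (p0 + #|([pred x | ~~ cpar x] : {pred cidx n m d})|) #|([pred x | cpar x] : {pred cidx n m d})| Y,
    forall y, V (base_map x y) &
    forall (N : sm R) (s : jet n (F_presheaf K) N), (forall t, V (base_map s t)) -> exists! g : smor N Y, pb g x = s].
  have [U [z [oU Uk zp zn zu]]] := dP k0.
  exact: (jet_chart sK0 oU Uk zp zn zu).
have [V VP] := choice ch.
have [Y YP] := choice VP.
pose xi k : jet n (F_presheaf K) (Y k) := projT1 (cid (YP k)).
have xiP k := projT2 (cid (YP k)).
apply: (glued_representable (@base_map_nat R n K) (@jet_separated R n K) (@jet_glue R n K)
   (xi := xi) (V := V)).
- by exists p0, 0%N.
- by move=> k; case: (xiP k) => _ _ h _ _; exact: h.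
- by move=> k; case: (xiP k).
- by move=> k; case: (xiP k).
- by move=> k; case: (xiP k).
- by move=> k; case: (xiP k).
Qed.
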